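(* In each of the following, balls are the closed balls of the indicated norm, and $\sup_{r,\mu}$ is taken over all $r>0$ and all $\tau$-additive, locally finite Borel measures $\mu$ on the space. (i) Given any norm $\|\cdot\|$ on the plane $\mathbb{R}^2$, if the unit ball is a parallelogram then $\sup_{r,\mu}\|A_{r,\mu}\|_{L^1(\mu)\to L^1(\mu)}=4$, while $\sup_{r,\mu}\|A_{r,\mu}\|_{L^1(\mu)\to L^1(\mu)}=5$ in every other case. (ii) On $(\mathbb{R}^d,\|\cdot\|_\infty)$, with balls defined using the $\ell_\infty$ norm, $\sup_{r,\mu}\|A_{r,\mu}\|_{L^1(\mu)\to L^1(\mu)}=2^d$, and the bound is attained, i.e. there exist $r>0$ and such a measure $\mu$ with $\|A_{r,\mu}\|_{L^1(\mu)\to L^1(\mu)}=2^d$. (iii) For the euclidean norm in dimension $3$, $\sup_{r,\mu}\|A_{r,\mu}\|_{L^1(\mu)\to L^1(\mu)}=12$, and the bound is attained, i.e. there exist $r>0$ and such a measure $\mu$ with $\|A_{r,\mu}\|_{L^1(\mu)\to L^1(\mu)}=12$. (iv) For the euclidean norm on $\mathbb{R}^d$, asymptotically as $d\to\infty$, $$(1+o(1))\sqrt{\frac{3\pi}{8}}\,\log\frac{3}{2\sqrt2}\; d^{3/2}\left(\frac{2}{\sqrt3}\right)^d\le \sup_{r,\mu}\|A_{r,\mu}\|_{L^1(\mu)\to L^1(\mu)}\le 2^{0.401(1+o(1))d}.$$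
   Context: All measures are assumed to be not identically zero. Closed balls: $B^{cl}(x,r)=\{y:\|x-y\|\le r\}$, $r>0$, where $\|\cdot\|$ is the norm under consideration. A Borel measure $\mu$ is $\tau$-additive if for every collection $\{O_\alpha:\alpha\in\Lambda\}$ of open sets, $\mu(\bigcup_\alpha O_\alpha)=\sup\mu(\bigcup_{i=1}^n O_{\alpha_i})$, the supremum being over all finite subcollections $\{O_{\alpha_1},\dots,O_{\alpha_n}\}$. It is locally finite if it assigns finite measure to bounded Borel sets. The support of $\mu$ is the complement of the union of all open balls of $\mu$-measure zero; for the measures considered, the complement of the support has measure zero. Averaging operators: for $r>0$, $g$ locally integrable and $x\in\operatorname{supp}\mu$, $A_{r,\mu}g(x):=\frac{1}{\mu(B^{cl}(x,r))}\int_{B^{cl}(x,r)}g\,d\mu$. $\|A_{r,\mu}\|_{L^1(\mu)\to L^1(\mu)}$ is the smallest $c$ with $\|A_{r,\mu}g\|_{L^1(\mu)}\le c\|g\|_{L^1(\mu)}$ for all $g\in L^1(\mu)$ (and $\infty$ if there is none). *)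

(* Defs.v *)
From mathcomp Require Import all_boot all_order all_algebra.
From mathcomp Require Import all_classical all_reals all_analysis.

Set Implicit Arguments.
Unset Strict Implicit.
Unset Printing Implicit Defensive.

Import Order.TTheory GRing.Theory Num.Theory.
Import numFieldNormedType.Exports.

Local Open Scope classical_set_scope.
Local Open Scope ring_scope.

(* R^d is 'rV[R]_d with its standard topology. Since all norms on R^d are
   equivalent, the open sets and the Borel sets do not depend on the norm under
   consideration, which is passed around as a function nm : 'rV[R]_d -> R. *)
Definition borelRd (R : realType) (d : nat) :=
  g_sigma_algebraType (@open 'rV[R]_d).

Definition is_norm (R : realType) (d : nat) (nm : 'rV[R]_d -> R) : Prop :=
  [/\ forall x y, nm (x + y) <= nm x + nm y,
      forall (a : R) x, nm (a *: x) = `|a| * nm x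
    & forall x, nm x = 0 -> x = 0].

Definition closed_nball (R : realType) (d : nat) (nm : 'rV[R]_d -> R)
  (x : 'rV[R]_d) (r : R) : set 'rV[R]_d := [set y | nm (x - y) <= r].

Definition open_nball (R : realType) (d : nat) (nm : 'rV[R]_d -> R)
  (x : 'rV[R]_d) (r : R) : set 'rV[R]_d := [set y | nm (x - y) < r].

(* The norm of 'rV[R]_d in the library is the maximum of the absolute values of
   the coordinates. *)
Definition linfty_norm (R : realType) (d : nat) (x : 'rV[R]_d) : R := `|x|.

Definition euclidean_norm (R : realType) (d : nat) (x : 'rV[R]_d) : R :=
  Num.sqrt (\sum_(i < d) x 0 i ^+ 2).

Definition parallelogram (R : realType) (P : set 'rV[R]_2) : Prop :=
  exists p u v : 'rV[R]_2, free [:: u; v] /\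
    P = [set x | exists s t : R,
           [/\ 0 <= s <= 1, 0 <= t <= 1 & x = p + s *: u + t *: v]].

Section averaging.
Context (R : realType) (d : nat).
Variables (nm : 'rV[R]_d -> R) (mu : {measure set (borelRd R d) -> \bar R}).
Local Open Scope ereal_scope.

Definition tau_additive : Prop :=
  forall O : set (set 'rV[R]_d), (forall U, O U -> open U) ->
    mu (\bigcup_(U in O) U) =
    ereal_sup [set mu (\bigcup_(U in F) U) |
               F in [set F : set (set 'rV[R]_d) | finite_set F /\ F `<=` O]].

Definition locally_finite : Prop :=
  forall B : set (borelRd R d), measurable B ->
    (exists M : R, forall x, B x -> (nm x <= M)%R) -> mu B < +oo.

Definition admissible : Prop :=
  [/\ mu [set: borelRd R d] != 0, tau_additive & locally_finite].

Definition msupp : set 'rV[R]_d :=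
  ~` \bigcup_(U in [set U | exists (x : 'rV[R]_d) (s : R),
        [/\ (0 < s)%R, U = open_nball nm x s & mu U = 0]]) U.

(* A_{r,mu} g is defined on the support only; it is extended here by 0 to the
   complement, a null set for an admissible mu. For x in the support, the
   measure of the ball is positive, and finite when mu is admissible. *)
Definition average (r : R) (g : borelRd R d -> R) : borelRd R d -> \bar R :=
  fun x => if x \in msupp then
    (mu (closed_nball nm x r))^-1 *
      \int[mu]_(y in closed_nball nm x r) (g y)%:E
  else 0.

(* The infimum of the empty set is +oo. *)
Definition average_opnorm (r : R) : \bar R :=
  ereal_inf [set c%:E | c in [set c : R |
    forall g : borelRd R d -> R, mu.-integrable setT (EFin \o g) ->
      'N[mu]_1[average r g] <= c%:E * 'N[mu]_1[EFin \o g]]].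

End averaging.

Definition sup_average_opnorm (R : realType) (d : nat) (nm : 'rV[R]_d -> R) :
    \bar R :=
  ereal_sup [set N | exists (r : R) (mu : {measure set (borelRd R d) -> \bar R}),
    [/\ 0 < r, admissible nm mu & N = average_opnorm nm mu r]].

Definition average_opnorm_attains (R : realType) (d : nat)
    (nm : 'rV[R]_d -> R) (N : \bar R) : Prop :=
  exists (r : R) (mu : {measure set (borelRd R d) -> \bar R}),
    [/\ 0 < r, admissible nm mu & average_opnorm nm mu r = N].

(* Main.v *)
(* For every norm, the supremum of the operator norms is the largest size of a
   packing: a set of points of the unit ball at mutual distances greater than 1.
   The norm of the averaging operator is at most the essential supremum of the
   function y |-> \int 1_{|x - y| <= r} / mu (B (x, r)) d mu (x), which is split
   greedily among balls centred at a packing; conversely, clusters made of a light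
   atom surrounded by heavy atoms placed at the points of a packing realize its
   size, the light atoms getting lighter along the sequence of clusters.

   In the plane, a hexagon with vertices u, v, v - u, ... on the unit circle
   bounds a packing by 5, or by 4 when the ball is a parallelogram, and a
   perturbed hexagon with one vertex dropped attains 5 in the other cases.
   For the maximum norm, orthants are used.

   For euclidean norms, packings are spherical codes of angle greater than 60
   degrees. In dimension 3, a polynomial f with nonnegative Legendre coefficients
   that is nonpositive on [-t0, 1/2], with t0 > 1 / sqrt 2, is summed over all
   pairs; at most three points of a code lie in the cap opposite to a given point,
   which bounds the remaining contributions. In high dimension, the upper bound is
   that of Kabatianskii and Levenshtein: a packing is covered by caps lifted one
   dimension higher to codes of angle 63 degrees, to which the linear programming
   bound applies. The lower bound is that of Jenssen, Joos and Perkins: the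
   hard-core model on the conflict graph of a discretized sphere has large
   expected size because the common neighbourhoods, contained in caps of angle
   arccos (1 / sqrt 3), are exponentially smaller than the neighbourhoods. *)

From HB Require Import structures.
Require Import Defs.
From Stdlib Require Import ZArith.
From mathcomp Require Import all_boot all_order all_algebra.
From mathcomp Require mpoly.
From mathcomp Require Import ring lra zify ssrZ.

Set Implicit Arguments.
Unset Strict Implicit.
Unset Printing Implicit Defensive.

Import Order.TTheory GRing.Theory Num.Theory.

Local Open Scope ring_scope.

(** * Gegenbauer polynomials are positive definite *)

(** No surface measure on the sphere is constructed. Positive definiteness of the Gegenbauer
    polynomials is algebraic: their homogenizations are harmonic and reproduce harmonic forms for
    the inner product in which multiplication by a variable is adjoint to differentiation. Caps are
    measured by the direction of a standard Gaussian vector, of which only the joint law of one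
    projection and the squared norm is used. The constants of the exponential upper bound hang
    together. With s = 227/500, the lifting radius is r^2 = 1 / (2 (1 - s)) = 250/273 and the cap
    cosine is c^2 = 1 - r^2 = 23/273; the degree ratio a = 23/376 makes 1 - (1 + 2 a)^-2 slightly
    larger than s^2, as the linear programming polynomial requires. The resulting rate is strictly
    below 0.401, so the error term of the upper bound can be taken equal to 0. In dimension 3 the
    margin is thin: the final comparison is 12.985 < 12.987. The polynomial is therefore controlled
    by exact integer certificates rather than by estimates. *)

Section Gegenbauer.
Variables (R : realFieldType) (n : nat).

(* Coefficients of the three-term recurrence of the monic Gegenbauer polynomials
   of the sphere S^(n-1), meaningful for n >= 3. *)
Definition gegen_kappa (k : nat) : R := k%:R * (k%:R + n%:R - 3) / (2 * k%:R + n%:R - 4).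
Definition gegen_beta (k : nat) : R := gegen_kappa k / (2 * k%:R + n%:R - 2).

Fixpoint gegen2 (k : nat) : {poly R} * {poly R} :=
  if k is k'.+1 then let: (p, q) := gegen2 k' in (q, 'X * q - gegen_beta k'.+1 *: p)
  else (1, 'X).

Definition gegen k := (gegen2 k).1.

Lemma gegen0 : gegen 0 = 1. Proof. by []. Qed.
Lemma gegen1 : gegen 1 = 'X. Proof. by []. Qed.
Lemma gegenSS k : gegen k.+2 = 'X * gegen k.+1 - gegen_beta k.+1 *: gegen k.
Proof. by rewrite /gegen /=; case: (gegen2 k). Qed.

End Gegenbauer.

Module Fischer.
Import mpoly.

Section FischerProduct.
Variables (R : realFieldType) (n : nat).
Implicit Types (p q : {mpoly R[n]}) (x y : 'I_n -> R).

(** On forms of degree [k] this is [k!] times Fischer's inner product: it sums, over ordered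
    [k]-tuples of directions, the products of iterated partial derivatives at the origin. The
    recursive shape gives positivity and adjunction by induction on [k]. *)
Fixpoint fip (k : nat) p q : R :=
  if k is k'.+1 then \sum_i fip k' p^`M(i) q^`M(i)
  else p.@[fun=> 0] * q.@[fun=> 0].

Lemma fip_ge0 k p : 0 <= fip k p p.
Proof.
elim: k p => [|k IH] p /=; first by rewrite -expr2 sqr_ge0.
by apply: sumr_ge0.
Qed.

Lemma fipD k p p' q : fip k (p + p') q = fip k p q + fip k p' q.
Proof.
elim: k p p' q => [|k IH] p p' q /=; first by rewrite mevalD mulrDl.
by rewrite -big_split; apply: eq_bigr => i _; rewrite mderivD IH.
Qed.

Lemma fipC k p q : fip k p q = fip k q p.
Proof.
elim: k p q => [|k IH] p q /=; first by rewrite mulrC.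
by apply: eq_bigr => i _; rewrite IH.
Qed.

Lemma fip0 k q : fip k 0 q = 0.
Proof. by apply: (@addrI _ (fip k 0 q)); rewrite -fipD !addr0. Qed.

Lemma fipZ k c p q : fip k (c%:MP * p) q = c * fip k p q.
Proof.
elim: k p q => [|k IH] p q /=; first by rewrite mevalM mevalC mulrA.
by rewrite mulr_sumr; apply: eq_bigr => i _; rewrite mderivM mderivC mul0r add0r IH.
Qed.

Lemma fip_sum k (I : Type) (r : seq I) (F : I -> {mpoly R[n]}) q :
  fip k (\sum_(i <- r) F i) q = \sum_(i <- r) fip k (F i) q.
Proof.
elim: r => [|i r IH]; first by rewrite !big_nil fip0.
by rewrite !big_cons fipD IH.
Qed.

Lemma mderivXU i j : ('X_j : {mpoly R[n]})^`M(i) = (i == j)%:R.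
Proof.
rewrite mderivX mnmE eq_sym; case: eqP => [->|_]; last by rewrite scale0r.
rewrite (_ : (U_(j) - U_(j))%MM = 0%MM) ?mpolyX0 ?scale1r//.
by apply/mnmP => k; rewrite !mnmE subnn.
Qed.

(** By Leibniz, exactly one of the [k.+1] derivatives must fall on ['X_i], the other terms vanishing
    at the origin. Up to the factor, multiplication by a variable is thus adjoint to
    differentiation. *)
Lemma fip_mulX k i p q : fip k.+1 ('X_i * p) q = k.+1%:R * fip k p q^`M(i).
Proof.
elim: k p q => [|k IH] p q.
  rewrite /= mul1r (bigD1 i)//= big1 ?addr0 => [|j ji].
    by rewrite mderivM mderivXU eqxx mul1r mevalD mevalM mevalXU mul0r addr0.
  by rewrite mderivM mderivXU (negbTE ji) mul0r add0r mevalM mevalXU !mul0r.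
rewrite [LHS]/=.
transitivity (\sum_j ((j == i)%:R * fip k.+1 p q^`M(j) + k.+1%:R * fip k p^`M(j) (q^`M(i))^`M(j))).
  apply: eq_bigr => j _; rewrite -/(fip k.+1 _ _) mderivM fipD IH (mderiv_comm j i).
  congr (_ + _); rewrite mderivXU; case: eqP => _; first by rewrite !mul1r.
  by rewrite mul0r fip0 mul0r.
rewrite big_split /= -mulr_sumr -/(fip k.+1 _ _).
have -> : \sum_j (j == i)%:R * fip k.+1 p q^`M(j) = fip k.+1 p q^`M(i).
  rewrite (bigD1 i)//= eqxx mul1r [X in _ + X]big1 ?addr0// => j /negbTE ->.
  by rewrite mul0r.
by rewrite -[k.+2%:R]natr1 mulrDl mul1r addrC.
Qed.

Definition lin x : {mpoly R[n]} := \sum_i (x i)%:MP * 'X_i.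
Definition rsq : {mpoly R[n]} := \sum_i 'X_i * 'X_i.
Definition ddir x p : {mpoly R[n]} := \sum_i (x i)%:MP * p^`M(i).
Definition lap p : {mpoly R[n]} := \sum_i (p^`M(i))^`M(i).
Definition euler p : {mpoly R[n]} := \sum_i 'X_i * p^`M(i).
Definition dotf x y : R := \sum_i x i * y i.

Lemma fip_lin k x p q : fip k.+1 (lin x * p) q = k.+1%:R * fip k p (ddir x q).
Proof.
rewrite /lin mulr_suml fip_sum (fipC _ p) fip_sum mulr_sumr; apply: eq_bigr => i _.
by rewrite -mulrA fipZ fip_mulX fipZ fipC; ring.
Qed.

Lemma fip_rsq k p q : fip k.+2 (rsq * p) q = k.+2%:R * k.+1%:R * fip k p (lap q).
Proof.
rewrite /rsq mulr_suml fip_sum (fipC _ p) fip_sum mulr_sumr; apply: eq_bigr => i _.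
by rewrite -mulrA !fip_mulX fipC; ring.
Qed.

Lemma ddirD x p q : ddir x (p + q) = ddir x p + ddir x q.
Proof. by rewrite -big_split; apply: eq_bigr => i _; rewrite mderivD mulrDr. Qed.
Lemma ddirM x p q : ddir x (p * q) = ddir x p * q + p * ddir x q.
Proof.
rewrite /ddir mulr_suml mulr_sumr -big_split; apply: eq_bigr => i _.
by rewrite mderivM /=; ring.
Qed.
Lemma ddirC x c : ddir x c%:MP = 0.
Proof. by apply: big1 => i _; rewrite mderivC mulr0. Qed.
Lemma ddirXU x j : ddir x 'X_j = (x j)%:MP.
Proof.
rewrite /ddir (bigD1 j)//= big1 ?addr0 => [|i /negbTE ij]; rewrite mderivXU ?eqxx ?mulr1//.
by rewrite ij mulr0.
Qed.
Lemma ddir_sum x (I : Type) (r : seq I) (F : I -> {mpoly R[n]}) :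
  ddir x (\sum_(i <- r) F i) = \sum_(i <- r) ddir x (F i).
Proof.
elim: r => [|i r IH]; last by rewrite !big_cons ddirD IH.
by rewrite !big_nil -mpolyC0 ddirC.
Qed.
Lemma ddir_lin x y : ddir x (lin y) = (dotf x y)%:MP.
Proof.
rewrite /lin ddir_sum /dotf raddf_sum; apply: eq_bigr => i _ /=.
by rewrite ddirM ddirC ddirXU mul0r add0r mulrC mpolyCM.
Qed.
Lemma ddir_rsq x : ddir x rsq = lin x + lin x.
Proof.
rewrite /rsq ddir_sum /lin -big_split; apply: eq_bigr => i _ /=.
by rewrite ddirM ddirXU; ring.
Qed.

Lemma eulerD p q : euler (p + q) = euler p + euler q.
Proof. by rewrite -big_split; apply: eq_bigr => i _; rewrite mderivD mulrDr. Qed.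
Lemma eulerM p q : euler (p * q) = euler p * q + p * euler q.
Proof.
rewrite /euler mulr_suml mulr_sumr -big_split; apply: eq_bigr => i _.
by rewrite mderivM /=; ring.
Qed.
Lemma eulerC c : euler c%:MP = 0.
Proof. by apply: big1 => i _; rewrite mderivC mulr0. Qed.
Lemma eulerXU j : euler 'X_j = 'X_j.
Proof.
rewrite /euler (bigD1 j)//= big1 ?addr0 => [|i /negbTE ij]; rewrite mderivXU ?eqxx ?mulr1//.
by rewrite ij mulr0.
Qed.
Lemma euler_sum (I : Type) (r : seq I) (F : I -> {mpoly R[n]}) :
  euler (\sum_(i <- r) F i) = \sum_(i <- r) euler (F i).
Proof.
elim: r => [|i r IH]; last by rewrite !big_cons eulerD IH.
by rewrite !big_nil -mpolyC0 eulerC.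
Qed.
Lemma euler_lin y : euler (lin y) = lin y.
Proof.
rewrite {1}/lin euler_sum; apply: eq_bigr => i _.
by rewrite eulerM eulerC eulerXU mul0r add0r.
Qed.
Lemma euler_rsq : euler rsq = rsq + rsq.
Proof.
rewrite {1}/rsq euler_sum -big_split; apply: eq_bigr => i _ /=.
by rewrite eulerM eulerXU.
Qed.

Lemma mderiv_lin i x : (lin x)^`M(i) = (x i)%:MP.
Proof.
rewrite /lin raddf_sum (bigD1 i)//= big1 ?addr0 => [|j /negbTE ji];
  rewrite mderivM mderivC mul0r add0r mderivXU ?eqxx ?mulr1// eq_sym ji mulr0//.
Qed.
Lemma mderiv_rsq i : rsq^`M(i) = 'X_i + 'X_i.
Proof.
rewrite /rsq raddf_sum (bigD1 i)//= big1 ?addr0 => [|j /negbTE ji];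
  rewrite mderivM mderivXU ?eqxx ?mulr1 ?mul1r// eq_sym ji mulr0 mul0r addr0//.
Qed.

Lemma lapD p q : lap (p + q) = lap p + lap q.
Proof. by rewrite -big_split; apply: eq_bigr => i _; rewrite !mderivD. Qed.
Lemma lapC c : lap c%:MP = 0.
Proof. by apply: big1 => i _; rewrite mderivC -mpolyC0 mderivC. Qed.
Lemma lapZ c p : lap (c%:MP * p) = c%:MP * lap p.
Proof.
rewrite /lap mulr_sumr; apply: eq_bigr => i _.
by rewrite !mderivM mderivC mul0r add0r mderivM mderivC mul0r add0r.
Qed.
Lemma lap_lin x p : lap (lin x * p) = ddir x p + ddir x p + lin x * lap p.
Proof.
rewrite /lap /ddir mulr_sumr -!big_split; apply: eq_bigr => i _ /=.
by rewrite mderivM mderiv_lin mderivD !mderivM mderiv_lin mderivC; ring.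
Qed.
Lemma lap_rsq p : lap (rsq * p) =
  (2 * n%:R)%:MP * p + 4%:MP * euler p + rsq * lap p.
Proof.
have -> : (2 * n%:R)%:MP * p = \sum_(i < n) 2%:MP * p.
  by rewrite sumr_const card_ord -mulr_natl mpolyCM !mpolyC_nat; ring.
rewrite /lap /euler !mulr_sumr -!big_split; apply: eq_bigr => i _ /=.
rewrite mderivM mderiv_rsq mderivD !mderivM mderiv_rsq mderivD !mderivXU eqxx.
rewrite !mpolyC_nat /=; ring.
Qed.

(** Constancy of the [k]-th derivatives only bounds the degree by [k]. Genuine homogeneity is
    expressed by this together with Euler's identity for [euler]. *)
Fixpoint homogen k p : Prop :=
  if k is k'.+1 then forall i, homogen k' p^`M(i) else exists c, p = c%:MP.

Lemma homogenD k p q : homogen k p -> homogen k q -> homogen k (p + q).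
Proof.
elim: k p q => [|k IH] p q; first by move=> [c ->] [c' ->]; exists (c + c'); rewrite mpolyCD.
by move=> hp hq i; rewrite mderivD; apply: IH.
Qed.

Lemma homogen0 k : homogen k 0.
Proof. by elim: k => [|k IH]; [exists 0; rewrite mpolyC0|move=> i; rewrite linear0]. Qed.

Lemma homogenZ k c p : homogen k p -> homogen k (c%:MP * p).
Proof.
elim: k p => [|k IH] p; first by move=> [c' ->]; exists (c * c'); rewrite mpolyCM.
by move=> hp i; rewrite mderivM mderivC mul0r add0r; apply: IH.
Qed.

Lemma homogen_sum k (I : Type) (r : seq I) (F : I -> {mpoly R[n]}) :
  (forall i, homogen k (F i)) -> homogen k (\sum_(i <- r) F i).
Proof.
move=> h; elim: r => [|i r IH]; first by rewrite big_nil; exact: homogen0.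
by rewrite big_cons; apply: homogenD.
Qed.

Lemma homogen_mulX k i p : homogen k p -> homogen k.+1 ('X_i * p).
Proof.
elim: k p => [|k IH] p hp j; rewrite mderivM mderivXU.
  move: hp => [c ->]; rewrite mderivC mulr0 addr0.
  by exists ((j == i)%:R * c); rewrite mpolyCM mpolyC_nat.
apply: (@homogenD k.+1); last exact: IH.
by rewrite -mpolyC_nat; apply: homogenZ.
Qed.

Lemma homogen_lin k x p : homogen k p -> homogen k.+1 (lin x * p).
Proof.
move=> hp; rewrite /lin mulr_suml; apply: homogen_sum => i.
by rewrite -mulrA; apply: homogenZ; apply: homogen_mulX.
Qed.

Lemma homogen_rsq k p : homogen k p -> homogen k.+2 (rsq * p).
Proof.
move=> hp; rewrite /rsq mulr_suml; apply: homogen_sum => i.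
by rewrite -mulrA; apply: homogen_mulX; apply: homogen_mulX.
Qed.

Lemma homogen_ddir k x p : homogen k.+1 p -> homogen k (ddir x p).
Proof. by move=> hp; apply: homogen_sum => i; apply: homogenZ. Qed.

(** The recurrence of [gegen2] made homogeneous: [rsq] restores the missing degree and [lin x] plays
    the variable. For unit vectors the value at [y] is the Gegenbauer polynomial of the cosine, see
    [meval_zonal]. *)
Fixpoint zonal2 x (k : nat) : {mpoly R[n]} * {mpoly R[n]} :=
  if k is k'.+1 then let: (p, q) := zonal2 x k' in
    (q, lin x * q - (gegen_beta R n k'.+1)%:MP * (rsq * p))
  else (1, lin x).
Definition zonal x k := (zonal2 x k).1.

Lemma zonal0 x : zonal x 0 = 1. Proof. by []. Qed.
Lemma zonal1 x : zonal x 1 = lin x. Proof. by []. Qed.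
Lemma zonalSS x k : zonal x k.+2 =
  lin x * zonal x k.+1 - (gegen_beta R n k.+1)%:MP * (rsq * zonal x k).
Proof. by rewrite /zonal /=; case: (zonal2 x k). Qed.

Lemma ddirB x p q : ddir x (p - q) = ddir x p - ddir x q.
Proof. by rewrite ddirD -[- q]mulN1r -mpolyC1 -mpolyCN ddirM ddirC mul0r add0r mpolyCN mpolyC1 mulN1r. Qed.
Lemma eulerB p q : euler (p - q) = euler p - euler q.
Proof. by rewrite eulerD -[- q]mulN1r -mpolyC1 -mpolyCN eulerM eulerC mul0r add0r mpolyCN mpolyC1 mulN1r. Qed.
Lemma lapB p q : lap (p - q) = lap p - lap q.
Proof. by rewrite lapD -[- q]mulN1r -mpolyC1 -mpolyCN lapZ mpolyCN mpolyC1 mulN1r. Qed.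

Lemma homogen_zonal x k : homogen k (zonal x k) /\ homogen k.+1 (zonal x k.+1).
Proof.
elim: k => [|k [h1 h2]]; split=> //.
- by exists 1; rewrite mpolyC1.
- by rewrite zonal1 -[lin x]mulr1; apply: homogen_lin; exists 1; rewrite mpolyC1.
rewrite zonalSS; apply: homogenD; first exact: homogen_lin.
rewrite -mulNr -mpolyCN; apply: homogenZ.
exact: homogen_rsq.
Qed.

Lemma euler_zonal x k : euler (zonal x k) = k%:R%:MP * zonal x k /\
  euler (zonal x k.+1) = k.+1%:R%:MP * zonal x k.+1.
Proof.
elim: k => [|k [h1 h2]]; split=> //.
- by rewrite zonal0 -mpolyC1 eulerC mpolyC0 mul0r.
- by rewrite zonal1 euler_lin mpolyC1 mul1r.
rewrite zonalSS eulerB !eulerM eulerC h1 h2 euler_lin euler_rsq.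
rewrite -!natr1 !mpolyCD mpolyC1; ring.
Qed.

Hypothesis n3 : (3 <= n)%N.

Lemma denom_neq0 k : (2 * k.+1%:R + n%:R - 4 : R) != 0.
Proof.
have : (1 : R) <= 2 * k.+1%:R + n%:R - 4.
  have : (3 : R) <= n%:R by rewrite ler_nat.
  have : (1 : R) <= k.+1%:R by rewrite ler1n.
  lra.
move=> h; apply: lt0r_neq0; lra.
Qed.

(** The constants [gegen_kappa] are those for which this lowering rule is compatible with the
    recurrence: [e1] matches the coefficients of [lin x * zonal x k.+1] and [e2] those of
    [rsq * zonal x k]. *)
Lemma ddir_zonal x k : dotf x x = 1 ->
  ddir x (zonal x k.+1) = (gegen_kappa R n k.+1)%:MP * zonal x k.
Proof.
move=> x1; suff [] : ddir x (zonal x k.+1) = (gegen_kappa R n k.+1)%:MP * zonal x k /\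
  ddir x (zonal x k.+2) = (gegen_kappa R n k.+2)%:MP * zonal x k.+1 by [].
have d k' := denom_neq0 k'.
have n0 : (3 : R) <= n%:R by rewrite ler_nat.
elim: k => [|k [h1 h2]]; split=> //.
- rewrite zonal1 zonal0 ddir_lin x1 mulr1; congr (_%:MP).
  by rewrite /gegen_kappa; field; apply: lt0r_neq0; lra.
- rewrite zonalSS zonal1 zonal0 mulr1 ddirB !ddirM ddirC ddir_lin ddir_rsq x1 mpolyC1.
  have -> : gegen_kappa R n 2 = 2 - 2 * gegen_beta R n 1.
    rewrite /gegen_beta /gegen_kappa; field.
    by rewrite !lt0r_neq0//; lra.
  by move: (gegen_beta R n 1) => b; rewrite mpolyCB mpolyCM (mpolyC_nat n R 2); ring.
rewrite zonalSS ddirB !ddirM ddirC ddir_lin ddir_rsq x1 mpolyC1 h1 h2 zonalSS.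
have k0 : (0 : R) <= k%:R by [].
have e1 : gegen_kappa R n k.+3 = 1 + gegen_kappa R n k.+2 - 2 * gegen_beta R n k.+2.
  rewrite /gegen_beta /gegen_kappa -!natr1; field.
  by rewrite !lt0r_neq0//; lra.
have e2 : gegen_beta R n k.+2 * gegen_kappa R n k.+1 =
    gegen_kappa R n k.+3 * gegen_beta R n k.+1 - gegen_beta R n k.+1.
  rewrite /gegen_beta /gegen_kappa -!natr1; field.
  by rewrite !lt0r_neq0//; lra.
move: e1 e2; move: (gegen_kappa R n k.+3) (gegen_beta R n k.+2) (gegen_beta R n k.+1)
  (gegen_kappa R n k.+2) (gegen_kappa R n k.+1) => ra rb2 rb1 ra2 ra1 e1 e2.
have E1 : ra%:MP = 1 + ra2%:MP - 2 * rb2%:MP :> {mpoly R[n]}.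
  by rewrite e1 mpolyCB mpolyCM mpolyCD mpolyC1 (mpolyC_nat n R 2).
have E2 : rb2%:MP * ra1%:MP = ra%:MP * rb1%:MP - rb1%:MP :> {mpoly R[n]}.
  by rewrite -!mpolyCM -mpolyCB e2.
set L := lin x; set Z1 := zonal x k.+1; set Z := zonal x k.
transitivity ((1 + ra2%:MP - 2 * rb2%:MP) * (L * Z1) - rb1%:MP * (rsq * Z)
  - (rb2%:MP * ra1%:MP) * (rsq * Z)); first ring.
by rewrite E2 -E1; ring.
Qed.

(** The constants [gegen_beta] are chosen for this: the directional derivative produced by [lin x]
    cancels against the Laplacian of the [rsq] term, which Euler's identity evaluates. *)
Lemma lap_zonal x k : dotf x x = 1 -> lap (zonal x k) = 0.
Proof.
move=> x1; suff [] : lap (zonal x k) = 0 /\ lap (zonal x k.+1) = 0 by [].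
have n0 : (3 : R) <= n%:R by rewrite ler_nat.
elim: k => [|k [h1 h2]]; split=> //.
- by rewrite zonal0 -mpolyC1 lapC.
- by rewrite zonal1 -[lin x]mulr1 lap_lin -mpolyC1 ddirC lapC mulr0 !addr0.
rewrite zonalSS lapB lap_lin lapZ lap_rsq ddir_zonal// h1 h2 (euler_zonal x k).1.
have k0 : (0 : R) <= k%:R by [].
have e : 2 * gegen_kappa R n k.+1 - gegen_beta R n k.+1 * (2 * n%:R + 4 * k%:R) = 0.
  rewrite /gegen_beta /gegen_kappa -!natr1; field.
  by rewrite !lt0r_neq0//; lra.
move: e; move: (gegen_kappa R n k.+1) (gegen_beta R n k.+1) => kk bb e.
have {}e : 2%:MP * kk%:MP - bb%:MP * ((2 * n%:R)%:MP + 4%:MP * k%:R%:MP) = 0 :> {mpoly R[n]}.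
  by rewrite -!mpolyCM -mpolyCD -mpolyCM -mpolyCB e mpolyC0.
rewrite (mpolyC_nat n R 2) in e.
set Z := zonal x k.
transitivity ((2 * kk%:MP - bb%:MP * ((2 * n%:R)%:MP + 4%:MP * k%:R%:MP)) * Z); first ring.
by rewrite e mul0r.
Qed.

Lemma mderiv_ddir x p j : (ddir x p)^`M(j) = ddir x p^`M(j).
Proof.
rewrite /ddir raddf_sum; apply: eq_bigr => i _ /=.
by rewrite mderivM mderivC mul0r add0r mderiv_comm.
Qed.

Lemma lap_ddir x p : lap p = 0 -> lap (ddir x p) = 0.
Proof.
move=> lp; have -> : lap (ddir x p) = ddir x (lap p).
  by rewrite {2}/lap ddir_sum; apply: eq_bigr => j _; rewrite !mderiv_ddir.
by rewrite lp -mpolyC0 ddirC.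
Qed.

(** Against a harmonic [q] the [rsq] terms of the recurrence disappear, since [rsq] is adjoint to
    the Laplacian. Each step then acts as [lin x], whose adjoint is [ddir x]. *)
Lemma fip_zonal x k q : lap q = 0 -> fip k (zonal x k) q = k`!%:R * (iter k (ddir x) q).@[fun=> 0].
Proof.
suff [] : (forall q, lap q = 0 -> fip k (zonal x k) q = k`!%:R * (iter k (ddir x) q).@[fun=> 0]) /\
  (forall q, lap q = 0 -> fip k.+1 (zonal x k.+1) q = k.+1`!%:R * (iter k.+1 (ddir x) q).@[fun=> 0]).
  by move=> h _; exact: h.
elim: k => [|k [_ h2]]; split=> //.
- by move=> q' _; rewrite /= zonal0 meval1 fact0 !mul1r.
- by move=> q' _; rewrite zonal1 -[lin x]mulr1 fip_lin /= meval1 (_ : 1`! = 1)%N// !mul1r.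
move=> q' lq; rewrite zonalSS fipD fip_lin -mulNr -mpolyCN fipZ fip_rsq lq.
rewrite (fipC k) fip0 !mulr0 addr0 h2; last exact: lap_ddir.
by rewrite -(iterSr k.+1) [in RHS]factS natrM mulrA.
Qed.

(** Taylor's formula for a form: evaluating Euler's identity at [x] turns one derivative along [x]
    into the factor [k]. *)
Lemma iter_ddir_eval x k q : homogen k q -> euler q = k%:R%:MP * q ->
  (iter k (ddir x) q).@[fun=> 0] = k`!%:R * q.@[x].
Proof.
elim: k q => [|k IH] q /= h e.
  by move: h => [c ->]; rewrite !mevalC mul1r.
rewrite -iterS iterSr IH; last 2 first.
- by apply: homogen_ddir.
- have : ddir x (euler q) = ddir x (k.+1%:R%:MP * q) by rewrite e.
  have -> : ddir x (euler q) = ddir x q + euler (ddir x q).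
    rewrite /euler ddir_sum [in X in _ + X]/ddir.
    under eq_bigr do rewrite ddirM ddirXU.
    rewrite big_split /=; congr (_ + _); apply: eq_bigr => i _; congr (_ * _).
    rewrite /ddir raddf_sum; apply: eq_bigr => j _ /=.
    by rewrite mderivM mderivC mul0r add0r mderiv_comm.
  rewrite ddirM ddirC mul0r add0r -natr1 mpolyCD mpolyC1 mulrDl mul1r addrC.
  by move/addIr.
have : (euler q).@[x] = k.+1%:R * q.@[x] by rewrite e mevalM mevalC.
have -> : (euler q).@[x] = (ddir x q).@[x].
  rewrite /euler /ddir !raddf_sum; apply: eq_bigr => i _ /=.
  by rewrite !mevalM mevalXU mevalC.
by move=> ->; rewrite factS natrM; ring.
Qed.

Lemma meval_zonal x y k : dotf y y = 1 -> (zonal x k).@[y] = (gegen R n k).[dotf x y].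
Proof.
move=> y1; suff [] : (zonal x k).@[y] = (gegen R n k).[dotf x y] /\
  (zonal x k.+1).@[y] = (gegen R n k.+1).[dotf x y] by [].
have ly : (lin x).@[y] = dotf x y.
  rewrite /lin /dotf raddf_sum; apply: eq_bigr => i _ /=.
  by rewrite mevalM mevalC mevalXU.
have ry : rsq.@[y] = 1.
  by rewrite /rsq raddf_sum -y1; apply: eq_bigr => i _ /=; rewrite mevalM mevalXU.
elim: k => [|k [h1 h2]]; split=> //.
- by rewrite zonal0 gegen0 meval1 hornerC.
- by rewrite zonal1 gegen1 ly hornerX.
by rewrite zonalSS gegenSS mevalB !mevalM mevalC ly ry h1 h2 hornerD hornerN hornerM hornerX hornerZ mul1r.
Qed.

(** By the reproducing property, two zonal polynomials have inner product [k!] squared times the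
    Gegenbauer polynomial of the cosine of their poles. The double sum is thus, up to that factor,
    the square of the sum of the zonal polynomials. *)
Lemma gegen_psd (I : finType) (x : I -> 'I_n -> R) k : (forall i, dotf (x i) (x i) = 1) ->
  0 <= \sum_i \sum_j (gegen R n k).[dotf (x i) (x j)].
Proof.
move=> hx; have k0 : 0 < k`!%:R * k`!%:R :> R by rewrite mulr_gt0// ltr0n fact_gt0.
rewrite -(pmulr_rge0 _ k0).
suff -> : k`!%:R * k`!%:R * (\sum_i \sum_j (gegen R n k).[dotf (x i) (x j)]) =
    fip k (\sum_i zonal (x i) k) (\sum_i zonal (x i) k) by exact: fip_ge0.
rewrite fip_sum mulr_sumr; apply: eq_bigr => i _.
rewrite fipC fip_sum mulr_sumr; apply: eq_bigr => j _.
rewrite fip_zonal ?lap_zonal// iter_ddir_eval ?meval_zonal//; first by rewrite mulrA.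
  by case: (homogen_zonal (x i) k).
by case: (euler_zonal (x i) k).
Qed.

End FischerProduct.
End Fischer.

(** * The linear programming bound *)

Section Linearization.
Variables (R : realFieldType) (n : nat).
Hypothesis n4 : (4 <= n)%N.
Local Notation p := (gegen R n).
Local Notation b := (gegen_beta R n).


(** This form shows that the coefficients increase towards 1/4, the numerator being nonnegative as
    [n >= 4]. *)
Lemma gegen_betaE k : (0 < k)%N -> b k = 1 / 4 -
  (n%:R - 2) * (n%:R - 4) / (4 * (2 * k%:R + n%:R - 2) * (2 * k%:R + n%:R - 4)).
Proof.
move=> k0; have k1 : (1 : R) <= k%:R by rewrite ler1n.
have n4R' : (4 : R) <= n%:R by rewrite ler_nat.
rewrite /gegen_beta /gegen_kappa; field.
by rewrite !lt0r_neq0//; lra.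
Qed.

Lemma gegen_beta_gt0 k : (0 < k)%N -> 0 < b k.
Proof.
move=> k0; have k1 : (1 : R) <= k%:R by rewrite ler1n.
have n4R' : (4 : R) <= n%:R by rewrite ler_nat.
by rewrite /gegen_beta /gegen_kappa !divr_gt0// ?mulr_gt0//; lra.
Qed.

Lemma gegen_beta_le i j : (0 < i <= j)%N -> b i <= b j.
Proof.
move=> /andP[i0 ij]; have j0 := leq_trans i0 ij.
have i1 : (1 : R) <= i%:R by rewrite ler1n.
have n4R' : (4 : R) <= n%:R by rewrite ler_nat.
have ij' : (i%:R : R) <= j%:R by rewrite ler_nat.
rewrite !gegen_betaE// lerD2l lerN2; apply: ler_wpM2l; first by rewrite mulr_ge0//; lra.
rewrite lef_pV2 ?posrE; try by rewrite !mulr_gt0//; lra.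
apply: ler_pM; [|lra| |lra]; last lra.
by rewrite mulr_ge0//; lra.
Qed.

(** The squared norm of the monic orthogonal polynomial of degree [k], as a product of recurrence
    coefficients. Here it appears as the constant coefficient of the square of that polynomial. *)
Fixpoint gegen_norm (k : nat) : R := if k is k'.+1 then gegen_norm k' * b k else 1.
Local Notation h := gegen_norm.

Lemma gegen_norm_gt0 k : 0 < h k.
Proof. by elim: k => //= k IH; rewrite mulr_gt0 ?gegen_beta_gt0. Qed.

(* [t] is the Gram matrix of a finite configuration of points of the sphere. *)
Variables (I : finType) (t : I -> I -> R).
Hypothesis psd : forall k, 0 <= \sum_i \sum_j (p k).[t i j].

(* [g - c] is positive definite on the configuration, tested on constants only. *)
Definition pdef (g : {poly R}) (c : R) := #|I|%:R ^+ 2 * c <= \sum_i \sum_j g.[t i j].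

Lemma pdefD g g' c c' : pdef g c -> pdef g' c' -> pdef (g + g') (c + c').
Proof.
rewrite /pdef => h1 h2; rewrite mulrDr; apply: le_trans (lerD h1 h2) _.
rewrite -big_split le_eqVlt; apply/orP; left; apply/eqP; apply: eq_bigr => i _.
by rewrite -big_split; apply: eq_bigr => j _; rewrite hornerD.
Qed.

Lemma pdefZ a g c : 0 <= a -> pdef g c -> pdef (a *: g) (a * c).
Proof.
rewrite /pdef => a0 h1; rewrite mulrCA; apply: le_trans (ler_wpM2l a0 h1) _.
rewrite mulr_sumr le_eqVlt; apply/orP; left; apply/eqP; apply: eq_bigr => i _.
by rewrite mulr_sumr; apply: eq_bigr => j _; rewrite hornerZ.
Qed.

Lemma pdef_sum (J : Type) (r : seq J) (g : J -> {poly R}) (c : J -> R) :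
  (forall j, pdef (g j) (c j)) -> pdef (\sum_(j <- r) g j) (\sum_(j <- r) c j).
Proof.
move=> hg; elim: r => [|j r IH]; last by rewrite !big_cons; apply: pdefD.
by rewrite !big_nil /pdef mulr0 big1// => i _; rewrite big1// => j _; rewrite horner0.
Qed.

Lemma pdef_gegen k : pdef (p k) (k == 0)%:R.
Proof.
rewrite /pdef; case: k => [|k]; last by rewrite mulr0 psd.
rewrite mulr1 gegen0; under eq_bigr do under eq_bigr do rewrite hornerC.
by rewrite !sumr_const -mulrnA -natrX expnS expn1.
Qed.

Let prodok i j := pdef (p i * p j) ((i == j)%:R * h i).

(** Expanding both products by the recurrence, the terms carrying ['X] cancel. What is left is the
    difference one step lower plus a product with coefficient [b j.+1 - b i.+1], nonnegative because
    the recurrence coefficients increase. *)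
Lemma pdef_swap i j : (i <= j)%N ->
  (forall a c, (a + c <= i + j)%N -> prodok a c) ->
  pdef (p i.+1 * p j - p i * p j.+1) ((j == i.+1)%:R * h i.+1).
Proof.
elim: i j => [|i IH] j ij ok.
  case: j ij ok => [|j] _ ok.
    rewrite gegen0 gegen1 mul1r mulr1 subrr mul0r.
    by have := pdefZ (lexx 0) (pdef_gegen 0); rewrite scale0r mul0r.
  have -> : p 1 * p j.+1 - p 0 * p j.+2 = b j.+1 *: p j.
    by rewrite gegenSS gegen0 gegen1 mul1r opprD opprK addrA subrr add0r.
  have -> : (j.+1 == 1)%:R * h 1 = b j.+1 * (j == 0)%:R.
    by rewrite /= mul1r eqSS; case: eqP => [->|_]; rewrite ?mulr1 ?mul1r ?mulr0 ?mul0r.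
  by apply: pdefZ; [rewrite ltW// gegen_beta_gt0|exact: pdef_gegen].
case: j ij ok => // j ij ok.
have -> : p i.+2 * p j.+1 - p i.+1 * p j.+2 = (b j.+1 - b i.+1) *: (p i.+1 * p j) +
    b i.+1 *: (p i.+1 * p j - p i * p j.+1).
  by rewrite !gegenSS -!mul_polyC polyCB; ring.
have -> : (j.+1 == i.+2)%:R * h i.+2 = (b j.+1 - b i.+1) * ((i.+1 == j)%:R * h i.+1) +
    b i.+1 * ((j == i.+1)%:R * h i.+1).
  by rewrite eqSS (eq_sym i.+1); case: eqP => [->|_] /=; rewrite ?mul1r ?mul0r ?mulr0 ?addr0//; ring.
apply: pdefD; apply: pdefZ.
- by rewrite subr_ge0; apply: gegen_beta_le.
- by apply: ok; rewrite addSn addnS; lia.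
- by rewrite ltW// gegen_beta_gt0.
- by apply: IH => // a c ac; apply: ok; lia.
Qed.

(** Nonnegativity of the linearization of products, without its explicit coefficients: inside an
    induction on the total degree, degree is moved from the smaller factor to the larger one until
    the smaller factor is 1, each move costing a [pdef_swap]. *)
Lemma pdef_gegenM i j : pdef (p i * p j) ((i == j)%:R * h i).
Proof.
have [s sE] : exists s, s = (i + j)%N by eexists.
elim/ltn_ind: s i j sE => s IH.
suff H i j : (i <= j)%N -> s = (i + j)%N -> prodok i j.
  move=> i j sE; have [ij|ji] := leqP i j; first exact: H.
  have := H j i (ltnW ji); rewrite addnC => /(_ sE).
  by rewrite /prodok mulrC (gtn_eqF ji) (ltn_eqF ji) !mul0r.
elim: i j => [|i IHi] j ij sE.
  by rewrite /prodok gegen0 mul1r mulr1 eq_sym; exact: pdef_gegen.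
rewrite /prodok (_ : p i.+1 * p j = p i * p j.+1 + (p i.+1 * p j - p i * p j.+1)); last by ring.
rewrite -[X in pdef _ X]add0r; apply: pdefD.
  have := IHi j.+1 ltac:(lia) ltac:(lia); rewrite /prodok (_ : i == j.+1 = false) ?mul0r//.
  by apply/eqP; lia.
rewrite (eq_sym i.+1 j); apply: pdef_swap; first lia.
move=> a c ac; apply: (IH (a + c)%N) => //; lia.
Qed.

End Linearization.

Section DelsarteBound.
Variables (R : realFieldType) (n : nat).
Hypothesis n4 : (4 <= n)%N.
Local Notation p := (gegen R n).
Local Notation b := (gegen_beta R n).
Local Notation h := (gegen_norm R n).

Variables (c : nat -> R) (K : nat) (s d : R).
Hypothesis c0 : forall i, 0 <= c i.
Hypothesis cK : forall i, (K <= i)%N -> c i = 0.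

Definition gegen_poly : {poly R} := \sum_(i < K) c i *: p i.
Definition mulX_coef (i : nat) : R :=
  (if i is i'.+1 then c i' else 0) + b i.+1 * c i.+1 - s * c i.

Lemma gegen_poly_mulX : ('X - s%:P) * gegen_poly = \sum_(i < K.+1) mulX_coef i *: p i.
Proof.
have XE : 'X * gegen_poly = \sum_(i < K.+1) ((if i : nat is i'.+1 then c i' else 0) + b i.+1 * c i.+1) *: p i.
  under eq_bigr do rewrite scalerDl.
  rewrite big_split /= big_ord_recl scale0r add0r.
  have -> : \sum_(i < K.+1) (b i.+1 * c i.+1) *: p i = \sum_(i < K) (if i : nat is i'.+1 then (b i * c i) *: p i' else 0).
    case: K cK => [|k] ck.
      by rewrite big_ord_recl !big_ord0 ck// mulr0 scale0r addr0.
    rewrite [RHS]big_ord_recl add0r !big_ord_recr /= !(ck k.+1) ?(ck k.+2)//.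
    by rewrite !mulr0 !scale0r !addr0; apply: eq_bigr.
  rewrite -big_split mulr_sumr; apply: eq_bigr => -[i iK] _ /=.
  case: i {iK} => [|i]; first by rewrite gegen0 gegen1 addr0 -scalerAr mulr1.
  by rewrite gegenSS scalerBr scalerA (mulrC (b _)) subrK scalerAr.
rewrite mulrBl XE; have -> : s%:P * gegen_poly = \sum_(i < K.+1) (s * c i) *: p i.
  rewrite big_ord_recr /= cK// mulr0 scale0r addr0 mulr_sumr; apply: eq_bigr => i _.
  by rewrite mul_polyC scalerA.
by rewrite -sumrB; apply: eq_bigr => i _; rewrite -scalerBl.
Qed.

Variables (I : finType) (t : I -> I -> R).
Hypothesis psd : forall k, 0 <= \sum_i \sum_j (p k).[t i j].
Hypothesis t1 : forall i, t i i = 1.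
Hypothesis ts : forall i j, i != j -> t i j <= s.
Hypothesis d0 : 0 < d.
Hypothesis ce : forall i, d * c i <= mulX_coef i.

Hypothesis s1 : s <= 1.

(** The test polynomial is ('X - s) G^2 with G = [gegen_poly]. Off the diagonal it is nonpositive.
    By [ce], the coefficients of ('X - s) G dominate those of d G, so the constant coefficient of
    the product with G is at least d times the squared norm of G. *)
Lemma delsarte_lp : #|I|%:R * (d * \sum_(i < K) c i ^+ 2 * h i) <= (1 - s) * gegen_poly.[1] ^+ 2.
Proof.
have h0 i : 0 < h i by exact: gegen_norm_gt0.
have [I0|I0] := posnP #|I|.
  by rewrite I0 mul0r mulr_ge0 ?sqr_ge0// subr_ge0.
have I0' : (0 : R) < #|I|%:R by rewrite ltr0n.
rewrite -(ler_pM2l I0') [X in X <= _]mulrA -(expr2 #|I|%:R).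
have low : pdef t (('X - s%:P) * gegen_poly * gegen_poly)
    (\sum_(i < K.+1) \sum_(j < K) (mulX_coef i * c j) * ((i == j :> nat)%:R * h i)).
  rewrite gegen_poly_mulX mulr_suml; apply: pdef_sum => i.
  rewrite mulr_sumr; apply: pdef_sum => j.
  rewrite -scalerAl -scalerAr scalerA; apply: pdefZ; last exact: pdef_gegenM.
  by rewrite mulr_ge0// (le_trans _ (ce i))// mulr_ge0// ltW.
have := low; rewrite /pdef => low'.
apply: (@le_trans _ _ (\sum_i \sum_j (('X - s%:P) * gegen_poly * gegen_poly).[t i j])).
  apply: le_trans low'; rewrite ler_pM2l ?exprn_gt0//.
  rewrite big_ord_recr /= [X in _ <= _ + X]big1 ?addr0 => [|j _]; last first.
    by rewrite gtn_eqF// mul0r mulr0.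
  rewrite mulr_sumr; apply: ler_sum => i _.
  rewrite (bigD1 i)//= eqxx big1 ?addr0 => [|j /negbTE ij]; last first.
    by rewrite eq_sym -val_eqE /= in ij; rewrite ij mul0r mulr0.
  by rewrite mulrA [X in _ <= _ * X]mul1r ler_pM2r// expr2 mulrA ler_wpM2r.
have -> : #|I|%:R * ((1 - s) * gegen_poly.[1] ^+ 2) = \sum_(i in I) ((1 - s) * gegen_poly.[1] ^+ 2).
  by rewrite sumr_const mulr_natl.
apply: ler_sum => i _; rewrite (bigD1 i)//= t1 -[leRHS]addr0; apply: lerD.
  by rewrite !hornerM hornerD hornerN hornerX hornerC -mulrA -expr2.
apply: sumr_le0 => j ji; rewrite !hornerM hornerD hornerN hornerX hornerC -mulrA -expr2.
by rewrite mulr_le0_ge0 ?sqr_ge0// subr_le0; apply: ts; rewrite eq_sym.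
Qed.

End DelsarteBound.

(* Required only here because the notations of mpoly and of the analysis
   library cannot be imported together. *)
From mathcomp Require Import all_classical all_reals all_analysis.
From mathcomp Require Import measurable_realfun.

Import numFieldNormedType.Exports.

Local Open Scope classical_set_scope.
Local Open Scope ring_scope.

(** * Averaging operators and packings *)

Section NormFacts.
Context (R : realType) (d : nat) (nm : 'rV[R]_d -> R).
Hypothesis nmP : is_norm nm.

Lemma is_norm0 : nm 0 = 0.
Proof. by case: nmP => _ /(_ 0 0) + _; rewrite scale0r normr0 mul0r. Qed.

Lemma is_normN x : nm (- x) = nm x.
Proof. by case: nmP => _ /(_ (-1) x) + _; rewrite scaleN1r normrN1 mul1r. Qed.

Lemma is_norm_ge0 x : 0 <= nm x.
Proof.
case: nmP => /(_ x (- x)) + _ _; rewrite subrr is_norm0 is_normN; lra.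
Qed.

Lemma is_normB x y : nm (x - y) = nm (y - x).
Proof. by rewrite -is_normN opprB. Qed.

Lemma is_norm_tri z x y : nm (x - y) <= nm (x - z) + nm (z - y).
Proof.
case: nmP => /(_ (x - z) (z - y)) + _ _.
by rewrite addrA subrK.
Qed.

Lemma is_norm_sum (I : Type) (s : seq I) (F : I -> 'rV[R]_d) :
  nm (\sum_(i <- s) F i) <= \sum_(i <- s) nm (F i).
Proof.
elim/big_ind2 : _ => //; first by rewrite is_norm0.
case: nmP => tri _ _ x1 x2 y1 y2 h1 h2.
exact: (le_trans (tri _ _) (lerD h1 h2)).
Qed.

(** A Lipschitz constant of [nm] for the maximum norm; the summand 1 keeps it positive. *)
Definition norm_lip : R := 1 + \sum_(i < d) nm (delta_mx 0 i).

Lemma norm_lip_gt0 : 0 < norm_lip.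
Proof.
by rewrite /norm_lip ltr_pwDl// sumr_ge0// => i _; exact: is_norm_ge0.
Qed.

Lemma is_norm_lip x : nm x <= norm_lip * `|x|.
Proof.
rewrite [in nm x](row_sum_delta x); apply: (le_trans (is_norm_sum _ _)).
rewrite /norm_lip mulrDl mul1r mulr_suml.
apply: (@le_trans _ _ (\sum_(i < d) nm (delta_mx 0 i) * `|x|)); last first.
  by rewrite lerDr.
apply: ler_sum => i _; case: nmP => _ -> _.
rewrite mulrC ler_wpM2l ?is_norm_ge0//.
by rewrite -[leRHS]/(mx_norm x) mx_normrE (bigmax_sup (ord0, i)).
Qed.

Lemma open_nball_open x r : open (open_nball nm x r).
Proof.
rewrite openE => y /= hy.
rewrite /interior/=; apply/nbhs_ballP.
exists ((r - nm (x - y)) / norm_lip) => /=; first by rewrite divr_gt0 ?subr_gt0// norm_lip_gt0.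
move=> z; rewrite -ball_normE /= ltr_pdivlMr ?norm_lip_gt0// => hz.
rewrite /open_nball /=.
apply: (le_lt_trans (is_norm_tri y x z)).
have := is_norm_lip (y - z); rewrite mulrC => h.
by rewrite -ltrBrDl; exact: le_lt_trans h hz.
Qed.

Lemma closed_nball_closed x r : closed (closed_nball nm x r).
Proof.
rewrite -[X in closed X]setCK; apply: open_closedC.
rewrite openE => y /=; rewrite /closed_nball /= => /negP; rewrite -ltNge => hy.
rewrite /interior/=; apply/nbhs_ballP.
exists ((nm (x - y) - r) / norm_lip) => /=; first by rewrite divr_gt0 ?subr_gt0// norm_lip_gt0.
move=> z; rewrite -ball_normE /= ltr_pdivlMr ?norm_lip_gt0// => hz.
apply/negP; rewrite -ltNge.
have := is_norm_lip (z - y); have := is_norm_tri z x y.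
rewrite mulrC distrC in hz * => h1 h2; lra.
Qed.

End NormFacts.

Section Rat.
Context (R : realType) (d : nat).

Lemma rat_dense (x : 'rV[R]_d) (e : R) : 0 < e ->
  exists q : 'rV[rat]_d, `|x - map_mx ratr q| < e.
Proof.
move=> e0.
have H i : exists q : rat, `|x 0 i - ratr q| < e.
  have [q] := @rat_in_itvoo R (x 0 i - e) (x 0 i + e) ltac:(lra).
  rewrite in_itv/= => /andP[h1 h2]; exists q.
  by rewrite ltr_norml; apply/andP; split; lra.
have [f hf] := choice H.
exists (\row_i f i).
rewrite -[ltLHS]/(mx_norm _) mx_normrE bigmax_lt// => -[i j] _ /=.
by rewrite !mxE [i]ord1; exact: hf.
Qed.

(** The topology has a countable base, so a union of open sets is already a countable union of some
    of them, and continuity from below applies to its finite partial unions. *)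
Lemma tau_additive_all (mu : {measure set (borelRd R d) -> \bar R}) : tau_additive mu.
Proof.
move=> O Oop.
pose I := ('rV[rat]_d * nat)%type.
pose B (i : I) : set 'rV[R]_d := [set y | `|map_mx ratr i.1 - y| < i.2.+1%:R^-1].
pose good (i : I) := exists U, O U /\ B i `<=` U.
(* Each rational ball contained in a member of [O] selects one such member; the other balls select
   the empty set, which need not belong to [O]. *)
have HU (i : I) : exists U : set 'rV[R]_d, (good i -> O U /\ B i `<=` U) /\ (~ good i -> U = set0).
  case: (pselect (good i)) => [[U hU]|h]; first by exists U; split=> // /(_ (ex_intro _ U hU)).
  by exists set0; split=> // /h.
have {HU}[U hU] := choice HU.
pose V (n : nat) : set 'rV[R]_d := if unpickle n is Some i then U i else set0.
have VO n : V n = set0 \/ O (V n).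
  rewrite /V; case: (unpickle n) => [i|]; last by left.
  case: (pselect (good i)) => h; first by right; have [/(_ h) []] := hU i.
  by left; have [_ /(_ h)] := hU i.
have Vop n : open (V n).
  by case: (VO n) => [->|/Oop//]; exact: open0.
have eV : \bigcup_(U in O) U = \bigcup_n V n.
  apply/seteqP; split => x; last first.
    move=> [n _ h]; case: (VO n) => [h0|h1]; first by rewrite h0 in h.
    by exists (V n).
  move=> [W OW Wx].
  have := Oop _ OW; rewrite openE => /(_ _ Wx); rewrite /interior/=.
  move=> /nbhs_ballP [e /= e0 he].
  pose n := Num.truncn (2 / e).
  have en : n.+1%:R^-1 < e / 2.
    rewrite -[e / 2]invrK ltf_pV2 ?posrE ?invr_gt0 ?divr_gt0//.
    by rewrite invfM invrK mulrC; exact: truncnS_gt.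
  have [q hq] := @rat_dense x n.+1%:R^-1 ltac:(by rewrite invr_gt0).
  have gi : good (q, n).
    exists W; split => // y; rewrite /B /= => hy; apply: he.
    rewrite -ball_normE /=.
    rewrite (splitr e); apply: (le_lt_trans (ler_distD (map_mx ratr q) _ _)).
    exact: ltrD (lt_trans hq en) (lt_trans hy en).
  exists (pickle (q, n)) => //; rewrite /V pickleK.
  have [/(_ gi) [_ h] _] := hU (q, n); apply: h.
  by rewrite /B /= distrC.
have mV n : measurable (V n : set (borelRd R d)).
  by apply: sub_sigma_algebra; exact: Vop.
apply/eqP; rewrite eq_le; apply/andP; split; last first.
  apply: ge_ereal_sup => _ [F [finF FO] <-].
  have mF (G : set (set 'rV[R]_d)) : G `<=` O -> measurable (\bigcup_(U in G) U : set (borelRd R d)).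
    by move=> GO; apply: sub_sigma_algebra; apply: bigcup_open => W GW; apply/Oop/GO.
  by apply: le_measure; rewrite ?inE; [exact: mF|exact: mF|exact: bigcup_subset].
rewrite eV.
pose W n := \big[setU/set0]_(i < n) V i.
have -> : \bigcup_n V n = \bigcup_n W n.
  apply/seteqP; split => x [n _ h].
    by exists n.+1 => //; rewrite /W big_ord_recr; right.
  by move: h; rewrite /W -bigcup_mkord => -[i /= _ ?]; exists i.
have cv : mu (W n) @[n --> \oo] --> mu (\bigcup_n W n).
  apply: nondecreasing_cvg_mu.
  - by move=> n; apply: bigsetU_measurable => i _; exact: mV.
  - by apply: bigcup_measurable => n _; apply: bigsetU_measurable => i _; exact: mV.
  - move=> n m nm; rewrite /W; apply/subsetPset; exact: subset_bigsetU.
rewrite -(cvg_lim _ cv)//.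
apply: lime_le; first by apply/cvg_ex; eexists; exact: cv.
apply: nearW => n; apply: ereal_sup_ubound.
(* Intersecting with [O] discards the empty sets introduced as default values. *)
exists [set U | (exists2 i, (i < n)%N & V i = U) /\ O U]; first split.
- apply: (@sub_finite_set _ _ [set V i | i in `I_n]).
    by move=> _ [[i ? <-] _]; exists i.
  exact/finite_image/finite_II.
- by move=> ? [].
- congr (mu _); apply/seteqP; split => x.
    by move=> [_ [[i ? <-] _]] ?; rewrite /W -bigcup_mkord; exists i.
  rewrite /W -bigcup_mkord => -[i /= ? h]; exists (V i) => //; split; first by exists i.
  by case: (VO i) => // h0; rewrite h0 in h.
Qed.

End Rat.

Section SigmaFiniteAlias.
Context d (T : measurableType d) (R : realType) (mu : {measure set T -> \bar R}).

(** A copy of [mu] indexed by a proof of sigma-finiteness, so that the structure required by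
    Tonelli's theorem is inferred from its name. *)
Definition sigma_finite_alias of sigma_finite setT mu : set T -> \bar R := mu.

Variable sf : sigma_finite setT mu.
HB.instance Definition _ := isMeasure.Build _ _ _ (sigma_finite_alias sf)
  (measure0 mu) (measure_ge0 mu) (@measure_semi_sigma_additive _ _ _ mu).
HB.instance Definition _ := Measure_isSigmaFinite.Build _ _ _ (sigma_finite_alias sf) sf.

End SigmaFiniteAlias.

(** The integral of a nonnegative function is a supremum over simple functions below it, so
    monotonicity holds without measurability. It is applied to [average], whose measurability is
    never established. *)
Lemma ge0_le_integral_nomeas d (T : measurableType d) (R : realType)
    (mu : {measure set T -> \bar R}) (f1 f2 : T -> \bar R) :
  (forall x, 0 <= f1 x)%E -> (forall x, f1 x <= f2 x)%E ->
  (\int[mu]_x f1 x <= \int[mu]_x f2 x)%E.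
Proof.
move=> h1 h2; rewrite !ge0_integralTE//; last first.
  by move=> x; exact: le_trans (h2 x).
by apply: le_ereal_sup => _ [h /= hh <-]; exists h => // x; exact: le_trans (h2 x).
Qed.

(** * Packing numbers bound the averaging operators *)

Section Upper.
Context (R : realType) (d : nat) (nm : 'rV[R]_d -> R).
Hypothesis nmP : is_norm nm.
Variable mu : {measure set (borelRd R d) -> \bar R}.
Hypothesis lf : locally_finite nm mu.
Variable r : R.
Hypothesis r0 : 0 < r.

Local Notation T := (borelRd R d).
Local Notation B x := (closed_nball nm x r : set T).

Lemma measurable_closed_nball x s : measurable (closed_nball nm x s : set T).
Proof.
rewrite -[X in measurable X]setCK; apply: measurableC; apply: sub_sigma_algebra.
exact/closed_openC/closed_nball_closed.
Qed.

Lemma measure_closed_nball_lty x s : (mu (closed_nball nm x s) < +oo)%E.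
Proof.
apply: lf; first exact: measurable_closed_nball.
exists (nm x + s) => y /= hy.
have := is_norm_tri nmP x 0 y; rewrite !sub0r !is_normN//.
move: hy; rewrite /closed_nball/=; lra.
Qed.

Lemma locally_finite_sigma_finite : sigma_finite [set: T] mu.
Proof.
exists (fun n => closed_nball nm 0 n%:R); last first.
  by move=> n; split; [exact: measurable_closed_nball|exact: measure_closed_nball_lty].
apply/seteqP; split => // x _; exists (Num.truncn (nm x)).+1 => //.
rewrite /closed_nball/= sub0r is_normN//.
exact/ltW/truncnS_gt.
Qed.

Let muS := sigma_finite_alias locally_finite_sigma_finite.

(** The sigma-algebra is that generated by rectangles. The complement is open, hence a countable
    union of products of rational balls. *)
Lemma measurable_nball_rel :
  measurable ([set z | nm (z.1 - z.2) <= r] : set (T * T)%type).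
Proof.
rewrite -[X in measurable X]setCK; apply: measurableC.
pose I := ('rV[rat]_d * 'rV[rat]_d * nat)%type.
pose b (q : 'rV[rat]_d) (n : nat) : set T :=
  ball (map_mx ratr q : 'rV[R]_d) (n.+1%:R^-1 : R).
pose F (i : I) : set (T * T) := [set z | (b i.1.1 i.2 `*` b i.1.2 i.2) z /\
   (b i.1.1 i.2 `*` b i.1.2 i.2 `<=` [set z | r < nm (z.1 - z.2)])].
have -> : ~` [set z : T * T | nm (z.1 - z.2) <= r] = \bigcup_i F i.
  apply/seteqP; split => -[x y] /=; last first.
    by move=> [i _ [h /(_ _ h)]] /=; rewrite ltNge => /negP.
  move=> /negP; rewrite -ltNge => hxy.
  (* Each coordinate moves by less than 2 e, so the norm of the difference changes by less than 4 e
     [norm_lip nm], which is the gap. *)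
  pose e := (nm (x - y) - r) / (norm_lip nm * 4).
  have L0 := norm_lip_gt0 nmP.
  have e0 : 0 < e by rewrite divr_gt0 ?subr_gt0// mulr_gt0.
  pose n := Num.truncn e^-1.
  have en : n.+1%:R^-1 < e.
    rewrite -[e]invrK ltf_pV2 ?posrE ?invr_gt0//; exact: truncnS_gt.
  have [q1 h1] := @rat_dense R d x n.+1%:R^-1 ltac:(by rewrite invr_gt0).
  have [q2 h2] := @rat_dense R d y n.+1%:R^-1 ltac:(by rewrite invr_gt0).
  exists ((q1, q2), n) => //; split.
    by split; rewrite /b /= -ball_normE /= distrC.
  move=> [x' y'] []; rewrite /b /= -!ball_normE /= => h1' h2'.
  have d1 : `|x - x'| < e + e.
    apply: (le_lt_trans (ler_distD (map_mx ratr q1) _ _)).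
    exact: ltrD (lt_trans h1 en) (lt_trans h1' en).
  have d2 : `|y' - y| < e + e.
    rewrite distrC; apply: (le_lt_trans (ler_distD (map_mx ratr q2) _ _)).
    exact: ltrD (lt_trans h2 en) (lt_trans h2' en).
  have t1 := is_norm_tri nmP x' x y; have t2 := is_norm_tri nmP y' x' y.
  have l1 := is_norm_lip nmP (x - x'); have l2 := is_norm_lip nmP (y' - y).
  have l1' : norm_lip nm * `|x - x'| < norm_lip nm * (e + e) by rewrite ltr_pM2l.
  have l2' : norm_lip nm * `|y' - y| < norm_lip nm * (e + e) by rewrite ltr_pM2l.
  have E : norm_lip nm * (e + e) * 2 = nm (x - y) - r.
    rewrite /e; field; exact: lt0r_neq0.
  lra.
apply: countable_bigcupT_measurable; first exact: countableP.
move=> i; case: (pselect (b i.1.1 i.2 `*` b i.1.2 i.2 `<=`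
    [set z | r < nm (z.1 - z.2)])) => h.
  rewrite (_ : F i = b i.1.1 i.2 `*` b i.1.2 i.2).
    by apply: measurableX; apply: sub_sigma_algebra; exact: ball_open.
  by apply/seteqP; split => z /=; [case|split].
rewrite (_ : F i = set0); first exact: measurable0.
by apply/seteqP; split => z //= [_ /h].
Qed.

Lemma measurable_mu_nball : measurable_fun [set: T] (fun x : T => mu (B x)).
Proof.
have := @measurable_fun_xsection _ _ T T R muS _ measurable_nball_rel.
congr (measurable_fun _ _); apply/funext => x /=.
congr (mu _); apply/seteqP; split => y; rewrite /xsection/= inE//.
Qed.

Lemma measurable_msupp : measurable (msupp nm mu : set T).
Proof.
apply: measurableC; apply: sub_sigma_algebra; apply: bigcup_open => U /= [x [s [_ -> _]]].
exact: open_nball_open.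
Qed.

Lemma msupp_gt0 x : msupp nm mu x -> (0 < mu (B x))%E.
Proof.
move=> hx; rewrite lt_neqAle measure_ge0 andbT eq_sym; apply/negP => /eqP h.
apply: hx; exists (open_nball nm x r); last first.
  by rewrite /open_nball/= subrr is_norm0.
exists x, r; split => //; apply/eqP.
rewrite eq_le measure_ge0 andbT -h; apply: le_measure; rewrite ?inE.
- by apply: sub_sigma_algebra; exact: open_nball_open.
- exact: measurable_closed_nball.
- by move=> y /=; rewrite /open_nball/closed_nball/= => /ltW.
Qed.

(** A real-valued, everywhere defined and measurable stand-in for the inverse measure of the ball;
    [inv_ballE] identifies the two on the support. *)
Definition inv_ball (x : T) : R := powR (fine (mu (B x))) (-1).

Lemma inv_ball_ge0 x : 0 <= inv_ball x. Proof. exact: powR_ge0. Qed.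

Lemma measurable_inv_ball : measurable_fun [set: T] inv_ball.
Proof.
apply: (measurableT_comp (measurable_powR _)).
apply: (measurableT_comp (fine_measurable _)) => //.
exact: measurable_mu_nball.
Qed.

Lemma inv_ballE x : msupp nm mu x -> (mu (B x))^-1%E = (inv_ball x)%:E.
Proof.
move=> /msupp_gt0 h; have := measure_closed_nball_lty x r; rewrite /inv_ball.
case: (mu _) h => //= s; rewrite lte_fin => s0 _.
by rewrite inver gt_eqF//= powR_inv1// ltW.
Qed.

Lemma inv_ballM x : msupp nm mu x -> ((inv_ball x)%:E * mu (B x) = 1)%E.
Proof.
move=> /msupp_gt0 h; have := measure_closed_nball_lty x r; rewrite /inv_ball.
case: (mu _) h => //= s; rewrite lte_fin => s0 _.
by rewrite powR_inv1 ?(ltW s0)// -EFinM mulVf// gt_eqF.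
Qed.

(** Take a point of [A] where [inv_ball] is maximal up to the factor 1 + e. Its ball contributes at
    most 1 + e, and the rest of [A] lies at distance more than [r] from it, so that the packing
    number of the rest drops by one. *)
Lemma inv_ball_greedy (e : R) (n : nat) (A : set T) : 0 < e -> measurable A ->
  A `<=` msupp nm mu -> (exists M, forall x, A x -> inv_ball x <= M) ->
  (forall s : seq 'rV[R]_d, (forall x, x \in s -> A x) ->
     pairwise (fun x y => r < nm (x - y)) s -> (size s <= n)%N) ->
  (\int[mu]_(x in A) (inv_ball x)%:E <= (n%:R * (1 + e))%:E)%E.
Proof.
move=> e0; elim: n A => [|n IH] A mA AS [M hM] hs.
  have -> : A = set0.
    apply/seteqP; split => x //= Ax.
    by have := hs [:: x] ltac:(by move=> y; rewrite inE => /eqP ->) isT.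
  by rewrite integral_set0 mul0r.
have [->|/set0P[x0 Ax0]] := eqVneq A set0.
  by rewrite integral_set0 lee_fin mulr_ge0// addr_ge0// ltW.
have pos x : A x -> 0 < inv_ball x.
  move=> Ax; rewrite lt_neqAle inv_ball_ge0 andbT; apply/eqP => h.
  by have := inv_ballM (AS _ Ax); rewrite -h mul0e => /esym/eqP; rewrite onee_eq0.
pose E := [set inv_ball x | x in A].
have sE : has_sup E.
  by split; [exists (inv_ball x0), x0|exists M => _ [x /hM ? <-]].
have supE x : A x -> inv_ball x <= sup E.
  by move=> Ax; apply: sup_upper_bound => //; exists x.
have sE0 : 0 < sup E by apply: lt_le_trans (supE _ Ax0); exact: pos.
have e1 : 0 < 1 + e by rewrite addr_gt0.
have [_ [x1 Ax1 <-]] := sup_adherent (eps := sup E - sup E / (1 + e)) ltac:(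
  by rewrite subr_gt0 ltr_pdivrMr// ltr_pMr// ltrDl) sE.
rewrite opprB addrC subrK ltr_pdivrMr// => hx1.
have mB := measurable_closed_nball x1 r.
have m1 : measurable (A `&` B x1) by exact: measurableI.
have m2 : measurable (A `\` B x1) by exact: measurableD.
rewrite -(setUIDK A (B x1)) ge0_integral_setU//=; last 3 first.
- by apply/measurable_EFinP; exact: measurable_funS measurable_inv_ball.
- by move=> x _; rewrite lee_fin inv_ball_ge0.
- by rewrite disj_set2E; apply/eqP/seteqP; split => x //= -[[_ h] [_]].
have I1 : (\int[mu]_(x in A `&` B x1) (inv_ball x)%:E <= (1 + e)%:E)%E.
  apply: (@le_trans _ _ (\int[mu]_(x in A `&` B x1) (cst (sup E)%:E x))%E).
    apply: ge0_le_integral => //.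
    - by move=> x _; rewrite lee_fin inv_ball_ge0.
    - by apply/measurable_EFinP; exact: measurable_funS measurable_inv_ball.
    - by move=> x [Ax _]; rewrite lee_fin supE.
  rewrite integral_cst//.
  apply: (@le_trans _ _ ((inv_ball x1 * (1 + e))%:E * mu (B x1)))%E.
    apply: lee_pmul => //; rewrite ?lee_fin ?(ltW sE0) ?(ltW hx1)//.
    by apply: le_measure; rewrite ?inE//; exact: subIsetr.
  by rewrite mulrC EFinM -muleA inv_ballM ?mule1//; exact: AS.
have -> : ((n.+1%:R * (1 + e))%:E = (1 + e)%:E + (n%:R * (1 + e))%:E)%E.
  by rewrite -EFinD -natr1; congr EFin; ring.
apply: (leeD I1).
apply: IH => //; first by move=> x [/AS].
  by exists M => x [/hM].
move=> s hs1 hs2; rewrite -ltnS.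
apply: (hs (x1 :: s)) => /=.
  by move=> x; rewrite inE => /orP[/eqP ->//|/hs1 []].
rewrite hs2 andbT; apply/allP => x /hs1 [_]; rewrite /closed_nball/=.
by move=> /negP; rewrite -ltNge.
Qed.

Variable N : nat.
Hypothesis hN : forall s : seq 'rV[R]_d, (forall x, x \in s -> nm x <= 1) ->
     pairwise (fun x y => 1 < nm (x - y)) s -> (size s <= N)%N.

Lemma inv_ball_integral_le y :
  (\int[mu]_(x in msupp nm mu `&` B y) (inv_ball x)%:E <= N%:R%:E)%E.
Proof.
(* The greedy choice needs a finite supremum: [inv_ball] is truncated at [n] and the truncation
   removed by monotone convergence. *)
pose A (n : nat) : set T := msupp nm mu `&` B y `&` [set x : T | inv_ball x <= n%:R].
have mA n : measurable (A n).
  apply: measurableI; first exact: (measurableI _ _ measurable_msupp (measurable_closed_nball _ _)).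
  rewrite [X in measurable X](_ : _ = setT `&` inv_ball @^-1` `]-oo, n%:R]%classic).
    exact: measurable_inv_ball.
  by apply/seteqP; split => x /=; rewrite in_itv//= => -[].
have -> : msupp nm mu `&` B y = \bigcup_n A n.
  apply/seteqP; split => x; last by move=> [n _ []].
  move=> h; exists (Num.truncn (inv_ball x)).+1 => //; split => //=.
  exact/ltW/truncnS_gt.
have cv : (\int[mu]_(x in A n) (inv_ball x)%:E @[n --> \oo] -->
    \int[mu]_(x in \bigcup_n A n) (inv_ball x)%:E)%E.
  apply: ge0_nondecreasing_set_cvg_integral => //.
  - move=> m n mn; apply/subsetPset => x [h1 h2]; split => //=.
    by apply: le_trans h2 _; rewrite ler_nat.
  - by move=> n; apply/measurable_EFinP; exact: measurable_funS measurable_inv_ball.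
  - by move=> n x _; rewrite lee_fin inv_ball_ge0.
rewrite -(cvg_lim _ cv)//; apply: lime_le; first by apply/cvg_ex; eexists; exact: cv.
apply: nearW => n; apply/lee_addgt0Pr => e e0.
have N0 : 0 < N.+1%:R :> R by [].
apply: (le_trans (@inv_ball_greedy (e / N.+1%:R) N (A n) _ (mA n) _ _ _)).
- by rewrite divr_gt0.
- by move=> x [[]].
- by exists n%:R => x [].
- move=> s hs1 hs2.
  (* Points of the ball of radius [r] about [y] at mutual distances above [r] are translated and
     rescaled to a packing of the unit ball. *)
  rewrite -(size_map (fun x => r^-1 *: (x - y)) s); apply: hN.
    move=> _ /mapP[x /hs1 [[_ +] _] ->]; rewrite /closed_nball/=.
    case: nmP => _ -> _; rewrite ger0_norm ?invr_ge0 ?(ltW r0)// => h.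
    by rewrite mulrC ler_pdivrMr// mul1r is_normB.
  rewrite pairwise_map; apply: sub_pairwise hs2 => x x' /=.
  rewrite -scalerBr; case: nmP => _ -> _; rewrite ger0_norm ?invr_ge0 ?(ltW r0)//.
  by rewrite opprB addrA subrK mulrC ltr_pdivlMr// mul1r.
- rewrite -EFinD lee_fin mulrDr mulr1 lerD2l mulrA ler_pdivrMr// mulrC.
  by rewrite ler_wpM2l ?ltW// ltr_nat.
Qed.

(** Tonelli's theorem exchanges the integrals: the norm of the average is at most the integral of
    the absolute value of g against y |-> the integral of [inv_ball] over the ball about y, which
    [inv_ball_integral_le] bounds by [N]. *)
Lemma average_opnorm_le : (average_opnorm nm mu r <= N%:R%:E)%E.
Proof.
apply: ereal_inf_lbound; exists N%:R => //= g ig.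
have mg := measurable_int _ ig.
have mG : measurable_fun [set: T] (fun x => `|(EFin \o g) x|%E).
  exact: measurableT_comp.
rewrite !Lnorm1.
pose ker : T * T -> R := fun z =>
  \1_(msupp nm mu : set T) z.1 * inv_ball z.1 * \1_[set z | nm (z.1 - z.2) <= r] z.
pose F : T * T -> \bar R := fun z => ((ker z)%:E * `|(EFin \o g) z.2|)%E.
have ker0 z : 0 <= ker z.
  by rewrite /ker !mulr_ge0// inv_ball_ge0.
have mker : measurable_fun [set: (T * T)%type] ker.
  apply: measurable_funM; last exact: measurable_indic measurable_nball_rel.
  apply: (measurableT_comp (f := fun x : T => \1_(msupp nm mu : set T) x * inv_ball x)) => //.
  apply: measurable_funM; last exact: measurable_inv_ball.
  exact: measurable_indic measurable_msupp.
have mF : measurable_fun [set: (T * T)%type] F.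
  apply: emeasurable_funM; first exact/measurable_EFinP.
  by apply: (measurableT_comp (f := fun x : T => `|(EFin \o g) x|%E)).
have F0 z : (0 <= F z)%E by rewrite /F mule_ge0// lee_fin.
apply: (@le_trans _ _ (\int[mu]_x \int[muS]_y F (x, y))%E).
  apply: ge0_le_integral_nomeas; first by move=> x; exact: abse_ge0.
  move=> x; rewrite /average; case: ifPn => [xS|_]; last first.
    by rewrite abse0; exact: integral_ge0.
  rewrite inv_ballE; last by rewrite inE in xS.
  rewrite abseM [X in (X * _)%E]gee0_abs ?lee_fin ?inv_ball_ge0//.
  apply: (@le_trans _ _ ((inv_ball x)%:E * \int[mu]_(y in B x) `|(g y)%:E|)%E).
    apply: lee_wpmul2l; first by rewrite lee_fin inv_ball_ge0.
    apply: le_abse_integral; first exact: measurable_closed_nball.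
    exact: measurable_funS mg.
  rewrite -ge0_integralZl//; last 3 first.
  - exact: measurable_closed_nball.
  - exact: measurable_funS mG.
  - by rewrite lee_fin inv_ball_ge0.
  rewrite integral_mkcond le_eqVlt; apply/orP; left; apply/eqP.
  apply: eq_integral => y _; rewrite /F /ker /patch /= !indicE xS mul1r.
  have -> : ((x, y) \in [set z : T * T | nm (z.1 - z.2) <= r]) = (y \in closed_nball nm x r).
    by apply/idP/idP; rewrite !inE.
  by case: (_ \in _); rewrite ?mulr1 ?mulr0 ?mul0e ?EFinM.
have -> : (\int[mu]_x \int[muS]_y F (x, y) = \int[muS]_x \int[muS]_y F (x, y))%E by [].
rewrite (@fubini_tonelli _ _ T T R muS muS F mF F0).
rewrite -ge0_integralZl ?lee_fin//.
apply: ge0_le_integral_nomeas; first by move=> y; exact: integral_ge0.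
move=> y.
have -> : (\int[muS]_x F (x, y) = `|(EFin \o g) y| * \int[mu]_(x in msupp nm mu `&` B y) (inv_ball x)%:E)%E.
  rewrite -ge0_integralZl//; last 3 first.
  - exact: (measurableI _ _ measurable_msupp (measurable_closed_nball _ _)).
  - by apply/measurable_EFinP; exact: measurable_funS measurable_inv_ball.
  - by move=> x _; rewrite lee_fin inv_ball_ge0.
  rewrite [RHS]integral_mkcond.
  apply: eq_integral => x _; rewrite /F /ker /patch /= !indicE muleC.
  rewrite in_setI; case: (x \in msupp nm mu) => /=; last by rewrite !mul0r mule0.
  rewrite mul1r.
  have -> : (x \in closed_nball nm y r) = ((x, y) \in [set z : T * T | nm (z.1 - z.2) <= r]).
    by apply/idP/idP; rewrite !inE /closed_nball/= is_normB.
  by case: (_ \in _); rewrite ?mulr1 ?mulr0 ?mule0.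
rewrite muleC; apply: lee_wpmul2r => //.
exact: inv_ball_integral_le.
Qed.

End Upper.

(** * Clusters of atoms realizing a packing *)

Section Lower.
Context (R : realType) (d : nat) (nm : 'rV[R]_d -> R).
Hypothesis nmP : is_norm nm.
Variable X : seq 'rV[R]_d.
Hypothesis X1 : forall x, x \in X -> nm x <= 1.
Hypothesis Xsep : pairwise (fun x y => 1 < nm (x - y)) X.
Hypothesis Xsize : (1 < size X)%N.

Local Notation T := (borelRd R d).
Local Notation N := (size X).

Lemma packing_neq0 x : x \in X -> x != 0.
Proof.
move=> xX; apply/eqP => x0.
have : exists2 y, y \in X & (1 < nm (x - y)).
  have ip := index_mem x X; rewrite xX in ip.
  have key i j : (i < j < N)%N -> 1 < nm (X`_i - X`_j).
    move=> /andP[ij jN]; move/(pairwiseP 0): Xsep; apply => //.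
    by rewrite inE (ltn_trans ij).
  case E : (index x X) => [|i].
    exists X`_1; first by rewrite mem_nth.
    have := key 0 1 ltac:(by rewrite Xsize).
    by have := nth_index 0 xX; rewrite E => ->.
  exists X`_0; first by rewrite mem_nth// ltnW.
  have iN : (i.+1 < N)%N by rewrite -E ip.
  have := key 0 i.+1 iN.
  by have := nth_index 0 xX; rewrite E => ->; rewrite is_normB.
move=> [y /X1 y1]; rewrite x0 sub0r is_normN//; lra.
Qed.

(** The clusters are strung along this unit vector; it exists because the points of a packing with
    at least two points are nonzero. *)
Definition cluster_dir : 'rV[R]_d := (nm X`_0)^-1 *: X`_0.

Lemma cluster_dir1 : nm cluster_dir = 1.
Proof.
have h : nm X`_0 != 0.
  case: nmP => _ _ h; apply/eqP => /h/eqP; apply/negP/packing_neq0.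
  by rewrite mem_nth// ltnW.
rewrite /cluster_dir; case: nmP => _ -> _; rewrite ger0_norm ?invr_ge0 ?is_norm_ge0//.
by rewrite mulVf.
Qed.

(* Site [n] is the [n %% N.+1]-th point of the cluster [n %/ N.+1]: position 0
   is the centre, with weight [1/(k+1)] in cluster [k], the others have weight 1. *)
Definition cluster_pt (n : nat) : T :=
  (4 * (n %/ N.+1)%:R) *: cluster_dir + nth 0 (0 :: X) (n %% N.+1).

Definition cluster_wt (n : nat) : {nonneg R} :=
  if (n %% N.+1 == 0)%N then NngNum (ltac:(by []) : 0 <= ((n %/ N.+1).+1%:R^-1 : R))
  else 1%:nng.

Definition cluster_measure : {measure set T -> \bar R} :=
  mseries (fun n => mscale (cluster_wt n) (dirac (cluster_pt n))) 0.

Let M := N.+1.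

Lemma cluster_ptE k i : (i <= N)%N ->
  cluster_pt (k * M + i) = (4 * k%:R) *: cluster_dir + (0 :: X)`_i.
Proof.
by move=> iN; rewrite /cluster_pt divnMDl// modnMDl divn_small ?modn_small ?addn0.
Qed.

Lemma cluster_wtE k i : (i <= N)%N ->
  (cluster_wt (k * M + i))%:num = if (i == 0)%N then k.+1%:R^-1 else 1 :> R.
Proof.
move=> iN; rewrite /cluster_wt divnMDl// modnMDl divn_small ?modn_small ?addn0//.
by case: ifP.
Qed.

Let a (A : set T) (n : nat) : \bar R :=
  ((cluster_wt n)%:num%:E * (cluster_pt n \in A)%:R%:E)%E.

Let a_ge0 A n : (0 <= a A n)%E. Proof. by rewrite mule_ge0// lee_fin. Qed.

Lemma cluster_measureE A : (cluster_measure A = \sum_(0 <= n <oo) a A n)%E.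
Proof. rewrite /cluster_measure/= /mseries; apply: eq_eseriesr => n _; by []. Qed.

Lemma cluster_measure_le A (s : seq nat) : uniq s ->
  (forall n, cluster_pt n \in A -> n \in s) ->
  (cluster_measure A <= (\sum_(n <- s) (cluster_wt n)%:num)%:E)%E.
Proof.
move=> us h; rewrite cluster_measureE; apply: lime_le.
  by apply: is_cvg_nneseries => n _ _; exact: a_ge0.
apply: nearW => m; rewrite (bigID (mem s))/= [X in (_ + X)%E]big1 ?adde0; last first.
  by move=> n nA; rewrite /a (contraNF (h n) nA) mule0.
rewrite -big_filter.
have -> : (\sum_(i <- [seq n <- index_iota 0 m | n \in s]) a A i =
           \sum_(i <- [seq n <- s | (n < m)%N]) a A i)%E.
  apply: perm_big; apply: uniq_perm; rewrite ?filter_uniq ?iota_uniq//.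
  by move=> n; rewrite !mem_filter mem_index_iota andbC.
rewrite big_filter big_mkcond -sumEFin; apply: lee_sum => n _.
case: ifP => _; last by rewrite lee_fin.
by rewrite /a -EFinM lee_fin ler_piMr//; case: (_ \in _).
Qed.

Lemma cluster_measure_ge A m : (\sum_(0 <= n < m) a A n <= cluster_measure A)%E.
Proof. by rewrite cluster_measureE; apply: nneseries_lim_ge. Qed.

Lemma cluster_measure_ge1 A n : cluster_pt n \in A ->
  ((cluster_wt n)%:num%:E <= cluster_measure A)%E.
Proof.
move=> nA; apply: le_trans (cluster_measure_ge _ n.+1).
rewrite big_nat_recr//= /a nA mule1.
by apply: leeDr; apply: sume_ge0 => i _; exact: a_ge0.
Qed.

Lemma cluster_center_norm y : y \in (0 :: X) -> nm y <= 1.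
Proof. by rewrite inE => /orP[/eqP ->|/X1//]; rewrite is_norm0. Qed.

Lemma divn_cluster n : n = (n %/ M * M + n %% M)%N.
Proof. exact: divn_eq. Qed.

Lemma modn_cluster n : (n %% M <= N)%N.
Proof. by rewrite -ltnS ltn_mod. Qed.

Lemma cluster_locally_finite : locally_finite nm cluster_measure.
Proof.
move=> A mA [b hb].
pose m := ((Num.truncn (b + 1)).+1 * M)%N.
apply: le_lt_trans (@cluster_measure_le A (iota 0 m) (iota_uniq _ _) _) _; last exact: ltry.
move=> n; rewrite inE => /hb h; rewrite mem_iota add0n /= ltnNge; apply/negP => mn.
have kn : (Num.truncn (b + 1) < n %/ M)%N by rewrite leq_divRL.
rewrite {1}(divn_cluster n) cluster_ptE ?modn_cluster// in h.
set y := (0 :: X)`_(n %% M) in h; set k := (n %/ M)%N in h kn.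
have y1 : nm y <= 1.
  by apply: cluster_center_norm; rewrite mem_nth//= ltnS modn_cluster.
have := is_norm_tri nmP ((4 * k%:R) *: cluster_dir + y) ((4 * k%:R) *: cluster_dir) 0.
rewrite subr0 opprD addrA subrr sub0r is_normN// subr0.
have -> : nm ((4 * k%:R) *: cluster_dir) = 4 * k%:R.
  by case: nmP => _ -> _; rewrite cluster_dir1 mulr1 ger0_norm// mulr_ge0.
have bk : b + 1 < k%:R.
  by apply: lt_le_trans (truncnS_gt _) _; rewrite ler_nat.
have k0 : 0 <= k%:R :> R by [].
have := is_norm_ge0 nmP ((4 * k%:R) *: cluster_dir + y); lra.
Qed.

Lemma cluster_admissible : admissible nm cluster_measure.
Proof.
split; [|exact: tau_additive_all|exact: cluster_locally_finite].
rewrite gt_eqF//; apply: lt_le_trans (@cluster_measure_ge1 setT 1 _); last by rewrite inE.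
by rewrite lte_fin -[1%N]/(0 * M + 1)%N cluster_wtE// ltnW.
Qed.

(** The unit ball about an outer atom meets no other cluster, as the spacing 4 exceeds 1 + 1 + 1,
    and within its own cluster it meets only the centre, by separation of the packing. *)
Lemma cluster_ball k i n : (0 < i <= N)%N ->
  nm (cluster_pt (k * M + i) - cluster_pt n) <= 1 ->
  n \in [:: (k * M)%N; (k * M + i)%N].
Proof.
move=> /andP[i0 iN]; rewrite cluster_ptE//.
have ky := modn_cluster n; rewrite {1}(divn_cluster n) cluster_ptE// => h.
set k' := (n %/ M)%N in h *; set j := (n %% M)%N in h ky *.
have yi : nm (0 :: X)`_i <= 1 by apply: cluster_center_norm; rewrite mem_nth.
have yj : nm (0 :: X)`_j <= 1 by apply: cluster_center_norm; rewrite mem_nth.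
set x := (0 :: X)`_i in h yi; set y := (0 :: X)`_j in h yj.
have E : (4 * k%:R) *: cluster_dir + x - ((4 * k'%:R) *: cluster_dir + y) =
  (4 * (k%:R - k'%:R)) *: cluster_dir + (x - y).
  by rewrite mulrBr scalerBl opprD addrACA.
have kk' : k = k'.
  apply/eqP/negP => /negP kn.
  have k1 : 1 <= `|k%:R - k'%:R| :> R.
    rewrite ler_normr; case: (ltngtP k k') kn => // kk _; apply/orP; [right|left].
      by rewrite opprB lerBrDl natr1 ler_nat.
    by rewrite lerBrDl natr1 ler_nat.
  have t1 := is_norm_tri nmP 0 x y.
  have t2 := is_norm_tri nmP ((4 * (k%:R - k'%:R)) *: cluster_dir + (x - y)) ((4 * (k%:R - k'%:R)) *: cluster_dir) 0.
  rewrite E in h.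
  rewrite opprD addrA subrr sub0r (is_normN nmP (x - y)) !subr0 in t2.
  rewrite subr0 sub0r is_normN// in t1.
  have E4 : nm ((4 * (k%:R - k'%:R)) *: cluster_dir) = 4 * `|k%:R - k'%:R|.
    by case: nmP => _ -> _; rewrite cluster_dir1 mulr1 normrM ger0_norm.
  rewrite E4 in t2; lra.
rewrite E -kk' subrr mulr0 scale0r add0r in h.
rewrite !inE {1 2}(divn_cluster n) -/k' -/j -kk'.
rewrite -[X in (_ + _ == X)%N]addn0 eqn_add2l.
case: eqP => //= /eqP j0; rewrite eqn_add2l.
case: (ltngtP j i) => // ij; move: h; rewrite leNgt => /negP[];
  rewrite /x /y; case: i i0 iN ij {x yi E} => // i' _ iN ij;
  case: j j0 ky ij {y yj} => // j' _ ky ij /=.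
  rewrite is_normB//; move/(pairwiseP 0): Xsep; apply => //; rewrite inE//.
by move/(pairwiseP 0): Xsep; apply => //; rewrite inE.
Qed.

Lemma measurable_set1_borelRd (x : T) : measurable [set x].
Proof.
rewrite (_ : [set x] = closed_nball nm x 0); first exact: measurable_closed_nball.
apply/seteqP; split => y; rewrite /closed_nball/=.
  by move=> ->; rewrite subrr is_norm0.
move=> h; have h0 : nm (x - y) = 0 by apply/eqP; rewrite eq_le h is_norm_ge0.
by case: nmP => _ _ /(_ _ h0)/eqP; rewrite subr_eq0 => /eqP.
Qed.

(** The test function is the indicator of the centre of cluster [k]. At each of the [N] outer atoms
    the ball has mass at most 1 + 1/(k+1), so the norm is at least N / (1 + 1/(k+1)); then [k]
    grows. *)
Lemma cluster_opnorm_ge : (N%:R%:E <= average_opnorm nm cluster_measure 1)%E.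
Proof.
apply: le_ereal_inf_tmp => _ [c /= hc <-]; rewrite lee_fin.
suff H (k : nat) : N%:R <= c * (1 + k.+1%:R^-1).
  rewrite leNgt; apply/negP => cN.
  have c0 : 0 <= c.
    rewrite leNgt; apply/negP => c0; have := H 0%N; rewrite leNgt => /negP; apply.
    by apply: (@lt_le_trans _ _ 0) => //; rewrite nmulr_rlt0// addr_gt0// invr_gt0.
  have d0 : 0 < N%:R - c by rewrite subr_gt0.
  (* If c < N, any k + 1 above c / (N - c) contradicts [H]. *)
  have := H (Num.truncn (c / (N%:R - c))).
  have := truncnS_gt (c / (N%:R - c)); set K := _.+1%:R.
  rewrite ltr_pdivrMr// => h1.
  have K0 : 0 < K by [].
  rewrite mulrDr mulr1 -lerBlDl ler_pdivlMr// mulrC => h2.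
  by have := lt_le_trans h1 h2; rewrite ltxx.
pose z : T := cluster_pt (k * M + 0).
have mz := measurable_set1_borelRd z.
pose g : T -> R := \1_[set z].
pose w := cluster_measure [set z].
have wlt : (w < +oo)%E.
  rewrite (le_lt_trans _ (measure_closed_nball_lty nmP cluster_locally_finite z 1))//.
  apply: le_measure; rewrite ?inE//; first exact: measurable_closed_nball.
  by move=> y /= ->; rewrite /closed_nball/= subrr is_norm0.
have wgt : (0 < w)%E.
  apply: lt_le_trans (@cluster_measure_ge1 _ (k * M + 0) _); last by rewrite inE.
  by rewrite lte_fin cluster_wtE.
have gw : (\int[cluster_measure]_x `|(EFin \o g) x| = w)%E.
  rewrite /w -[X in cluster_measure X]setIT -integral_indic//.
  by apply: eq_integral => x _ /=; rewrite ger0_norm.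
have ig : cluster_measure.-integrable setT (EFin \o g).
  apply/integrableP; split; last by rewrite gw.
  by apply/measurable_EFinP; exact: measurable_indic.
have := hc g ig; rewrite !Lnorm1 gw.
pose F : set T := [set cluster_pt (k * M + i.+1)%N | i in `I_N].
pose q := (1 + k.+1%:R^-1 : R)^-1.
have q0 : 0 < q by rewrite invr_gt0 addr_gt0// invr_gt0.
have mF : measurable F.
  rewrite /F; apply: countable_measurable; first exact: measurable_set1_borelRd.
  exact/finite_set_countable/finite_image/finite_II.
have NF : (N%:R%:E <= cluster_measure F)%E.
  apply: le_trans (cluster_measure_ge _ (k.+1 * M)).
  have le1 : ((k * M).+1 <= k.+1 * M)%N by rewrite mulSn -add1n leq_add2r.
  rewrite (big_cat_nat (leq0n _) le1)/=.
  apply: (@le_trans _ _ (\sum_((k * M).+1 <= i < k.+1 * M) 1%:E)%E); last first.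
    rewrite -[leLHS]add0e; apply: leeD; first by apply: sume_ge0 => i _; exact: a_ge0.
    rewrite !big_nat; apply: lee_sum => i /andP[i1 i2].
    have ii : (i = k * M + (i - (k * M).+1).+1)%N by lia.
    have iN : (i - (k * M).+1 < N)%N by rewrite /M in i1 i2 *; lia.
    rewrite /a {1}ii cluster_wtE//= -EFinM lee_fin mul1r.
    by rewrite mem_set//; exists (i - (k * M).+1)%N => //; rewrite -ii.
  rewrite sumEFin lee_fin big_const_nat iter_addr addr0 ler_nat.
  by rewrite mulSn /M; lia.
have key : (q%:E * w * cluster_measure F <= \int[cluster_measure]_x `|average nm cluster_measure 1 g x|)%E.
  have -> : (q%:E * w * cluster_measure F = \int[cluster_measure]_(x in F) cst (q%:E * w) x)%E.
    by rewrite integral_cst.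
  rewrite integral_mkcond; apply: ge0_le_integral_nomeas.
    by move=> x; apply: erestrict_ge0 => y _; rewrite mule_ge0// ?lee_fin ?ltW.
  move=> x; rewrite /patch; case: ifPn => [|_]; last exact: abse_ge0.
  rewrite inE => -[i /= iN <-].
  set x' := cluster_pt _.
  have xz : closed_nball nm x' 1 z.
    rewrite /closed_nball/= /x' /z !cluster_ptE//= addr0 addrC addKr.
    by apply: X1; rewrite mem_nth.
  have mub : (cluster_measure (closed_nball nm x' 1) <= (1 + k.+1%:R^-1)%:E)%E.
    have us : uniq [:: (k * M)%N; (k * M + i.+1)%N].
      by rewrite /= inE andbT; apply/eqP; lia.
    apply: le_trans (@cluster_measure_le _ _ us _) _.
      by move=> n; rewrite inE => /= hn; apply: cluster_ball.
    rewrite !big_cons big_nil -[X in cluster_wt X]addn0 !cluster_wtE//= addr0.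
    by rewrite lee_fin addrC.
  have pw : (w <= cluster_measure (closed_nball nm x' 1))%E.
    apply: le_measure; rewrite ?inE//; first exact: measurable_closed_nball.
    by move=> y /= ->.
  (* Outer atoms belong to the support: a ball containing one has mass at least 1. *)
  rewrite /average ifT; last first.
    rewrite inE => -[U /= [y [s [s0 -> hU]]] Ux].
    have := @cluster_measure_ge1 (open_nball nm y s) (k * M + i.+1) ltac:(by rewrite inE).
    have hU' : cluster_measure (open_nball nm y s) = 0%E := hU.
    by rewrite hU' cluster_wtE//= lee_fin ler10.
  have -> : (\int[cluster_measure]_(y in closed_nball nm x' 1) (g y)%:E = w)%E.
    rewrite integral_indic//; last exact: measurable_closed_nball.
    by rewrite /w; congr (cluster_measure _); apply/seteqP; split => y /=; [case|move=> ->].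
  rewrite gee0_abs; last first.
    by apply: mule_ge0; [rewrite inve_ge0 measure_ge0|exact: ltW].
  apply: lee_wpmul2r; first exact: ltW.
  have := lt_le_trans wgt pw; move: mub; case: (cluster_measure _) => // s.
  rewrite lee_fin lte_fin => h1 s0; rewrite inver gt_eqF// lee_fin.
  by rewrite /q lef_pV2 ?posrE// (lt_le_trans s0).
move=> /(le_trans key).
have [w' ew] : exists w', w = w'%:E.
  by move: wgt wlt; case: (w) => // w' _ _; exists w'.
rewrite ew lte_fin in wgt *.
have : (q%:E * w'%:E * N%:R%:E <= q%:E * w'%:E * cluster_measure F)%E.
  by apply: lee_wpmul2l => //; rewrite -EFinM lee_fin mulr_ge0 ?ltW.
move=> h1 /(le_trans h1); rewrite -!EFinM lee_fin.
rewrite mulrAC ler_pM2r// /q mulrC ler_pdivrMr// addr_gt0// invr_gt0//.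
Qed.

End Lower.

Definition packing (R : realType) (d : nat) (nm : 'rV[R]_d -> R) (s : seq 'rV[R]_d) :=
  (forall x, x \in s -> nm x <= 1) /\ pairwise (fun x y => 1 < nm (x - y)) s.

Theorem sup_average_opnorm_le (R : realType) (d : nat) (nm : 'rV[R]_d -> R) (N : nat) :
  is_norm nm -> (forall s, packing nm s -> (size s <= N)%N) ->
  (sup_average_opnorm nm <= N%:R%:E)%E.
Proof.
move=> nmP h; apply: ge_ereal_sup => _ [r [mu [r0 [_ _ lf] ->]]].
by apply: average_opnorm_le => // s s1 s2; exact: h.
Qed.

Theorem packing_attains (R : realType) (d : nat) (nm : 'rV[R]_d -> R) (s : seq 'rV[R]_d) :
  is_norm nm -> packing nm s -> (1 < size s)%N ->
  exists mu : {measure set (borelRd R d) -> \bar R},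
    admissible nm mu /\ ((size s)%:R%:E <= average_opnorm nm mu 1)%E.
Proof.
move=> nmP [s1 s2] s3; exists (cluster_measure nm s).
by split; [exact: cluster_admissible|exact: cluster_opnorm_ge].
Qed.

Theorem sup_average_opnorm_ge (R : realType) (d : nat) (nm : 'rV[R]_d -> R) (s : seq 'rV[R]_d) :
  is_norm nm -> packing nm s -> (1 < size s)%N ->
  ((size s)%:R%:E <= sup_average_opnorm nm)%E.
Proof.
move=> nmP ps s1; have [mu [am h]] := packing_attains nmP ps s1.
by apply: le_trans h _; apply: ereal_sup_ubound; exists 1, mu.
Qed.

Theorem sup_average_opnormE (R : realType) (d : nat) (nm : 'rV[R]_d -> R) (s : seq 'rV[R]_d) :
  is_norm nm -> packing nm s -> (1 < size s)%N ->
  (forall s', packing nm s' -> (size s' <= size s)%N) ->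
  sup_average_opnorm nm = (size s)%:R%:E /\
  average_opnorm_attains nm (size s)%:R%:E.
Proof.
move=> nmP ps s1 h; have le := sup_average_opnorm_le nmP h.
split; first by apply/eqP; rewrite eq_le le sup_average_opnorm_ge.
have [mu [am hm]] := packing_attains nmP ps s1; exists 1, mu; split => //.
apply/eqP; rewrite eq_le hm andbT.
by apply: le_trans le; apply: ereal_sup_ubound; exists 1, mu.
Qed.

(** * Norms on the plane *)

(** The pigeonhole principle behind the bounds by sectors, quadrants and orthants: related points
    cannot share a class. *)
Lemma pairwise_class_size (T : Type) (K : finType) (P : pred T) (r : rel T) (c : T -> K)
    (s : seq T) : all P s -> pairwise r s ->
  (forall x y, P x -> P y -> c x = c y -> ~~ r x y) -> (size s <= #|K|)%N.
Proof.
move=> Ps rs h; rewrite -(size_map c s).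
suff /card_uniqP <- : uniq (map c s) by exact: max_card.
rewrite uniq_pairwise pairwise_map; apply: (sub_in_pairwise (P := P)) Ps rs => x y Px Py /=.
by move=> rxy; apply/eqP => /(h _ _ Px Py); rewrite rxy.
Qed.

(** * Norms in coordinates *)

Section Norm2.
Context (R : realType).

Definition norm2 (f : R -> R -> R) :=
  (forall a b c d, f (a + c) (b + d) <= f a b + f c d) /\
  (forall t a b, f (t * a) (t * b) = `|t| * f a b).

Variable f : R -> R -> R.
Hypothesis fP : norm2 f.

Lemma norm2_ge0 a b : 0 <= f a b.
Proof.
case: fP => D Z; have := D a b (-1 * a) (-1 * b); rewrite Z normrN1 mul1r.
have -> : a + -1 * a = 0 * 0 by ring.
have -> : b + -1 * b = 0 * 0 by ring.
rewrite Z normr0 mul0r; lra.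
Qed.

Lemma norm2N a b : f (- a) (- b) = f a b.
Proof. by case: fP => _ Z; rewrite -(mulN1r a) -(mulN1r b) Z normrN1 mul1r. Qed.

Lemma norm2_comb s t a b c d x y : 0 <= s -> 0 <= t -> x = s * a + t * c -> y = s * b + t * d ->
  f x y <= s * f a b + t * f c d.
Proof.
move=> s0 t0 -> ->; case: fP => D Z; apply: le_trans (D _ _ _ _) _.
by rewrite !Z !ger0_norm.
Qed.

Lemma norm2x a : f a 0 = `|a| * f 1 0.
Proof. by case: fP => _ Z; rewrite -Z mulr1 mulr0. Qed.

Lemma norm2y a : f 0 a = `|a| * f 0 1.
Proof. by case: fP => _ Z; rewrite -Z mulr1 mulr0. Qed.

Lemma norm2_lip a b c d : f a b - f c d <= (`|a - c| + `|b - d|) * (f 1 0 + f 0 1).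
Proof.
case: (fP) => D _; have h1 := D c d (a - c) (b - d).
have h2 := D (a - c) 0 0 (b - d); rewrite addr0 add0r norm2x norm2y in h2.
rewrite (addrC c) subrK (addrC d) subrK in h1.
have a1 := norm2_ge0 1 0; have a2 := norm2_ge0 0 1.
have n1 := normr_ge0 (a - c); have n2 := normr_ge0 (b - d); nra.
Qed.

Lemma norm2_open a b : 1 < f a b -> exists2 e, 0 < e &
  forall c d, `|c - a| <= e -> `|d - b| <= e -> 1 < f c d.
Proof.
move=> h; have a1 := norm2_ge0 1 0; have a2 := norm2_ge0 0 1.
set K := f 1 0 + f 0 1 + 1; have K0 : 0 < K by rewrite /K; lra.
exists ((f a b - 1) / (4 * K)).
  by rewrite divr_gt0 ?mulr_gt0// subr_gt0.
set e := _ / _; have eK : e * K * 4 = f a b - 1 by rewrite /e; field; apply: lt0r_neq0.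
move=> c d h1 h2; have := norm2_lip a b c d; rewrite -/K (distrC a) (distrC b) => h3.
have e0 : 0 <= e by apply: le_trans h1.
have n1 := normr_ge0 (c - a); have n2 := normr_ge0 (d - b).
have : (`|c - a| + `|d - b|) * (f 1 0 + f 0 1) <= (e + e) * K.
  by apply: ler_pM; [lra|lra|lra|rewrite /K; lra].
lra.
Qed.

(* For a hexagon [u, v, v - u, ...] inscribed in the unit circle, each of its six
   sectors of the unit ball has diameter at most 1. *)
Lemma norm2_sector a b c d : f 1 0 = 1 -> f 0 1 = 1 -> f 1 (-1) = 1 ->
  0 <= a -> 0 <= b -> 0 <= c -> 0 <= d -> f a b <= 1 -> f c d <= 1 ->
  f (a - c) (b - d) <= 1.
Proof.
move=> u1 v1 w1.
have w1' : f (-1) 1 = 1 by rewrite -[RHS]w1 -[RHS](norm2N 1 (-1)) opprK.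
(* Here (x + y) (1, 0) = (x, y) + y (1, -1), and symmetrically for the other coordinate. *)
have le1 x y : 0 <= x -> 0 <= y -> f x y <= 1 -> x <= 1 /\ y <= 1.
  move=> x0 y0 h; split.
    have := @norm2_comb y 1 1 (-1) x y (x + y) 0 y0 ler01 ltac:(ring) ltac:(ring).
    rewrite norm2x u1 w1 ger0_norm ?addr_ge0//; lra.
  have := @norm2_comb x 1 (-1) 1 x y 0 (x + y) x0 ler01 ltac:(ring) ltac:(ring).
  rewrite norm2y v1 w1' ger0_norm ?addr_ge0//; lra.
(* The point (s, t) is a combination of (x, y) and one of the axis vectors, with nonnegative
   coefficients of sum at most 1; which axis depends on the side of the ray through (x, y). *)
have same x y s t : 0 <= s <= x -> 0 <= t <= y -> f x y <= 1 -> f s t <= 1.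
  move=> /andP[s0 sx] /andP[t0 ty] h.
  have [x1 y1] := le1 x y ltac:(lra) ltac:(lra) h.
  have [sy|sy] := leP (s * y) (t * x).
    have [y0|y0] := eqVneq y 0.
      have t00 : t = 0 by clear -t0 ty y0; lra.
      by rewrite t00 norm2x u1 ger0_norm// mulr1 (le_trans sx).
    have yp : 0 < y by lra.
    have E : t / y * y = t by rewrite divfK.
    have l1 : t / y <= 1 by rewrite ler_pdivrMr// mul1r.
    have l0 : 0 <= t / y by rewrite divr_ge0// ltW.
    have [x0|x0] := eqVneq x 0.
      have s00 : s = 0 by clear -s0 sx x0; lra.
      by rewrite s00 norm2y v1 ger0_norm// mulr1 (le_trans ty).
    have xp : 0 < x by lra.
    have k0 : 0 <= s / x by rewrite divr_ge0// ltW.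
    have kl : s / x <= t / y by rewrite ler_pdivrMr// mulrAC ler_pdivlMr.
    have := @norm2_comb (s / x) (t / y - s / x) x y 0 y s t k0 ltac:(by rewrite subr_ge0)
      ltac:(by rewrite mulr0 addr0 divfK) ltac:(by rewrite mulrBl !divfK// addrC subrK).
    rewrite norm2y v1 (ger0_norm (ltW yp)); nra.
  have [x0|x0] := eqVneq x 0.
    have s00 : s = 0 by clear -s0 sx x0; lra.
    by rewrite s00 norm2y v1 ger0_norm// mulr1 (le_trans ty).
  have xp : 0 < x by lra.
  have l1 : s / x <= 1 by rewrite ler_pdivrMr// mul1r.
  have l0 : 0 <= s / x by rewrite divr_ge0// ltW.
  have [y0|y0] := eqVneq y 0.
    have t00 : t = 0 by clear -t0 ty y0; lra.
    by rewrite t00 norm2x u1 ger0_norm// mulr1 (le_trans sx).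
  have yp : 0 < y by lra.
  have k0 : 0 <= t / y by rewrite divr_ge0// ltW.
  have kl : t / y <= s / x by rewrite ler_pdivrMr// mulrAC ler_pdivlMr// ltW.
  have := @norm2_comb (t / y) (s / x - t / y) x y x 0 s t k0 ltac:(by rewrite subr_ge0)
    ltac:(by rewrite mulrBl !divfK// addrC subrK) ltac:(by rewrite mulr0 addr0 divfK).
  rewrite norm2x u1 (ger0_norm (ltW xp)); nra.
(* The point lies in one of the two sectors bounded by (1, -1), where the norm is at most the larger
   of s and t. *)
have opp s t : 0 <= s <= 1 -> 0 <= t <= 1 -> f s (- t) <= 1.
  move=> /andP[s0 s1] /andP[t0 t1].
  have [st|st] := leP s t.
    have := @norm2_comb s (t - s) 1 (-1) 0 (-1) s (- t) s0 ltac:(by rewrite subr_ge0) ltac:(ring) ltac:(ring).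
    rewrite w1 norm2y v1 normrN1; lra.
  have := @norm2_comb t (s - t) 1 (-1) 1 0 s (- t) t0 ltac:(by rewrite subr_ge0 ltW) ltac:(ring) ltac:(ring).
  rewrite w1 u1; lra.
move=> a0 b0 c0 d0 hab hcd.
have [a1 b1] := le1 _ _ a0 b0 hab; have [c1 d1] := le1 _ _ c0 d0 hcd.
have [ac|ac] := leP a c; have [bd|bd] := leP b d.
- by rewrite -norm2N !opprB; apply: (same c d) => //; lra.
- rewrite -norm2N opprB (_ : - (b - d) = - (b - d))//; apply: opp; lra.
- have -> : b - d = - (d - b) by ring.
  apply: opp; lra.
- apply: (same a b) => //; lra.
Qed.

Lemma norm2_square : f 1 0 = 1 -> f 0 1 = 1 -> f 1 1 <= 1 -> f (-1) 1 <= 1 ->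
  forall a b, (f a b <= 1) = (`|a| <= 1) && (`|b| <= 1).
Proof.
move=> u1 v1 h1 h2 a b.
have h3 : f 1 (-1) <= 1 by rewrite -norm2N opprK.
have h4 : f (-1) (-1) <= 1 by rewrite norm2N.
apply/idP/andP => [h|[]].
  split.
    have [a0|a0] := leP 0 a; have [b0|b0] := leP 0 b.
    - have := @norm2_comb b 1 1 (-1) a b (a + b) 0 b0 ler01 ltac:(ring) ltac:(ring).
      rewrite norm2x u1 ger0_norm ?addr_ge0//; rewrite ger0_norm//; nra.
    - have := @norm2_comb (- b) 1 1 1 a b (a - b) 0 ltac:(lra) ler01 ltac:(ring) ltac:(ring).
      rewrite norm2x u1 ger0_norm; last lra. rewrite ger0_norm//; nra.
    - have := @norm2_comb b 1 (-1) (-1) a b (a - b) 0 b0 ler01 ltac:(ring) ltac:(ring).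
      rewrite norm2x u1 ler0_norm; last lra. rewrite ltr0_norm//; nra.
    - have := @norm2_comb (- b) 1 (-1) 1 a b (a + b) 0 ltac:(lra) ler01 ltac:(ring) ltac:(ring).
      rewrite norm2x u1 ler0_norm; last lra. rewrite ltr0_norm//; nra.
  have [a0|a0] := leP 0 a; have [b0|b0] := leP 0 b.
  - have := @norm2_comb a 1 (-1) 1 a b 0 (a + b) a0 ler01 ltac:(ring) ltac:(ring).
    rewrite norm2y v1 ger0_norm ?addr_ge0//; rewrite ger0_norm//; nra.
  - have := @norm2_comb a 1 (-1) (-1) a b 0 (b - a) a0 ler01 ltac:(ring) ltac:(ring).
    rewrite norm2y v1 ler0_norm; last lra. rewrite ltr0_norm//; nra.
  - have := @norm2_comb (- a) 1 1 1 a b 0 (b - a) ltac:(lra) ler01 ltac:(ring) ltac:(ring).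
    rewrite norm2y v1 ger0_norm; last lra. rewrite ger0_norm//; nra.
  - have := @norm2_comb (- a) 1 1 (-1) a b 0 (a + b) ltac:(lra) ler01 ltac:(ring) ltac:(ring).
    rewrite norm2y v1 ler0_norm; last lra. rewrite ltr0_norm//; nra.
rewrite !ler_norml => /andP[a1 a2] /andP[b1 b2].
have k1 : f 1 b <= 1.
  have := @norm2_comb ((1 + b) / 2) ((1 - b) / 2) 1 1 1 (-1) 1 b ltac:(lra) ltac:(lra) ltac:(field) ltac:(field).
  nra.
have k2 : f (-1) b <= 1.
  have := @norm2_comb ((1 + b) / 2) ((1 - b) / 2) (-1) 1 (-1) (-1) (-1) b ltac:(lra) ltac:(lra) ltac:(field) ltac:(field).
  nra.
have := @norm2_comb ((1 + a) / 2) ((1 - a) / 2) 1 b (-1) b a b ltac:(lra) ltac:(lra) ltac:(field) ltac:(field).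
nra.
Qed.

Definition packing2 (s : seq (R * R)) :=
  all (fun x => f x.1 x.2 <= 1) s && pairwise (fun x y => 1 < f (x.1 - y.1) (x.2 - y.2)) s.

(* The pentagon obtained from the hexagon by dropping a vertex and sliding the
   others along its edges, the later ones much further than the earlier ones. *)
Lemma norm2_pentagon : f 1 0 = 1 -> f 0 1 = 1 -> f 1 (-1) = 1 ->
  1 < f 1 1 -> 1 < f 2 (-1) -> 1 < f (-1) 2 ->
  (forall e, 0 < e -> 1 < f (-1 - e) 1) ->
  (forall e, 0 < e -> 1 < f 1 e) ->
  (forall e, 0 < e -> 1 < f (- e) (1 + e)) ->
  exists2 s, packing2 s & size s = 5.
Proof.
move=> u1 v1 w1 h11 h21 h12 F1 F2 F3.
have u1' : f (-1) 0 = 1 by rewrite norm2x u1 normrN1 mulr1.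
have v1' : f 0 (-1) = 1 by rewrite norm2y v1 normrN1 mulr1.
have w1' : f (-1) 1 = 1 by rewrite -[RHS]w1 -[RHS](norm2N 1 (-1)) opprK.
have h20 : 1 < f 2 0 by rewrite norm2x u1 ger0_norm//; lra.
have h02 : 1 < f 0 2 by rewrite norm2y v1 ger0_norm//; lra.
have [e1 e10 o1] := norm2_open h11; have [e2 e20 o2] := norm2_open h21.
have [e3 e30 o3] := norm2_open h12; have [e4 e40 o4] := norm2_open h20.
have [e5 e50 o5] := norm2_open h02.
have ex m1 m2 : 0 < m1 -> 0 < m2 -> exists m : R, [/\ 0 < m, m <= m1 & m <= m2].
  move=> p1 p2; have [h|h] := leP m1 m2; first by exists m1.
  by exists m2; split => //; exact: ltW.
have [m1 [m10 m1a m1b]] := ex _ _ e10 e20.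
have [m2 [m20 m2a m2b]] := ex _ _ e30 e40.
have [m3 [m30 m3a m3b]] := ex _ _ m10 m20.
have [m4 [m40 m4a m4b]] := ex _ _ m30 e50.
have [m [m0 ma mb]] := ex _ _ m40 (ltr01 : 0 < 1).
(* The displacements are fixed in the order x, z, h, e. The strict inequality [F1] at x, [F3] at z
   and [F2] at h leave room that bounds the next displacement. *)
pose x := m / 4; have x0 : 0 < x by rewrite /x; lra.
have [ez ez0 oz] := norm2_open (F1 _ x0).
have [z [z0 za zb]] := ex _ _ x0 ez0.
have [eh eh0 oh] := norm2_open (F3 _ z0).
have [h [h0 ha hb]] := ex _ _ z0 eh0.
have [ee ee0 oe] := norm2_open (F2 _ h0).
have [e [e0 ea eb]] := ex _ _ h0 ee0.
have xm : x * 4 = m by clear; rewrite /x; field.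
have [X1 X2 X3 X4 [X5 X6]] : [/\ x * 4 <= e1, x * 4 <= e2, x * 4 <= e3, x * 4 <= e4 &
    x * 4 <= e5 /\ x * 4 <= 1].
  clear -xm ma mb m4a m4b m3a m3b m2a m2b m1a m1b; split; lra.
have [B1 B2 B3 B4] : [/\ e <= 1, h <= 1, z <= 1 & x <= 1].
  clear -ea ha za x0 X6; split; lra.
have tiny (a b : R) : - b <= a -> a <= b -> `|a| <= b by move=> ? ?; rewrite ler_norml; apply/andP.
exists [:: (1, 0); (- e, 1); (-1, 1 - h); (-1 + z, - z); (x, -1)] => //.
have conv s a b c d y y' : 0 < s -> s <= 1 -> y = (1 - s) * a + s * c ->
    y' = (1 - s) * b + s * d -> f a b = 1 -> f c d = 1 -> f y y' <= 1.
  move=> s0 s1 yE yE' k1 k2.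
  have := norm2_comb (a := a) (b := b) (c := c) (d := d) (s := 1 - s) (t := s)
    ltac:(by rewrite subr_ge0) (ltW s0) yE yE'.
  by rewrite k1 k2 !mulr1 subrK.
rewrite /packing2 /= !andbT; apply/andP; split.
  apply/and5P; split; [by rewrite u1| | | |].
  - by apply: (conv e 0 1 (-1) 1) => //; ring.
  - by apply: (conv h (-1) 1 (-1) 0) => //; ring.
  - by apply: (conv z (-1) 0 0 (-1)) => //; ring.
  - by apply: (conv x 0 (-1) 1 (-1)) => //; ring.
(* Four pairs have differences close to unit vectors and use [F1], [oe], [oh] and [oz]. The other
   differences are small perturbations of vectors of norm greater than 1. *)
apply/and4P; split; [apply/and4P; split|apply/and3P; split|apply/andP; split|].
- rewrite -norm2N (_ : - (1 - - e) = -1 - e); last by clear; ring.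
  rewrite (_ : - (0 - 1) = 1); last by clear; ring.
  exact: F1.
- apply: o2; apply: tiny; clear -X2 x0 z0 h0 e0 za ha ea; lra.
- apply: o4; apply: tiny; clear -X4 x0 z0 h0 e0 za ha ea; lra.
- apply: o1; apply: tiny; clear -X1 x0 z0 h0 e0 za ha ea; lra.
- apply: oe; apply: tiny; clear -e0 eb; lra.
- apply: o1; apply: tiny; clear -X1 x0 z0 h0 e0 za ha ea; lra.
- apply: o5; apply: tiny; clear -X5 x0 z0 h0 e0 za ha ea; lra.
- apply: oh; apply: tiny; clear -h0 hb; lra.
- apply: o3; apply: tiny; clear -X3 x0 z0 h0 e0 za ha ea; lra.
- apply: oz; apply: tiny; clear -z0 zb; lra.
Qed.

(** The top edge of the ball contains a segment of length 2 h > 1, which carries two points. One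
    bottom point and two points slightly below (1, 0) and (-1, 0) complete the pentagon. *)
Lemma norm2_long_pentagon h : 1 / 2 < h -> h < 1 -> f 1 0 = 1 ->
  f h 1 <= 1 -> f (- h) 1 <= 1 -> 1 < f 1 1 -> 1 < f (-1) 1 ->
  (forall a b, `|b| <= f a b) ->
  exists2 s, packing2 s & size s = 5.
Proof.
move=> h1 h2 u1 p1 p2 q1 q2 lb.
have u1' : f (-1) 0 = 1 by rewrite norm2x u1 normrN1 mulr1.
have p1' : f (- h) (-1) <= 1 by rewrite norm2N.
have p2' : f h (-1) <= 1 by rewrite -norm2N opprK.
have q1' : 1 < f (-1) (-1) by rewrite norm2N.
have q2' : 1 < f 1 (-1) by rewrite -norm2N opprK.
have c1 : f 0 (-1) <= 1.
  have := @norm2_comb (1 / 2) (1 / 2) h (-1) (- h) (-1) 0 (-1) ltac:(lra) ltac:(lra) ltac:(field) ltac:(field).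
  lra.
have [e1 e10 o1] := norm2_open q1'; have [e2 e20 o2] := norm2_open q2'.
have [t [t0 t1 t2 t3]] : exists t : R, [/\ 0 < t, t <= e1, t <= e2 & t <= 1].
  exists (Num.min e1 (Num.min e2 1)).
  by rewrite !lt_min !ge_min e10 e20 ltr01 !lexx !orbT; split.
(* This abscissa puts (m, - t) on the segment from (1, 0) to (h, -1), hence in the ball. *)
set m := 1 - t * (1 - h).
have m1 : h <= m by rewrite /m; nra.
have m2 : m <= 1 by rewrite /m; nra.
have m3 : 1 - t <= m by rewrite /m; nra.
exists [:: (- h, 1); (h, 1); (0, -1); (m, - t); (- m, - t)] => //.
have big a b : 1 < b -> 1 < f a b.
  by move=> b1; apply: lt_le_trans (lb a b); rewrite ger0_norm//; lra.
have tiny (a b : R) : - b <= a -> a <= b -> `|a| <= b by move=> ? ?; rewrite ler_norml; apply/andP.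
rewrite /packing2 /= !andbT; apply/andP; split.
  apply/and5P; split => //.
  - have := @norm2_comb (1 - t) t 1 0 h (-1) m (- t) ltac:(lra) ltac:(lra) ltac:(rewrite /m; ring) ltac:(ring).
    rewrite u1; nra.
  - have := @norm2_comb (1 - t) t (-1) 0 (- h) (-1) (- m) (- t) ltac:(lra) ltac:(lra) ltac:(rewrite /m; ring) ltac:(ring).
    rewrite u1'; nra.
apply/and4P; split; [apply/and4P; split|apply/and3P; split|apply/andP; split|].
- rewrite subrr norm2x u1 ler0_norm; lra.
- apply: big; lra.
- apply: big; lra.
- apply: big; lra.
- apply: big; lra.
- apply: big; lra.
- apply: big; lra.
- apply: o1; apply: tiny; lra.
- apply: o2; apply: tiny; lra.
- rewrite subrr norm2x u1 ger0_norm; lra.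
Qed.

End Norm2.

(** * Hexagons, parallelograms and pentagons in a normed plane *)

Section Planar.
Context (R : realType) (nm : 'rV[R]_2 -> R).
Hypothesis nmP : is_norm nm.

Definition in_basis (u v : 'rV[R]_2) (a b : R) : R := nm (a *: u + b *: v).

Lemma in_basis_norm2 u v : norm2 (in_basis u v).
Proof.
case: nmP => D Z _; split => [a b c d|t a b].
  by rewrite /in_basis !scalerDl addrACA; exact: D.
by rewrite /in_basis -!scalerA -scalerDr Z.
Qed.

Lemma packing2_packing u v s : packing2 (in_basis u v) s ->
  packing nm [seq x.1 *: u + x.2 *: v | x <- s].
Proof.
move=> /andP[/allP s1 s2]; split; first by move=> _ /mapP[x /s1 ? ->].
rewrite pairwise_map; apply: sub_pairwise s2 => x y /=.
by rewrite /in_basis !scalerBl addrACA -opprD.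
Qed.

Lemma packing2_pentagon u v :
  (exists2 s, packing2 (in_basis u v) s & size s = 5) ->
  exists2 s, packing nm s & size s = 5.
Proof.
move=> [s /packing2_packing h sz]; eexists; first exact: h.
by rewrite size_map.
Qed.

Lemma free2P (u v : 'rV[R]_2) :
  (forall a b, a *: u + b *: v = 0 -> a = 0 /\ b = 0) <-> free [:: u; v].
Proof.
split => h.
  suff : free [tuple u; v] by [].
  apply/freeP => k; rewrite !big_ord_recl big_ord0 addr0 /= => /h[k0 k1] i.
  by case: (unliftP ord0 i) => [j|] ->; rewrite ?[j]ord1.
have {}h : free [tuple u; v] by [].
move=> a b ab; move/freeP : h => /(_ (fun i => if i == ord0 then a else b)).
rewrite !big_ord_recl big_ord0 addr0 /= => /(_ ab) h.
by split; [have := h ord0|have := h (lift ord0 ord0)].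
Qed.

Lemma free2_span (u v x : 'rV[R]_2) : free [:: u; v] -> exists a b, x = a *: u + b *: v.
Proof.
move=> h; have : basis_of fullv [:: u; v].
  by rewrite basisEfree h subvf dimvf /dim/= mul1n.
move=> /coord_basis /(_ (memvf x)); rewrite !big_ord_recl big_ord0 addr0 /= => e.
by eexists; eexists; exact: e.
Qed.

Lemma in_basis_free u v : (forall a b, `|a| <= in_basis u v a b /\ `|b| <= in_basis u v a b) ->
  free [:: u; v].
Proof.
move=> h; apply/free2P => a b e; have := h a b; rewrite /in_basis e is_norm0//.
by rewrite !normr_le0 => -[/eqP ? /eqP ?].
Qed.

Lemma norm_square_parallelogram u v : nm u = 1 -> nm v = 1 ->
  nm (u + v) <= 1 -> nm (u - v) <= 1 -> parallelogram (closed_nball nm 0 1).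
Proof.
move=> u1 v1 h1 h2; have fP := in_basis_norm2 u v.
have E := norm2_square fP _ _ _ _.
have {}E : forall a b, (in_basis u v a b <= 1) = (`|a| <= 1) && (`|b| <= 1).
  apply: E; rewrite /in_basis ?scale1r ?scale0r ?addr0 ?add0r//.
  by rewrite scaleN1r -is_normN// opprD opprK.
have le1 a b : `|a| <= in_basis u v a b /\ `|b| <= in_basis u v a b.
  have f0 := norm2_ge0 fP a b; have [fz|fz] := eqVneq (in_basis u v a b) 0.
    suff [a0 b0] : a = 0 /\ b = 0 by rewrite a0 b0 normr0; split; exact: norm2_ge0.
    have key k : in_basis u v (k * a) (k * b) <= 1.
      by case: fP => _ ->; rewrite fz mulr0.
    have big c : (forall k : R, `|k * c| <= 1) -> c = 0.
      move=> hk; apply/eqP/negPn/negP => c0.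
      by have := hk (2 / c); rewrite divfK// ger0_norm//; lra.
    by split; apply: big => k; have := key k; rewrite E => /andP[].
  have fp : 0 < in_basis u v a b by rewrite lt_neqAle eq_sym fz.
  have : in_basis u v ((in_basis u v a b)^-1 * a) ((in_basis u v a b)^-1 * b) <= 1.
    by case: fP => _ ->; rewrite ger0_norm ?invr_ge0// mulVf.
  by rewrite E !normrM ger0_norm ?invr_ge0// !ler_pdivrMl// !mulr1 => /andP[].
have fr := in_basis_free le1.
exists (- u - v), (2 *: u), (2 *: v); split.
  apply/free2P => a b; rewrite !scalerA => e.
  have [] := (free2P u v).2 fr _ _ e.
  by move=> /eqP + /eqP; rewrite !mulf_eq0 pnatr_eq0 !orbF => /eqP ? /eqP ?.
apply/seteqP; split => x; rewrite /closed_nball/= sub0r is_normN//.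
  move=> x1; have [a [b xE]] := free2_span x fr.
  have : in_basis u v a b <= 1 by rewrite /in_basis -xE.
  rewrite E !ler_norml => /andP[/andP[a1 a2] /andP[b1 b2]].
  exists ((a + 1) / 2), ((b + 1) / 2); split; [lra|lra|].
  rewrite !scalerA !divfK// xE !scalerDl !scale1r.
  by apply/rowP => j; rewrite !mxE; ring.
move=> [s [t [s01 t01 ->]]]; rewrite !scalerA.
have -> : - u - v + (s * 2) *: u + (t * 2) *: v = (s * 2 - 1) *: u + (t * 2 - 1) *: v.
  by apply/rowP => j; rewrite !mxE; ring.
have := E (s * 2 - 1) (t * 2 - 1); rewrite /in_basis => ->.
by rewrite !ler_norml; lra.
Qed.

(** By convexity the norm is at least 1 on the line through [w] along [u], so this line supports the
    ball and meets it in a segment containing [-1, e], of length between 1 and 2. Recentred at the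
    midpoint of the segment, the ball is a parallelogram if the length is 2; otherwise
    [norm2_long_pentagon] applies. *)
Lemma norm_long_segment u w e : nm u = 1 -> nm w = 1 -> nm (w - u) = 1 ->
  0 < e -> nm (w + e *: u) <= 1 ->
  parallelogram (closed_nball nm 0 1) \/ exists2 s, packing nm s & size s = 5.
Proof.
move=> u1 w1 wu e0 we; pose f := in_basis u w; have fP : norm2 f := in_basis_norm2 u w.
have f10 : f 1 0 = 1 by rewrite /f /in_basis scale1r scale0r addr0.
have f01 : f 0 1 = 1 by rewrite /f /in_basis scale1r scale0r add0r.
have fm : f (-1) 1 = 1 by rewrite /f /in_basis scale1r scaleN1r addrC.
have fe : f e 1 <= 1 by rewrite /f /in_basis scale1r addrC.
have ge1 s : 1 <= f s 1.
  have [s0|s0] := leP 0 s.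
    have := @norm2_comb _ f fP s 1 (-1) 1 s 1 0 (1 + s) s0 ler01 ltac:(ring) ltac:(ring).
    rewrite norm2y// f01 fm ger0_norm; lra.
  have := @norm2_comb _ f fP e (- s) s 1 e 1 0 (e - s) (ltW e0) ltac:(lra) ltac:(ring) ltac:(ring).
  rewrite norm2y// f01 ger0_norm; nra.
pose T := [set s | f s 1 <= 1].
have lip s t : f s 1 - f t 1 <= `|s - t|.
  have := norm2_comb fP (s := 1) (t := 1) (a := t) (b := 1) (c := s - t) (d := 0) (x := s) (y := 1)
    ler01 ler01 ltac:(ring) ltac:(ring).
  rewrite norm2x// f10; lra.
have Tbd s : T s -> `|s| <= 2.
  rewrite /T/= => hs.
  have := norm2_comb fP (s := 1) (t := 1) (a := s) (b := 1) (c := 0) (d := -1) (x := s) (y := 0)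
    ler01 ler01 ltac:(ring) ltac:(ring).
  rewrite norm2x// f10 norm2y// f01 normrN1; lra.
have T1 : T (-1) by rewrite /T/= fm.
have Te : T e by [].
have hsT : has_sup T.
  by split; [exists e|exists 2 => s /Tbd; rewrite ler_norml => /andP[]].
have hiT : has_inf T.
  by split; [exists e|exists (-2) => s /Tbd; rewrite ler_norml => /andP[]].
pose s1 := sup T; pose s0 := inf T.
have Ts1 : f s1 1 <= 1.
  rewrite leNgt; apply/negP => h.
  have [t Tt ht] := sup_adherent (eps := f s1 1 - 1) ltac:(by rewrite subr_gt0) hsT.
  have ts : t <= s1 by apply: sup_upper_bound.
  rewrite /T/= -/s1 in Tt ht.
  have := lip s1 t; rewrite ger0_norm; lra.
have Ts0 : f s0 1 <= 1.
  rewrite leNgt; apply/negP => h.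
  have [t Tt ht] := inf_adherent (eps := f s0 1 - 1) ltac:(by rewrite subr_gt0) hiT.
  have ts : s0 <= t by apply: ge_inf => //; case: hiT.
  rewrite /T/= -/s0 in Tt ht.
  have := lip s0 t; rewrite ler0_norm; lra.
have out1 s : s1 < s -> 1 < f s 1.
  move=> h; rewrite ltNge; apply/negP => Ts.
  have : s <= s1 by apply: sup_upper_bound.
  by rewrite leNgt h.
have out0 s : s < s0 -> 1 < f s 1.
  move=> h; rewrite ltNge; apply/negP => Ts.
  have : s0 <= s by apply: ge_inf => //; case: hiT.
  by rewrite leNgt h.
have es1 : e <= s1 by apply: sup_upper_bound.
have es0 : s0 <= -1 by apply: ge_inf => //; case: hiT.
have len : s1 - s0 <= 2.
  have := norm2_comb fP (s := 1) (t := 1) (a := s1) (b := 1) (c := - s0) (d := -1) (x := s1 - s0) (y := 0)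
    ler01 ler01 ltac:(ring) ltac:(ring).
  rewrite norm2x// f10 norm2N// ger0_norm; lra.
pose c := (s0 + s1) / 2; pose h := (s1 - s0) / 2.
have hE : c + h = s1 /\ c - h = s0 by rewrite /c /h; split; field.
case: hE => c1 c0.
(* The shear sends the midpoint of the segment to the second basis vector, so that its ends become
   (h, 1) and (- h, 1). *)
pose v := w + c *: u; pose f' := in_basis u v.
have f'E a b : f' a b = f (a + b * c) b.
  by rewrite /f' /f /in_basis /v; congr nm; apply/rowP => j; rewrite !mxE; ring.
have fP' : norm2 f' := in_basis_norm2 u v.
have h12 : 1 / 2 < h by rewrite /h; lra.
have [h1|h1] := leP 1 h.
  left; have h1' : h = 1 by rewrite /h in h1 *; lra.
  have v1 : f' 0 1 = 1.
    apply/eqP; rewrite eq_le f'E ge1 andbT.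
    have := norm2_comb fP (s := 1 / 2) (t := 1 / 2) (a := s1) (b := 1) (c := s0) (d := 1)
      (x := 0 + 1 * c) (y := 1) ltac:(lra) ltac:(lra) ltac:(rewrite /c; field) ltac:(field).
    lra.
  have nv : nm v = 1 by rewrite -v1 /f' /in_basis scale0r scale1r add0r.
  apply: (norm_square_parallelogram u1 nv).
    have := f'E 1 1; rewrite {1}/f' /in_basis !scale1r => ->.
    by rewrite (_ : 1 + 1 * c = s1)//; rewrite -c1 h1'; ring.
  have := f'E (-1) 1; rewrite {1}/f' /in_basis scale1r scaleN1r addrC => e1.
  by rewrite is_normB// e1 (_ : -1 + 1 * c = s0)//; rewrite -c0 h1'; ring.
right; apply: (@packing2_pentagon u v); apply: (norm2_long_pentagon (h := h) fP') => //.
- by rewrite f'E mul0r addr0.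
- by rewrite f'E mul1r addrC c1.
- by rewrite f'E mul1r addrC c0.
- by rewrite f'E mul1r; apply: out1; lra.
- by rewrite f'E mul1r; apply: out0; lra.
move=> a b; rewrite f'E; have [->|b0] := eqVneq b 0; first by rewrite normr0 norm2_ge0.
have -> : f (a + b * c) b = f (b * (a / b + c)) (b * 1).
  by congr f; field.
by case: fP => _ ->; rewrite ler_peMr.
Qed.

(** Intermediate values along a path from - p to p: the distance from [p] to the normalized point
    varies from 2 to 0. *)
Lemma norm_hexagon p : nm p = 1 -> exists2 q, nm q = 1 & nm (p - q) = 1.
Proof.
move=> p1.
have p0 : p != 0 by apply/eqP => p0; move: p1; rewrite p0 is_norm0//; lra.
have [w hw] : exists w, free [:: p; w].
  have /rV0Pn[i pi] := p0.
  have [j ji] : exists j : 'I_2, j != i.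
    by exists (if i == 0 then 1 else 0); case: (i) => -[|[|//]].
  exists (delta_mx 0 j); apply/free2P => a b /matrixP e.
  have := e 0 i; rewrite !mxE eqxx (negbTE (_ : i != j)) 1?eq_sym//= mulr0 addr0.
  move=> /eqP; rewrite mulf_eq0 (negbTE pi) orbF => /eqP a0.
  by have := e 0 j; rewrite !mxE a0 mul0r !eqxx add0r /= mulr1.
pose f := in_basis p w; have fP : norm2 f := in_basis_norm2 p w.
have f10 : f 1 0 = 1 by rewrite /f /in_basis scale1r scale0r addr0.
(* Multiplying through by the norm [n s] of the point avoids normalization: [h] vanishes exactly
   when the normalized point is at distance 1 from [p], and it is visibly Lipschitz. *)
pose n s := f s (1 - `|s|).
pose h s := f (s - n s) (1 - `|s|) - n s.
pose K := f 1 0 + f 0 1.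
have K0 : 0 <= K by rewrite addr_ge0// norm2_ge0.
have lip1 s t : `|n s - n t| <= 2 * K * `|s - t|.
  have key a b : n a - n b <= 2 * K * `|a - b|.
    apply: le_trans (norm2_lip fP _ _ _ _) _; rewrite -/K.
    have -> : 1 - `|a| - (1 - `|b|) = `|b| - `|a| by ring.
    have := ler_dist_dist b a; rewrite (distrC b a) => k.
    by have := normr_ge0 (a - b); nra.
  rewrite ler_norml key andbT lerNl opprB; apply: le_trans (key t s) _.
  by rewrite distrC.
have lip2 s t : `|h s - h t| <= (2 * K * (K + 1) + 2 * K) * `|s - t|.
  have key a b : h a - h b <= (2 * K * (K + 1) + 2 * K) * `|a - b|.
    have := norm2_lip fP (a - n a) (1 - `|a|) (b - n b) (1 - `|b|); rewrite -/K.
    have -> : 1 - `|a| - (1 - `|b|) = `|b| - `|a| by ring.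
    have := ler_dist_dist b a; rewrite (distrC b a) => k1.
    have k2 := lip1 a b.
    have k3 : `|a - n a - (b - n b)| <= `|a - b| + `|n a - n b|.
      have -> : a - n a - (b - n b) = (a - b) - (n a - n b) by ring.
      exact: ler_normB.
    have k4 : - (n a - n b) <= `|n a - n b| by rewrite -normrN ler_norm.
    have := normr_ge0 (a - b).
    rewrite /h; set X := f _ _; set Y := f _ _; nra.
  rewrite ler_norml key andbT lerNl opprB; apply: le_trans (key t s) _.
  by rewrite distrC.
have ch : {within `[(-1), 1], continuous h}.
  apply: continuous_subspaceT => x.
  apply/cvgrPdist_le => e e0 /=.
  pose C := 2 * K * (K + 1) + 2 * K + 1.
  have C0 : 0 < C by rewrite /C; nra.
  apply/nbhs_ballP; exists (e / C) => /=; first by rewrite divr_gt0.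
  move=> t /=; rewrite ltr_pdivlMr// => ht.
  apply: (le_trans (lip2 x t)); apply: le_trans (ltW ht).
  by rewrite mulrC ler_wpM2l// /C lerDl.
have := @IVT R h (-1) 1 0 ltac:(lra) ch.
have hm : h (-1) = 1.
  have n1 : n (-1) = 1 by rewrite /n normrN1 subrr norm2x// normrN1 f10 mulr1.
  rewrite /h n1 normrN1 subrr norm2x// f10 ler0_norm; lra.
have hp : h 1 = -1.
  have n1 : n 1 = 1 by rewrite /n normr1 subrr f10.
  by rewrite /h n1 normr1 !subrr norm2x// normr0 mul0r sub0r.
rewrite hm hp => -[]; first by rewrite ge_min le_max; lra.
move=> s _ hs.
pose v := s *: p + (1 - `|s|) *: w.
have nv : nm v = n s by [].
have v0 : nm v != 0.
  apply/eqP => nv0; case: nmP => _ _ /(_ _ nv0) vz.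
  by have [s0] := (free2P p w).2 hw _ _ vz; rewrite s0 normr0 subr0; lra.
exists ((nm v)^-1 *: v).
  by case: nmP => _ -> _; rewrite ger0_norm ?invr_ge0 ?is_norm_ge0// mulVf.
have : nm (v - nm v *: p) = nm v.
  rewrite nv; move/eqP: hs; rewrite /h subr_eq0 => /eqP hs; rewrite -[RHS]hs.
  by rewrite /f /in_basis /v; congr nm; apply/rowP => j; rewrite !mxE; ring.
have -> : v - nm v *: p = - nm v *: (p - (nm v)^-1 *: v).
  by rewrite scalerBr scalerA mulNr divff// !scaleN1r scaleNr opprK addrC.
case: nmP => _ -> _; rewrite normrN ger0_norm ?is_norm_ge0//.
by move=> /(congr1 (fun x => (nm v)^-1 * x)); rewrite mulrA mulVf// mul1r.
Qed.

Lemma norm2_lin (f : R -> R -> R) m11 m12 m21 m22 : norm2 f ->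
  norm2 (fun a b => f (m11 * a + m12 * b) (m21 * a + m22 * b)).
Proof.
move=> [D Z]; split => [a b c d|t a b].
  by apply: le_trans (D _ _ _ _); rewrite le_eqVlt; apply/orP; left; apply/eqP; congr f; ring.
by rewrite -Z; congr f; ring.
Qed.

(** A relation between the two vectors with coefficients a and b forces a, b and a + b to have the
    same absolute value, hence to vanish. *)
Lemma hexagon_free p q : nm p = 1 -> nm q = 1 -> nm (p - q) = 1 -> free [:: p; q].
Proof.
move=> p1 q1 pq1; apply/free2P => a b ab; case: nmP => _ Z _.
have h1 : `|a| = `|b|.
  rewrite -[LHS]mulr1 -[RHS]mulr1 -{1}p1 -q1 -!Z -[in RHS]is_normN//.
  by congr nm; apply/eqP; rewrite -subr_eq0 opprK; apply/eqP.
have h2 : `|a + b| = `|a|.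
  rewrite -[LHS]mulr1 -[RHS]mulr1 -{1}q1 -pq1 -!Z -[in RHS]is_normN//.
  congr nm; apply/eqP; rewrite -subr_eq0 opprK; apply/eqP; rewrite -ab.
  by apply/rowP => j; rewrite !mxE; ring.
have s1 : a ^+ 2 = b ^+ 2 by rewrite -(real_normK (num_real a)) h1 real_normK// num_real.
have s2 : (a + b) ^+ 2 = a ^+ 2.
  by rewrite -(real_normK (num_real (a + b))) h2 real_normK// num_real.
have /eqP : b * (b + 2 * a) = 0.
  have -> : b * (b + 2 * a) = (a + b) ^+ 2 - a ^+ 2 by ring.
  by rewrite s2 subrr.
have z (x : R) : x ^+ 2 = 0 -> x = 0 by move=> /eqP; rewrite sqrf_eq0 => /eqP.
rewrite mulf_eq0 => /orP[/eqP b0|/eqP b0].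
  by split=> //; apply: z; rewrite s1 b0 expr0n.
have bE : b = - 2 * a by lra.
have a0 : a = 0.
  apply: z; have : a ^+ 2 = 4 * a ^+ 2 by rewrite {1}s1 bE; ring.
  by lra.
by split=> //; rewrite bE a0 mulr0.
Qed.

(** The inscribed hexagon is drawn with a vertex in the direction of the first point. The two
    sectors along that ray contain no other point of the packing and the four others at most one
    each. *)
Lemma packing_plane_le5 s : packing nm s -> (size s <= 5)%N.
Proof.
case: s => // x0 [//|x1 s] [s1 s2]; rewrite ltnS; set s' := x1 :: s in s1 s2 *.
have x00 : x0 != 0 by apply: (packing_neq0 nmP s1 s2) => //; rewrite mem_head.
have n0 : nm x0 != 0.
  by apply/eqP => h; case: nmP => _ _ /(_ _ h) /eqP; apply/negP.
have np : 0 < nm x0 by rewrite lt_neqAle eq_sym n0 is_norm_ge0.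
pose p := (nm x0)^-1 *: x0.
have p1 : nm p = 1.
  by case: nmP => _ Z _; rewrite Z ger0_norm ?invr_ge0 ?is_norm_ge0// mulVf.
have [q q1 pq1] := norm_hexagon p1.
have fr := hexagon_free p1 q1 pq1.
pose f := in_basis p q; have fP : norm2 f := in_basis_norm2 p q.
have f10 : f 1 0 = 1 by rewrite /f /in_basis scale1r scale0r addr0.
have f01 : f 0 1 = 1 by rewrite /f /in_basis scale1r scale0r add0r.
have fm : f 1 (-1) = 1 by rewrite /f /in_basis scale1r scaleN1r.
have f10' : f (-1) 0 = 1 by rewrite norm2x// normrN1 f10 mulr1.
have f01' : f 0 (-1) = 1 by rewrite norm2y// normrN1 f01 mulr1.
have fm' : f (-1) 1 = 1 by rewrite -[RHS]fm -[RHS](norm2N fP) opprK.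
have [F hF] : exists F : 'rV[R]_2 -> R * R, forall x, x = (F x).1 *: p + (F x).2 *: q.
  suff /choice[F hF] : forall x, exists y : R * R, x = y.1 *: p + y.2 *: q by exists F.
  by move=> x; have [a [b e]] := free2_span x fr; exists (a, b).
have nF x : nm x = f (F x).1 (F x).2 by rewrite {1}(hF x).
have nFB x y : nm (x - y) = f ((F x).1 - (F y).1) ((F x).2 - (F y).2).
  by rewrite {1}(hF x) {1}(hF y) /f /in_basis !scalerBl addrACA -opprD.
have sector m11 m12 m21 m22 a b c d x y : f m11 m21 = 1 -> f m12 m22 = 1 ->
    f (m11 - m12) (m21 - m22) = 1 -> 0 <= a -> 0 <= b -> 0 <= c -> 0 <= d ->
    F x = (m11 * a + m12 * b, m21 * a + m22 * b) ->
    F y = (m11 * c + m12 * d, m21 * c + m22 * d) -> nm x <= 1 -> nm y <= 1 -> nm (x - y) <= 1.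
  move=> e1 e2 e3 a0 b0 c0 d0 ex ey; rewrite nFB (nF x) (nF y) ex ey /= => h1 h2.
  have := norm2_sector (norm2_lin m11 m12 m21 m22 fP) _ _ _ a0 b0 c0 d0 h1 h2.
  rewrite !mulr1 !mulr0 !addr0 !add0r !mulrN1; move=> /(_ e1 e2 e3).
  congr (_ <= _); congr f; ring.
have Fx0 : F x0 = (nm x0, 0).
  have e : ((F x0).1 - nm x0) *: p + (F x0).2 *: q = 0.
    rewrite scalerBl addrAC -hF /p scalerA divff// scale1r subrr//.
  have [/eqP + e2] := (free2P p q).2 fr _ _ e.
  by rewrite subr_eq0 => /eqP e1; rewrite [LHS]surjective_pairing e1 e2.
pose P x := (nm x <= 1) && (1 < nm (x0 - x)).
have Ps : all P s'.
  apply/allP => x xs; have xs0 : x \in x0 :: s' by rewrite inE xs orbT.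
  rewrite /P s1//=.
  by move: s2; rewrite pairwise_cons => /andP[/allP h _]; exact: h.
have x0n : nm x0 <= 1 by apply: s1; rewrite mem_head.
have n1 x : P x -> ~ (0 <= (F x).1 /\ 0 <= (F x).2).
  move=> /andP[x1' ]; rewrite ltNge => /negP h [a0 b0]; apply: h.
  apply: (sector 1 0 0 1 (nm x0) 0 (F x).1 (F x).2) => //.
  - by rewrite subr0 sub0r.
  - exact: ltW.
  - by rewrite Fx0 !mul1r !mul0r addr0 add0r.
  - by rewrite !mul1r !mul0r addr0 add0r -surjective_pairing.
have n6 x : P x -> ~ (0 <= (F x).1 + (F x).2 /\ (F x).2 <= 0).
  move=> /andP[x1' ]; rewrite ltNge => /negP h [a0 b0]; apply: h.
  apply: (sector 1 1 (-1) 0 0 (nm x0) (- (F x).2) ((F x).1 + (F x).2)) => //.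
  - by rewrite subrr subr0.
  - exact: ltW.
  - by rewrite oppr_ge0.
  - by rewrite Fx0; congr pair; ring.
  - by rewrite [LHS]surjective_pairing; congr pair; ring.
(* The four remaining sectors, in the order from q to q - p, to - p, to - q, to p - q. *)
pose c x : bool * bool := if 0 <= (F x).1 + (F x).2 then (true, true) else
  if 0 <= (F x).2 then (true, false) else if (F x).1 <= 0 then (false, true) else (false, false).
have -> : 4%N = #|{: bool * bool}| by rewrite card_prod card_bool.
apply: (@pairwise_class_size _ (bool * bool)%type P (fun x y => 1 < nm (x - y)) c s' Ps).
  by move: s2; rewrite pairwise_cons => /andP[].
move=> x y Px Py; rewrite /= -leNgt.
have xn : nm x <= 1 by case/andP: Px.
have yn : nm y <= 1 by case/andP: Py.
have {}n1x := n1 _ Px; have {}n6x := n6 _ Px; have {}n1y := n1 _ Py; have {}n6y := n6 _ Py.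
have a2 z : ~ (0 <= (F z).1 /\ 0 <= (F z).2) -> ~ (0 <= (F z).1 + (F z).2 /\ (F z).2 <= 0) ->
    0 <= (F z).1 + (F z).2 -> (F z).1 <= 0.
  by move=> k1 k2 k3; rewrite leNgt; apply/negP => k4; have [k5|k5] := leP 0 (F z).2;
    [apply: k1|apply: k2]; split => //; exact: ltW.
rewrite /c.
case: (leP 0 ((F x).1 + (F x).2)) => x3; case: (leP 0 ((F y).1 + (F y).2)) => y3.
- have := a2 _ n1x n6x x3; have := a2 _ n1y n6y y3 => ya xa _.
  apply: (sector 0 (-1) 1 1 ((F x).1 + (F x).2) (- (F x).1) ((F y).1 + (F y).2) (- (F y).1)) => //.
  + by rewrite subrr sub0r opprK.
  + by rewrite oppr_ge0.
  + by rewrite oppr_ge0.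
  + by rewrite [LHS]surjective_pairing; congr pair; ring.
  + by rewrite [LHS]surjective_pairing; congr pair; ring.
- by case: ifP => _ //; case: ifP.
- by case: ifP => _ //; case: ifP.
case: (leP 0 (F x).2) => x4; case: (leP 0 (F y).2) => y4.
- move=> _; apply: (sector (-1) (-1) 1 0 (F x).2 (- ((F x).1 + (F x).2)) (F y).2 (- ((F y).1 + (F y).2))) => //.
  + by rewrite subrr subr0.
  + by rewrite oppr_ge0 ltW.
  + by rewrite oppr_ge0 ltW.
  + by rewrite [LHS]surjective_pairing; congr pair; ring.
  + by rewrite [LHS]surjective_pairing; congr pair; ring.
- by case: ifP.
- by case: ifP.
case: (leP (F x).1 0) => x5; case: (leP (F y).1 0) => y5.
- move=> _; apply: (sector (-1) 0 0 (-1) (- (F x).1) (- (F x).2) (- (F y).1) (- (F y).2)) => //;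
    rewrite ?oppr_ge0 ?(ltW x4) ?(ltW y4)//.
  + by rewrite subr0 sub0r opprK.
  + by rewrite [LHS]surjective_pairing; congr pair; ring.
  + by rewrite [LHS]surjective_pairing; congr pair; ring.
- by [].
- by [].
move=> _; apply: (sector 0 1 (-1) (-1) (- ((F x).1 + (F x).2)) (F x).1 (- ((F y).1 + (F y).2)) (F y).1) => //;
  rewrite ?oppr_ge0 ?(ltW x3) ?(ltW y3) ?(ltW x5) ?(ltW y5)//.
+ by rewrite subrr sub0r.
+ by rewrite [LHS]surjective_pairing; congr pair; ring.
+ by rewrite [LHS]surjective_pairing; congr pair; ring.
Qed.

(** If one of the strict inequalities required by [norm2_pentagon] fails, then either a side of the
    hexagon extends to a long edge of the ball, treated by [norm_long_segment], or two unit vectors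
    span a square ball. *)
Lemma plane_pentagon : ~ parallelogram (closed_nball nm 0 1) ->
  exists2 s, packing nm s & size s = 5.
Proof.
move=> npar; have [e e1] : exists e, nm e = 1.
  pose e : 'rV[R]_2 := delta_mx 0 0.
  have e0 : nm e != 0.
    apply/eqP => h; case: nmP => _ _ /(_ _ h) /matrixP/(_ 0 0).
    by rewrite !mxE !eqxx /= => /eqP; rewrite oner_eq0.
  exists ((nm e)^-1 *: e).
  by case: nmP => _ -> _; rewrite ger0_norm ?invr_ge0 ?is_norm_ge0// mulVf.
have [q q1 pq1] := norm_hexagon e1; set p := e in pq1 e1.
have long u w t : nm u = 1 -> nm w = 1 -> nm (w - u) = 1 -> 0 < t ->
    (exists2 s, packing nm s & size s = 5) \/ 1 < nm (w + t *: u).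
  move=> u1 w1 wu t0; have [h|h] := leP (nm (w + t *: u)) 1; last by right.
  by case: (norm_long_segment u1 w1 wu t0 h) => [/npar//|]; left.
case: (pselect (exists2 s, packing nm s & size s = 5)) => // no.
have {}long u w t : nm u = 1 -> nm w = 1 -> nm (w - u) = 1 -> 0 < t -> 1 < nm (w + t *: u).
  by move=> u1 w1 wu t0; case: (long u w t u1 w1 wu t0).
have sq u v : nm u = 1 -> nm v = 1 -> nm (u - v) <= 1 -> 1 < nm (u + v).
  by move=> u1 v1 h; rewrite ltNge; apply/negP => h'; apply: npar; exact: (norm_square_parallelogram u1 v1).
have qp1 : nm (q - p) = 1 by rewrite is_normB.
have fP := in_basis_norm2 p q.
apply: (@packing2_pentagon p q); apply: (norm2_pentagon fP); rewrite /in_basis.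
- by rewrite scale1r scale0r addr0.
- by rewrite scale1r scale0r add0r.
- by rewrite scale1r scaleN1r.
- by rewrite !scale1r; apply: sq => //; rewrite pq1.
- rewrite scaleN1r (_ : _ - q = p + (p - q)); last by apply/rowP => j; rewrite !mxE; ring.
  by apply: sq => //; rewrite subKr q1.
- rewrite scaleN1r (_ : _ + _ = q + (q - p)); last by apply/rowP => j; rewrite !mxE; ring.
  by apply: sq => //; rewrite subKr e1.
- move=> t t0; rewrite (_ : _ + _ = (q - p) + t *: (- p)); last by apply/rowP => j; rewrite !mxE; ring.
  by apply: long; rewrite ?is_normN// opprK subrK.
- move=> t t0; rewrite scale1r; apply: long => //.
- move=> t t0; rewrite (_ : _ + _ = q + t *: (q - p)); last by apply/rowP => j; rewrite !mxE; ring.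
  by apply: long => //; rewrite subKr.
Qed.

Lemma parallelogram_packing : parallelogram (closed_nball nm 0 1) ->
  (exists2 s, packing nm s & size s = 4) /\ (forall s, packing nm s -> (size s <= 4)%N).
Proof.
move=> [p [u [v [fr E]]]].
have le1 x : nm x <= 1 <-> exists s t : R, [/\ 0 <= s <= 1, 0 <= t <= 1 & x = p + s *: u + t *: v].
  rewrite -[X in _ <-> X]/([set x | exists s t : R, [/\ 0 <= s <= 1, 0 <= t <= 1 & x = p + s *: u + t *: v]] x).
  by rewrite -E /closed_nball/= sub0r is_normN.
(* Symmetry of the ball, tested on the two opposite vertices p and p + u + v, forces its centre to
   be the origin. *)
have pE : p = - (1 / 2) *: u - (1 / 2) *: v.
  have /le1[s [t [s01 t01 e1]]] : nm (- p) <= 1.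
    rewrite is_normN//; apply/le1; exists 0, 0; split; rewrite ?lexx ?ler01//.
    by rewrite !scale0r !addr0.
  have /le1[s' [t' [s01' t01' e2]]] : nm (- (p + u + v)) <= 1.
    rewrite is_normN//; apply/le1; exists 1, 1; split; rewrite ?lexx ?ler01//.
    by rewrite !scale1r.
  have e : (s - s' - 1) *: u + (t - t' - 1) *: v = 0.
    have -> : (s - s' - 1) *: u + (t - t' - 1) *: v =
      (p + s *: u + t *: v) - (p + s' *: u + t' *: v) - u - v.
      by apply/rowP => j; rewrite !mxE; ring.
    by rewrite -e1 -e2; apply/rowP => j; rewrite !mxE; ring.
  have [k1 k2] := (free2P u v).2 fr _ _ e.
  have s1 : s = 1 by lra.
  have t1 : t = 1 by lra.
  rewrite s1 t1 !scale1r in e1.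
  apply/rowP => j; move/rowP/(_ j): e1; rewrite !mxE => e1; lra.
have coord a b : nm (a *: u + b *: v) <= 1 <-> `|a| <= 1 / 2 /\ `|b| <= 1 / 2.
  split.
    move=> /le1[s [t [s01 t01 e1]]].
    have e : (a - s + 1 / 2) *: u + (b - t + 1 / 2) *: v = 0.
      have -> : (a - s + 1 / 2) *: u + (b - t + 1 / 2) *: v = (a *: u + b *: v) -
        ((- (1 / 2) *: u - (1 / 2) *: v) + s *: u + t *: v).
        by apply/rowP => j; rewrite !mxE; ring.
      by rewrite e1 -pE subrr.
    have [k1 k2] := (free2P u v).2 fr _ _ e.
    rewrite !ler_norml; lra.
  rewrite !ler_norml => -[/andP[a1 a2] /andP[b1 b2]].
  apply/le1; exists (a + 1 / 2), (b + 1 / 2); split; [lra|lra|].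
  by rewrite pE; apply/rowP => j; rewrite !mxE; ring.
split.
  pose w a b : 'rV[R]_2 := a *: u + b *: v.
  have wB a b c d : w a b - w c d = w (a - c) (b - d).
    by apply/rowP => j; rewrite !mxE; ring.
  have big a b : (1 / 2 < `|a|) || (1 / 2 < `|b|) -> 1 < nm (w a b).
    move=> h; rewrite ltNge; apply/negP => /coord[k1 k2]; move: h.
    by rewrite !ltNge k1 k2.
  have h2 : 1 / 2 < `|1 / 2 - -(1 / 2)| :> R by rewrite ger0_norm; lra.
  have h3 : 1 / 2 < `|-(1 / 2) - 1 / 2| :> R by rewrite distrC.
  exists [:: w (1/2) (1/2); w (1/2) (-(1/2)); w (-(1/2)) (1/2); w (-(1/2)) (-(1/2))] => //.
  split.
    move=> x; rewrite !inE => /or4P[] /eqP ->; apply/coord; rewrite ?normrN; split;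
      rewrite ger0_norm; lra.
  by rewrite /= !wB !big ?h2 ?h3 ?orbT.
move=> s [s1 s2].
have [F hF] : exists F : 'rV[R]_2 -> R * R, forall x, x = (F x).1 *: u + (F x).2 *: v.
  suff /choice[F hF] : forall x, exists y : R * R, x = y.1 *: u + y.2 *: v by exists F.
  by move=> x; have [a [b e]] := free2_span x fr; exists (a, b).
have s1' : all (fun x => nm x <= 1) s by apply/allP => x /s1.
have := @pairwise_class_size _ (bool * bool)%type (fun x => nm x <= 1) _
  (fun x => (0 <= (F x).1, 0 <= (F x).2)) s s1' s2.
rewrite card_prod card_bool; apply => x y; rewrite {1}(hF x) {1}(hF y) => /coord[x1 x2] /coord[y1 y2].
move=> [e1 e2]; rewrite -leNgt {1}(hF x) {1}(hF y).
have -> : (F x).1 *: u + (F x).2 *: v - ((F y).1 *: u + (F y).2 *: v) =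
  ((F x).1 - (F y).1) *: u + ((F x).2 - (F y).2) *: v.
  by apply/rowP => j; rewrite !mxE; ring.
apply/coord; have key (a b : R) : `|a| <= 1 / 2 -> `|b| <= 1 / 2 -> (0 <= a) = (0 <= b) -> `|a - b| <= 1 / 2.
  rewrite !ler_norml => /andP[a1 a2] /andP[b1 b2].
  by case: (leP 0 a) => a0; case: (leP 0 b) => b0 // _; apply/andP; split; lra.
by split; apply: key.
Qed.

End Planar.

Theorem sup_average_opnorm_plane (R : realType) (nm : 'rV[R]_2 -> R) : is_norm nm ->
  (parallelogram (closed_nball nm 0 1) -> sup_average_opnorm nm = 4%:E) /\
  (~ parallelogram (closed_nball nm 0 1) -> sup_average_opnorm nm = 5%:E).
Proof.
move=> nmP; split => h.
  have [[s ps sz] le] := parallelogram_packing nmP h.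
  by have [-> _] := sup_average_opnormE nmP ps ltac:(by rewrite sz) ltac:(by rewrite sz); rewrite sz.
have [s ps sz] := plane_pentagon nmP h.
have le := packing_plane_le5 nmP.
by have [-> _] := sup_average_opnormE nmP ps ltac:(by rewrite sz) ltac:(by rewrite sz); rewrite sz.
Qed.

(** * The maximum norm and the dot product *)

Section LinftyNorm.
Context (R : realType) (d : nat).

Lemma linfty_coord (x : 'rV[R]_d) i : `|x 0 i| <= `|x|.
Proof. by rewrite -[leRHS]/(mx_norm x) mx_normrE (bigmax_sup (ord0, i)). Qed.

Lemma linfty_le (x : 'rV[R]_d) (r : R) : 0 <= r -> (forall i, `|x 0 i| <= r) -> `|x| <= r.
Proof.
move=> r0 h; rewrite -[leLHS]/(mx_norm x) mx_normrE bigmax_le// => -[i j] _ /=.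
by rewrite [i]ord1.
Qed.

Lemma is_norm_linfty : is_norm (@linfty_norm R d).
Proof.
split=> [x y|a x|x]; first exact: ler_normD.
- exact: normrZ.
- exact: normr0_eq0.
Qed.

Lemma packing_linfty (s : seq 'rV[R]_d) : packing (@linfty_norm R d) s -> (size s <= 2 ^ d)%N.
Proof.
move=> [s1 s2].
have s1' : all (fun x : 'rV[R]_d => `|x| <= 1) s by apply/allP.
have := @pairwise_class_size _ {ffun 'I_d -> bool} _ _ (fun x : 'rV[R]_d => [ffun i => 0 <= x 0 i]) s s1' s2.
rewrite card_ffun card_bool card_ord; apply => x y x1 y1 /ffunP xy.
rewrite -leNgt; apply: linfty_le => // i; have := xy i; rewrite !ffunE !mxE.
have := le_trans (linfty_coord x i) x1; have := le_trans (linfty_coord y i) y1.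
rewrite !ler_norml; case: (lerP 0 (x 0 i)); case: (lerP 0 (y 0 i)) => //; clear; lra.
Qed.

Theorem sup_average_opnorm_linfty : (0 < d)%N ->
  sup_average_opnorm (@linfty_norm R d) = (2 ^+ d)%:E /\
  average_opnorm_attains (@linfty_norm R d) (2 ^+ d)%:E.
Proof.
move=> d0; pose corner (f : {ffun 'I_d -> bool}) : 'rV[R]_d := \row_i (if f i then 1 else -1).
pose s := map corner (enum {ffun 'I_d -> bool}).
have ss : size s = (2 ^ d)%N by rewrite size_map -cardT card_ffun card_bool card_ord.
have ps : packing (@linfty_norm R d) s.
  split=> [_ /mapP[f _ ->]|].
    by apply: linfty_le => // i; rewrite mxE; case: ifP; rewrite ?normrN normr1.
  rewrite pairwise_map; apply: sub_pairwise (_ : pairwise [rel x y | x != y] _).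
    move=> f g /= fg; apply: contraNT fg; rewrite -leNgt => h.
    apply/eqP/ffunP => i; apply/eqP; apply: contraLR h => fgi; rewrite -ltNge.
    apply: lt_le_trans (linfty_coord _ i); rewrite !mxE; move: fgi.
    by case: (f i); case: (g i) => //= _; rewrite -?opprD ?normrN ?opprK ger0_norm; lra.
  by rewrite -uniq_pairwise enum_uniq.
have [||e1 e2] := sup_average_opnormE is_norm_linfty ps.
- by rewrite ss -{1}(expn0 2) ltn_exp2l.
- by move=> s' /packing_linfty; rewrite ss.
by rewrite ss natrX in e1 e2.
Qed.

End LinftyNorm.

Lemma cauchy_schwarz (R : realFieldType) (I : Type) (r : seq I) (w a b : I -> R) :
  (forall i, 0 <= w i) ->
  (\sum_(i <- r) w i * (a i * b i)) ^+ 2 <=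
  (\sum_(i <- r) w i * a i ^+ 2) * (\sum_(i <- r) w i * b i ^+ 2).
Proof.
move=> w0; set A := \sum_(i <- r) w i * a i ^+ 2; set B := \sum_(i <- r) w i * b i ^+ 2; set C := \sum_(i <- r) _.
have A0 : 0 <= A by apply: sumr_ge0 => i _; rewrite mulr_ge0 ?sqr_ge0.
have key u v : 0 <= u ^+ 2 * A - 2 * u * v * C + v ^+ 2 * B.
  have -> : u ^+ 2 * A - 2 * u * v * C + v ^+ 2 * B = \sum_(i <- r) w i * (u * a i - v * b i) ^+ 2.
    rewrite !mulr_sumr -sumrB -big_split; apply: eq_bigr => i _ /=; ring.
  by apply: sumr_ge0 => i _; rewrite mulr_ge0 ?sqr_ge0.
have [A00|A00] := eqVneq A 0.
  suff -> : C = 0 by rewrite expr0n/= A00 mul0r.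
  have [//|C0] := eqVneq C 0.
  have := key ((B + 1) / (2 * C)) 1; rewrite A00.
  have -> : ((B + 1) / (2 * C)) ^+ 2 * 0 - 2 * ((B + 1) / (2 * C)) * 1 * C + 1 ^+ 2 * B = - 1.
    by field.
  by rewrite lerNr oppr0 ler10.
have A1 : 0 < A by rewrite lt_def A00.
have := key C A.
have -> : C ^+ 2 * A - 2 * C * A * C + A ^+ 2 * B = A * (A * B - C ^+ 2) by ring.
by rewrite pmulr_rge0// subr_ge0.
Qed.

Section DotProduct.
Context (R : realType) (d : nat).
Implicit Types x y z : 'rV[R]_d.

Definition dot x y : R := \sum_i x 0 i * y 0 i.

Lemma dotC x y : dot x y = dot y x.
Proof. by apply: eq_bigr => i _; rewrite mulrC. Qed.

Lemma dotDl x y z : dot (x + y) z = dot x z + dot y z.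
Proof. by rewrite -big_split; apply: eq_bigr => i _; rewrite !mxE mulrDl. Qed.

Lemma dotZl a x z : dot (a *: x) z = a * dot x z.
Proof. by rewrite mulr_sumr; apply: eq_bigr => i _; rewrite !mxE mulrA. Qed.

Lemma dotNl x z : dot (- x) z = - dot x z.
Proof. by rewrite -scaleN1r dotZl mulN1r. Qed.

Lemma dotBl x y z : dot (x - y) z = dot x z - dot y z.
Proof. by rewrite dotDl dotNl. Qed.

Lemma dotDr x y z : dot z (x + y) = dot z x + dot z y.
Proof. by rewrite dotC dotDl !(dotC z). Qed.

Lemma dotZr a x z : dot z (a *: x) = a * dot z x.
Proof. by rewrite dotC dotZl (dotC z). Qed.

Lemma dotNr x z : dot z (- x) = - dot z x.
Proof. by rewrite dotC dotNl (dotC z). Qed.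

Lemma dotBr x y z : dot z (x - y) = dot z x - dot z y.
Proof. by rewrite dotC dotBl !(dotC z). Qed.

Lemma dot_ge0 x : 0 <= dot x x.
Proof. by apply: sumr_ge0 => i _; rewrite -expr2 sqr_ge0. Qed.

Lemma dot_eq0 x : dot x x = 0 -> x = 0.
Proof.
move/eqP; rewrite psumr_eq0 => [/allP h|i _]; last by rewrite -expr2 sqr_ge0.
apply/rowP => i; rewrite mxE; apply/eqP.
by have := h i; rewrite mem_index_enum -expr2 sqrf_eq0 => /(_ isT).
Qed.

Lemma dot_CS x y : dot x y ^+ 2 <= dot x x * dot y y.
Proof.
have := @cauchy_schwarz R _ (index_enum 'I_d) (fun=> 1) (fun i => x 0 i) (fun i => y 0 i) (fun=> ler01).
by under eq_bigr do rewrite mul1r; under [in X in _ <= X * _]eq_bigr do rewrite mul1r expr2;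
  under [in X in _ <= _ * X]eq_bigr do rewrite mul1r expr2.
Qed.

Lemma euclidean_normE x : euclidean_norm x = Num.sqrt (dot x x).
Proof. by congr Num.sqrt; apply: eq_bigr => i _; rewrite expr2. Qed.

Lemma sqr_euclidean_norm x : euclidean_norm x ^+ 2 = dot x x.
Proof. by rewrite euclidean_normE sqr_sqrtr// dot_ge0. Qed.

Lemma euclidean_norm_le1 x : (euclidean_norm x <= 1) = (dot x x <= 1).
Proof. by rewrite euclidean_normE -[X in _ <= X]sqrtr1 ler_sqrt. Qed.

Lemma euclidean_norm_gt1 x : (1 < euclidean_norm x) = (1 < dot x x).
Proof. by rewrite !ltNge euclidean_norm_le1. Qed.

Lemma is_norm_euclidean : is_norm (@euclidean_norm R d).
Proof.
split=> [x y|a x|x].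
- rewrite -(@ler_pXn2r _ 2)// ?nnegrE ?addr_ge0 ?euclidean_normE ?sqrtr_ge0//.
  rewrite -!euclidean_normE sqrrD !sqr_euclidean_norm dotDl !dotDr (dotC y x).
  suff : dot x y <= euclidean_norm x * euclidean_norm y by clear; lra.
  apply: le_trans (ler_norm _) _; rewrite -(@ler_pXn2r _ 2)// ?nnegrE ?mulr_ge0 ?euclidean_normE ?sqrtr_ge0//.
  by rewrite -!euclidean_normE exprMn !sqr_euclidean_norm real_normK ?num_real// dot_CS.
- by rewrite !euclidean_normE dotZl dotZr mulrA -expr2 sqrtrM ?sqr_ge0// sqrtr_sqr.
move=> /(congr1 (fun r => r ^+ 2)); rewrite sqr_euclidean_norm expr0n/=; exact: dot_eq0.
Qed.

Lemma dot_sub x y : dot (x - y) (x - y) = dot x x + dot y y - 2 * dot x y.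
Proof. rewrite dotBl !dotBr (dotC y x); ring. Qed.

Lemma packing_spherical (s : seq 'rV[R]_d) : (forall x, x \in s -> dot x x = 1) ->
  pairwise (fun x y => dot x y < 2^-1) s -> packing (@euclidean_norm R d) s.
Proof.
move=> s1 s2; split=> [x /s1 xx|]; first by rewrite euclidean_norm_le1 xx.
apply: (sub_in_pairwise (P := mem s)) s2; last by apply/allP.
move=> x y /s1 x1 /s1 y1 h; rewrite euclidean_norm_gt1 dot_sub x1 y1; lra.
Qed.

(* Radial projection does not decrease the angles of a packing below 60 degrees. *)
Lemma spherical_packing (s : seq 'rV[R]_d) : packing (@euclidean_norm R d) s -> (1 < size s)%N ->
  exists s', [/\ size s' = size s, forall x, x \in s' -> dot x x = 1
    & pairwise (fun x y => dot x y < 2^-1) s'].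
Proof.
move=> ps s0; have [s1 s2] := ps.
pose u x := (euclidean_norm x)^-1 *: x.
have n0 x : x \in s -> 0 < euclidean_norm x.
  move=> xs; rewrite lt_def; apply/andP; split; last by rewrite euclidean_normE sqrtr_ge0.
  apply/eqP => x0; have := packing_neq0 is_norm_euclidean s1 s2 s0 xs.
  by case: is_norm_euclidean => _ _ /(_ _ x0) ->; rewrite eqxx.
exists (map u s); split; first by rewrite size_map.
- move=> _ /mapP[x xs ->]; rewrite dotZl dotZr -sqr_euclidean_norm.
  by field; rewrite lt0r_neq0// n0.
rewrite pairwise_map; apply: (sub_in_pairwise (P := mem s)) s2; last by apply/allP.
move=> x y xs ys /=; rewrite euclidean_norm_gt1 dot_sub -!sqr_euclidean_norm /u dotZl dotZr.
have := n0 _ xs; have := n0 _ ys; have := s1 _ xs; have := s1 _ ys.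
(* With lengths a, b and inner product c, the hypothesis reads 2 c < a^2 + b^2 - 1, and a^2 + b^2 -
   a b <= 1 for a, b at most 1. *)
move: (euclidean_norm x) (euclidean_norm y) (dot x y) => a b c b1 a1 b0 a0 h.
rewrite mulrA -invfM mulrC ltr_pdivrMr ?mulr_gt0//.
nra.
Qed.

End DotProduct.

(** * Asymptotics of the linear programming bound *)

(** A single term of the binomial expansion of (x + (1 - x))^(i + N). *)
Lemma binomial_weight_le1 (R : realDomainType) (i N : nat) (x : R) : 0 <= x <= 1 ->
  'C(i + N, i)%:R * x ^+ i * (1 - x) ^+ N <= 1.
Proof.
move=> /andP[x0 x1]; have := @exprDn R (1 - x) x (i + N).
rewrite subrK expr1n => E; rewrite [leRHS]E.
have iN : (i < (i + N).+1)%N by rewrite ltnS leq_addr.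
rewrite (bigD1 (Ordinal iN))//= addKn -[X in X <= _]mulrA mulr_natl [x ^+ i * _]mulrC lerDl.
apply: sumr_ge0 => j _; rewrite mulrn_wge0// mulr_ge0// exprn_ge0// subr_ge0//.
Qed.

(** The bump j (L - j) is an approximate eigenvector: its two neighbours of j + 1 sum to twice its
    value there minus 2, and that value is at least L - 1. After rescaling by powers of b, the
    recurrence thus acts with eigenvalue at least 2 b (1 - 1/(L - 1)). *)
Lemma tent_coef (R : realFieldType) (j L s d b B Q : R) : 0 <= j -> j + 2 <= L -> 0 < b -> b ^+ 2 <= B ->
  0 < Q -> s + d <= 2 * b * (1 - (L - 1)^-1) ->
  d * ((j + 1) * (L - (j + 1)) / (b * Q)) <=
  j * (L - j) / Q + B * ((j + (1 + 1)) * (L - (j + (1 + 1))) / (b * (b * Q))) - s * ((j + 1) * (L - (j + 1)) / (b * Q)).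
Proof.
move=> j0 jL b0 bB Q0 sd; have L1 : 0 < L - 1 by lra.
set P := (j + 1) * (L - (j + 1)).
have PL : L - 1 <= P.
  have : 0 <= j * (L - (j + 2)) by rewrite mulr_ge0// subr_ge0.
  by rewrite /P; lra.
have h1 : (s + d) * P <= 2 * b * (P - 1).
  apply: le_trans (ler_wpM2r (le_trans (ltW L1) PL) sd) _.
  rewrite -[leLHS]mulrA ler_pM2l ?mulr_gt0// mulrBl mul1r lerD2l lerN2 mulrC ler_pdivlMr//.
  by rewrite mul1r.
rewrite lerBrDr -mulrDl addrC -(ler_pM2r (mulr_gt0 b0 Q0)).
have -> : (s + d) * (P / (b * Q)) * (b * Q) = (s + d) * P by field; rewrite !gt_eqF.
apply: le_trans h1 _.
have -> : (j * (L - j) / Q + B * ((j + (1 + 1)) * (L - (j + (1 + 1))) / (b * (b * Q)))) * (b * Q) =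
  b * (j * (L - j)) + B * ((j + 2) * (L - (j + 2))) / b by field; rewrite !gt_eqF.
have h2 : b * ((j + 2) * (L - (j + 2))) <= B * ((j + 2) * (L - (j + 2))) / b.
  rewrite ler_pdivlMr// mulrAC -expr2; apply: ler_wpM2r => //.
  by apply: mulr_ge0; lra.
apply: le_trans (_ : _ <= b * (j * (L - j)) + b * ((j + 2) * (L - (j + 2)))) _; last by rewrite lerD2l.
by rewrite le_eqVlt; apply/orP; left; apply/eqP; rewrite /P; ring.
Qed.

(** * Codes of a given angle and dimensions of spaces of harmonics *)

Section SphericalCode.
Variables (R : realFieldType) (n : nat).
Hypothesis n4 : (4 <= n)%N.
Local Notation p := (gegen R n).
Local Notation b := (gegen_beta R n).
Local Notation h := (gegen_norm R n).

Lemma gegen_one i : 0 < (p i).[1] /\ (p i.+1).[1] = (i%:R + n%:R - 2) / (2 * i%:R + n%:R - 2) * (p i).[1].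
Proof.
have n4R : (4 : R) <= n%:R by rewrite ler_nat.
elim: i => [|i [h0 h1]].
  rewrite gegen0 gegen1 hornerX hornerC ltr01 mulr1; split=> //.
  by rewrite mulr0 !add0r divff// lt0r_neq0//; lra.
have i0 : (0 : R) <= i%:R by [].
have h2 : 0 < (p i.+1).[1] by rewrite h1 mulr_gt0// divr_gt0//; lra.
split=> //; rewrite gegenSS hornerD hornerN hornerM hornerX hornerZ mul1r.
have -> : (p i).[1] = (p i.+1).[1] * (2 * i%:R + n%:R - 2) / (i%:R + n%:R - 2).
  by rewrite h1; field; rewrite !lt0r_neq0//; lra.
rewrite /gegen_beta /gegen_kappa -!natr1; field.
by rewrite !lt0r_neq0//; lra.
Qed.

(** This is the dimension of the space of spherical harmonics of degree i on the sphere of R^n. *)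
Lemma gegen_dimE i : (p i).[1] ^+ 2 / h i =
  (2 * i%:R + n%:R - 2) / (n%:R - 2) * 'C(i + (n - 3), i)%:R.
Proof.
have n4R : (4 : R) <= n%:R by rewrite ler_nat.
elim: i => [|i IH].
  by rewrite gegen0 hornerC bin0 mulr0 add0r expr1n !divr1 mulr1 divff// lt0r_neq0//; lra.
have i0 : (0 : R) <= i%:R by [].
have hb := gegen_beta_gt0 R n4 (ltn0Sn i); have hh := gegen_norm_gt0 R n4 i.
rewrite (gegen_one i).2 /=.
have -> : ((i%:R + n%:R - 2) / (2 * i%:R + n%:R - 2) * (p i).[1]) ^+ 2 / (h i * b i.+1) =
   (p i).[1] ^+ 2 / h i * (((i%:R + n%:R - 2) / (2 * i%:R + n%:R - 2)) ^+ 2 / b i.+1).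
  by field; rewrite !lt0r_neq0//; lra.
have C : 'C(i.+1 + (n - 3), i.+1)%:R = (i%:R + n%:R - 2) / i.+1%:R * 'C(i + (n - 3), i)%:R :> R.
  have := mul_bin_diag (i + (n - 3)).+1 i; rewrite -addSn.
  move/(congr1 (fun k => k%:R : R)); rewrite !natrM /= addSn.
  have -> : (i + (n - 3)).+1%:R = i%:R + n%:R - 2 :> R.
    by rewrite -natr1 natrD natrB; [ring|exact: leq_trans n4].
  by move=> E; rewrite mulrAC E mulrAC divff ?mul1r// pnatr_eq0.
rewrite IH C /gegen_beta /gegen_kappa -!natr1; field.
by rewrite !lt0r_neq0//; lra.
Qed.

Lemma gegen_dim_le i (x : R) : 0 < x < 1 -> (i <= n)%N ->
  (p i).[1] ^+ 2 / h i <= 6 / (x ^+ i * (1 - x) ^+ n).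
Proof.
move=> /andP[x0 x1] iN; rewrite gegen_dimE.
have n4R : (4 : R) <= n%:R by rewrite ler_nat.
have i0 : (i%:R : R) <= n%:R by rewrite ler_nat.
have y0 : 0 < 1 - x by rewrite subr_gt0.
apply: ler_pM.
- by rewrite divr_ge0//; have : (0 : R) <= i%:R by []; lra.
- exact: ler0n.
- by rewrite ler_pdivrMr; lra.
rewrite -[leRHS]mul1r ler_pdivlMr ?mulr_gt0 ?exprn_gt0// mulrA.
apply: le_trans (@binomial_weight_le1 R i (n - 3) x _); last by rewrite !ltW.
apply: ler_wpM2l; first by rewrite mulr_ge0// exprn_ge0// ltW.
by apply: ler_wiXn2l; rewrite ?leq_subr//; lra.
Qed.

Variables (m L : nat) (s d bb x : R).
Hypothesis m0 : (0 < m)%N.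
Hypothesis L2 : (2 <= L)%N.
Hypothesis mL : (m + L <= n)%N.
Hypothesis bb0 : 0 < bb.
Hypothesis bbm : bb ^+ 2 <= b m.
Hypothesis x01 : 0 < x < 1.
Hypothesis s0 : 0 <= s <= 1.
Hypothesis d0 : 0 < d.
Hypothesis dE : s + d <= 2 * bb * (1 - (L%:R - 1)^-1).

(** A bump supported on the degrees from [m] to [m + L], where the recurrence coefficients are at
    least [bb ^+ 2]; it vanishes at both ends, which makes the boundary cases of [ccoef] trivial. *)
Let c (i : nat) : R := if (m <= i <= m + L)%N then (i - m)%:R * (m + L - i)%:R / bb ^+ (i - m) else 0.

Let cm j : (j <= L)%N -> c (m + j) = j%:R * (L%:R - j%:R) / bb ^+ j.
Proof.
move=> jL; rewrite /c leq_addr leq_add2l jL addKn subnDl natrB//.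
Qed.

Let c0 i : 0 <= c i.
Proof. by rewrite /c; case: ifP => // _; rewrite divr_ge0// ?mulr_ge0// exprn_ge0// ltW. Qed.

Let cK i : (m + L <= i)%N -> c i = 0.
Proof.
rewrite leq_eqVlt => /orP[/eqP <-|h1]; first by rewrite cm// subrr mulr0 mul0r.
by rewrite /c [(i <= _)%N]leqNgt h1 andbF.
Qed.

Let ccoef i : d * c i <= mulX_coef n c s i.
Proof.
have [im|im] := leqP i m.
  have ci : c i = 0.
    rewrite /c; case: ifP => // /andP[mi _]; have -> : i = m by apply/eqP; rewrite eqn_leq im mi.
    by rewrite subnn mul0r mul0r.
  have b0 := gegen_beta_gt0 R n4 (ltn0Sn i).
  rewrite /mulX_coef ci !mulr0 subr0; apply: addr_ge0; last exact: mulr_ge0 (ltW b0) _.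
  by case: i {im b0 ci}.
have [iL|iL] := leqP (m + L) i.
  rewrite cK// /mulX_coef (cK iL) (cK (leqW iL)) !mulr0 subr0 addr0.
  by case: i {im iL}.
have [j iE] : exists j, i = (m + j.+1)%N by exists (i - m.+1)%N; lia.
subst i; rewrite /mulX_coef addnS /= -addnS -[(m + j.+1).+1]addnS.
have jL : (j.+2 <= L)%N by clear -iL; lia.
rewrite (cm (ltnW jL)) (cm jL) (cm (ltnW (ltnW jL))).
have bm : bb ^+ 2 <= b (m + j).+2.
  apply: le_trans bbm _; apply: gegen_beta_le => //; lia.
have jL' : j%:R + 2 <= L%:R :> R by rewrite -(natrD R j 2) ler_nat addn2.
have := tent_coef (ler0n R j) jL' bb0 bm (exprn_gt0 j bb0) dE.
have n1 : j.+1%:R = j%:R + 1 :> R by rewrite natr1.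
have n2 : j.+2%:R = j%:R + (1 + 1) :> R by rewrite addrA !natr1.
by rewrite n1 n2 !addnS !(exprS bb).
Qed.

(** Cauchy-Schwarz bounds the squared value at 1 of the test polynomial by its squared norm times
    the number of harmonics of degree below [m + L]. The squared norm also stands on the left of
    [delsarte_lp] and cancels. *)
Lemma spherical_code_le (I : finType) (v : I -> 'I_n -> R) :
  (forall i, Fischer.dotf (v i) (v i) = 1) ->
  (forall i j, i != j -> Fischer.dotf (v i) (v j) <= s) ->
  #|I|%:R <= (1 - s) / d * ((m + L)%:R * (6 / (x ^+ (m + L) * (1 - x) ^+ n))).
Proof.
move=> v1 vs; have [x0 x1] := andP x01.
have n3 : (3 <= n)%N by exact: leq_trans n4.
have h0 i : 0 < h i by exact: gegen_norm_gt0.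
have lp := @delsarte_lp R n n4 c (m + L) s d c0 cK I (fun i j => Fischer.dotf (v i) (v j))
  (fun k => Fischer.gegen_psd n3 k v1) v1 vs d0 ccoef (andP s0).2.
pose S := \sum_(i < m + L) c i ^+ 2 * h i.
have S0 : 0 < S.
  have mL' : (m.+1 < m + L)%N by rewrite -addn1 ltn_add2l.
  rewrite /S (bigD1 (Ordinal mL'))//=; apply: ltr_pwDl.
    have h1 := h0 m.+1; rewrite mulr_gt0//; apply: exprn_gt0; rewrite -addn1 cm 1?ltnW// mul1r divr_gt0// ?exprn_gt0//.
    by rewrite subr_gt0 ltr1n.
  by apply: sumr_ge0 => i _; rewrite mulr_ge0 ?sqr_ge0// ltW.
have F1 : (gegen_poly n c (m + L)).[1] ^+ 2 <= S * \sum_(i < m + L) ((p i).[1] ^+ 2 / h i).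
  have := @cauchy_schwarz R _ (index_enum 'I_(m + L)) (fun i => h i) (fun i => c i)
    (fun i => (p i).[1] / h i) (fun i => ltW (h0 i)).
  have -> : \sum_(i < m + L) h i * (c i * ((p i).[1] / h i)) = (gegen_poly n c (m + L)).[1].
    rewrite horner_sum; apply: eq_bigr => i _; rewrite hornerZ.
    by field; rewrite lt0r_neq0.
  have -> : \sum_(i < m + L) h i * c i ^+ 2 = S by apply: eq_bigr => i _; rewrite mulrC.
  have -> : \sum_(i < m + L) h i * ((p i).[1] / h i) ^+ 2 = \sum_(i < m + L) ((p i).[1] ^+ 2 / h i).
    by apply: eq_bigr => i _; field; rewrite lt0r_neq0.
  by [].
have D1 : \sum_(i < m + L) ((p i).[1] ^+ 2 / h i) <= (m + L)%:R * (6 / (x ^+ (m + L) * (1 - x) ^+ n)).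
  have -> : (m + L)%:R * (6 / (x ^+ (m + L) * (1 - x) ^+ n)) = \sum_(i < m + L) (6 / (x ^+ (m + L) * (1 - x) ^+ n)).
    by rewrite sumr_const card_ord mulr_natl.
  apply: ler_sum => i _; apply: le_trans (gegen_dim_le x01 _) _.
    by apply: leq_trans mL; exact: ltnW.
  have y0 : 0 < 1 - x by rewrite subr_gt0.
  rewrite ler_pM2l// lef_pV2 ?posrE ?mulr_gt0 ?exprn_gt0//.
  by apply: ler_wpM2r; [rewrite exprn_ge0// ltW|apply: ler_wiXn2l; [exact: ltW|exact: ltW|exact: ltnW]].
rewrite mulrAC ler_pdivlMr// -(ler_pM2r S0) -mulrA; apply: le_trans lp _.
rewrite -mulrA; apply: ler_wpM2l; first by rewrite subr_ge0; case/andP: s0.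
by apply: le_trans F1 _; rewrite mulrC ler_pM2r.
Qed.

End SphericalCode.

(* The exponential rate of the linear programming bound for codes of angle
   arccos (227/500), at which a suitable ratio degree/dimension is 23/376. *)
Definition kl_rate (R : realType) : R := 23 / 376 * ln (399 / 23) + ln (399 / 376).

Lemma spherical_code_asymptotic (R : realType) : exists2 C : R, 0 < C &
  \forall n \near \oo, forall (I : finType) (v : I -> 'I_n -> R),
  (forall i, Fischer.dotf (v i) (v i) = 1) ->
  (forall i j, i != j -> Fischer.dotf (v i) (v j) <= 227 / 500) ->
  #|I|%:R <= C * n%:R * expR (n%:R * kl_rate R).
Proof.
(* The limit of the recurrence coefficient of index m, for m / n tending to 23/376, is the
   right-hand side of the last condition, 188/211 being 1 / (1 + 2 * 23/376). Its square root barely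
   exceeds 227/1000, half the cosine. *)
have [d [bb [d0 bb0 dbb bb2]]] : exists d bb : R, [/\ 0 < d, 0 < bb, 2 * bb - 227 / 500 - d = d
    & bb ^+ 2 <= 1 / 4 - (188 / 211) ^+ 2 / 4].
  by exists (3 / (1000 * 1000)), (227 / 1000 + 3 / (1000 * 1000)); split; lra.
have [L L0 hL] : exists2 L : nat, (2 <= L)%N & (227 / 500 + d <= 2 * bb * (1 - (L%:R - 1)^-1)).
  exists (2 + Num.truncn (2 * bb / d)).+1 => //.
  have := truncnS_gt (2 * bb / d).
  set k : R := (Num.truncn (2 * bb / d)).+1%:R => hk.
  have -> : ((2 + Num.truncn (2 * bb / d)).+1%:R - 1 : R) = k + 1.
    by rewrite /k -addnS natrD; ring.
  have k0 : 0 < k by rewrite ltr0n.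
  have {}hk : 2 * bb < k * d by rewrite -ltr_pdivrMr.
  have k1 : 0 < k + 1 by lra.
  rewrite -subr_ge0.
  have -> : 2 * bb * (1 - (k + 1)^-1) - (227 / 500 + d) = (k + 1)^-1 * ((k + 1) * (2 * bb - 227 / 500 - d) - 2 * bb).
    by field; rewrite lt0r_neq0.
  apply: mulr_ge0; first by rewrite invr_ge0 ltW.
  rewrite dbb.
  clear -hk d0 k0; nra.
(* The inverse 23/399 of X is a / (1 + a) for a = 23/376; it minimizes x^-m (1 - x)^-n when m = a
   n. *)
have [X XE] : exists X : R, X = 399 / 23 by exists (399 / 23).
have X1 : 1 < X by rewrite XE; lra.
have X0 : 0 < X := lt_trans ltr01 X1.
have s01 : 0 <= (227 / 500 : R) <= 1 by lra.
have s1 : 0 < (1 - 227 / 500 : R) by lra.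
have [s sE] : exists s : R, s = 227 / 500 by exists (227 / 500).
rewrite -sE in s01 s1 hL *.
exists ((1 - s) / d * 6 * X ^+ L.+1).
  apply: mulr_gt0; last exact: exprn_gt0.
  by apply: mulr_gt0; [exact: divr_gt0|].
near=> n => I v v1 vs.
have n4 : (4 <= n)%N by near: n; exact: nbhs_infty_ge.
have [q q1 q2] : exists2 q, (376 * q <= 23 * n)%N & (23 * n <= 376 * q.+1)%N.
  exists ((23 * n) %/ 376)%N; first by rewrite mulnC leq_trunc_div.
  by rewrite (mulnC 376) ltnW// ltn_ceil.
have [m mE] : exists m, m = q.+1 by exists q.+1.
have m0 : (0 < m)%N by rewrite mE.
have mn : (m + L <= n)%N.
  have : (2 * L.+1 <= n)%N by near: n; exact: nbhs_infty_ge.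
  by rewrite mE; clear -q1; lia.
have m1 : (23 / 376 * n%:R : R) <= m%:R.
  move: q2; rewrite -mE -(ler_nat R) !natrM; clear; lra.
have m2 : (m%:R : R) <= 23 / 376 * n%:R + 1.
  by move: q1; rewrite mE -natr1 -(ler_nat R) !natrM; clear; lra.
have n4R : (4 : R) <= n%:R by rewrite ler_nat.
have bbm : bb ^+ 2 <= gegen_beta R n m.
  rewrite gegen_betaE//.
  apply: le_trans bb2 _.
  rewrite lerD2l lerN2 ler_pdivrMr; last first.
    by rewrite !mulr_gt0//; clear -n4R m1; lra.
  have h1 : 422 * (n%:R - 2) <= 376 * (2 * m%:R + n%:R - 2) :> R by clear -n4R m1; lra.
  have h2 : 422 * (n%:R - 4) <= 376 * (2 * m%:R + n%:R - 4) :> R by clear -n4R m1; lra.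
  have := @ler_pM R _ _ _ _ _ _ h1 h2.
  have e1 : 0 <= 422 * (n%:R - 2) :> R by clear -n4R; lra.
  have e2 : 0 <= 422 * (n%:R - 4) :> R by clear -n4R; lra.
  move=> /(_ e1 e2).
  have -> : 422 * (n%:R - 2) * (422 * (n%:R - 4)) = (422 ^+ 2) * ((n%:R - 2) * (n%:R - 4)) :> R by ring.
  have -> : 376 * (2 * m%:R + n%:R - 2) * (376 * (2 * m%:R + n%:R - 4)) = (376 ^+ 2) * ((2 * m%:R + n%:R - 2) * (2 * m%:R + n%:R - 4)) :> R by ring.
  have -> : 4 * (2 * m%:R + n%:R - 2) * (2 * m%:R + n%:R - 4) = 4 * ((2 * m%:R + n%:R - 2) * (2 * m%:R + n%:R - 4)) :> R by ring.
  move: ((n%:R - 2) * (n%:R - 4) : R) ((2 * m%:R + n%:R - 2) * (2 * m%:R + n%:R - 4) : R) => u w.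
  by clear; lra.
have XV : X^-1 = 23 / 399 by rewrite XE; field.
have XB : 1 - X^-1 = (399 / 376)^-1 by rewrite XE; field.
have [Y YE] : exists Y : R, Y = 399 / 376 by exists (399 / 376).
have Y0 : 0 < Y by rewrite YE; lra.
rewrite -YE in XB.
have rE : kl_rate R = 23 / 376 * ln X + ln Y by rewrite /kl_rate XE YE.
have x01 : 0 < X^-1 < 1 by rewrite invr_gt0 X0 invf_lt1.
apply: le_trans (spherical_code_le n4 m0 L0 mn bb0 bbm x01 s01 d0 hL v1 vs) _.
rewrite -!mulrA; apply: ler_wpM2l; first exact: ltW.
apply: ler_wpM2l; first by rewrite invr_ge0 ltW.
have E : ((X^-1 ^+ (m + L) * (1 - X^-1) ^+ n)^-1 : R) <= X ^+ L.+1 * expR (n%:R * kl_rate R).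
  rewrite XB invfM -!exprVn !invrK addnC exprD exprSr -!mulrA; apply: ler_wpM2l; first by rewrite exprn_ge0// ltW.
  have e1 : X ^+ m = expR (m%:R * ln X) by rewrite -powR_mulrn ?ltW// /powR gt_eqF.
  have e2 : Y ^+ n = expR (n%:R * ln Y) :> R by rewrite -powR_mulrn ?ltW// /powR gt_eqF.
  rewrite e1 e2 -expRD -[in leRHS](lnK (x := X)) ?posrE// -expRD ler_expR rE.
  have : m%:R * ln X <= (23 / 376 * n%:R + 1) * ln X.
    by apply: ler_wpM2r => //; apply: ln_ge0; exact: ltW.
  clear; lra.
have n0 : (m + L)%:R <= n%:R :> R by rewrite ler_nat.
have -> : 6 * (X ^+ L.+1 * (n%:R * expR (n%:R * kl_rate R))) =
    n%:R * (6 * (X ^+ L.+1 * expR (n%:R * kl_rate R))).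
  by rewrite (mulrCA (X ^+ L.+1)) (mulrCA 6).
apply: ler_pM => //; last first.
  by rewrite ler_pM2l.
by apply: mulr_ge0 => //; rewrite invr_ge0 XB; apply: mulr_ge0; apply: exprn_ge0; rewrite invr_ge0 ltW.
Unshelve. all: by end_near. Qed.

(** * Gaussian measure *)

Section Density.
Local Open Scope ereal_scope.
Context d (T : measurableType d) (R : realType) (mu nu : {measure set T -> \bar R}).
Variable p : T -> R.
Hypothesis mp : measurable_fun setT p.
Hypothesis p0 : forall x, (0 <= p x)%R.
Hypothesis nuE : forall A, measurable A -> nu A = \int[mu]_(x in A) (p x)%:E.

Let pe0 x : 0 <= (p x)%:E. Proof. by rewrite lee_fin. Qed.
Let mpe : measurable_fun setT (fun x => (p x)%:E). Proof. exact/measurable_EFinP. Qed.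

Import HBNNSimple.

Let integral_density_nnsfun (f : {nnsfun T >-> R}) :
  \int[nu]_x (f x)%:E = \int[mu]_x ((p x)%:E * (f x)%:E).
Proof.
under [LHS]eq_integral do rewrite fimfunE -fsumEFin//.
rewrite [LHS]ge0_integral_fsum//; last 2 first.
  - by move=> r; exact/measurable_EFinP/measurableT_comp.
  - by move=> n x _; rewrite EFinM nnfun_muleindic_ge0.
under [RHS]eq_integral.
  move=> x xD; rewrite fimfunE -fsumEFin// ge0_mule_fsumr; last first.
    by move=> r; rewrite EFinM nnfun_muleindic_ge0.
  over.
rewrite [RHS]ge0_integral_fsum//; last 2 first.
  - move=> r; apply: emeasurable_funM => //; apply/measurable_EFinP.
    by apply/measurableT_comp.
  - by move=> n x _; rewrite EFinM mule_ge0// nnfun_muleindic_ge0.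
apply: eq_fsbigr => r _.
have r0 : f @^-1` [set r] !=set0 -> (0 <= r)%R.
  by move=> [x /= <-].
have [->|/set0P/r0 {}r0] := eqVneq (f @^-1` [set r]) set0.
  rewrite indic0 /=; under eq_integral do rewrite mulr0.
  by rewrite integral0; under eq_integral do rewrite mulr0 mule0; rewrite integral0.
have mA : measurable (f @^-1` [set r]) by exact: measurable_sfunP.
transitivity (r%:E * nu (f @^-1` [set r])).
  under eq_integral do rewrite EFinM.
  rewrite ge0_integralZl//= ?integral_indic ?setIT//.
  exact/measurable_EFinP/measurable_indic.
rewrite nuE// integral_mkcond -ge0_integralZl//=; last 2 first.
- exact/(measurable_restrictT _ mA)/measurable_funTS.
- by move=> x _; rewrite patchE; case: ifP.
apply: eq_integral => x _; rewrite patchE indicE; case: ifP => _; last by rewrite mulr0 !mule0.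
by rewrite mulr1 muleC.
Qed.

Lemma integral_density (f : T -> \bar R) : measurable_fun setT f -> (forall x, 0 <= f x) ->
  \int[nu]_x f x = \int[mu]_x ((p x)%:E * f x).
Proof.
move=> mf f0; pose f_ := nnsfun_approx measurableT mf.
have f_cvg x : (f_ n x)%:E @[n --> \oo] --> f x by exact: cvg_nnsfun_approx.
have f_nd x : {homo (fun n => (f_ n x)%:E) : m n / (m <= n)%N >-> m <= n}.
  by move=> m n mn; rewrite lee_fin; exact/lefP/nd_nnsfun_approx.
have mf_ n : measurable_fun setT (fun x => (f_ n x)%:E) by exact/measurable_EFinP.
have f_0 n x : 0 <= (f_ n x)%:E by rewrite lee_fin.
transitivity (lim (\int[nu]_x (f_ n x)%:E @[n --> \oo])).
  rewrite -monotone_convergence//=.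
  by apply: eq_integral => x _; apply/esym/cvg_lim => //; exact: f_cvg.
transitivity (lim (\int[mu]_x ((p x)%:E * (f_ n x)%:E) @[n --> \oo])).
  by apply: congr_lim; apply/funext => n; exact: integral_density_nnsfun.
rewrite -monotone_convergence//=; last 3 first.
- by move=> n; exact: emeasurable_funM.
- by move=> n x _; rewrite mule_ge0.
- by move=> x _ m n mn; rewrite lee_wpmul2l// f_nd.
by apply: eq_integral => x _; apply/cvg_lim => //; apply: cvgeZl => //; exact: f_cvg.
Qed.

End Density.

Section Affine.
Context (R : realType) (a b : R).
Hypothesis a0 : a != 0.
Local Notation lam := (@lebesgue_measure R).
Local Notation RR := (measurableTypeR R).

Definition affine_map (x : RR) : RR := (a * x + b : R).

Lemma measurable_affine_map : measurable_fun setT affine_map.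
Proof. by apply: measurable_funD => //; exact: measurable_funM. Qed.

Let na : {nonneg R} := `|a|%:nng.
Let push : {measure set RR -> \bar R} :=
  measure_function_pushforward__canonical__measure_function_Measure lam measurable_affine_map.

Lemma lebesgue_measure_affine (A : set RR) : measurable A ->
  lam A = mscale na push A.
Proof.
have na0 : 0 < `|a| by rewrite normr_gt0.
apply: (@lebesgue_measure_unique R (mscale na push)) => X.
move=> /ocitvP[->|[[l r] /= lr ->]]; first by rewrite !measure0.
rewrite /mscale /= /pushforward lebesgue_measure_itv /= lte_fin lr.
have [ap|an] := ltP 0 a.
  have -> : affine_map @^-1` `]l, r] = [set` `](l - b) / a, (r - b) / a]] :> set RR.
    apply/seteqP; split=> x /=; rewrite !in_itv /= /affine_map ltr_pdivrMr// ler_pdivlMr// ltrBlDr lerBrDr (mulrC x)//.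
  rewrite lebesgue_measure_itv /= lte_fin ltr_pM2r ?invr_gt0// ltrD2r lr -!EFinD -EFinM.
  by congr EFin; rewrite gtr0_norm//; field.
have {}an : a < 0 by rewrite lt_neqAle a0.
have -> : affine_map @^-1` `]l, r] = [set` `[(r - b) / a, (l - b) / a[] :> set RR.
  by apply/seteqP; split=> x /=; rewrite !in_itv /= /affine_map ltr_ndivlMr// ler_ndivrMr// ltrBlDr lerBrDr (mulrC x) andbC.
rewrite lebesgue_measure_itv /= lte_fin ltr_nM2r ?invr_lt0// ltrD2r lr -!EFinD -EFinM.
by congr EFin; rewrite ltr0_norm//; field.
Qed.

Lemma integral_affine (f : RR -> \bar R) : measurable_fun setT f -> (forall x, (0 <= f x)%E) ->
  (\int[lam]_x f x = `|a|%:E * \int[lam]_x f (a * x + b)%R)%E.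
Proof.
move=> mf f0.
rewrite (@eq_measure_integral _ _ _ _ (mscale na push)); last first.
  by move=> A mA _; exact: lebesgue_measure_affine.
rewrite ge0_integral_mscale//; congr (_ * _)%E.
by rewrite ge0_integral_pushforward// ?preimage_setT//; exact: measurable_affine_map.
Qed.

End Affine.

(** * Rotation invariance of the Gaussian measure in the plane *)

Section GaussianRotation.
Context (R : realType).
Local Notation lam := (@lebesgue_measure R).
Local Notation RR := (measurableTypeR R).
Local Notation gam := (normal_prob (0 : R) 1).
Local Open Scope ereal_scope.

Definition gpdf (x : RR) : R := normal_pdf 0 1 x.

Lemma gpdfE x : gpdf x = ((Num.sqrt (pi *+ 2))^-1 * expR (- x ^+ 2 / 2))%R.
Proof.
rewrite /gpdf normal_pdfE ?oner_neq0// /normal_peak /normal_fun expr1n mul1r subr0.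
by rewrite mulr2n.
Qed.

Lemma gpdf_ge0 x : (0 <= gpdf x)%R. Proof. exact: normal_pdf_ge0. Qed.

Lemma measurable_gpdf : measurable_fun setT gpdf. Proof. exact: measurable_normal_pdf. Qed.

Local Opaque gpdf.

Lemma integral_gauss (f : RR -> \bar R) : measurable_fun setT f -> (forall x, 0 <= f x) ->
  \int[gam]_x f x = \int[lam]_x ((gpdf x)%:E * f x).
Proof. by apply: integral_density => //; [exact: measurable_gpdf|exact: gpdf_ge0]. Qed.


Lemma gpdf_even x : gpdf (- x)%R = gpdf x.
Proof. by rewrite !gpdfE sqrrN. Qed.

Let measurable_lin (a b : R) : measurable_fun setT (fun z : RR * RR => (a * z.1 + b * z.2)%R : RR).
Proof.
by apply: measurable_funD; apply: measurable_funM => //.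
Qed.

Lemma gauss_oppr (f : RR -> \bar R) : measurable_fun setT f -> (forall x, 0 <= f x) ->
  \int[gam]_x f (- x)%R = \int[gam]_x f x.
Proof.
move=> mf f0.
have mfN : measurable_fun setT (fun x : RR => f (- x)%R).
  by apply: (measurableT_comp mf); exact: measurable_funN.
rewrite !integral_gauss//.
have m1 : (-1 : R)%R != 0%R by rewrite oppr_eq0 oner_neq0.
rewrite [RHS](@integral_affine _ (-1)%R 0%R m1); last 2 first.
- by apply: emeasurable_funM => //; apply/measurable_EFinP; exact: measurable_gpdf.
- by move=> x; rewrite mule_ge0// lee_fin gpdf_ge0.
rewrite normrN1 mul1e; apply: eq_integral => x _.
by rewrite mulN1r addr0 gpdf_even.
Qed.

Variables (s t : R).
Hypothesis st : (s ^+ 2 + t ^+ 2 = 1)%R.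

(** The rotation is a product of two maps, each affine in one coordinate with the other fixed. Their
    factors, the absolute values of 1/s and s, cancel. *)
Lemma lebesgue_rotation (W : RR * RR -> \bar R) : s != 0%R -> measurable_fun setT W -> (forall z, 0 <= W z) ->
  \int[lam]_p \int[lam]_q W (p, q) =
  \int[lam]_p \int[lam]_q W ((s * p - t * q)%R, (t * p + s * q)%R).
Proof.
move=> s0 mW W0.
pose W1 (z : RR * RR) := W ((s^-1 * z.1 + - (t / s) * z.2)%R, z.2).
have mW1 : measurable_fun setT W1.
  apply: (measurableT_comp mW); apply/measurable_fun_pairP; split => /=; last exact: measurable_snd.
  exact: measurable_lin.
have W10 z : 0 <= W1 z by exact: W0.
have m1 p : measurable_fun setT (fun q : RR => W1 (p, q)).
  by apply: (measurableT_comp mW1); exact: pair1_measurable.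
have sV0 : s^-1%R != 0%R by rewrite invr_eq0.
transitivity (\int[lam]_q \int[lam]_p W (p, q)).
  exact: (@fubini_tonelli _ _ _ _ R lam lam W mW W0).
transitivity (\int[lam]_q (`|s^-1|%:E * \int[lam]_p W1 (p, q))).
  apply: eq_integral => q _; rewrite (@integral_affine _ s^-1 (- (t / s) * q)%R sV0)//.
  by apply: (measurableT_comp mW); exact: pair2_measurable.
rewrite ge0_integralZl//; last 2 first.
- exact: (@measurable_fun_fubini_tonelli_G _ _ _ _ R lam W1 mW1 W10).
- by move=> q _; apply: integral_ge0.
rewrite -(@fubini_tonelli _ _ _ _ R lam lam W1 mW1 W10) /fubini_F.
rewrite -ge0_integralZl//; last 2 first.
- exact: (@measurable_fun_fubini_tonelli_F _ _ _ _ R lam W1 mW1 W10).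
- by move=> q _; apply: integral_ge0.
apply: eq_integral => p _.
rewrite (@integral_affine _ s (t * p)%R s0 (fun q => W1 (p, q)))// muleA -EFinM -normrM mulVf// normr1 mul1e.
apply: eq_integral => q _; rewrite /W1 /=; congr (W (_, _)); last by rewrite addrC.
have -> : (s * p = s^-1 * p * s ^+ 2)%R by field.
have -> : (s ^+ 2 = 1 - t ^+ 2)%R by rewrite -st addrK.
by field.
Qed.

Variable F : RR * RR -> \bar R.
Hypothesis mF : measurable_fun setT F.
Hypothesis F0 : forall x, 0 <= F x.

Let sqs (z : RR * RR) : RR := (z.1 ^+ 2 + z.2 ^+ 2)%R.
Let msqs : measurable_fun setT sqs.
Proof.
by apply: measurable_funD; apply: measurable_funX.
Qed.

Let rot (a b : R) (z : RR * RR) : RR * RR := ((a * z.1 + b * z.2)%R, sqs z).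

Let measurable_rot a b : measurable_fun setT (F \o rot a b).
Proof.
apply: measurableT_comp => //; apply/measurable_fun_pairP; split => /=; first exact: measurable_lin.
exact: msqs.
Qed.

Let wt a b (z : RR * RR) : \bar R := (gpdf z.1 * gpdf z.2)%:E * F (rot a b z).

Let gE a b : \int[gam]_p \int[gam]_q F (rot a b (p, q)) = \int[lam]_p \int[lam]_q wt a b (p, q).
Proof.
have m1 p : measurable_fun setT (fun q : RR => F (rot a b (p, q))).
  by apply: (measurableT_comp (measurable_rot a b)); exact: pair1_measurable.
have m2 : measurable_fun setT (fun z : RR * RR => (gpdf z.2)%:E * F (rot a b z)).
  apply: emeasurable_funM; last exact: measurable_rot.
  apply/measurable_EFinP; apply: (measurableT_comp measurable_gpdf); exact: measurable_snd.
have g0 p : 0 <= (gpdf p)%:E by rewrite lee_fin gpdf_ge0.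
transitivity (\int[gam]_p \int[lam]_q ((gpdf q)%:E * F (rot a b (p, q)))).
  by apply: eq_integral => p _; rewrite integral_gauss.
rewrite integral_gauss.
- apply: eq_integral => p _; rewrite -ge0_integralZl//.
  + by apply: eq_integral => q _; rewrite muleA.
  + exact: (measurableT_comp m2 (pair1_measurable p)).
  + by move=> q _; rewrite mule_ge0.
- by apply: (@measurable_fun_fubini_tonelli_F _ _ _ _ R lam (fun z => (gpdf z.2)%:E * F (rot a b z))) => // z; rewrite mule_ge0.
- by move=> p; apply: integral_ge0 => q _; rewrite mule_ge0.
Qed.

Let mwt a b : measurable_fun setT (wt a b).
Proof.
apply: emeasurable_funM; last exact: measurable_rot.
apply/measurable_EFinP; apply: measurable_funM; apply: (measurableT_comp measurable_gpdf).
  exact: measurable_fst.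
exact: measurable_snd.
Qed.

Let wt0 a b z : 0 <= wt a b z.
Proof. by rewrite mule_ge0// lee_fin mulr_ge0// gpdf_ge0. Qed.

(** For s = 0 the factorization fails; then t is 1 or -1, and symmetry of the Gaussian together with
    Tonelli's theorem is enough. *)
Lemma gauss_rotation :
  \int[gam]_p \int[gam]_q F ((s * p + t * q)%R, (p ^+ 2 + q ^+ 2)%R) =
  \int[gam]_p \int[gam]_q F (p, (p ^+ 2 + q ^+ 2)%R).
Proof.
have -> : \int[gam]_p \int[gam]_q F (p, (p ^+ 2 + q ^+ 2)%R) = \int[gam]_p \int[gam]_q F (rot 1 0 (p, q)).
  by apply: eq_integral => p _; apply: eq_integral => q _; rewrite /rot /= mul1r mul0r addr0.
have -> : \int[gam]_p \int[gam]_q F ((s * p + t * q)%R, (p ^+ 2 + q ^+ 2)%R) =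
  \int[gam]_p \int[gam]_q F (rot s t (p, q)) by [].
have [s0|s0] := eqVneq s 0%R; last first.
  rewrite (gE s t) (gE 1 0) (lebesgue_rotation s0 (mwt s t) (wt0 s t)); apply: eq_integral => p _; apply: eq_integral => q _.
  rewrite /wt /rot /sqs /=; congr (_%:E * F (_, _)).
  - rewrite !gpdfE mulrACA -expRD [RHS]mulrACA -expRD; congr (_ * expR _)%R.
    have -> : (- p ^+ 2 / 2 + - q ^+ 2 / 2 = - (p ^+ 2 + q ^+ 2) * (s ^+ 2 + t ^+ 2) / 2)%R.
      by rewrite st mulr1; field.
    by field.
  - have -> : (s * (s * p - t * q) + t * (t * p + s * q) = p * (s ^+ 2 + t ^+ 2))%R by ring.
    by rewrite st; ring.
  - have -> : ((s * p - t * q) ^+ 2 + (t * p + s * q) ^+ 2 = (p ^+ 2 + q ^+ 2) * (s ^+ 2 + t ^+ 2))%R by ring.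
    by rewrite st mulr1.
have t2 : (t ^+ 2 = 1)%R by rewrite -st s0 expr0n/= add0r.
have m1 p : measurable_fun setT (fun q : RR => F (rot 0 1 (p, q))).
  by apply: (measurableT_comp (measurable_rot 0 1)); exact: pair1_measurable.
transitivity (\int[gam]_p \int[gam]_q F (rot 0 1 (p, q))).
  apply: eq_integral => p _.
  have : ((t - 1) * (t + 1) = 0 :> R)%R by rewrite -subr_sqr expr1n t2 subrr.
  move/eqP; rewrite mulf_eq0 subr_eq0 addr_eq0 s0 => /orP[|] /eqP -> //.
  rewrite -[RHS]gauss_oppr//; apply: eq_integral => q _.
  by rewrite /rot /sqs /= sqrrN !mul0r !add0r mulN1r mul1r.
rewrite (@fubini_tonelli _ _ _ _ R gam gam (F \o rot 0 1) (measurable_rot 0 1) (fun=> F0 _)).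
apply: eq_integral => p _; apply: eq_integral => q _; rewrite /rot /sqs /=.
by rewrite addrC [X in F (_, X)]addrC.
Qed.

End GaussianRotation.

(** * A Gaussian vector seen from a unit direction *)

Section ChiSquare.
Context (R : realType).
Local Notation RR := (measurableTypeR R).
Local Notation gam := (normal_prob (0 : R) 1).
Local Open Scope ereal_scope.

Definition sqr_add (z : RR * RR) : RR := (z.1 ^+ 2 + z.2)%R.

Lemma measurable_sqr_add : measurable_fun setT sqr_add.
Proof. by apply: measurable_funD => //; apply: measurable_funX. Qed.

HB.instance Definition _ := isMeasurableFun.Build _ _ _ _ _ measurable_sqr_add.

(* The law of the squared norm of a standard Gaussian vector. *)
Fixpoint chi2 (n : nat) : probability RR R :=
  if n is n'.+1 then distribution ((gam \x chi2 n') : probability (RR * RR)%type R) sqr_add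
  else \d_(0%R : RR).

Lemma integral_chi20 (f : RR -> \bar R) : measurable_fun setT f -> \int[chi2 0]_w f w = f 0%R.
Proof. by move=> mf; rewrite /= integral_dirac// diracT mul1e. Qed.

Lemma integral_chi2S n (f : RR -> \bar R) : measurable_fun setT f -> (forall x, 0 <= f x) ->
  \int[chi2 n.+1]_w f w = \int[gam]_z \int[chi2 n]_w f (z ^+ 2 + w)%R.
Proof.
move=> mf f0; rewrite [LHS]ge0_integral_distribution//.
rewrite (@fubini_tonelli1 _ _ _ _ R gam (chi2 n))//.
  exact: measurableT_comp measurable_sqr_add.
by move=> x; exact: f0.
Qed.

Lemma measurable_comp_pair dsp (T : measurableType dsp) (F : RR * RR -> \bar R) (f g : T -> RR) :
  measurable_fun setT F -> measurable_fun setT f -> measurable_fun setT g ->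
  measurable_fun setT (fun x => F (f x, g x)).
Proof. by move=> mF mf mg; exact: (measurableT_comp mF (measurable_fun_pair mf mg)). Qed.

(** For every unit x, the pair made of x . u and the squared norm of u is distributed as (p, p^2 +
    w), with p Gaussian and w an independent chi-square variable. One coordinate is added at a time,
    and the plane rotation realigns the direction x. *)
Lemma gaussian_vector_exists n : exists dsp (T : measurableType dsp) (P : probability T R)
    (u : T -> 'rV[R]_n.+1), (forall i, measurable_fun setT (fun w => u w 0%R i : RR)) /\
  forall x, dot x x = 1%R -> forall F : RR * RR -> \bar R, measurable_fun setT F ->
  (forall z, 0 <= F z) ->
  \int[P]_w F (dot x (u w), dot (u w) (u w)) = \int[gam]_p \int[chi2 n]_w F (p, (p ^+ 2 + w)%R).
Proof.
elim: n => [|n [dsp [T [P [u [mu uE]]]]]].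
  exists _, RR, (gam : probability RR R), (fun z : RR => const_mx (z : R) : 'rV[R]_1); split.
    by move=> i; apply: (eq_measurable_fun id) => // z _; rewrite mxE.
  move=> x x1 F mF F0.
  have x2 : ((x 0%R 0%R) ^+ 2 = 1 :> R)%R by move: x1; rewrite /dot big_ord_recl big_ord0 addr0.
  have mF1 : measurable_fun setT (fun z : RR => F (z, (z ^+ 2)%R)).
    by apply: (measurable_comp_pair (f := id) (g := fun z => (z ^+ 2)%R)) => //; exact: measurable_funX.
  transitivity (\int[gam]_z F (z, z ^+ 2)%R).
    under eq_integral do rewrite /dot !big_ord_recl !big_ord0 !mxE !addr0 -expr2.
    have : ((x 0%R 0%R - 1) * (x 0%R 0%R + 1) = 0 :> R)%R by rewrite -subr_sqr expr1n x2 subrr.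
    move/eqP; rewrite mulf_eq0 subr_eq0 addr_eq0 => /orP[|] /eqP ->.
      by under eq_integral do rewrite mul1r.
    rewrite -[RHS]gauss_oppr//.
    by under eq_integral do rewrite mulN1r; under [RHS]eq_integral do rewrite sqrrN.
  apply: eq_integral => z _; rewrite integral_chi20 ?addr0//.
  by apply: (measurable_comp_pair (f := fun=> z) (g := fun w => (z ^+ 2 + w)%R)) => //; exact: measurable_funD.
pose u' (w : T * RR) : 'rV[R]_n.+2 := \row_i (if unlift ord0 i is Some j then u w.1 0%R j else w.2).
exists _, (T * RR)%type, ((P \x gam) : probability _ R), u'; split.
  move=> i; rewrite /u'; case: (unliftP ord0 i) => [j ->|->].
    apply: (eq_measurable_fun (fun w : T * RR => u w.1 0%R j : RR)) => [w _|]; first by rewrite mxE liftK.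
    exact: (measurableT_comp (mu j)).
  by apply: (eq_measurable_fun (fun w : T * RR => w.2)) => [w _|]; [rewrite mxE unlift_none|exact: measurable_snd].
move=> x x1 F mF F0.
pose t : R := x 0%R ord0; pose x' : 'rV[R]_n.+1 := \row_j x 0%R (lift ord0 j).
have dE (w : T * RR) : dot x (u' w) = (t * w.2 + dot x' (u w.1))%R.
  rewrite /dot big_ord_recl !mxE unlift_none; congr (_ + _)%R.
  by apply: eq_bigr => j _; rewrite !mxE liftK.
have sE (w : T * RR) : dot (u' w) (u' w) = (w.2 ^+ 2 + dot (u w.1) (u w.1))%R.
  rewrite /dot big_ord_recl !mxE unlift_none -expr2; congr (_ + _)%R.
  by apply: eq_bigr => j _; rewrite !mxE liftK.
have xE : (dot x' x' + t ^+ 2 = 1)%R.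
  rewrite -x1 [in RHS]/dot big_ord_recl -expr2 addrC; congr (_ + _)%R.
  by apply: eq_bigr => j _; rewrite !mxE.
(* The old coordinates of x are s times a unit vector y; when they all vanish, y is arbitrary and s
   = 0. *)
have [s [y [y1 xs st]]] : exists s y, [/\ dot y y = 1%R, x' = (s *: y)%R & (s ^+ 2 + t ^+ 2 = 1 :> R)%R].
  have [x0|x0] := eqVneq (dot x' x') 0%R.
    exists 0%R, (delta_mx 0%R 0%R); split.
    - rewrite /dot (bigD1 ord0)//= !mxE !eqxx mulr1 big1 ?addr0// => i /negbTE i0.
      by rewrite !mxE i0 andbF mul0r.
    - by rewrite scale0r; exact: dot_eq0.
    - by rewrite expr0n/= add0r -xE x0 add0r.
  have x0' : (0 < dot x' x')%R by rewrite lt_def x0 dot_ge0.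
  exists (Num.sqrt (dot x' x')), ((Num.sqrt (dot x' x'))^-1 *: x')%R; split.
  - rewrite dotZl dotZr mulrA -expr2 exprVn sqr_sqrtr ?mulVf//; exact: dot_ge0.
  - by rewrite scalerA divff ?scale1r// gt_eqF// sqrtr_gt0.
  - by rewrite sqr_sqrtr ?dot_ge0.
have mF3 : measurable_fun setT (fun z : RR * RR * RR => F ((s * z.1.1 + t * z.2)%R, (z.2 ^+ 2 + z.1.2)%R)).
  apply: (measurable_comp_pair (f := fun z : RR * RR * RR => (s * z.1.1 + t * z.2)%R)
    (g := fun z : RR * RR * RR => (z.2 ^+ 2 + z.1.2)%R)) => //.
    apply: measurable_funD; apply: measurable_funM => //.
    exact: (measurableT_comp measurable_fst).
  apply: measurable_funD; first exact: measurable_funX.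
  exact: (measurableT_comp measurable_snd).
pose F' (a : RR * RR) := \int[gam]_z F ((s * a.1 + t * z)%R, (z ^+ 2 + a.2)%R).
have mF' : measurable_fun setT F'.
  exact: (@measurable_fun_fubini_tonelli_F _ _ _ _ R gam _ mF3 (fun=> F0 _)).
have mF4 : measurable_fun setT (fun z : RR * RR * RR => F (z.1.1, (z.1.2 + z.2)%R)).
  apply: (measurable_comp_pair (f := fun z : RR * RR * RR => z.1.1)
    (g := fun z : RR * RR * RR => (z.1.2 + z.2)%R)) => //.
    exact: (measurableT_comp measurable_fst).
  by apply: measurable_funD => //; exact: (measurableT_comp measurable_snd).
pose H (a : RR * RR) := \int[chi2 n]_w F (a.1, (a.2 + w)%R).
have mH : measurable_fun setT H.
  exact: (@measurable_fun_fubini_tonelli_F _ _ _ _ R (chi2 n) _ mF4 (fun=> F0 _)).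
have H0 z : 0 <= H z by apply: integral_ge0.
have mdot (v : 'rV[R]_n.+1) : measurable_fun setT (fun w : T => dot v (u w) : RR).
  by apply: measurable_sum => i; apply: measurable_funM => //; exact: mu.
have msq : measurable_fun setT (fun w : T => dot (u w) (u w) : RR).
  by apply: measurable_sum => i; apply: measurable_funM; exact: mu.
transitivity (\int[P]_w F' (dot y (u w), dot (u w) (u w))).
  transitivity (\int[P \x gam]_w F ((s * dot y (u w.1) + t * w.2)%R, (w.2 ^+ 2 + dot (u w.1) (u w.1))%R)).
    by apply: eq_integral => w _; rewrite dE sE xs dotZl addrC.
  rewrite (@fubini_tonelli1 _ _ _ _ R P gam)//.
  apply: (measurable_comp_pair (f := fun w : T * RR => (s * dot y (u w.1) + t * w.2)%R)
    (g := fun w : T * RR => (w.2 ^+ 2 + dot (u w.1) (u w.1))%R)) => //.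
    apply: measurable_funD; apply: measurable_funM => //.
    exact: (measurableT_comp (mdot y)).
  apply: measurable_funD; first exact: measurable_funX.
  exact: (measurableT_comp msq).
rewrite uE//; last by move=> z; apply: integral_ge0.
transitivity (\int[gam]_p \int[gam]_q H ((s * p + t * q)%R, (p ^+ 2 + q ^+ 2)%R)).
  apply: eq_integral => p _; rewrite /F' /H /=.
  pose G (z : RR * RR) := F ((s * p + t * z.2)%R, (z.2 ^+ 2 + (p ^+ 2 + z.1))%R).
  have mG : measurable_fun setT G.
    apply: (measurable_comp_pair (f := fun z : RR * RR => (s * p + t * z.2)%R)
      (g := fun z : RR * RR => (z.2 ^+ 2 + (p ^+ 2 + z.1))%R)) => //.
      by apply: measurable_funD => //; apply: measurable_funM.
    by apply: measurable_funD; [exact: measurable_funX|exact: measurable_funD].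
  transitivity (\int[gam]_q \int[chi2 n]_w G (w, q)).
    exact: (@fubini_tonelli _ _ _ _ R (chi2 n) gam G mG (fun=> F0 _)).
  apply: eq_integral => q _; apply: eq_integral => w _ /=.
  by rewrite /G /= [X in F (_, X)]addrCA addrA.
transitivity (\int[gam]_p \int[gam]_q H (p, p ^+ 2 + q ^+ 2)%R); first exact: gauss_rotation.
apply: eq_integral => p _; rewrite (@integral_chi2S n (fun w => F (p, (p ^+ 2 + w)%R))); last by move=> w; exact: F0.
  by apply: eq_integral => q _; rewrite /H; apply: eq_integral => w _ /=; rewrite addrA.
by apply: (measurable_comp_pair (f := fun=> p) (g := fun w => (p ^+ 2 + w)%R)) => //; exact: measurable_funD.
Qed.

End ChiSquare.

(** * Laplace transforms and inverse moments of the chi-square law *)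

Section ChiSquareMoments.
Context (R : realType).
Local Notation lam := (@lebesgue_measure R).
Local Notation RR := (measurableTypeR R).
Local Notation gam := (normal_prob (0 : R) 1).

Lemma measurable_expRM (a b : R) : measurable_fun setT (fun w : RR => expR (a * w / b) : RR).
Proof. by apply: measurableT_comp => //; apply: measurable_funM => //; exact: measurable_funM. Qed.

Lemma gauss_mgf (s : R) : 0 <= s ->
  (\int[gam]_z (expR (- s * z ^+ 2 / 2))%:E = (powR (1 + s) (- (1 / 2)))%:E)%E.
Proof.
move=> s0; pose a := Num.sqrt (1 + s).
have s1 : 0 < 1 + s by lra.
have a0 : 0 < a by rewrite sqrtr_gt0.
have a2 : a ^+ 2 = 1 + s by rewrite sqr_sqrtr// ltW.
have mf : measurable_fun setT (fun z : RR => (expR (- s * z ^+ 2 / 2))%:E).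
  apply/measurable_EFinP; apply: measurableT_comp => //; apply: measurable_funM => //.
  by apply: measurable_funM => //; exact: measurable_funX.
have mg : measurable_fun setT (fun z : RR => (gpdf z)%:E).
  by apply/measurable_EFinP; exact: measurable_gpdf.
rewrite integral_gauss; [|exact: mf|by move=> x; rewrite lee_fin expR_ge0].
transitivity (\int[lam]_x (gpdf (a * x + 0))%:E)%E.
  apply: eq_integral => x _; rewrite -EFinM !gpdfE addr0 exprMn a2 -[X in X%:E = _]mulrA -expRD.
  by congr (_ * expR _)%:E; field.
have := @integral_normal_pdf R 0 1; rewrite -/(@gpdf R).
rewrite (@integral_affine _ a 0 (lt0r_neq0 a0) (fun x => (gpdf x)%:E))//; last first.
  by move=> x; rewrite lee_fin gpdf_ge0.
move=> h; have -> : powR (1 + s) (- (1 / 2)) = a^-1.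
  by rewrite powRN mul1r powR12_sqrt// ltW.
have : ((a^-1)%:E * (`|a|%:E * \int[lam]_x (gpdf (a * x + 0))%:E) = (a^-1)%:E)%E.
  by rewrite h mule1.
by rewrite muleA -EFinM gtr0_norm// mulVf ?mul1e// gt_eqF.
Qed.

Lemma chi2_mgf n (s : R) : 0 <= s ->
  (\int[chi2 R n]_w (expR (- s * w / 2))%:E = (powR (1 + s) (- (n%:R / 2)))%:E)%E.
Proof.
move=> s0; have s1 : 0 < 1 + s by lra.
have mf : measurable_fun setT (fun z : RR => (expR (- s * z / 2))%:E).
  by apply/measurable_EFinP; exact: measurable_expRM.
elim: n => [|n IH].
  rewrite integral_chi20; last exact: mf.
  by rewrite mulr0 !mul0r oppr0 powRr0 expR0.
rewrite integral_chi2S; [|exact: mf|by move=> x; rewrite lee_fin expR_ge0].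
transitivity (\int[gam]_z ((powR (1 + s) (- (n%:R / 2)))%:E * (expR (- s * z ^+ 2 / 2))%:E))%E.
  apply: eq_integral => z _; rewrite -IH -ge0_integralZr; [|exact: measurableT|exact: mf|by move=> w _; rewrite lee_fin expR_ge0|by rewrite lee_fin expR_ge0].
  apply: eq_integral => w _; rewrite -EFinM -expRD; congr (expR _)%:E.
  by rewrite mulrDr mulrDl addrC.
have mf2 : measurable_fun setT (fun z : RR => (expR (- s * z ^+ 2 / 2))%:E).
  apply/measurable_EFinP; apply: measurableT_comp => //; apply: measurable_funM => //.
  by apply: measurable_funM => //; exact: measurable_funX.
rewrite ge0_integralZl; [|exact: measurableT|exact: mf2|by move=> w _; rewrite lee_fin expR_ge0|by rewrite lee_fin powR_ge0].
rewrite gauss_mgf// -EFinM -powRD; last by rewrite (gt_eqF s1) implybT.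
by congr (powR _ _)%:E; rewrite -natr1; field.
Qed.

Lemma integral_powR (A p : R) : 0 < A -> 1 < p ->
  (\int[lam]_(v in `[0%R, +oo[) (powR (A + v) (- p))%:E = (powR A (1 - p) / (p - 1))%:E)%E.
Proof.
move=> A0 p1.
have pos v : 0 <= v -> 0 < A + v by move=> v0; lra.
have p10 : p - 1 != 0 by rewrite gt_eqF// subr_gt0.
have df (q v : R) : 0 <= v -> is_derive v 1 (fun x => powR (x + A) q) (q * powR (v + A) (q - 1)).
  move=> v0; have vA : 0 < v + A by rewrite addrC pos.
  have := @is_derive1_comp R (fun y => powR y q) (shift A) v _ _ (is_derive1_powR q vA) (is_derive_shift v 1 A).
  by rewrite mulr1.
pose F (v : R) := - ((p - 1)^-1 * powR (v + A) (1 - p)).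
have dF (v : R) : 0 <= v -> is_derive v 1 F (powR (v + A) (- p)).
  move=> v0; have h := df (1 - p) v v0.
  have := @is_deriveN _ _ _ _ _ _ _ (@is_deriveZ _ _ _ _ (p - 1)^-1 _ _ _ h).
  have -> : - ((p - 1)^-1 *: ((1 - p) * powR (v + A) (1 - p - 1))) = powR (v + A) (- p).
    by rewrite (_ : 1 - p - 1 = - p); [rewrite /GRing.scale /=; field|ring].
  by [].
have cf q : {within `[0, +oo[, continuous (fun x => powR (x + A) q)}.
  apply: continuous_in_subspaceT => x; rewrite inE /= in_itv/= andbT => x0.
  by apply/differentiable_continuous/derivable1_diffP; case: (df q x x0).
under eq_integral do rewrite addrC.
rewrite (@ge0_continuous_FTC2y _ _ F _ 0).
- by rewrite /F -EFinB sub0r opprK add0r mulrC.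
- by move=> x _; exact: powR_ge0.
- exact: cf.
- rewrite -oppr0; apply: cvgN; rewrite -[X in _ --> X](mulr0 (p - 1)^-1); apply: cvgM; first exact: cvg_cst.
  apply/cvgr0Pnorm_lt => e e0; near=> x.
  rewrite ger0_norm ?powR_ge0//.
  have e1 : 0 < powR e (- (p - 1)^-1) by apply: powR_gt0.
  have x1 : powR e (- (p - 1)^-1) < x + A.
    have : powR e (- (p - 1)^-1) < x by near: x; apply: nbhs_pinfty_gt; rewrite num_real.
    lra.
  have q0 : 0 < p - 1 by lra.
  have -> : 1 - p = - (p - 1) by ring.
  rewrite powRN.
  have -> : e = (powR (powR e (- (p - 1)^-1)) (p - 1))^-1.
    by rewrite -powRrM mulNr mulVf// powRN powRr1 ?invrK// ltW.
  rewrite ltf_pV2 ?posrE ?powR_gt0//; last exact: lt_trans x1.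
  by rewrite gt0_ltr_powR// nnegrE ltW// (lt_trans e1).
- by move=> x x0; case: (dF x (ltW x0)).
- apply: cvg_at_right_filter; apply/differentiable_continuous/derivable1_diffP.
  by case: (dF 0 (lexx 0)).
move=> x; rewrite in_itv/= andbT => x0.
by rewrite derive1E; case: (dF x (ltW x0)).
Unshelve. all: by end_near. Qed.

(** The function 2 / w, infinite for w <= 0, written as an integral of exponentials so that its
    expectation reduces to the Laplace transform. *)
Definition exp_int (w : R) : \bar R := (\int[lam]_(v in `[0%R, +oo[) (expR (- v * w / 2))%:E)%E.

Lemma exp_intE w : 0 < w -> exp_int w = (2 / w)%:E.
Proof.
move=> w0; have w2 : 0 < w / 2 by lra.
have := integral_exponential_pdf w2.
have mE : measurable_fun setT (fun v : RR => (expR (- v * w / 2))%:E).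
  apply/measurable_EFinP; apply: measurableT_comp => //; apply: measurable_funM => //.
  by apply: measurable_funM => //; exact: measurable_funN.
have -> : (\int[lam]_x (exponential_pdf (w / 2) x)%:E)%E = (\int[lam]_(v in `[0%R, +oo[) ((w / 2)%:E * (expR (- v * w / 2))%:E))%E.
  rewrite [RHS]integral_mkcond; apply: eq_integral => v _.
  rewrite /exponential_pdf !patchE; case: ifP => // _; rewrite -EFinM; congr (_ * expR _)%:E.
  by ring.
rewrite ge0_integralZl; [|exact: measurable_itv|exact: measurable_funTS|by move=> v _; rewrite lee_fin expR_ge0|by rewrite lee_fin ltW].
rewrite -/(exp_int w) => h.
have : ((2 / w)%:E * ((w / 2)%:E * exp_int w) = (2 / w)%:E)%E by rewrite h mule1.
rewrite muleA -EFinM.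
have -> : 2 / w * (w / 2) = 1 by field; rewrite gt_eqF.
by rewrite mul1e.
Qed.

Lemma exp_int_le0 w : w <= 0 -> exp_int w = +oo%E.
Proof.
move=> w0; apply/eqP; rewrite -leye_eq.
apply: (@le_trans _ _ (\int[lam]_(v in `[0%R, +oo[) (1 : R)%:E)%E).
  by rewrite integral_cst//= lebesgue_measure_itv/= mul1e ltry.
apply: ge0_le_integral => //.
- apply: measurable_funTS; apply/measurable_EFinP.
  apply: measurableT_comp => //; apply: measurable_funM => //.
  by apply: measurable_funM => //; exact: measurable_funN.
move=> v /=; rewrite in_itv/= andbT => v0; rewrite lee_fin -[leLHS]expR0 ler_expR.
nra.
Qed.

(** Tonelli's theorem turns the left-hand side into the integral over v >= 0 of (1 + s + v)^(- n/2),
    convergent since n > 2. *)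
Lemma chi2_exp_int n (s : R) : 0 <= s -> (2 < n)%N ->
  (\int[chi2 R n]_w ((expR (- s * w / 2))%:E * exp_int w) =
   (powR (1 + s) (1 - n%:R / 2) / (n%:R / 2 - 1))%:E)%E.
Proof.
move=> s0 n2; pose D : set RR := `[0%R, +oo[%classic.
have mD : measurable D by exact: measurable_itv.
have s1 : 0 < 1 + s by lra.
have n2' : 1 < n%:R / 2 :> R by rewrite ltr_pdivlMr// mul1r ltr_nat.
pose E (z : RR * RR) : \bar R := (expR (- (s + z.2) * z.1 / 2))%:E.
have mE : measurable_fun setT E.
  apply/measurable_EFinP; apply: measurableT_comp => //; apply: measurable_funM => //.
  by apply: measurable_funM => //; apply: measurable_funN; exact: measurable_funD.
have E0 z : (0 <= E z)%E by rewrite lee_fin expR_ge0.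
pose F (z : RR * RR) : \bar R := (E z * (\1_D z.2)%:E)%E.
have mF : measurable_fun setT F.
  apply: emeasurable_funM => //; apply/measurable_EFinP.
  by apply: (measurableT_comp (measurable_indic mD)); exact: measurable_snd.
have F0 z : (0 <= F z)%E by rewrite mule_ge0.
transitivity (\int[chi2 R n]_w \int[lam]_v F (w, v))%E.
  apply: eq_integral => w _; have mw : measurable_fun setT (fun v : RR => (expR (- v * w / 2))%:E).
    apply/measurable_EFinP; apply: measurableT_comp => //; apply: measurable_funM => //.
    by apply: measurable_funM => //; exact: measurable_funN.
  rewrite /exp_int -ge0_integralZl; [|exact: mD|exact: measurable_funTS|by move=> v _; rewrite lee_fin expR_ge0|by rewrite lee_fin expR_ge0].
  rewrite integral_mkcond epatch_indic; apply: eq_integral => v _ /=.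
  rewrite /F; congr (_ * _)%E; rewrite /E -EFinM -expRD; congr (expR _)%:E => /=.
  by ring.
transitivity (\int[lam]_v \int[chi2 R n]_w F (w, v))%E.
  exact: (@fubini_tonelli _ _ _ _ R (chi2 R n) lam F mF F0).
rewrite -(integral_powR s1 n2') [RHS]integral_mkcond epatch_indic; apply: eq_integral => v _ /=.
rewrite indicE; case: (boolP (v \in D)) => [vD|vD]; last first.
  by rewrite mule0 integral0_eq// => w _; rewrite /F indicE /= (negbTE vD) mule0.
have v0 : 0 <= s + v by move: vD; rewrite inE /D /= in_itv/= andbT => v0; rewrite addr_ge0.
rewrite mule1 -addrA -chi2_mgf//; apply: eq_integral => w _.
by rewrite /F indicE /= vD mule1.
Qed.

Lemma measurable_exp_int : measurable_fun setT (exp_int : RR -> \bar R).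
Proof.
pose D : set RR := `[0%R, +oo[%classic.
pose F (z : RR * RR) : \bar R := ((expR (- z.2 * z.1 / 2))%:E * (\1_D z.2)%:E)%E.
have mF : measurable_fun setT F.
  apply: emeasurable_funM; apply/measurable_EFinP.
    apply: measurableT_comp => //; apply: measurable_funM => //.
    by apply: measurable_funM => //; exact: measurable_funN.
  by apply: (measurableT_comp (measurable_indic (measurable_itv _ : measurable D))); exact: measurable_snd.
have F0 z : (0 <= F z)%E by rewrite mule_ge0// lee_fin expR_ge0.
apply: (eq_measurable_fun (fubini_F lam F)) => [w _|].
  by rewrite /exp_int [RHS]integral_mkcond epatch_indic.
exact: (@measurable_fun_fubini_tonelli_F _ _ _ _ R lam F mF F0).
Qed.

End ChiSquareMoments.

(** * Spherical caps *)

Section GaussianTail.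
Context (R : realType).
Local Notation lam := (@lebesgue_measure R).
Local Notation RR := (measurableTypeR R).
Local Notation gam := (normal_prob (0 : R) 1).
Let g0 : R := (Num.sqrt (pi *+ 2))^-1.

(** Mills' bound, density over y. After translation by y, the factor exp (- x^2 / 2) is dropped;
    writing 1 / y as [exp_int (2 * y)] covers y = 0, where the bound is infinite. *)
Lemma gauss_tail_le (y : R) : 0 <= y ->
  (gam (`[y, +oo[%classic : set RR) <= (gpdf y)%:E * exp_int (2 * y))%E.
Proof.
move=> y0; pose D : set RR := `[0%R, +oo[%classic.
have mD : measurable D by exact: measurable_itv.
have mDy : measurable (`[y, +oo[%classic : set RR) by exact: measurable_itv.
have mg : measurable_fun setT (fun z : RR => (gpdf z)%:E).
  by apply/measurable_EFinP; exact: measurable_gpdf.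
have me : measurable_fun setT (fun v : RR => (expR (- v * (2 * y) / 2))%:E).
  apply/measurable_EFinP; apply: measurableT_comp => //; apply: measurable_funM => //.
  by apply: measurable_funM => //; exact: measurable_funN.
rewrite /normal_prob -/(@gpdf R) integral_mkcond epatch_indic.
pose f (x : RR) : \bar R := ((gpdf x)%:E * (\1_(`[y, +oo[%classic : set RR) x)%:E)%E.
have mf : measurable_fun setT f.
  by apply: emeasurable_funM => //; apply/measurable_EFinP; exact: measurable_indic.
have f0 x : (0 <= f x)%E by rewrite mule_ge0// lee_fin gpdf_ge0.
rewrite -[leLHS]/(\int[lam]_x f x)%E (@integral_affine _ 1 y (oner_neq0 _) f)// normr1 mul1e.
rewrite /exp_int -ge0_integralZl; [|exact: mD|exact: measurable_funTS|by move=> v _; rewrite lee_fin expR_ge0|by rewrite lee_fin gpdf_ge0].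
rewrite [leRHS]integral_mkcond epatch_indic; apply: ge0_le_integral => //.
- by apply: (measurableT_comp mf); apply: measurable_funD.
- by apply: emeasurable_funM; [exact: emeasurable_funM|apply/measurable_EFinP; exact: measurable_indic].
move=> x _ /=; rewrite /f mul1r !indicE.
have -> : (x + y \in (`[y, +oo[%classic : set RR)) = (x \in D).
  by apply/idP/idP; rewrite !inE /D /= !in_itv/= !andbT lerDr.
case: (boolP (x \in D)) => xD; last by rewrite !mule0.
rewrite !mule1 -EFinM lee_fin !gpdfE -[X in _ <= X]mulrA -expRD; apply: ler_wpM2l; first by rewrite invr_ge0.
by rewrite ler_expR -subr_ge0 (_ : _ - _ = x ^+ 2 / 2) ?divr_ge0 ?sqr_ge0//; field.
Qed.

Lemma gauss_tail_ge (y : R) : 0 <= y -> ((gpdf (y + 1))%:E <= gam (`]y, +oo[%classic : set RR))%E.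
Proof.
move=> y0; pose D : set RR := `]y, y + 1]%classic.
have mD : measurable D by exact: measurable_itv.
have mg : measurable_fun setT (fun z : RR => (gpdf z)%:E).
  by apply/measurable_EFinP; exact: measurable_gpdf.
apply: (@le_trans _ _ (gam D)); last first.
  apply: le_measure; [by rewrite inE|by rewrite inE; exact: measurable_itv|].
  by move=> x; rewrite /D /= !in_itv/= andbT => /andP[].
apply: (@le_trans _ _ (\int[lam]_(x in D) (gpdf (y + 1))%:E)%E).
  by rewrite integral_cst//= lebesgue_measure_itv/= lte_fin ltrDl ltr01 -EFinD (addrC y) addrK mule1.
apply: ge0_le_integral => //; first by move=> x _; rewrite lee_fin gpdf_ge0.
  exact: measurable_funTS.
move=> x; rewrite /D /= in_itv/= => /andP[yx xy]; rewrite lee_fin -/(gpdf x) !gpdfE ler_wpM2l ?invr_ge0//.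
rewrite ler_expR -subr_ge0.
have -> : - x ^+ 2 / 2 - - (y + 1) ^+ 2 / 2 = ((y + 1) - x) * ((y + 1) + x) / 2 by field.
by rewrite divr_ge0// mulr_ge0//; lra.
Qed.

(** The induction expresses that the law is carried by the nonnegative numbers: the comparison is
    only assumed there. *)
Lemma le_chi2 n (f g : RR -> \bar R) : measurable_fun setT f -> measurable_fun setT g ->
  (forall w, 0 <= f w)%E -> (forall w, 0 <= g w)%E -> (forall w : R, 0 <= w -> (f w <= g w)%E) ->
  (\int[chi2 R n]_w f w <= \int[chi2 R n]_w g w)%E.
Proof.
move=> mf mg f0 g0' fg; elim: n f g mf mg f0 g0' fg => [|n IH] f g mf mg f0 g0' fg.
  by rewrite !integral_chi20// fg.
rewrite !integral_chi2S//.
have mc (h : RR -> \bar R) : measurable_fun setT h -> measurable_fun setT (fun z : RR * RR => h (z.1 ^+ 2 + z.2)).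
  by move=> mh; exact: (measurableT_comp mh (@measurable_sqr_add R)).
apply: ge0_le_integral => //.
- by move=> z _; apply: integral_ge0.
- exact: (@measurable_fun_fubini_tonelli_F _ _ _ _ R (chi2 R n) _ (mc f mf) (fun=> f0 _)).
- exact: (@measurable_fun_fubini_tonelli_F _ _ _ _ R (chi2 R n) _ (mc g mg) (fun=> g0' _)).
move=> z _; apply: IH => //.
- by apply: (measurableT_comp mf); exact: measurable_funD.
- by apply: (measurableT_comp mg); exact: measurable_funD.
by move=> w w0; apply: fg; rewrite addr_ge0// sqr_ge0.
Qed.

Lemma measurable_sqrt : measurable_fun setT (fun x : RR => Num.sqrt x : RR).
Proof. by apply: continuous_measurable_fun; exact: sqrt_continuous. Qed.

(** With y^2 = k w, Mills' bound contains 1 / y, whose expectation is not directly available. It is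
    bounded by (al + 1 / (al y^2)) / 2, which leaves a Laplace transform and an inverse moment. *)
Lemma chi2_tail_le (n : nat) (c : R) (h : RR -> \bar R) : (2 < n)%N -> 0 < c < 1 ->
  (forall w, (0 <= h w)%E) ->
  (forall w, (h w <= gam (`[(Num.sqrt (c ^+ 2 / (1 - c ^+ 2)) * Num.sqrt w)%R, +oo[%classic : set RR))%E) ->
  (\int[chi2 R n]_w h w <=
   (g0 * powR (1 - c ^+ 2) (n%:R / 2) / (c * Num.sqrt (n%:R - 2)))%:E)%E.
Proof.
move=> n2 /andP[c0 c1] h0 hle.
have n2R : (2 : R) < n%:R by rewrite ltr_nat.
have g00 : 0 < g0 by rewrite invr_gt0 sqrtr_gt0 pmulrn_lgt0// pi_gt0.
have c2 : 0 < 1 - c ^+ 2 by rewrite subr_gt0 expr_lt1// ltW.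
set k := c ^+ 2 / (1 - c ^+ 2).
have k0 : 0 < k by rewrite divr_gt0// exprn_gt0.
(* The weight for which the two resulting terms are equal. *)
pose al := (c * Num.sqrt (n%:R - 2))^-1.
have sn : 0 < Num.sqrt (n%:R - 2 : R) by rewrite sqrtr_gt0 subr_gt0.
have al0 : 0 < al by rewrite invr_gt0 mulr_gt0.
pose B (w : RR) : \bar R := ((g0 * al / 2)%:E * (expR (- k * w / 2))%:E +
  (g0 / (4 * al * k))%:E * ((expR (- k * w / 2))%:E * exp_int w))%E.
have me : measurable_fun setT (fun w : RR => (expR (- k * w / 2))%:E).
  by apply/measurable_EFinP; exact: measurable_expRM.
have ei0 (w : RR) : (0 <= exp_int w)%E by apply: integral_ge0 => v _; rewrite lee_fin expR_ge0.
have mei := @measurable_exp_int R.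
have m2 : measurable_fun setT (fun w : RR => (expR (- k * w / 2))%:E * exp_int w)%E by exact: emeasurable_funM.
have mB : measurable_fun setT B by apply: emeasurable_funD; apply: emeasurable_funM.
have a1 : 0 < g0 * al / 2 by rewrite divr_gt0// mulr_gt0.
have a2 : 0 < g0 / (4 * al * k) by rewrite divr_gt0//; apply: mulr_gt0 => //; exact: mulr_gt0.
have pB (w : RR) : (gam (`[(Num.sqrt k * Num.sqrt w)%R, +oo[%classic : set RR) <= B w)%E.
  have [w0|w0] := leP w 0.
    rewrite /B exp_int_le0// gt0_muley ?lte_fin ?expR_gt0// gt0_muley ?lte_fin// addey ?leey//.
  pose y := Num.sqrt k * Num.sqrt w.
  have y0 : 0 < y by rewrite mulr_gt0// sqrtr_gt0.
  have y2 : y ^+ 2 = k * w by rewrite exprMn !sqr_sqrtr// ltW.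
  apply: le_trans (gauss_tail_le (ltW y0)) _.
  rewrite /B !exp_intE//; last by rewrite mulr_gt0.
  rewrite -!EFinM -EFinD lee_fin gpdfE -/g0 (_ : - y ^+ 2 / 2 = - k * w / 2); last by rewrite y2; ring.
  move: (expR_gt0 (- k * w / 2)); set e := expR _ => e0.
  have -> : g0 * e * (2 / (2 * y)) = g0 * e * y^-1 by field; rewrite gt_eqF.
  have -> : g0 * al / 2 * e + g0 / (4 * al * k) * (e * (2 / w)) = g0 * e * ((al + (al * (k * w))^-1) / 2).
    by field; rewrite !gt_eqF.
  rewrite ler_pM2l ?mulr_gt0// -y2 -subr_ge0.
  have -> : (al + (al * y ^+ 2)^-1) / 2 - y^-1 = (al * y - 1) ^+ 2 / (2 * al * y ^+ 2).
    by field; rewrite !gt_eqF.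
  by rewrite divr_ge0 ?sqr_ge0// !mulr_ge0 ?exprn_ge0// ltW.
apply: (@le_trans _ _ (\int[chi2 R n]_w B w)%E).
  by apply: ge0_le_integral_nomeas => // w; exact: le_trans (pB w).
have e0 (w : RR) : (0 <= (expR (- k * w / 2))%:E)%E by rewrite lee_fin expR_ge0.
rewrite ge0_integralD//; last 4 first.
- by move=> w _; rewrite mule_ge0// lee_fin ltW.
- exact: emeasurable_funM.
- by move=> w _; rewrite mule_ge0 ?mule_ge0// lee_fin ltW.
- exact: emeasurable_funM.
rewrite ge0_integralZl; [|exact: measurableT|exact: me|by move=> w _; exact: e0|by rewrite lee_fin ltW].
rewrite ge0_integralZl; [|exact: measurableT|exact: m2|by move=> w _; rewrite mule_ge0|by rewrite lee_fin ltW].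
rewrite (chi2_mgf n (ltW k0)) (chi2_exp_int (ltW k0) n2) -!EFinM -EFinD lee_fin.
have kE : 1 + k = (1 - c ^+ 2)^-1 by rewrite /k; field; rewrite gt_eqF.
have k1 : 0 < 1 + k by lra.
rewrite powRD ?(gt_eqF k1) ?implybT// powRr1 ?(ltW k1)//.
have -> : powR (1 + k) (- (n%:R / 2)) = powR (1 - c ^+ 2) (n%:R / 2).
  by rewrite kE -powR_inv1 ?ltW// -powRrM; congr powR; ring.
move: (powR _ _) => P; rewrite le_eqVlt; apply/orP; left; apply/eqP.
have -> : 1 + k = (1 - c ^+ 2)^-1 := kE.
have -> : n%:R / 2 - 1 = Num.sqrt (n%:R - 2) ^+ 2 / 2 :> R.
  by rewrite sqr_sqrtr; [field|lra].
rewrite /al /k; move: sn; move: (Num.sqrt _) => q q0.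
by field; rewrite !gt_eqF//.
Qed.

(** The density at y + 1 is compared with a Gaussian in y by (y + 1)^2 <= (1 + t) y^2 + 1 + 1/t. A
    small t costs only a constant factor. *)
Lemma chi2_tail_ge (n : nat) (k t : R) (h : RR -> \bar R) : 0 <= k -> 0 < t ->
  measurable_fun setT h -> (forall w, (0 <= h w)%E) ->
  (forall w, 0 <= w -> (gam (`](Num.sqrt k * Num.sqrt w)%R, +oo[%classic : set RR) <= h w)%E) ->
  ((g0 * expR (- (1 + t^-1) / 2) * powR (1 + (1 + t) * k) (- (n%:R / 2)))%:E <=
  \int[chi2 R n]_w h w)%E.
Proof.
move=> k0 t0 mh h0 hle.
have g00 : 0 < g0 by rewrite invr_gt0 sqrtr_gt0 pmulrn_lgt0// pi_gt0.
pose s := (1 + t) * k.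
have s0 : 0 <= s by rewrite mulr_ge0//; lra.
pose C := g0 * expR (- (1 + t^-1) / 2).
have C0 : 0 <= C by rewrite mulr_ge0 ?expR_ge0// ltW.
have me : measurable_fun setT (fun w : RR => (expR (- s * w / 2))%:E).
  by apply/measurable_EFinP; exact: measurable_expRM.
rewrite EFinM -(chi2_mgf n s0) -ge0_integralZl; [|exact: measurableT|exact: me|by move=> w _; rewrite lee_fin expR_ge0|by rewrite lee_fin].
apply: le_chi2 => //; first exact: emeasurable_funM.
  by move=> w; rewrite mule_ge0// lee_fin expR_ge0.
move=> w w0; apply: le_trans (hle w w0).
apply: le_trans (gauss_tail_ge _); last by rewrite mulr_ge0 ?sqrtr_ge0.
rewrite -EFinM lee_fin gpdfE -/g0 /C -[X in X <= _]mulrA -expRD ler_wpM2l ?(ltW g00)// ler_expR.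
set y := Num.sqrt k * Num.sqrt w.
have y2 : y ^+ 2 = k * w by rewrite exprMn !sqr_sqrtr.
rewrite -subr_ge0 (_ : _ - _ = (y ^+ 2 * t - 2 * y + t^-1) / 2); last first.
  by rewrite (_ : - s * w = - ((1 + t) * y ^+ 2)); [field; rewrite gt_eqF|rewrite y2 /s; ring].
rewrite divr_ge0//.
have -> : y ^+ 2 * t - 2 * y + t^-1 = (t * y - 1) ^+ 2 / t by field; rewrite gt_eqF.
by rewrite divr_ge0 ?sqr_ge0// ltW.
Qed.

Lemma measurable_set_ler dsp (T : measurableType dsp) (f g : T -> RR) :
  measurable_fun setT f -> measurable_fun setT g -> measurable [set x | (f x <= g x :> R)%R].
Proof.
move=> mf mg; have := measurable_fun_ler mf mg measurableT (I : measurable [set true]).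
by rewrite setTI.
Qed.

Lemma measurable_set_ltr dsp (T : measurableType dsp) (f g : T -> RR) :
  measurable_fun setT f -> measurable_fun setT g -> measurable [set x | (f x < g x :> R)%R].
Proof.
move=> mf mg; have := measurable_fun_ltr mf mg measurableT (I : measurable [set true]).
by rewrite setTI.
Qed.

Let measurable_sqr_shift (c w : R) : measurable_fun setT (fun p : RR => (c * Num.sqrt (p ^+ 2 + w))%R : RR).
Proof.
apply: measurable_funM => //; apply: (measurableT_comp measurable_sqrt).
by apply: measurable_funD => //; exact: measurable_funX.
Qed.

Let measurable_snd_sqrt (c : R) : measurable_fun setT (fun z : RR * RR => (c * Num.sqrt z.2)%R : RR).
Proof. by apply: measurable_funM => //; exact: (measurableT_comp measurable_sqrt). Qed.

Section Caps.
Context (n : nat) (dsp : measure_display) (T : measurableType dsp) (P : probability T R) (u : T -> 'rV[R]_n.+1).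
Hypothesis law : forall x, dot x x = 1%R -> forall F : RR * RR -> \bar R, measurable_fun setT F ->
  (forall z, 0 <= F z)%E ->
  (\int[P]_w F (dot x (u w), dot (u w) (u w)) = \int[gam]_p \int[chi2 R n]_w F (p, (p ^+ 2 + w)%R))%E.
Hypothesis mu : forall i, measurable_fun setT (fun w => u w 0 i : RR).

Lemma measurable_dotl x : measurable_fun setT (fun w => dot x (u w) : RR).
Proof. by apply: measurable_sum => i; apply: measurable_funM => //; exact: mu. Qed.

Lemma measurable_dotuu : measurable_fun setT (fun w => dot (u w) (u w) : RR).
Proof. by apply: measurable_sum => i; apply: measurable_funM; exact: mu. Qed.

Let region (S : set (RR * RR)) x : measurable S -> dot x x = 1 ->
  P [set w | S (dot x (u w), dot (u w) (u w))] =
  (\int[chi2 R n]_w gam [set p | S (p, (p ^+ 2 + w)%R)])%E.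
Proof.
move=> mS x1.
have mF : measurable_fun setT (fun z : RR * RR => (\1_S z : R)%:E) by apply/measurable_EFinP; exact: measurable_indic.
have F0 (z : RR * RR) : (0 <= (\1_S z)%:E :> \bar R)%E by rewrite lee_fin.
have mA : measurable [set w | S (dot x (u w), dot (u w) (u w))].
  have := measurable_fun_pair (measurable_dotl x) measurable_dotuu measurableT mS.
  by rewrite setTI.
transitivity (\int[P]_w (\1_S (dot x (u w), dot (u w) (u w)) : R)%:E)%E.
  by rewrite -(setIT [set w | _]) -integral_indic.
rewrite (law x1 mF F0).
have mG : measurable_fun setT (fun z : RR * RR => (\1_S (z.1, (z.1 ^+ 2 + z.2)%R) : R)%:E).
  apply: (measurable_comp_pair (F := fun z : RR * RR => (\1_S z)%:E) (f := fst)) => //.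
  by apply: measurable_funD => //; exact: measurable_funX.
have -> := @fubini_tonelli _ _ _ _ R gam (chi2 R n) _ mG (fun=> F0 _).
apply: eq_integral => w _ /=.
have mB : measurable ([set p | S (p, (p ^+ 2 + w)%R)] : set RR).
  have m1 : measurable_fun setT (fun p : RR => (p, (p ^+ 2 + w)%R : RR)).
    by apply: measurable_fun_pair => //; apply: measurable_funD => //; exact: measurable_funX.
  by have := m1 measurableT _ mS; rewrite setTI.
by rewrite -[in RHS](setIT [set p | _]) -integral_indic.
Qed.

(** Since the squared norm is p^2 + w, belonging to the cap of cosine c means that p is at least the
    square root of w c^2 / (1 - c^2). *)
Lemma cap_le (c : R) x : (2 < n)%N -> 0 < c < 1 -> dot x x = 1 ->
  (P [set w | (c * Num.sqrt (dot (u w) (u w)) <= dot x (u w))%R] <=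
   (g0 * powR (1 - c ^+ 2) (n%:R / 2) / (c * Num.sqrt (n%:R - 2)))%:E)%E.
Proof.
move=> n2 c01 x1; have /andP[c0 c1] := c01.
have mS : measurable [set z : RR * RR | (c * Num.sqrt z.2 <= z.1)%R].
  by apply: measurable_set_ler => //; exact: measurable_snd_sqrt.
rewrite (region mS x1) /=; apply: chi2_tail_le => // w.
apply: le_measure; rewrite ?inE; [|exact: measurable_itv|].
  by apply: measurable_set_ler => //; exact: measurable_sqr_shift.
move=> p /= hp; rewrite in_itv/= andbT.
have p0 : 0 <= p by apply: le_trans hp; rewrite mulr_ge0 ?sqrtr_ge0// ltW.
have c2 : 0 < 1 - c ^+ 2 by rewrite subr_gt0 expr_lt1// ltW.
have [w0|w0] := leP w 0; first by rewrite (ler0_sqrtr w0) mulr0.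
rewrite -(@ler_pXn2r _ 2)// ?nnegrE ?mulr_ge0 ?sqrtr_ge0//.
rewrite exprMn !sqr_sqrtr ?(ltW w0)//; last by rewrite divr_ge0 ?sqr_ge0// ltW.
rewrite mulrAC ler_pdivrMr//.
move: hp; rewrite -(@ler_pXn2r _ 2)// ?nnegrE ?mulr_ge0 ?sqrtr_ge0 ?(ltW c0)//.
rewrite exprMn sqr_sqrtr; [lra|by rewrite addr_ge0 ?sqr_ge0// ltW].
Qed.

Lemma cap_ge (c t : R) x : 0 < t -> 0 < c < 1 -> dot x x = 1 ->
  ((g0 * expR (- (1 + t^-1) / 2) * powR (1 + (1 + t) * (c ^+ 2 / (1 - c ^+ 2))) (- (n%:R / 2)))%:E <=
  P [set w | (c * Num.sqrt (dot (u w) (u w)) < dot x (u w))%R])%E.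
Proof.
move=> t0 c01 x1; have /andP[c0 c1] := c01.
have c2 : 0 < 1 - c ^+ 2 by rewrite subr_gt0 expr_lt1// ltW.
have mS : measurable [set z : RR * RR | (c * Num.sqrt z.2 < z.1)%R].
  by apply: measurable_set_ltr => //; exact: measurable_snd_sqrt.
rewrite (region mS x1) /=; apply: chi2_tail_ge => //.
- by rewrite divr_ge0 ?sqr_ge0// ltW.
- have mS2 : measurable [set z : RR * RR | (c * Num.sqrt (z.1 ^+ 2 + z.2) < z.1)%R].
    apply: measurable_set_ltr => //; apply: measurable_funM => //; apply: (measurableT_comp measurable_sqrt).
    by apply: measurable_funD => //; exact: measurable_funX.
  apply: (eq_measurable_fun (gam \o ysection [set z : RR * RR | (c * Num.sqrt (z.1 ^+ 2 + z.2) < z.1)%R])).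
    move=> w _ /=; congr (gam _); apply/seteqP; split=> p; rewrite /ysection /= inE//.
  exact: measurable_fun_ysection.
move=> w w0; apply: le_measure; rewrite ?inE; [exact: measurable_itv| |].
  by apply: measurable_set_ltr => //; exact: measurable_sqr_shift.
move=> p /=; rewrite in_itv/= andbT => hp.
have p0 : 0 < p by apply: le_lt_trans hp; rewrite mulr_ge0 ?sqrtr_ge0.
have hp2 : (Num.sqrt (c ^+ 2 / (1 - c ^+ 2)) * Num.sqrt w) ^+ 2 < p ^+ 2.
  by rewrite ltr_pXn2r// nnegrE ?mulr_ge0 ?sqrtr_ge0// ltW.
rewrite -(@ltr_pXn2r _ 2)// ?nnegrE ?mulr_ge0 ?sqrtr_ge0 ?(ltW c0) ?(ltW p0)//.
rewrite exprMn sqr_sqrtr; last by rewrite addr_ge0 ?sqr_ge0.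
move: hp2; rewrite exprMn !sqr_sqrtr//; last by rewrite divr_ge0 ?sqr_ge0// ltW.
rewrite mulrAC ltr_pdivrMr//; lra.
Qed.

End Caps.
End GaussianTail.

(** * The exponential upper bound *)

Lemma expR_gt_linear (R : realType) (C a : R) : 0 < a ->
  \forall d \near \oo, C * d.+1%:R <= expR (a * d%:R).
Proof.
move=> a0; near=> d.
have d1 : 8 * `|C| / a ^+ 2 <= d%:R.
  by near: d; apply: nbhs_infty_ger.
have d2 : (1 : R) <= d%:R by rewrite ler1n; near: d; exact: nbhs_infty_gt.
have ad : 0 <= a * d%:R / 2 by rewrite divr_ge0// mulr_ge0// ltW.
apply: (@le_trans _ _ ((a * d%:R / 2) ^+ 2)).
  apply: (@le_trans _ _ (`|C| * (2 * d%:R))).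
    apply: (le_trans (ler_wpM2r _ (ler_norm C))) => //.
    by rewrite ler_wpM2l// -natr1; lra.
  have : 8 * `|C| <= d%:R * a ^+ 2 by rewrite -ler_pdivrMr ?exprn_gt0.
  rewrite -subr_ge0 => h; rewrite -subr_ge0.
  have -> : (a * d%:R / 2) ^+ 2 - `|C| * (2 * d%:R) = d%:R * (d%:R * a ^+ 2 - 8 * `|C|) / 4 by field.
  by rewrite divr_ge0// mulr_ge0.
have E : a * d%:R = a * d%:R / 2 + a * d%:R / 2 by field.
rewrite [in leRHS]E expRD -expr2; apply: lerXn2r; rewrite ?nnegrE ?expR_ge0//.
by apply: le_trans (expR_ge1Dx _); lra.
Unshelve. all: by end_near. Qed.

Lemma ln_monomial_le (R : realType) (x y z q : R) (a b c e : nat) : 0 < x -> 0 < y -> 0 < z -> 0 < q ->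
  x ^+ a * y ^+ b * z ^+ c <= 2 ^+ e * q ->
  a%:R * ln x + b%:R * ln y + c%:R * ln z <= e%:R * ln 2 + ln q.
Proof.
move=> x0 y0 z0 q0; rewrite -ler_ln ?posrE ?mulr_gt0 ?exprn_gt0//.
rewrite !lnM ?posrE ?mulr_gt0 ?exprn_gt0// !lnXn//.
by rewrite !mulr_natl.
Qed.

Lemma kl_rate_lt (R : realType) : kl_rate R + ln (273 / 250) / 2 < 401 / 1000 * ln 2.
Proof.
rewrite /kl_rate.
have p1 : 0 < 399 / 23 :> R by lra.
have p2 : 0 < 399 / 376 :> R by lra.
have p3 : 0 < 273 / 250 :> R by lra.
have p4 : 0 < 17 / 10 :> R by lra.
(* The logarithm of the left side is 376 times the rate. With [e2], which bounds ln (17/10) by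
   96/125 times ln 2, the rate is at most 150.768 / 376 in units of ln 2, less than 0.401. *)
have e1 : (399 / 23 : R) ^+ 23 * (399 / 376) ^+ 376 * (273 / 250) ^+ 188 <= 2 ^+ 150 * (17 / 10) by lra.
have e2 : (17 / 10 : R) ^+ 125 * 2 ^+ 1 * 1 ^+ 0 <= 2 ^+ 97 * 1 by lra.
have := ln_monomial_le p1 p2 p3 p4 e1.
have := ln_monomial_le p4 (ltr0Sn R 1) ltr01 ltr01 e2.
have : 0 < ln 2 :> R by rewrite ln_gt0// ltr1n.
clear; rewrite ln1; move: (ln (399 / 23)) (ln (399 / 376)) (ln (273 / 250)) (ln 2) (ln (17 / 10)) => a b c e f.
lra.
Qed.

Section Lift.
Context (R : realType) (n : nat).
Variables (s : seq 'rV[R]_n.+1).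
Hypothesis ps : packing (@euclidean_norm R n.+1) s.

(* Lifting the points at distance at most r = sqrt (250/273) from p to the
   upper half of the sphere of radius r centred at p, one dimension higher. *)
Let r : R := Num.sqrt (250 / 273).
Let up (p x : 'rV[R]_n.+1) (i : 'I_n.+2) : R :=
  if unlift ord0 i is Some j then (x - p) 0 j / r else Num.sqrt (1 - dot (x - p) (x - p) / r ^+ 2).

Let r0 : 0 < r. Proof. by rewrite sqrtr_gt0; lra. Qed.
Let r2 : r ^+ 2 = 250 / 273. Proof. by apply: sqr_sqrtr; apply: divr_ge0; rewrite ler0n. Qed.

Let dotf_up p x y : Fischer.dotf (up p x) (up p y) =
  Num.sqrt (1 - dot (x - p) (x - p) / r ^+ 2) * Num.sqrt (1 - dot (y - p) (y - p) / r ^+ 2) +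
  dot (x - p) (y - p) / r ^+ 2.
Proof.
rewrite /Fischer.dotf big_ord_recl /up unlift_none; congr (_ + _).
rewrite /dot [RHS]mulr_suml; apply: eq_bigr => j _; rewrite liftK; field.
exact: lt0r_neq0.
Qed.

(** Lifting does not decrease distances: points more than 1 apart on a sphere with r^2 = 250/273
    have cosine below 1 - 1 / (2 r^2) = 227/500. In the computation, the product of the two heights
    is bounded by the mean of their squares. *)
Lemma packing_local_le (p : 'rV[R]_n.+1) (q : pred (matrix R 1 n.+1)) (B : R) :
  (forall x, x \in s -> q x -> dot (x - p) (x - p) <= 250 / 273) ->
  (forall (I : finType) (v : I -> 'I_n.+2 -> R), (forall i, Fischer.dotf (v i) (v i) = 1) ->
  (forall i j, i != j -> Fischer.dotf (v i) (v j) <= 227 / 500) -> #|I|%:R <= B) ->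
  (count q s)%:R <= B.
Proof.
move=> hq hB; pose s' := [seq x <- s | q x].
have s'P x : x \in s' -> dot (x - p) (x - p) / r ^+ 2 <= 1.
  by rewrite mem_filter => /andP[qx xs]; rewrite ler_pdivrMr ?exprn_gt0// mul1r r2; exact: hq.
pose v (i : 'I_(size s')) := up p s'`_i.
have -> : (count q s)%:R = #|'I_(size s')|%:R :> R by rewrite card_ord size_filter.
apply: (hB _ v) => [i|i j ij].
  have h := s'P _ (mem_nth 0 (ltn_ord i)).
  by rewrite /v dotf_up -expr2 sqr_sqrtr ?subr_ge0// subrK.
have sep x y : x \in s' -> y \in s' -> 1 < dot (x - y) (x - y) -> Fischer.dotf (up p x) (up p y) <= 227 / 500.
  move=> /s'P xs /s'P ys xy; rewrite dotf_up.
  move: xy; have -> : x - y = (x - p) - (y - p) by rewrite opprB addrA subrK.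
  rewrite dot_sub; move: xs ys; rewrite r2.
  move: (dot (x - p) (x - p)) (dot (y - p) (y - p)) (dot (x - p) (y - p)) => a b c ha hb hc.
  have h1 : 0 <= 1 - a / (250 / 273) by lra.
  have h2 : 0 <= 1 - b / (250 / 273) by lra.
  have : Num.sqrt (1 - a / (250 / 273)) * Num.sqrt (1 - b / (250 / 273)) <= ((1 - a / (250 / 273)) + (1 - b / (250 / 273))) / 2.
    rewrite -{2}(sqr_sqrtr h1) -{2}(sqr_sqrtr h2).
    move: (Num.sqrt _) (Num.sqrt _) => e f; have := sqr_ge0 (e - f); nra.
  lra.
have pw : pairwise (fun x y => 1 < euclidean_norm (x - y)) s' by apply: pairwise_filter; case: ps.
have key (k l : 'I_(size s')) : (k < l)%N -> Fischer.dotf (v k) (v l) <= 227 / 500.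
  move=> kl; apply: sep; rewrite ?mem_nth//.
  by rewrite -euclidean_norm_gt1; apply: (pairwiseP 0 pw); rewrite ?inE.
have := ij; rewrite -val_eqE neq_ltn => /orP[/key//|/key].
by rewrite /Fischer.dotf; under eq_bigr do rewrite mulrC.
Qed.

End Lift.

(** The expected number of events that occur, counted in two ways. *)
Lemma size_le_cover (R : realType) (T : eqType) dsp (Om : measurableType dsp) (P : probability Om R)
    (s : seq T) (E : T -> set Om) (p0 M : R) :
  (forall x, measurable (E x)) -> (forall x, x \in s -> (p0%:E <= P (E x))%E) ->
  (forall w, (count (fun x => w \in E x) s)%:R <= M) -> (size s)%:R * p0 <= M.
Proof.
move=> mE pE cM.
have mf x : measurable_fun setT (fun w => (\1_(E x) w : R)%:E).
  by apply/measurable_EFinP; exact: measurable_indic.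
have sumE : (\int[P]_w (\sum_(x <- s) (\1_(E x) w : R)%:E)%E = \sum_(x <- s) P (E x))%E.
  rewrite ge0_integral_sum//; by apply: eq_bigr => x _; rewrite integral_indic// setIT.
rewrite -lee_fin; apply: (@le_trans _ _ (\sum_(x <- s) P (E x))%E).
  have -> : (size s)%:R * p0 = \sum_(x <- s) p0.
    by rewrite big_const_seq iter_addr_0 count_predT mulr_natl.
  by rewrite -sumEFin big_seq [leRHS]big_seq; apply: lee_sum => x /pE.
rewrite -sumE.
apply: (@le_trans _ _ (\int[P]_w M%:E)%E); last by rewrite integral_cst//= [X in (_ * X)%E]probability_setT mule1.
apply: ge0_le_integral_nomeas.
  by move=> w; apply: sume_ge0 => x _; rewrite lee_fin.
move=> w; rewrite sumEFin lee_fin; apply: le_trans (cM w).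
rewrite -sum1_count natr_sum.
by rewrite [leRHS]big_mkcond; apply: ler_sum => x _; rewrite indicE; case: (_ \in _).
Qed.

Lemma lift_radius_exists (R : realType) : exists2 c : R, 0 < c < 1 & c ^+ 2 = 23 / 273.
Proof.
have h0 : 0 < 23 / 273 :> R by apply: divr_gt0; rewrite ltr0n.
have h1 : 23 / 273 < 1 :> R by lra.
exists (Num.sqrt (23 / 273)); last exact: sqr_sqrtr (ltW h0).
by rewrite sqrtr_gt0 h0 /= -[ltRHS]sqrtr1 ltr_sqrt.
Qed.

(** The centre lies at distance c from the origin in the random direction, with b = c^2. Among the
    points of the ball seen from the origin within the cap of cosine c, the worst one has length a =
    1, at squared distance 1 - b. *)
Lemma lift_radius_le (R : realFieldType) (a b h : R) : 0 <= a <= 1 -> b = 23 / 273 -> b <= h ->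
  a ^+ 2 + b - 2 * (a * h) <= 250 / 273.
Proof.
move=> /andP[a0 a1] -> h1.
have : a * (23 / 273) <= a * h by apply: ler_wpM2l.
have h2 : a - 1 <= 0 by lra.
have h3 : 0 <= a + 227 / 273 by lra.
have : (a - 1) * (a + 227 / 273) <= 0 by exact: mulr_le0_ge0.
lra.
Qed.

Lemma lift_base_gt0 (R : realFieldType) (e : R) : 0 < e -> 0 < 1 + (1 + e) * (23 / 250).
Proof. by move=> e0; lra. Qed.

Lemma ln_lift_ge0 (R : realType) : 0 <= ln (273 / 250) :> R.
Proof. by apply: ln_ge0; lra. Qed.

Lemma ln_lift_le (R : realType) (e : R) : 0 < e ->
  ln (1 + (1 + e) * (23 / 250)) <= ln (273 / 250) + e.
Proof.
move=> e0; have h1 : 0 < 273 / 250 :> R by lra.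
have h2 : 0 < 1 + e * (23 / 273) by lra.
have -> : 1 + (1 + e) * (23 / 250) = 273 / 250 * (1 + e * (23 / 273)) by field.
rewrite lnM ?posrE// lerD2l; have h3 : -1 < e * (23 / 273) by lra.
by apply: le_trans (le_ln1Dx h3) _; lra.
Qed.

Lemma lift_exponent_le (R : realType) (n k b l e : R) : 0 <= n -> 0 <= b -> 0 <= e ->
  e = 401 / 1000 * l - (k + b / 2) ->
  expR (e / 2 * n) * (expR ((n + 1) * k) * expR (n / 2 * (b + e))) <= expR (401 / 1000 * (n + 1) * l).
Proof.
move=> n0 b0 e0 eE; rewrite -!expRD ler_expR.
have -> : 401 / 1000 * (n + 1) * l = (n + 1) * (e + (k + b / 2)) by rewrite eE; ring.
nra.
Qed.

Theorem packing_euclidean_le (R : realType) : \forall d \near \oo, forall s : seq 'rV[R]_d,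
  packing (@euclidean_norm R d) s -> (size s)%:R <= powR 2 (401 / 1000 * d%:R) :> R.
Proof.
have [C C0 hC] := spherical_code_asymptotic R.
set kap := kl_rate R in hC.
(* The slack between 0.401 and the rate pays both for the linear factor and for the parameter t of
   [cap_ge]. *)
pose eta : R := 401 / 1000 * ln 2 - (kap + ln (273 / 250) / 2).
have eta0 : 0 < eta by rewrite subr_gt0; exact: kl_rate_lt.
pose g0 : R := (Num.sqrt (pi *+ 2))^-1.
have g00 : 0 < g0 by rewrite invr_gt0 sqrtr_gt0 pmulrn_lgt0// pi_gt0.
pose g1 : R := g0 * expR (- (1 + eta^-1) / 2).
have g10 : 0 < g1 by rewrite mulr_gt0// expR_gt0.
have lin := expR_gt_linear (2 * (C / g1 * expR kap)) (divr_gt0 eta0 (ltr0Sn R 1)).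
suff : \forall d \near \oo, forall s : seq 'rV[R]_d.+1,
    packing (@euclidean_norm R d.+1) s -> (size s)%:R <= powR 2 (401 / 1000 * d.+1%:R) :> R.
  move=> [N _ hN]; exists N.+1 => // -[//|d] /= dN s; apply: hN; exact: dN.
near=> n => s ps.
have [hl hcode] : C / g1 * expR kap * n.+2%:R <= expR (eta / 2 * n%:R) /\ 
   forall (I : finType) (v : I -> 'I_n.+2 -> R),
  (forall i, Fischer.dotf (v i) (v i) = 1) ->
  (forall i j, i != j -> Fischer.dotf (v i) (v j) <= 227 / 500) ->
  #|I|%:R <= C * n.+2%:R * expR (n.+2%:R * kap).
  split.
    have : 2 * (C / g1 * expR kap) * n.+1%:R <= expR (eta / 2 * n%:R) by near: n.
    apply: le_trans; rewrite -[leRHS]mulrA [leRHS]mulrCA; apply: ler_wpM2l.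
      by rewrite mulr_ge0 ?expR_ge0// divr_ge0// ltW.
    by rewrite -natrM ler_nat; clear; lia.
  near: n; move: hC => [N _ hN]; exists N => // n /= nN; apply: hN => /=.
  by apply: leq_trans nN _; clear; lia.
have [dsp [Om [P [u [mu law]]]]] := @gaussian_vector_exists R n.
have [c c01 c2] := lift_radius_exists R.
have /andP[c0 c1] := c01.
pose dir (x : 'rV[R]_n.+1) : 'rV[R]_n.+1 := if x == 0 then delta_mx 0 0 else (Num.sqrt (dot x x))^-1 *: x.
have sx x : x != 0 -> 0 < Num.sqrt (dot x x).
  move=> x0; rewrite sqrtr_gt0 lt_def dot_ge0 andbT; apply: contra x0 => /eqP/dot_eq0 ->.
  exact: eqxx.
have dir1 x : dot (dir x) (dir x) = 1.
  rewrite /dir; case: ifPn => [_|x0].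
    rewrite /dot (bigD1 ord0)//= !mxE !eqxx mulr1 big1 ?addr0// => i /negbTE i0.
    by rewrite !mxE i0 andbF mul0r.
  by rewrite dotZl dotZr -{3}(@sqr_sqrtr _ (dot x x)) ?dot_ge0//; field; rewrite gt_eqF// sx.
have dirE x : x = Num.sqrt (dot x x) *: dir x.
  rewrite /dir; case: eqP => [->|/eqP x0]; last by rewrite scalerA divff ?scale1r// gt_eqF// sx.
  by rewrite /dot big1 ?sqrtr0 ?scale0r// => i _; rewrite mxE mul0r.
pose E x : set Om := [set w | (c * Num.sqrt (dot (u w) (u w)) < dot (dir x) (u w))%R].
have mE x : measurable (E x).
  apply: measurable_set_ltr; last exact: measurable_dotl.
  by apply: measurable_funM => //; apply: (measurableT_comp (@measurable_sqrt R)); exact: measurable_dotuu.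
pose p0 := g1 * powR (1 + (1 + eta) * (23 / 250)) (- (n%:R / 2)).
have pE x : (p0%:E <= P (E x))%E.
  have := cap_ge law mu eta0 c01 (dir1 x).
  by rewrite c2 (_ : 23 / 273 / (1 - 23 / 273) = 23 / 250)//; field.
have := @size_le_cover R _ _ _ P s E p0 (C * n.+2%:R * expR (n.+2%:R * kap)) mE (fun x _ => pE x).
have local w : (count (fun x => w \in E x) s)%:R <= C * n.+2%:R * expR (n.+2%:R * kap).
  apply: (@packing_local_le R n s ps ((c / Num.sqrt (dot (u w) (u w))) *: u w)) => // x xs.
  rewrite inE /E /= => wx.
  (* The inequality defining [E] is strict, which excludes a zero Gaussian vector. *)
  have q0 : 0 < Num.sqrt (dot (u w) (u w)).
    rewrite lt_def sqrtr_ge0 andbT; apply: contraTneq wx => q0.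
    have : dot (u w) (u w) = 0.
      by apply/eqP; rewrite eq_le dot_ge0 andbT -sqrtr_eq0 q0.
    by move/dot_eq0 => ->; rewrite /dot !big1 ?sqrtr0 ?mulr0 ?ltxx// => i _; rewrite mxE mulr0.
  have x1 : dot x x <= 1 by rewrite -euclidean_norm_le1; case: ps => + _; apply.
  have a1 : Num.sqrt (dot x x) <= 1 by rewrite -[X in _ <= X]sqrtr1 ler_sqrt.
  rewrite {1 2}(dirE x) dot_sub !dotZl !dotZr dir1.
  have := @sqr_sqrtr _ (dot (u w) (u w)) (dot_ge0 _).
  move: wx q0 a1 (sqrtr_ge0 (dot x x)); move: (Num.sqrt (dot x x)) (Num.sqrt (dot (u w) (u w))) => a q.
  move: (dot (dir x) (u w)) (dot (u w) (u w)) => b e wx q0 a1 a0 <-.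
  have -> : c / q * (c / q * q ^+ 2) = c ^+ 2 by field; rewrite gt_eqF.
  have : c ^+ 2 <= c / q * b.
    by rewrite expr2 mulrAC -mulrA ler_pM2l// ler_pdivlMr// ltW.
  rewrite mulr1 -(expr2 a) => h; apply: (@lift_radius_le _ a (c ^+ 2) (c / q * b)) => //.
  by rewrite a0 a1.
move=> /(_ local) main.
have B0 := lift_base_gt0 eta0.
have p00 : 0 < p0 := mulr_gt0 g10 (powR_gt0 _ B0).
move: main; rewrite -ler_pdivlMr// => /le_trans; apply.
rewrite /p0 powRN invfM invrK mulrA.
have Bln := ln_lift_le eta0.
have -> : powR (1 + (1 + eta) * (23 / 250)) (n%:R / 2) = expR (n%:R / 2 * ln (1 + (1 + eta) * (23 / 250))).
  by rewrite /powR gt_eqF.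
have -> : powR 2 (401 / 1000 * n.+1%:R) = expR (401 / 1000 * n.+1%:R * ln 2) :> R by rewrite /powR gt_eqF.
have -> : C * n.+2%:R * expR (n.+2%:R * kap) / g1 = C / g1 * expR kap * n.+2%:R * expR (n.+1%:R * kap).
  by rewrite -[in LHS](natr1 n.+1) mulrDl mul1r expRD; ring.
have e2 : expR (n%:R / 2 * ln (1 + (1 + eta) * (23 / 250))) <= expR (n%:R / 2 * (ln (273 / 250) + eta)).
  by rewrite ler_expR ler_wpM2l// divr_ge0.
apply: le_trans (ler_wpM2l _ e2) _.
  by rewrite !mulr_ge0 ?expR_ge0 ?invr_ge0// ltW.
rewrite -[leLHS]mulrA; apply: le_trans (ler_wpM2r _ hl) _.
  by rewrite mulr_ge0 ?expR_ge0.
rewrite -(natr1 n).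
exact: (@lift_exponent_le R n%:R kap (ln (273 / 250)) (ln 2) eta (ler0n _ _) (ln_lift_ge0 R) (ltW eta0) erefl).
Unshelve. all: by end_near. Qed.

(** * Independent sets and the hard-core model *)

Module HardCore.
Import fintype mathcomp.boot.finset.
Local Close Scope classical_set_scope.
Local Open Scope set_scope.

Section HardCore.
Context (R : realType) (V : finType) (e : rel V) (lam : V -> R).
Hypothesis e_sym : symmetric e.
Hypothesis e_refl : reflexive e.
Hypothesis lam0 : forall a, 0 <= lam a.
Implicit Types (U I J A : {set V}) (u v a b : V).

(** As [e] is reflexive, this is the closed neighbourhood. Below, [hcZ] is the partition function of
    the hard-core model with fugacities [lam] and [hcN] its unnormalized expected size. *)
Definition nbr (u : V) : {set V} := [set a | e u a].
Definition indep (I : {set V}) := [forall a in I, forall b in I, (a != b) ==> ~~ e a b].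
Definition ind (U I : {set V}) := (I \subset U) && indep I.
Definition wt (I : {set V}) : R := \prod_(a in I) lam a.
Definition hcZ (U : {set V}) : R := \sum_(I | ind U I) wt I.
Definition hcN (U : {set V}) : R := \sum_(I | ind U I) wt I * #|I|%:R.
Definition lamS (U : {set V}) : R := \sum_(a in U) lam a.

Lemma indepP (I : {set V}) : reflect (forall a b, a \in I -> b \in I -> a != b -> ~~ e a b) (indep I).
Proof.
apply: (iffP forall_inP) => [h a b aI bI ab|h a aI].
  by move/forall_inP: (h a aI) => /(_ b bI); rewrite ab.
by apply/forall_inP => b bI; apply/implyP; exact: h.
Qed.

Lemma indepS (I J : {set V}) : I \subset J -> indep J -> indep I.
Proof.
move=> /subsetP IJ /indepP h; apply/indepP => a b aI bI; apply: h; exact: IJ.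
Qed.

Lemma wt_ge0 I : 0 <= wt I. Proof. by apply: prodr_ge0. Qed.

Lemma hcZ_ge0 U : 0 <= hcZ U. Proof. by apply: sumr_ge0 => I _; exact: wt_ge0. Qed.

Lemma ind0 U : ind U set0.
Proof. by rewrite /ind sub0set; apply/indepP => a b; rewrite inE. Qed.

Lemma hcZ_gt0 U : 0 < hcZ U.
Proof.
rewrite /hcZ (bigD1 set0 (ind0 U)) /= /wt big_set0 ltr_pwDl//.
by apply: sumr_ge0 => I _; exact: wt_ge0.
Qed.

Lemma indU1 U u I : u \in U -> u \notin I ->
  ind U (u |: I) = ind U I && [disjoint I & nbr u].
Proof.
move=> uU uI; rewrite /ind subUset sub1set uU /=; case: (boolP (I \subset U)) => //= _.
apply/idP/andP => [h|[h d]].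
  split; first by apply: indepS h; exact: subsetUr.
  rewrite disjoint_subset; apply/subsetP => a aI; rewrite inE inE.
  move/indepP: h => /(_ u a); rewrite !inE eqxx aI orbT; apply => //.
  by apply: contraNneq uI => ->.
have nu a : a \in I -> ~~ e u a.
  move=> aI; move: d; rewrite disjoint_subset => /subsetP/(_ a aI).
  by rewrite inE inE.
apply/indepP => a b; rewrite !inE => /orP[/eqP ->|aI] /orP[/eqP ->|bI] ab.
- by rewrite eqxx in ab.
- exact: nu.
- by rewrite e_sym; exact: nu.
- by move/indepP: h; apply.
Qed.

(** Deleting u is a bijection from the independent sets containing u to those avoiding its closed
    neighbourhood. *)
Lemma hc_vertex U u : u \in U ->
  \sum_(I | ind U I && (u \in I)) wt I =
  lam u * \sum_(I | ind U I && [disjoint I & nbr u]) wt I.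
Proof.
move=> uU; rewrite mulr_sumr.
rewrite (reindex_onto (fun I : {set V} => u |: I) (fun I => I :\ u)) /=; last first.
  by move=> I /andP[_ uI]; rewrite setD1K.
apply: eq_big => [I|I /andP[_ /eqP h]].
  rewrite setU11 andbT; case: (boolP (u \in I)) => uI.
    rewrite (_ : [disjoint I & nbr u] = false) ?andbF; last first.
      apply/negbTE/negP; rewrite disjoint_subset => /subsetP/(_ u uI).
      by rewrite inE inE e_refl.
    apply/negbTE; rewrite negb_and; apply/orP; right.
    by apply: contraL uI => /eqP <-; rewrite !inE eqxx.
  by rewrite indU1// setU1K// eqxx andbT.
have uI : u \notin I by rewrite -h !inE eqxx.
by rewrite /wt big_setU1.
Qed.

Lemma hc_size U : hcN U = \sum_(u in U) lam u * \sum_(I | ind U I && [disjoint I & nbr u]) wt I.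
Proof.
transitivity (\sum_(u in U) \sum_(I | ind U I && (u \in I)) wt I); last first.
  by apply: eq_bigr => u uU; exact: hc_vertex.
rewrite (exchange_big_dep (fun I => ind U I)) /= => [|u I _ /andP[]//].
apply: eq_bigr => I hI; have /andP[/subsetP IU _] := hI.
rewrite (eq_bigl (fun u => u \in I)) => [|u]; last first.
  by rewrite hI /=; apply/andb_idl; exact: IU.
by rewrite sumr_const mulr_natr.
Qed.

Lemma hcZ_le U : hcZ U <= expR (lamS U).
Proof.
have [n nE] : exists n, n = #|U| by eexists.
elim: n U nE => [|n IH] U nE.
  have U0 : U = set0 by apply/eqP; rewrite -cards_eq0 -nE.
  rewrite U0 /lamS big_set0 expR0 /hcZ (bigD1 set0 (ind0 _)) /= /wt big_set0 big1 ?addr0//.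
  by move=> I /andP[/andP[]]; rewrite subset0 => ->.
have [u uU] : exists u, u \in U by apply/set0Pn; rewrite -cards_eq0 -nE.
have h1 : hcZ U <= (1 + lam u) * hcZ (U :\ u).
  rewrite /hcZ (bigID (fun I => u \in I)) /= hc_vertex// addrC mulrDl mul1r; apply: lerD.
    rewrite le_eqVlt; apply/orP; left; apply/eqP; apply: eq_bigl => I.
    by rewrite /ind subsetD1 -!andbA; congr (_ && _); rewrite andbC.
  apply: ler_wpM2l => //; rewrite [leLHS]big_mkcond [leRHS]big_mkcond; apply: ler_sum => I _.
  case: ifP => [/andP[/andP[IU hI] d]|_]; last by case: ifP => // _; exact: wt_ge0.
  rewrite ifT// /ind subsetD1 IU hI andbT /=; apply/negP => uI.
  move: d; rewrite disjoint_subset => /subsetP/(_ u uI).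
  by rewrite inE inE e_refl.
apply: le_trans h1 _.
rewrite /lamS (big_setD1 u uU) /= expRD; apply: ler_pM.
- by rewrite addr_ge0.
- exact: hcZ_ge0.
- exact: expR_ge1Dx.
- by apply: IH; move: nE; rewrite (cardsD1 u) uU add1n => -[].
Qed.

(** A vertex is free with probability at least one minus the expected occupation of its
    neighbourhood; each neighbour is occupied with probability at most its fugacity. *)
Lemma hcN_ge U K : \sum_(u in U) lam u * lamS (nbr u :&: U) <= K * lamS U ->
  hcZ U * (lamS U * (1 - K)) <= hcN U.
Proof.
move=> hK; rewrite hc_size.
apply: (@le_trans _ _ (\sum_(u in U) lam u * (hcZ U - hcZ U * lamS (nbr u :&: U)))).
  have -> : \sum_(u in U) lam u * (hcZ U - hcZ U * lamS (nbr u :&: U)) =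
    hcZ U * (lamS U - \sum_(u in U) lam u * lamS (nbr u :&: U)).
    rewrite /lamS -sumrB mulr_sumr; apply: eq_bigr => u _; ring.
  by apply: (ler_wpM2l (hcZ_ge0 U)); rewrite mulrBr mulr1 (mulrC _ K) lerD2l lerN2.
apply: ler_sum => u uU; apply: ler_wpM2l => //.
rewrite lerBlDr [leLHS](bigID (fun I => [disjoint I & nbr u])) /= lerD2l.
apply: (@le_trans _ _ (\sum_(a in nbr u :&: U) \sum_(I | ind U I && (a \in I)) wt I)).
  rewrite (exchange_big_dep (fun I => ind U I)) /= => [|a I _ /andP[]//].
  rewrite [leLHS]big_mkcond [leRHS]big_mkcond; apply: ler_sum => I _.
  case: (boolP (ind U I)) => //= hI; case: ifP => [d|_]; last first.
    by apply: sumr_ge0 => a _; exact: wt_ge0.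
  move: d; rewrite -setI_eq0 => /set0Pn[a]; rewrite inE => /andP[aI au].
  have aU : a \in U by case/andP: hI => /subsetP/(_ a aI).
  rewrite (bigD1 a) /=; last by rewrite !inE aI aU; move: au; rewrite inE => ->.
  by rewrite lerDl; apply: sumr_ge0 => b _; exact: wt_ge0.
rewrite mulr_sumr; apply: ler_sum => a; rewrite inE => /andP[_ aU].
rewrite hc_vertex// mulrC; apply: ler_wpM2r => //.
rewrite [leRHS](bigID (fun I => [disjoint I & nbr a])) /= lerDl.
by apply: sumr_ge0 => I _; exact: wt_ge0.
Qed.

Definition free_part (S J : {set V}) : {set V} := [set u in S | [disjoint J & nbr u]].

(** The spatial Markov property: given the part J outside S, the part inside S is a hard-core
    configuration on the vertices of S that J does not block. *)
Lemma hc_split (S : {set V}) (g : {set V} -> {set V} -> R) :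
  \sum_(I | indep I) wt I * g (I :\: S) (I :&: S) =
  \sum_(J | indep J && [disjoint J & S]) wt J * \sum_(A | ind (free_part S J) A) wt A * g J A.
Proof.
rewrite (partition_big (fun I => I :\: S) (fun J => indep J && [disjoint J & S])) /=; last first.
  move=> I hI; rewrite (indepS (subsetDl I S) hI) /= disjoint_subset.
  by apply/subsetP => a; rewrite !inE => /andP[].
apply: eq_bigr => J /andP[hJ dJ]; rewrite mulr_sumr.
have JS a : a \in J -> a \notin S.
  by move: dJ; rewrite disjoint_subset => /subsetP/(_ a) /[apply]; rewrite inE.
rewrite (reindex_onto (fun A => J :|: A) (fun I => I :&: S)) /=; last first.
  by move=> I /andP[_ /eqP <-]; rewrite setUC setID.
have fp A : A \subset S -> (J :|: A) :\: S = J /\ (J :|: A) :&: S = A.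
  move=> /subsetP AS; split; apply/setP => a; rewrite !inE.
    case: (boolP (a \in J)) => aJ /=; first by rewrite andbT JS.
    by case: (boolP (a \in A)) => [/AS ->|]; rewrite ?andbF.
  case: (boolP (a \in J)) => aJ /=.
    by rewrite (negbTE (JS _ aJ)); apply/esym/negbTE; apply: contra (JS _ aJ) => /AS.
  by apply: andb_idr => /AS.
apply: eq_big => [A|A /andP[/andP[_ /eqP h1] /eqP h2]]; last first.
  rewrite h1 h2 mulrA; congr (_ * _); rewrite /wt.
  have AS : A \subset S by rewrite -h2 subsetIr.
  have d : [disjoint J & A].
    rewrite disjoint_subset; apply/subsetP => a aJ; rewrite inE.
    by apply: contra (JS _ aJ) => /(subsetP AS).
  by rewrite -bigU//; apply: eq_bigl => a; rewrite !inE.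
apply/idP/idP => [/andP[/andP[hJA /eqP _] /eqP h2]|/andP[Af hA]].
  have AS : A \subset S by rewrite -h2 subsetIr.
  rewrite /ind (indepS (subsetUr J A) hJA) andbT; apply/subsetP => a aA.
  rewrite inE (subsetP AS _ aA) /= disjoint_subset; apply/subsetP => b bJ.
  rewrite inE inE; move/indepP: hJA; apply; rewrite ?inE ?aA ?bJ ?orbT//.
  by apply: contraTneq (subsetP AS _ aA) => ->; exact: JS.
have AS : A \subset S by apply/subsetP => a /(subsetP Af); rewrite inE => /andP[].
have [-> ->] := fp A AS; rewrite !eqxx !andbT.
have nJA a b : a \in J -> b \in A -> ~~ e b a.
  move=> aJ /(subsetP Af); rewrite inE => /andP[_]; rewrite disjoint_subset.
  by move=> /subsetP/(_ a aJ); rewrite inE inE.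
apply/indepP => a b; rewrite !inE => /orP[aJ|aA] /orP[bJ|bA] ab.
- by move/indepP: hJ; apply.
- by rewrite e_sym; exact: nJA.
- exact: nJA.
- by move/indepP: hA; apply.
Qed.

(* It suffices to count each adjacent pair once, from its end with the smaller
   value of [f]. *)
Lemma one_sided_codegree (f : V -> R) (v : V) (K : R) :
  (forall u, e v u -> \sum_(a | [&& e v a, e u a & f u <= f a]) lam a <= K) ->
  forall U, U \subset nbr v -> \sum_(u in U) lam u * lamS (nbr u :&: U) <= 2 * K * lamS U.
Proof.
move=> hK U UN.
have eU u : u \in U -> e v u by move=> /(subsetP UN); rewrite inE.
pose S := \sum_(u in U) \sum_(a in U | e u a && (f u <= f a)) lam u * lam a.
have hS : S <= K * lamS U.
  rewrite /S /lamS mulr_sumr; apply: ler_sum => u uU; rewrite -mulr_sumr mulrC.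
  apply: ler_wpM2r => //; apply: le_trans (hK u (eU u uU)).
  rewrite [leLHS]big_mkcond [leRHS]big_mkcond; apply: ler_sum => a _.
  case: ifP => [/andP[/eU -> ->]//|_]; by case: ifP.
have sw : \sum_(u in U) \sum_(a in U | e u a && (f a <= f u)) lam u * lam a = S.
  rewrite /S (exchange_big_dep (fun a => a \in U)) /= => [|u a _ /andP[]//].
  by apply: eq_bigr => a aU; apply: eq_big => [u|u _]; [rewrite aU /= e_sym|rewrite mulrC].
apply: (@le_trans _ _ (S + S)); last first.
  by rewrite -mulrA; move: hS; move: (K * lamS U) => x; lra.
rewrite -{2}sw /S -big_split; apply: ler_sum => u uU /=.
rewrite /lamS mulr_sumr [leLHS]big_mkcond [X in X + _]big_mkcond [X in _ + X]big_mkcond -big_split.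
apply: ler_sum => a _ /=; rewrite !inE; case: (a \in U); rewrite /= ?andbF ?andbT ?addr0//.
have la : 0 <= lam u * lam a by rewrite mulr_ge0.
case: (e u a); rewrite /= ?addr0//.
by case: (lerP (f u) (f a)) => h; rewrite ?lerDl ?(ltW h) ?add0r//; case: ifP.
Qed.

Variables (D K : R) (al : nat).
Hypothesis D0 : 0 <= D.
Hypothesis hD : forall u, lamS (nbr u) <= D.
Hypothesis hK : forall v (U : {set V}), U \subset nbr v ->
  \sum_(u in U) lam u * lamS (nbr u :&: U) <= K * lamS U.
Hypothesis K1 : K < 1.
Hypothesis hal : forall I, indep I -> (#|I| <= al)%N.

(** Two lower bounds for the expected size. By [step1], the neighbourhood of v is empty with
    conditional probability 1 / Z(T) >= exp (- lam(T)), where T is its free part, and exp is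
    replaced by its tangent at - t. By [step2], that neighbourhood holds on average (1 - K) lam(T)
    points. The expectation of lam(T) enters with opposite signs and is eliminated. *)
Lemma hardcore_le t : (1 + t) * \sum_v lam v <= al%:R * (expR t + D / (1 - K)).
Proof.
pose Z := hcZ setT; have Z0 : 0 < Z by exact: hcZ_gt0.
have indT I : ind setT I = indep I by rewrite /ind subsetT.
have ZE : Z = \sum_(I | indep I) wt I by apply: eq_bigl => I; exact: indT.
pose Nn := hcN setT.
have NnE : Nn = \sum_(I | indep I) wt I * #|I|%:R by apply: eq_bigl => I; exact: indT.
have Nle : Nn <= al%:R * Z.
  rewrite NnE ZE mulr_sumr; apply: ler_sum => I hI; rewrite mulrC ler_wpM2r ?wt_ge0//.
  by rewrite ler_nat hal.
pose T v J := free_part (nbr v) J.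
(* [Z] times the expected total fugacity of the free part of the neighbourhood of v. *)
pose F v := \sum_(J | indep J && [disjoint J & nbr v]) wt J * (hcZ (T v J) * lamS (T v J)).
have Zs v : Z = \sum_(J | indep J && [disjoint J & nbr v]) wt J * hcZ (T v J).
  rewrite ZE; transitivity (\sum_(I | indep I) wt I * (fun _ _ => 1) (I :\: nbr v) (I :&: nbr v)).
    by apply: eq_bigr => I _; rewrite mulr1.
  rewrite (hc_split (nbr v) (fun _ _ => 1)); apply: eq_bigr => J _; congr (_ * _); apply: eq_bigr => A _.
  by rewrite mulr1.
have step1 v : expR (- t) * ((1 + t) * Z - F v) <= \sum_(I | indep I && [disjoint I & nbr v]) wt I.
  have -> : expR (- t) * ((1 + t) * Z - F v) =
    \sum_(J | indep J && [disjoint J & nbr v]) wt J * (hcZ (T v J) * (expR (- t) * (1 + t - lamS (T v J)))).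
    rewrite (Zs v) /F mulr_sumr -sumrB mulr_sumr; apply: eq_bigr => J _; ring.
  apply: ler_sum => J _; rewrite -[leRHS]mulr1; apply: (ler_wpM2l (wt_ge0 J)).
  apply: (@le_trans _ _ (hcZ (T v J) * expR (- lamS (T v J)))).
    apply: (ler_wpM2l (hcZ_ge0 _)).
    have E : - lamS (T v J) = - t + (t - lamS (T v J)) by ring.
    rewrite [in leRHS]E expRD; apply: (ler_wpM2l (expR_ge0 _)).
    by have := expR_ge1Dx (t - lamS (T v J)); rewrite addrA.
  by rewrite -ler_pdivlMr ?expR_gt0// -expRN opprK mul1r; exact: hcZ_le.
have step2 v : (1 - K) * F v <= \sum_(I | indep I) wt I * #|I :&: nbr v|%:R.
  rewrite (hc_split (nbr v) (fun _ A => #|A|%:R)) /F mulr_sumr; apply: ler_sum => J _.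
  rewrite mulrCA; apply: (ler_wpM2l (wt_ge0 J)); rewrite mulrCA (mulrC (1 - K)).
  apply: hcN_ge; apply: (hK (v := v)).
  by apply/subsetP => a; rewrite !inE => /andP[].
have sum2 : \sum_v lam v * \sum_(I | indep I) wt I * #|I :&: nbr v|%:R <= D * Nn.
  rewrite NnE mulr_sumr; under eq_bigr do rewrite mulr_sumr.
  rewrite exchange_big /=; apply: ler_sum => I hI.
  have -> : \sum_v lam v * (wt I * #|I :&: nbr v|%:R) = wt I * \sum_(u in I) lamS (nbr u).
    rewrite mulr_sumr /lamS; under [RHS]eq_bigr do rewrite mulr_sumr.
    rewrite (exchange_big_dep xpredT) //=; apply: eq_bigr => v _.
    rewrite (eq_bigl (fun u => u \in I :&: nbr v)) => [|u]; last by rewrite !inE e_sym.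
    by rewrite sumr_const -mulr_natr; ring.
  rewrite mulrCA; apply: (ler_wpM2l (wt_ge0 I)).
  by rewrite mulr_natr -sumr_const; apply: ler_sum => u _.
have sum1 : expR (- t) * ((1 + t) * Z * \sum_v lam v - \sum_v lam v * F v) <= Nn.
  rewrite /Nn hc_size; apply: (@le_trans _ _ (\sum_v lam v * (expR (- t) * ((1 + t) * Z - F v)))).
    rewrite le_eqVlt; apply/orP; left; apply/eqP.
    by rewrite !mulr_sumr -sumrB mulr_sumr; apply: eq_bigr => v _; ring.
  rewrite [leRHS](eq_bigl xpredT) => [|u]; last by rewrite inE.
  apply: ler_sum => v _; apply: (ler_wpM2l (lam0 v)); apply: le_trans (step1 v) _.
  by rewrite le_eqVlt; apply/orP; left; apply/eqP; apply: eq_bigl => I; rewrite indT.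
have K0 : 0 < 1 - K by rewrite subr_gt0.
have sumF : \sum_v lam v * F v <= D / (1 - K) * Nn.
  rewrite mulrAC ler_pdivlMr// mulrC; apply: le_trans sum2.
  by rewrite mulr_sumr; apply: ler_sum => v _; rewrite mulrCA ler_wpM2l.
have N0 : 0 <= Nn by apply: sumr_ge0 => I _; rewrite mulr_ge0// wt_ge0.
rewrite expRN ler_pdivrMl ?expR_gt0// in sum1.
have : (1 + t) * Z * \sum_v lam v <= Nn * (expR t + D / (1 - K)).
  by rewrite mulrDr (mulrC Nn (D / _)) -lerBlDr (mulrC Nn); apply: le_trans sum1; rewrite lerD2l lerN2.
move=> h.
have De0 : 0 <= expR t + D / (1 - K).
  by rewrite addr_ge0 ?expR_ge0// divr_ge0 ?(ltW K0).
have : (1 + t) * Z * \sum_v lam v <= al%:R * Z * (expR t + D / (1 - K)).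
  by apply: le_trans h _; apply: ler_wpM2r.
by rewrite mulrAC (mulrAC al%:R) ler_pM2r.
Qed.

End HardCore.
Lemma independent_seq (R : realType) (V : finType) (e : rel V) (lam : V -> R)
    (f : V -> V -> R) (D K t : R) : symmetric e -> reflexive e -> (forall a, 0 <= lam a) ->
  (forall u, \sum_(a | e u a) lam a <= D) ->
  (forall v u, e v u -> \sum_(a | [&& e v a, e u a & f v u <= f v a]) lam a <= K) ->
  0 <= D -> 2 * K < 1 ->
  exists s : seq V, pairwise (fun a b => ~~ e a b) s /\
    (1 + t) * \sum_v lam v <= (size s)%:R * (expR t + D / (1 - 2 * K)).
Proof.
move=> es er l0 hD hK D0 K1.
have i0 : indep e set0 by apply/indepP => a b; rewrite inE.
case: (@arg_maxnP _ set0 (indep e) (fun I : {set V} => #|I|) i0) => I hI maxI.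
exists (enum I); split.
  apply: (@sub_in_pairwise _ (mem I) (fun a b => a != b)); last 2 first.
  - by apply/allP => a; rewrite mem_enum.
  - by rewrite -uniq_pairwise enum_uniq.
  by move=> a b aI bI; move/indepP: hI; apply.
rewrite -cardE; apply: (hardcore_le es er l0 D0 _ _ K1) => [u|v U UN|J hJ].
- by rewrite /lamS (eq_bigl (fun a => e u a)) // => a; rewrite inE.
- exact: (one_sided_codegree (f := f v) es l0 (hK v)).
- exact: maxI.
Qed.

End HardCore.

(** * The lower bound in high dimension *)

Lemma probability_preimage (R : realType) dsp (T : measurableType dsp) (P : probability T R)
    (V : finType) (f : T -> V) (B : pred V) : (forall a, measurable [set w | f w = a]) ->
  measurable [set w | B (f w)] /\
  (P [set w | B (f w)] = \sum_(a | B a) P [set w | f w = a])%E.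
Proof.
move=> mf; have mB : measurable [set w | B (f w)].
  have -> : [set w | B (f w)] = \bigcup_(a in [set a | B a]) [set w | f w = a].
    apply/seteqP; split=> [w Bw|w [a Ba h]]; first by exists (f w).
    by rewrite /= in h *; rewrite h.
  by apply: fin_bigcup_measurable => //; exact: finite_finset.
split=> //; transitivity (\int[P]_w (\sum_(a | B a) (\1_[set w | f w = a] w : R)%:E)%E)%E; last first.
  under eq_integral do rewrite -big_filter.
  rewrite ge0_integral_sum//.
    by rewrite big_filter; apply: eq_bigr => a _; rewrite integral_indic// setIT.
  by move=> a; apply/measurable_EFinP; exact: measurable_indic.
rewrite -(setIT [set w | _]) -integral_indic//; apply: eq_integral => w _.
rewrite sumEFin; congr EFin; rewrite big_mkcond (bigD1 (f w))//= big1 ?addr0.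
  rewrite !indicE; case: ifP => Bw; first by rewrite !mem_set.
  by rewrite memNset//= Bw.
by move=> a /eqP aw; case: ifP => // _; rewrite indicE memNset//= => /esym.
Qed.

(** The bound of [cap_le] for the proportion of the sphere of R^(n+1) in a cap of cosine c. *)
Definition cap_bound (R : realType) (n : nat) (c : R) : R :=
  (Num.sqrt (pi *+ 2))^-1 * powR (1 - c ^+ 2) (n%:R / 2) / (c * Num.sqrt (n%:R - 2)).

Lemma level_code_dist (R : realType) (m : nat) (x y : R) : 0 <= x <= m%:R -> 0 <= y <= m%:R ->
  (forall k : 'I_m.+1, (k%:R <= x) = (k%:R <= y)) -> `|x - y| <= 1.
Proof.
have half (a b : R) : 0 <= a <= m%:R -> 0 <= b -> (forall k : 'I_m.+1, (k%:R <= a) = (k%:R <= b)) -> a - b <= 1.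
  move=> /andP[a0 am] b0 h; have /andP[ka ka1] := truncn_itv a0.
  have km : (Num.truncn a < m.+1)%N by rewrite ltnS -(ler_nat R); exact: le_trans ka am.
  have := h (Ordinal km); rewrite /= ka => /esym kb.
  by rewrite lerBlDr -natr1 in ka1 *; apply: le_trans (ltW ka1) _; rewrite addrC lerD2l.
move=> hx hy h; rewrite ler_norml; have /andP[x0 _] := hx; have /andP[y0 _] := hy.
have := half x y hx y0 h; have := half y x hy x0 (fun k => esym (h k)); lra.
Qed.

Lemma dot_coord_le1 (R : realType) n (x : 'rV[R]_n) i : dot x x = 1 -> `|x 0 i| <= 1.
Proof.
move=> x1; rewrite -(@ler_pXn2r _ 2)// ?nnegrE// expr1n -normrX ger0_norm ?sqr_ge0// -x1.
rewrite /dot (bigD1 i)//= -expr2 lerDl; apply: sumr_ge0 => j _; rewrite -expr2; exact: sqr_ge0.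
Qed.

Lemma unit_scale (R : realType) n (x : 'rV[R]_n) : x != 0 ->
  0 < Num.sqrt (dot x x) /\ dot ((Num.sqrt (dot x x))^-1 *: x) ((Num.sqrt (dot x x))^-1 *: x) = 1.
Proof.
move=> x0; have s0 : 0 < Num.sqrt (dot x x).
  rewrite sqrtr_gt0 lt_def dot_ge0 andbT; apply: contra x0 => /eqP/dot_eq0 ->.
  exact: eqxx.
split=> //; rewrite dotZl dotZr -{3}(@sqr_sqrtr _ (dot x x)) ?dot_ge0//; field.
by rewrite gt_eqF.
Qed.

(* The cells of the partition group the directions of the gaussian vector [u]
   with the same position relative to a fine grid. *)
Lemma sphere_partition (R : realType) (n : nat) (dl : R) : 0 < dl -> (2 < n)%N ->
  exists (V : finType) (v : V -> 'rV[R]_n.+1) (p : V -> R),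
  [/\ forall a, dot (v a) (v a) = 1, forall a, 0 <= p a, \sum_a p a = 1
  & forall (B : pred V) x c, 0 < c < 1 -> dot x x = 1 -> (forall a, B a -> c + dl <= dot x (v a)) ->
    \sum_(a | B a) p a <= cap_bound n c].
Proof.
move=> dl0 n2; have [dsp [T [P [u [mu law]]]]] := @gaussian_vector_exists R n.
pose m := (Num.truncn (n.+1%:R / dl)).+1.
have mdl : n.+1%:R / m%:R <= dl.
  rewrite ler_pdivrMr ?ltr0n// mulrC -ler_pdivrMr//; apply: ltW.
  by have := truncnS_gt (n.+1%:R / dl).
have m0 : 0 < m%:R :> R by rewrite ltr0n.
pose nu w : R := Num.sqrt (dot (u w) (u w)).
have nu0 w : 0 <= nu w by exact: sqrtr_ge0.
(* Comparing m (u_i / |u| + 1) with every integer level determines its integer part. The inequality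
   is multiplied by |u| so that it also makes sense when u vanishes. *)
pose code w : {ffun 'I_n.+1 * 'I_(2 * m).+1 -> bool} :=
  [ffun ik => (nat_of_ord ik.2)%:R * nu w <= m%:R * (u w ord0 ik.1 + nu w)].
have mnu : measurable_fun setT (fun w => nu w : measurableTypeR R).
  by apply: (measurableT_comp (@measurable_sqrt R)); exact: measurable_dotuu.
have mcode a : measurable [set w | code w = a].
  have -> : [set w | code w = a] = \bigcap_(ik in setT) [set w | code w ik = a ik].
    apply/seteqP; split=> [w <- //|w h]; apply/ffunP => ik; exact: h.
  apply: fin_bigcap_measurable => [|ik _]; first exact: finite_finset.
  have mS : measurable [set w | (ik.2%:R * nu w <= m%:R * (u w 0 ik.1 + nu w))%R].
    apply: measurable_set_ler; apply: measurable_funM => //.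
    by apply: measurable_funD => //; exact: mu.
  case: (a ik).
    by congr measurable : mS; apply/seteqP; split=> w /=; rewrite ffunE.
  have := measurableC mS; congr measurable; apply/seteqP; split=> w /=; rewrite ffunE.
    by move/negP/negbTE.
  by move=> ->.
pose e0 : 'rV[R]_n.+1 := delta_mx 0 0.
have e01 : dot e0 e0 = 1.
  rewrite /dot (bigD1 ord0)//= !mxE !eqxx mulr1 big1 ?addr0// => i /negbTE i0.
  by rewrite !mxE i0 andbF mul0r.
(* Every cell gets a unit vector within 1/m, in each coordinate, of all its directions; cells
   without a nonzero vector get a default one. *)
have rep a : exists x : 'rV[R]_n.+1, dot x x = 1 /\
    forall w, code w = a -> u w != 0 -> forall i, `|x 0 i - u w 0 i / nu w| <= m%:R^-1.
  have [[w0 [w0a w00]]|h] := pselect (exists w, code w = a /\ u w != 0); last first.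
    by exists e0; split=> // w wa w0; case: h; exists w.
  have [s0 s1] := unit_scale w00; exists ((nu w0)^-1 *: u w0); split=> // w wa wn i.
  have [t0 t1] := unit_scale wn.
  rewrite mxE (mulrC _^-1); set x := u w0 0 i / nu w0; set y := u w 0 i / nu w.
  have x1 : `|x| <= 1 by have := dot_coord_le1 i s1; rewrite mxE mulrC.
  have y1 : `|y| <= 1 by have := dot_coord_le1 i t1; rewrite mxE mulrC.
  have lv w' (k : 'I_(2 * m).+1) : 0 < nu w' -> code w' (i, k) = (k%:R <= m%:R * (u w' 0 i / nu w' + 1)).
    move=> w'0; rewrite ffunE /=.
    have -> : m%:R * (u w' 0 i / nu w' + 1) = m%:R * (u w' 0 i + nu w') / nu w' by field; rewrite gt_eqF.
    by rewrite ler_pdivlMr.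
  have rg (z : R) : `|z| <= 1 -> 0 <= m%:R * (z + 1) <= (2 * m)%:R.
    rewrite ler_norml => /andP[z0 z1]; rewrite natrM mulr_ge0 ?ler0n//=; last by lra.
    by rewrite (mulrC 2) ler_wpM2l//; lra.
  have := level_code_dist (rg x x1) (rg y y1) _.
  have -> : m%:R * (x + 1) - m%:R * (y + 1) = m%:R * (x - y) by ring.
  rewrite normrM (ger0_norm (ltW m0)) -[X in _ -> _ <= X]mulr1 ler_pdivlMl//; apply=> k.
  by rewrite -!lv// wa w0a.
have [v vP] := choice rep.
pose p a := fine (P [set w | code w = a]).
have pE a : ((p a)%:E = P [set w | code w = a])%E by rewrite /p fineK// fin_num_measure.
have sumE (B : pred {ffun 'I_n.+1 * 'I_(2 * m).+1 -> bool}) :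
    ((\sum_(a | B a) p a)%:E = P [set w | B (code w)])%E.
  have [_ ->] := probability_preimage P B mcode.
  by rewrite -sumEFin; apply: eq_bigr => a _.
exists {ffun 'I_n.+1 * 'I_(2 * m).+1 -> bool}, v, p; split=> [a|a||B x c c01 x1 hB].
- by have [] := vP a.
- by rewrite fine_ge0.
- by apply: EFin_inj; rewrite sumE -[RHS](@probability_setT _ _ _ P); congr (P _); apply/seteqP; split.
rewrite -lee_fin sumE; apply: le_trans (cap_le law mu n2 c01 x1).
have mS : measurable [set w | (c * Num.sqrt (dot (u w) (u w)) <= dot x (u w) :> R)%R].
  apply: measurable_set_ler; last exact: measurable_dotl.
  by apply: measurable_funM.
apply: le_measure; rewrite ?inE//.
  by have [] := probability_preimage P B mcode.
move=> w /= Bw; have [uw0|uw0] := eqVneq (u w) 0.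
  by rewrite uw0 /dot !big1 ?sqrtr0 ?mulr0// => i _; rewrite mxE mulr0.
have [s0 s1] := unit_scale uw0; have [_ hv] := vP (code w).
rewrite -ler_pdivlMr//.
(* Replacing the direction by the representative of its cell costs at most (n + 1) / m, hence at
   most [dl]. *)
have -> : dot x (u w) / nu w = dot x (v (code w)) - \sum_i x 0 i * (v (code w) 0 i - u w 0 i / nu w).
  rewrite /dot mulr_suml -sumrB; apply: eq_bigr => i _; ring.
have : `|\sum_i x 0 i * (v (code w) 0 i - u w 0 i / nu w)| <= dl.
  apply: le_trans mdl; apply: le_trans (ler_norm_sum _ _ _) _.
  have -> : n.+1%:R / m%:R = \sum_(i < n.+1) m%:R^-1 :> R by rewrite sumr_const card_ord mulr_natl.
  apply: ler_sum => i _; rewrite normrM -[leRHS]mul1r; apply: ler_pM => //; first exact: dot_coord_le1.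
  exact: hv.
rewrite ler_norml => /andP[_ h]; have := hB _ Bw; lra.
Qed.

Lemma inv_sqrt3_bounds (R : realType) : 1 / 2 < (Num.sqrt (3 : R))^-1 < 7 / 10.
Proof.
have s3 : 0 < Num.sqrt 3 :> R by rewrite sqrtr_gt0.
have e : Num.sqrt 3 ^+ 2 = 3 :> R by rewrite sqr_sqrtr.
apply/andP; split.
  rewrite div1r ltf_pV2 ?posrE// -(@ltr_pXn2r _ 2)// ?nnegrE ?(ltW s3)// e; lra.
have : 10 / 7 < Num.sqrt 3 :> R.
  by rewrite -(@ltr_pXn2r _ 2)// ?nnegrE ?(ltW s3)// ?e; lra.
by move=> h; rewrite -div1r ltr_pdivrMr//; lra.
Qed.

(** Two unit vectors at cosine s have a sum of norm the square root of 2 + 2 s. A vector with inner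
    products at least 1/2 and s has cosine (1/2 + s) over this with their bisector, smallest at s =
    1/2. *)
Lemma bisector_dot_ge (R : realType) (s b : R) : 1 / 2 <= s -> 1 / 2 + s <= b ->
  (Num.sqrt 3)^-1 <= (Num.sqrt (2 + 2 * s))^-1 * b.
Proof.
move=> s0 sb; have q0 : 0 < Num.sqrt (2 + 2 * s) by rewrite sqrtr_gt0; lra.
have q3 : 0 < Num.sqrt 3 :> R by rewrite sqrtr_gt0.
rewrite ler_pdivlMl// -ler_pdivlMr ?invr_gt0// invrK.
rewrite -(@ler_pXn2r _ 2)// ?nnegrE ?(ltW q0)//; last by apply: mulr_ge0; [lra|exact: ltW].
rewrite exprMn !sqr_sqrtr//; last by lra.
nra.
Qed.

Lemma cap_bound_ge0 (R : realType) n (c : R) : 0 <= c -> 0 <= cap_bound n c.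
Proof.
by move=> c0; rewrite /cap_bound !mulr_ge0 ?invr_ge0 ?powR_ge0 ?sqrtr_ge0// mulr_ge0// sqrtr_ge0.
Qed.

Lemma packing_euclidean_ge (R : realType) (n : nat) (dl L t : R) : (2 < n)%N -> 0 < dl < 1 / 4 ->
  0 < L -> 2 * (L * cap_bound n ((Num.sqrt 3)^-1 - dl)) < 1 ->
  exists s : seq 'rV[R]_n.+1, packing (@euclidean_norm R n.+1) s /\
    (1 + t) * L <= (size s)%:R *
      (expR t + L * cap_bound n (1 / 2 - dl) / (1 - 2 * (L * cap_bound n ((Num.sqrt 3)^-1 - dl)))).
Proof.
move=> n2 /andP[dl0 dl1] L0 hL.
have [V [v [p [v1 p0 psum hp]]]] := sphere_partition dl0 n2.
have /andP[q0 q1] := inv_sqrt3_bounds R.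
pose e : rel V := fun a b => 2^-1 <= dot (v a) (v b).
have es : symmetric e by move=> a b; rewrite /e dotC.
have er : reflexive e by move=> a; rewrite /e v1; lra.
have hD u : \sum_(a | e u a) L * p a <= L * cap_bound n (1 / 2 - dl).
  rewrite -mulr_sumr; apply: ler_wpM2l; first exact: ltW.
  apply: (hp _ (v u)) => // [|a]; first by apply/andP; split; lra.
  by rewrite /e subrK div1r.
have hK w u : e w u -> \sum_(a | [&& e w a, e u a & dot (v w) (v u) <= dot (v w) (v a)]) L * p a <=
    L * cap_bound n ((Num.sqrt 3)^-1 - dl).
  rewrite /e => wu; rewrite -mulr_sumr; apply: ler_wpM2l; first exact: ltW.
  have nE : dot (v w + v u) (v w + v u) = 2 + 2 * dot (v w) (v u).
    by rewrite dotDl !dotDr !v1 (dotC (v u)); ring.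
  have nz : v w + v u != 0.
    apply/negP => /eqP z; move: nE; rewrite z /dot big1 => [|i _]; last by rewrite mxE mul0r.
    rewrite -/(dot _ _) => h; clear - wu h; lra.
  have [n0 n1] := unit_scale nz.
  apply: (hp _ _ _ _ n1) => [|a /and3P[_ ua wa]]; first by apply/andP; split; lra.
  rewrite subrK nE dotZl dotDl; apply: bisector_dot_ge; first by rewrite div1r.
  by rewrite addrC div1r; apply: lerD.
have Lp a : 0 <= L * p a by rewrite mulr_ge0// ltW.
have D0 : 0 <= L * cap_bound n (1 / 2 - dl).
  by rewrite mulr_ge0 ?(ltW L0)// cap_bound_ge0//; lra.
have [s [sP sS]] := HardCore.independent_seq t es er Lp hD hK D0 hL.
exists [seq v a | a <- s]; split; last first.
  by move: sS; rewrite -mulr_sumr psum mulr1 size_map.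
apply: packing_spherical => [x /mapP[a _ ->]|]; first exact: v1.
rewrite pairwise_map; apply: sub_pairwise sP => a b /=; by rewrite /e -ltNge.
Qed.

Lemma ln_le_scale (R : realType) (a b e : R) : 0 < a -> 0 < b -> b <= a * (1 + e) -> ln b <= ln a + e.
Proof.
move=> a0 b0 h; have e1 : 0 < 1 + e.
  by have := lt_le_trans b0 h; rewrite pmulr_rgt0.
apply: (@le_trans _ _ (ln (a * (1 + e)))); first by rewrite ler_ln// posrE mulr_gt0.
by rewrite lnM ?posrE// lerD2l; apply: le_ln1Dx; lra.
Qed.

Lemma ln_9_8 (R : realType) : ln (9 / 8) = ln (3 / 4) - ln (2 / 3) :> R.
Proof.
by rewrite -ln_div ?posrE; [congr ln; field|lra|lra].
Qed.

Lemma ln_4_3 (R : realType) : ln (3 / 4) = - 2 * ln (2 / Num.sqrt 3) :> R.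
Proof.
have s3 : 0 < Num.sqrt 3 :> R by rewrite sqrtr_gt0.
have e : Num.sqrt 3 ^+ 2 = 3 :> R by rewrite sqr_sqrtr.
have -> : 3 / 4 = ((2 / Num.sqrt 3) ^+ 2)^-1 :> R by rewrite -{1}e; field; rewrite gt_eqF.
rewrite lnV ?posrE ?exprn_gt0 ?divr_gt0// lnXn ?divr_gt0//; ring.
Qed.

Lemma cap_bound_half_le (R : realType) (n : nat) (dl : R) : 0 < dl < 1 / 4 ->
  cap_bound n (1 / 2 - dl) <= (Num.sqrt (pi *+ 2))^-1 * (expR (2 / 3 * dl * n%:R) * (2 / Num.sqrt 3) ^- n) /
    ((1 / 2 - dl) * Num.sqrt (n%:R - 2)).
Proof.
move=> /andP[dl0 dl1]; have s3 : 0 < Num.sqrt 3 :> R by rewrite sqrtr_gt0.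
have c0 : 0 < 1 / 2 - dl by lra.
have b0 : 0 < 1 - (1 / 2 - dl) ^+ 2 by nra.
rewrite /cap_bound ler_wpM2r ?invr_ge0 ?mulr_ge0 ?sqrtr_ge0 ?(ltW c0)//.
rewrite ler_wpM2l ?invr_ge0 ?sqrtr_ge0// /powR gt_eqF//.
have q0 : 0 < 2 / Num.sqrt 3 :> R by rewrite divr_gt0.
have -> : (2 / Num.sqrt 3) ^- n = expR (- (n%:R * ln (2 / Num.sqrt 3))) :> R.
  by rewrite expRN expRM_natl lnK ?posrE.
rewrite -expRD ler_expR.
have : ln (1 - (1 / 2 - dl) ^+ 2) <= ln (3 / 4) + 4 / 3 * dl by apply: ln_le_scale => //; nra.
rewrite ln_4_3; have : 0 <= n%:R :> R by []; nra.
Qed.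

(** The squared sines of the two caps are close to 3/4 and 2/3, of ratio 9/8; this gain is the
    source of the logarithm in the final constant. *)
Lemma cap_bound_ratio (R : realType) (n : nat) (dl : R) : (2 < n)%N -> 0 < dl < 1 / 4 ->
  expR (n%:R / 2 * (ln (9 / 8) - 3 * dl)) * cap_bound n ((Num.sqrt 3)^-1 - dl) <= cap_bound n (1 / 2 - dl).
Proof.
move=> n2 /andP[dl0 dl1]; have /andP[] := inv_sqrt3_bounds R.
have e3 : (Num.sqrt (3 : R))^-1 ^+ 2 = 1 / 3 by rewrite exprVn sqr_sqrtr// div1r.
move: e3; set q := (Num.sqrt (3 : R))^-1 => e3 q0 q1.
have c0 : 0 < 1 / 2 - dl by lra.
have c1 : 0 < q - dl by lra.
have b0 : 0 < 1 - (1 / 2 - dl) ^+ 2 by nra.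
have b1 : 0 < 1 - (q - dl) ^+ 2 by nra.
have r0 : 0 < Num.sqrt (n%:R - 2 : R) by rewrite sqrtr_gt0 subr_gt0 ltr_nat.
have g0 : 0 <= (Num.sqrt (pi *+ 2))^-1 :> R by rewrite invr_ge0 sqrtr_ge0.
rewrite /cap_bound mulrA; apply: ler_pM.
- by rewrite mulr_ge0 ?expR_ge0// mulr_ge0// powR_ge0.
- by rewrite invr_ge0 mulr_ge0 ?(ltW c1)// ltW.
- rewrite mulrCA ler_wpM2l// /powR !gt_eqF// -expRD ler_expR -mulrDr ler_wpM2l ?divr_ge0//.
  have : ln (1 - (q - dl) ^+ 2) <= ln (2 / 3) + 3 * dl by apply: ln_le_scale => //; nra.
  have : ln (3 / 4) <= ln (1 - (1 / 2 - dl) ^+ 2) by rewrite ler_ln ?posrE//; nra.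
  rewrite ln_9_8; lra.
- by rewrite lef_pV2 ?posrE ?mulr_gt0// ler_wpM2r ?(ltW r0)// lerD2r ltW.
Qed.

Lemma packing_euclidean_large (R : realType) (n : nat) : (2 < n)%N ->
  exists s : seq 'rV[R]_n.+1, packing (@euclidean_norm R n.+1) s /\
    1 + (n%:R / 2 * (ln (9 / 8) - 3 / n%:R ^+ 2) - 2 * ln n%:R) <= (size s)%:R * (
    (Num.sqrt (pi *+ 2))^-1 * (expR (2 / 3 / n%:R ^+ 2 * n%:R) * (2 / Num.sqrt 3) ^- n) /
    ((1 / 2 - (n%:R ^+ 2)^-1) * Num.sqrt (n%:R - 2)) * (n%:R^-1 + n%:R / (n%:R - 2))) :> R.
Proof.
move=> n2; have n3 : 3 <= n%:R :> R by rewrite ler_nat.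
set N := n%:R in n3 *.
have N0 : 0 < N by lra.
have dlP : 0 < (N ^+ 2)^-1 < 1 / 4.
  rewrite invr_gt0 exprn_gt0//= div1r ltf_pV2 ?posrE ?exprn_gt0//; nra.
move: (cap_bound_half_le n dlP) (cap_bound_ratio n2 dlP); rewrite -/N.
set dl := (N ^+ 2)^-1 in dlP *; set S := cap_bound n (1 / 2 - dl).
have k0 : 0 < cap_bound n ((Num.sqrt 3)^-1 - dl).
  have /andP[q0 _] := inv_sqrt3_bounds R; have /andP[dl0 dl1] := dlP.
  have e3 : (Num.sqrt (3 : R))^-1 ^+ 2 = 1 / 3 by rewrite exprVn sqr_sqrtr// div1r.
  move: e3 q0; set q := (Num.sqrt (3 : R))^-1 => e3 q0.
  rewrite /cap_bound divr_gt0// mulr_gt0//.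
  - by rewrite invr_gt0 sqrtr_gt0 pmulrn_lgt0// pi_gt0.
  - by apply: powR_gt0; nra.
  - by lra.
  - by rewrite sqrtr_gt0 subr_gt0 ltr_nat.
set k := cap_bound n ((Num.sqrt 3)^-1 - dl) in k0 * => S1 S2.
(* The fugacity is as large as possible while the codegree bound K = 1/N tends to 0. *)
pose L := (N * k)^-1.
have Lk : L * k = N^-1 by rewrite /L; field; rewrite !gt_eqF.
have L0 : 0 < L by rewrite invr_gt0 mulr_gt0.
have Lk1 : 2 * (L * k) < 1 by rewrite Lk -/(2 / N) ltr_pdivrMr//; lra.
(* With this t, exp t is at most S / (k N^2) = L S / N, negligible against the degree bound L S,
   while t still grows like N ln (9/8) / 2. *)
set t := N / 2 * (ln (9 / 8) - 3 / N ^+ 2) - 2 * ln N.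
have [s [sP h]] := packing_euclidean_ge t n2 dlP L0 Lk1.
exists s; split=> //; apply: le_trans (_ : _ <= (size s)%:R * (S * (N^-1 + N / (N - 2)))) _; last first.
  apply: ler_wpM2l => //; apply: ler_wpM2r.
    by rewrite addr_ge0 ?invr_ge0 ?(ltW N0)// divr_ge0 ?(ltW N0)//; lra.
  by move: S1; rewrite (mulrC (2 / 3)) (mulrC dl).
move: h; rewrite -/S -/k Lk -ler_pdivlMr//; move/le_trans; apply.
rewrite -[leLHS]mulrA; apply: ler_wpM2l => //.
rewrite ler_pdivrMr//.
have -> : S * (N^-1 + N / (N - 2)) * L = S * N^-1 * L + L * S / (1 - 2 * N^-1).
  by field; rewrite !gt_eqF//; lra.
rewrite lerD2r /t expRD expRN expRM_natl lnK ?posrE//.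
rewrite ler_pdivrMr ?exprn_gt0//.
have -> : S * N^-1 * L * N ^+ 2 = S / k by rewrite /L; field; rewrite !gt_eqF.
by rewrite ler_pdivlMr.
Qed.

(** Five factors are each within 1 - eta of their limits, and (1 - eta)^5 >= 1 - 5 eta. *)
Lemma combine_errors (R : realFieldType) (al g E Q a r W X Y q eta : R) :
  0 <= al -> 0 < g -> 0 <= E -> 0 < Q -> 0 < a -> 0 < r -> 0 <= W -> 0 <= Y -> 0 <= q -> 0 <= eta <= 1 ->
  Y * (1 - eta) <= X -> X <= al * (g * (E / Q) / (a * r) * W) ->
  E * (1 - eta) <= 1 -> W * (1 - eta) <= 1 -> (1 - eta) / 2 <= a -> q * (1 - eta) <= r ->
  (1 - 5 * eta) * (Y * q * Q / (2 * g)) <= al.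
Proof.
move=> al0 g0 E0 Q0 a0 r0 W0 Y0 q0 /andP[e0 e1] hX X2 hE hW ha hr.
pose u := 1 - eta; have u0 : 0 <= u by rewrite subr_ge0.
have b5 : 1 - 5 * eta <= u ^+ 5.
  rewrite -subr_ge0 (_ : _ - _ = eta ^+ 2 * (10 * (1 - eta) + eta ^+ 2 * (5 - eta))); last by rewrite /u; ring.
  rewrite mulr_ge0 ?sqr_ge0// addr_ge0// ?mulr_ge0 ?sqr_ge0//; lra.
apply: le_trans (ler_wpM2r _ b5) _.
  by rewrite !mulr_ge0 ?invr_ge0 ?mulr_ge0 ?(ltW Q0) ?(ltW g0).
have h1 : Y * u * (Q * (a * r)) <= al * g * (E * W).
  rewrite -ler_pdivlMr ?mulr_gt0//; apply: le_trans hX _; apply: le_trans X2 _.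
  by rewrite le_eqVlt; apply/orP; left; apply/eqP; field; rewrite !gt_eqF.
have h2 : (E * u) * (W * u) <= 1 by rewrite -[leRHS]mulr1; apply: ler_pM; rewrite ?mulr_ge0.
have h3 : (u / 2) * (q * u) <= a * r.
  by apply: ler_pM; rewrite ?mulr_ge0 ?invr_ge0.
rewrite mulrA ler_pdivrMr ?mulr_gt0//.
apply: (@le_trans _ _ (2 * (u ^+ 2 * (Y * u * (Q * (a * r)))))).
  rewrite (_ : u ^+ 5 * (Y * q * Q) = 2 * (u ^+ 2 * (Y * u * (Q * ((u / 2) * (q * u)))))); last by field.
  rewrite ler_wpM2l// ler_wpM2l ?sqr_ge0// ler_wpM2l ?mulr_ge0// ler_wpM2l// ltW//.
apply: (@le_trans _ _ (2 * (u ^+ 2 * (al * g * (E * W))))).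
  by rewrite ler_wpM2l// ler_wpM2l ?sqr_ge0.
rewrite (_ : 2 * (_ * _) = 2 * (al * g) * (E * u * (W * u))); last by ring.
rewrite (_ : al * (2 * g) = 2 * (al * g) * 1); last by ring.
by rewrite ler_wpM2l// !mulr_ge0// ltW.
Qed.

(** The square of 3 / (2 sqrt 2) is 9/8, and sqrt (3 pi / 8) times 2 / sqrt 3 equals sqrt (2 pi) /
    2. *)
Lemma target_constant (R : realType) (n : nat) :
  Num.sqrt (3 * pi / 8) * ln (3 / (2 * Num.sqrt 2)) * powR n.+1%:R (3 / 2) * (2 / Num.sqrt 3) ^+ n.+1 =
  ln (9 / 8) / 2 * n.+1%:R * Num.sqrt n.+1%:R * (2 / Num.sqrt 3) ^+ n / (2 * (Num.sqrt (pi *+ 2))^-1) :> R.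
Proof.
have s3 : 0 < Num.sqrt 3 :> R by rewrite sqrtr_gt0.
have s2 : 0 < Num.sqrt 2 :> R by rewrite sqrtr_gt0.
have pi0 : 0 < pi :> R := pi_gt0 R.
have e1 : Num.sqrt (3 * pi / 8) * (2 / Num.sqrt 3) = Num.sqrt (pi *+ 2) / 2 :> R.
  have p1 : 0 <= pi *+ 2 :> R by rewrite pmulrn_lge0// ltW.
  have p2 : 0 <= 3 * pi / 8 :> R by rewrite divr_ge0// mulr_ge0// ltW.
  apply/eqP; rewrite -(@eqrXn2 _ 2) ?mulr_ge0 ?divr_ge0 ?sqrtr_ge0//; apply/eqP.
  rewrite !exprMn !exprVn (sqr_sqrtr p1) (sqr_sqrtr p2) (sqr_sqrtr (ler0n _ 3)).
  by rewrite -mulr_natl; field.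
have e2 : ln (3 / (2 * Num.sqrt 2)) = ln (9 / 8) / 2 :> R.
  have -> : 9 / 8 = (3 / (2 * Num.sqrt 2)) ^+ 2 :> R.
    by rewrite expr_div_n exprMn sqr_sqrtr//; field.
  by rewrite lnXn ?divr_gt0 ?mulr_gt0// -mulr_natl; field.
have e3 : powR n.+1%:R (3 / 2) = n.+1%:R * Num.sqrt n.+1%:R :> R.
  rewrite (_ : 3 / 2 = 1 + 2^-1 :> R); last by field.
  by rewrite powRD ?powRr1// ?powR12_sqrt// pnatr_eq0 implybT.
rewrite e2 e3 exprS; have p0 : 0 < Num.sqrt (pi *+ 2) :> R by rewrite sqrtr_gt0 pmulrn_lgt0.
rewrite [RHS](_ : _ = Num.sqrt (pi *+ 2) / 2 * (ln (9 / 8) / 2 * n.+1%:R * Num.sqrt n.+1%:R * (2 / Num.sqrt 3) ^+ n)); last first.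
  by field; rewrite gt_eqF.
by rewrite -e1; ring.
Qed.

Theorem packing_euclidean_asymptotic (R : realType) (eps : R) : 0 < eps <= 1 -> \forall d \near \oo,
  exists s : seq 'rV[R]_d, packing (@euclidean_norm R d) s /\
  (1 - eps) * (Num.sqrt (3 * pi / 8) * ln (3 / (2 * Num.sqrt 2)) * powR d%:R (3 / 2) * (2 / Num.sqrt 3) ^+ d)
    <= (size s)%:R.
Proof.
move=> /andP[eps0 eps1]; pose eta := eps / 5.
have eta0 : 0 < eta by rewrite divr_gt0.
have eta1 : eta <= 1 by rewrite /eta; lra.
have h0 : 0 < ln (9 / 8) :> R by rewrite ln_gt0//; lra.
have h1 : ln (9 / 8) <= 1 / 8 :> R.
  by rewrite (_ : 9 / 8 = 1 + 1 / 8 :> R); [apply: le_ln1Dx; lra|field].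
set h := ln (9 / 8) in h0 h1.
have lin := @expR_gt_linear R 1 (eta * h / 4) (divr_gt0 (mulr_gt0 eta0 h0) (ltr0Sn R 3)).
suff : \forall n \near \oo, exists s : seq 'rV[R]_n.+1, packing (@euclidean_norm R n.+1) s /\
  (1 - eps) * (Num.sqrt (3 * pi / 8) * ln (3 / (2 * Num.sqrt 2)) * powR n.+1%:R (3 / 2) * (2 / Num.sqrt 3) ^+ n.+1)
    <= (size s)%:R.
  move=> [N _ hN]; exists N.+1 => // -[//|d] /= dN; apply: hN; exact: dN.
near=> n.
have n2 : (2 < n)%N by near: n; exact: nbhs_infty_gt.
have [s [sP hs]] := packing_euclidean_large R n2.
exists s; split=> //; rewrite target_constant -/h (_ : eps = 5 * eta); last by rewrite /eta; field.
have n3 : 3 <= n%:R :> R by rewrite ler_nat.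
have n4 : 8 / eta <= n%:R by near: n; apply: nbhs_infty_ger.
have n5 : 1 * n.+1%:R <= expR (eta * h / 4 * n%:R) by near: n.
move: hs n4 n5; rewrite -(natr1 n) mul1r -/h.
set N := n%:R in n3 *; move=> hs n4 n5.
have N0 : 0 < N by lra.
have n4' : 8 <= eta * N by move: n4; rewrite ler_pdivrMr// mulrC.
have lnN : 2 * ln N <= eta * h / 2 * N.
  have : ln N <= eta * h / 4 * N.
    by rewrite -ler_expR lnK ?posrE//; apply: le_trans n5; rewrite mul1r lerDl.
  lra.
have Ni : N^-1 <= eta / 8 by rewrite -div1r ler_pdivrMr//; lra.
have Ni0 : 0 < N^-1 by rewrite invr_gt0.
have N2i : (N ^+ 2)^-1 <= N^-1 / 3.
  by rewrite expr2 invfM ler_wpM2l ?(ltW Ni0)// lef_pV2 ?posrE.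
have N2i0 : 0 < (N ^+ 2)^-1 by rewrite invr_gt0 exprn_gt0.
have N3i : N * (N ^+ 2)^-1 = N^-1 by field; rewrite gt_eqF.
apply: (combine_errors _ _ _ _ _ _ _ _ _ _ _ hs).
- by [].
- by rewrite invr_gt0 sqrtr_gt0 pmulrn_lgt0// pi_gt0.
- exact: expR_ge0.
- by rewrite exprn_gt0// divr_gt0// sqrtr_gt0.
- lra.
- by rewrite sqrtr_gt0; lra.
- by rewrite addr_ge0 ?(ltW Ni0)// divr_ge0 ?(ltW N0)//; lra.
- by rewrite mulr_ge0; lra.
- exact: sqrtr_ge0.
- by rewrite (ltW eta0).
- have e : N / 2 * (h - 3 / N ^+ 2) = h * N / 2 - 3 / 2 * (N * (N ^+ 2)^-1) by field; rewrite gt_eqF.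
  rewrite e N3i; have : 0 <= eta * h by rewrite mulr_ge0 ?ltW.
  nra.
- have e : 2 / 3 / N ^+ 2 * N = 2 / 3 * N^-1 by field; rewrite gt_eqF.
  have : expR (2 / 3 * N^-1) * expR (- (2 / 3 * N^-1)) = 1 by rewrite -expRD subrr expR0.
  move=> ee; rewrite e -[leRHS]ee ler_wpM2l ?expR_ge0//; apply: le_trans (expR_ge1Dx _); lra.
- have : N / (N - 2) = 1 + 2 / (N - 2) by field; rewrite gt_eqF//; lra.
  move=> ->; have : (N - 2)^-1 <= 3 * N^-1.
    rewrite -[3]invrK -invfM lef_pV2 ?posrE; [lra|lra|].
    by rewrite mulr_gt0// invr_gt0.
  have : 0 <= (N - 2)^-1 by rewrite invr_ge0; lra.
  move: (N - 2)^-1 => w w0 w1; nra.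
- lra.
- rewrite -(@ler_pXn2r _ 2)// ?nnegrE ?mulr_ge0 ?sqrtr_ge0//; last by lra.
  rewrite exprMn !sqr_sqrtr; [nra|lra|lra].
Unshelve. all: by end_near. Qed.

(** Clusters require two points; a smaller packing is replaced by an antipodal pair. *)
Lemma sup_average_opnorm_euclidean_ge (R : realType) d (s : seq 'rV[R]_d) : (0 < d)%N ->
  packing (@euclidean_norm R d) s -> ((size s)%:R%:E <= sup_average_opnorm (@euclidean_norm R d))%E.
Proof.
case: d s => // n s _ ps; have [s1|s1] := ltnP 1 (size s).
  exact: sup_average_opnorm_ge (is_norm_euclidean _ _) ps s1.
pose x : 'rV[R]_n.+1 := delta_mx 0 0.
have x1 : dot x x = 1.
  rewrite /dot (bigD1 ord0)//= !mxE !eqxx mulr1 big1 ?addr0// => i /negbTE i0.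
  by rewrite !mxE i0 andbF mul0r.
have p2 : packing (@euclidean_norm R n.+1) [:: x; - x].
  apply: packing_spherical => [y|]; first by rewrite !inE => /orP[] /eqP ->; rewrite ?dotNl ?dotNr ?opprK x1.
  by rewrite /= dotNr x1; lra.
apply: (@le_trans _ _ 2%:R%:E); last exact: sup_average_opnorm_ge (is_norm_euclidean _ _) p2 isT.
by rewrite lee_fin ler_nat; exact: leq_trans s1 _.
Qed.

Theorem sup_average_opnorm_euclidean (R : realType) : exists e1 e2 : nat -> R,
  [/\ e1 d @[d --> \oo] --> 0, e2 d @[d --> \oo] --> 0 & \forall d \near \oo,
    (((1 + e1 d) * Num.sqrt (3 * pi / 8) * ln (3 / (2 * Num.sqrt 2)) * powR d%:R (3 / 2) *
        (2 / Num.sqrt 3) ^+ d)%:E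
      <= sup_average_opnorm (@euclidean_norm R d)
      <= (powR 2 (401 / 1000 * (1 + e2 d) * d%:R))%:E)%E].
Proof.
pose T d : R := Num.sqrt (3 * pi / 8) * ln (3 / (2 * Num.sqrt 2)) * powR d%:R (3 / 2) * (2 / Num.sqrt 3) ^+ d.
pose S d := sup_average_opnorm (@euclidean_norm R d).
have T0 d : (0 < d)%N -> 0 < T d.
  case: d => // n _; have s3 : 0 < Num.sqrt 3 :> R by rewrite sqrtr_gt0.
  have h0 : 0 < ln (9 / 8) :> R by rewrite ln_gt0//; lra.
  rewrite /T target_constant divr_gt0 ?mulr_gt0 ?exprn_gt0 ?divr_gt0 ?sqrtr_gt0//.
  by rewrite invr_gt0 sqrtr_gt0 pmulrn_lgt0// pi_gt0.
have SU : \forall d \near \oo, (S d <= (powR 2 (401 / 1000 * d%:R))%:E)%E.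
  near=> d; have h : forall s : seq 'rV[R]_d, packing (@euclidean_norm R d) s ->
      (size s)%:R <= powR 2 (401 / 1000 * d%:R) :> R by near: d; exact: packing_euclidean_le.
  apply: (@le_trans _ _ (Num.truncn (powR 2 (401 / 1000 * d%:R) : R))%:R%:E).
    apply: sup_average_opnorm_le; first exact: is_norm_euclidean.
    by move=> s ps; rewrite truncn_ge_nat ?powR_ge0//; exact: h.
  by rewrite lee_fin truncn_le ?powR_ge0.
have SF : \forall d \near \oo, S d \is a fin_num.
  near=> d; have h : (S d <= (powR 2 (401 / 1000 * d%:R))%:E)%E by near: d.
  have d0 : (0 < d)%N by near: d; exact: nbhs_infty_gt.
  have : (0 <= S d)%E.
    by apply: (sup_average_opnorm_euclidean_ge (s := [::]) d0); split.
  by move=> S0; rewrite ge0_fin_numE//; apply: le_lt_trans h (ltry _).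
(* The largest nonpositive error for which the lower bound holds; only its convergence to 0 remains
   to be proved. *)
exists (fun d => Num.min 0 (fine (S d) / T d - 1)), (fun=> 0); split; last 2 first.
- exact: cvg_cst.
- near=> d; have fd : S d \is a fin_num by near: d.
  have d0 : (0 < d)%N by near: d; exact: nbhs_infty_gt.
  apply/andP; split; last by rewrite addr0 mulr1; near: d.
  rewrite -/(S d) -(fineK fd) lee_fin.
  rewrite (_ : _ * _ = (1 + Num.min 0 (fine (S d) / T d - 1)) * T d); last by rewrite /T; ring.
  rewrite -ler_pdivlMr ?T0//.
  by rewrite addrC -lerBrDr ge_min lexx orbT.
apply/cvgr0Pnorm_le => eps eps0.
have e01 : 0 < Num.min eps 1 <= 1 by rewrite lt_min eps0 ltr01/= ge_min lexx orbT.
near=> d; have fd : S d \is a fin_num by near: d.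
have d0 : (0 < d)%N by near: d; exact: nbhs_infty_gt.
have : (1 - Num.min eps 1) * T d <= fine (S d).
  have [s [ps hs]] : exists s : seq 'rV[R]_d, packing (@euclidean_norm R d) s /\
    (1 - Num.min eps 1) * T d <= (size s)%:R by near: d; exact: packing_euclidean_asymptotic.
  apply: le_trans hs _; rewrite -lee_fin fineK//; exact: sup_average_opnorm_euclidean_ge.
rewrite -ler_pdivlMr ?T0// => h.
have h2 : Num.min eps 1 <= eps by rewrite ge_min lexx.
rewrite ler0_norm ?ge_min ?lexx// lerNl le_min oppr_le0 (ltW eps0)/=; lra.
Unshelve. all: by end_near. Qed.

(** * Thirteen spheres *)

(** Polynomials are coefficient lists over [Z], constant term first, so that the certificates below
    are decided by computation. *)
Fixpoint zadd (p q : seq Z) : seq Z :=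
  match p, q with
  | [::], _ => q
  | _, [::] => p
  | a :: p', b :: q' => Z.add a b :: zadd p' q'
  end.
Definition zscale (c : Z) (p : seq Z) : seq Z := [seq Z.mul c a | a <- p].
Fixpoint zmul (p q : seq Z) : seq Z :=
  if p is a :: p' then zadd (zscale a q) (Z0 :: zmul p' q) else [::].
Fixpoint zderiv (p : seq Z) : seq Z :=
  if p is a :: p' then zadd p' (Z0 :: zderiv p') else [::].
Definition zneg (p : seq Z) : seq Z := zscale (Z.opp (Zpos xH)) p.

(* The numerator and the denominator w ^ (size p) of p (u / w). *)
Fixpoint zsubst (u w p : seq Z) : seq Z * seq Z :=
  if p is c :: p' then
    let: (h, d) := zsubst u w p' in let d' := zmul w d in (zadd (zscale c d') (zmul u h), d')
  else ([::], [:: Zpos xH]).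

(* After the substitution t = (a + b x) / (d (1 + x)), which maps [0, +oo[ onto
   [a / d, b / d[, all the coefficients are nonnegative. *)
Definition znonneg (p : seq Z) (a b d : Z) : bool :=
  all (fun c => Z.leb Z0 c) (zsubst [:: a; b] [:: d; d] p).1.

Section Zpoly.
Context (R : realType).
Implicit Types (t x y : R) (p q : seq Z).

Definition zr (c : Z) : R := (int_of_Z c)%:~R.

Lemma zrD a b : zr (Z.add a b) = zr a + zr b. Proof. by rewrite /zr (rmorphD int_of_Z) rmorphD. Qed.
Lemma zrM a b : zr (Z.mul a b) = zr a * zr b. Proof. by rewrite /zr (rmorphM int_of_Z) rmorphM. Qed.
Lemma zr0 : zr Z0 = 0. Proof. by []. Qed.
Lemma zr1 : zr (Zpos xH) = 1. Proof. by []. Qed.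
Lemma zrN a : zr (Z.opp a) = - zr a. Proof. by rewrite /zr (rmorphN int_of_Z) rmorphN. Qed.
Lemma zr_nat n : zr (Z.of_nat n) = n%:R.
Proof. by elim: n => [//|n IH]; rewrite Nat2Z.inj_succ -Z.add_1_r zrD IH zr1 natr1. Qed.
Lemma zr_ge0 a : Z.leb Z0 a -> 0 <= zr a.
Proof. by move=> /Z.leb_le a0; rewrite -(Z2Nat.id _ a0) zr_nat. Qed.

Fixpoint zeval p t : R := if p is c :: p' then zr c + t * zeval p' t else 0.

Lemma zeval_cons c p t : zeval (c :: p) t = zr c + t * zeval p t. Proof. by []. Qed.
Lemma zeval_nil t : zeval [::] t = 0. Proof. by []. Qed.

Lemma zevalD p q t : zeval (zadd p q) t = zeval p t + zeval q t.
Proof.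
elim: p q => [|a p IH] [|b q] /=; rewrite ?add0r ?addr0//.
rewrite zrD IH; ring.
Qed.

Lemma zevalZ c p t : zeval (zscale c p) t = zr c * zeval p t.
Proof. by elim: p => [|a p /= ->]; rewrite /= ?mulr0// zrM; ring. Qed.

Lemma zevalN p t : zeval (zneg p) t = - zeval p t.
Proof. by rewrite zevalZ zrN zr1 mulN1r. Qed.

Lemma zevalM p q t : zeval (zmul p q) t = zeval p t * zeval q t.
Proof.
elim: p => [|a p IH] /=; first by rewrite mul0r.
by rewrite zevalD zevalZ /= IH zr0; ring.
Qed.

Lemma zeval_subst u w p x : zeval w x != 0 ->
  zeval (zsubst u w p).2 x = zeval w x ^+ size p /\
  zeval (zsubst u w p).1 x = zeval p (zeval u x / zeval w x) * zeval w x ^+ size p.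
Proof.
move=> w0; elim: p => [|c p] /=; first by rewrite zr1 mulr0 addr0 mul0r.
case: (zsubst u w p) => h d /= [e1 e2]; rewrite zevalD zevalZ !zevalM e1 e2 exprS; split=> //.
by field.
Qed.

Lemma znonnegP p a b d t : znonneg p a b d -> 0 < zr d -> zr a <= zr d * t < zr b -> 0 <= zeval p t.
Proof.
move=> h d0 /andP[at1 tb]; pose x := (zr d * t - zr a) / (zr b - zr d * t).
have b0 : 0 < zr b - zr d * t by rewrite subr_gt0.
have x0 : 0 <= x by rewrite divr_ge0 ?subr_ge0// ltW.
have w0 : 0 < zeval [:: d; d] x by rewrite /= mulr0 addr0 ltr_pwDl// mulr_ge0// ltW.
have [_] := zeval_subst [:: a; b] p (lt0r_neq0 w0).
have -> : zeval [:: a; b] x / zeval [:: d; d] x = t.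
  move: w0 => /=; rewrite !mulr0 !addr0 => w0; apply: (mulIf (lt0r_neq0 w0)).
  rewrite divfK ?lt0r_neq0//; move: b0; rewrite /x => b0; field; exact: lt0r_neq0.
move=> e; rewrite -(pmulr_lge0 _ (exprn_gt0 (size p) w0)) -e.
move: h; rewrite /znonneg; elim: (zsubst _ _ _).1 => [//|c l IH] /= /andP[/zr_ge0 c0 /IH l0].
by rewrite addr_ge0// mulr_ge0.
Qed.

Lemma zeval_derive p t : is_derive t (1 : R) (zeval p) (zeval (zderiv p) t).
Proof.
elim: p => [|c p IH] /=; first exact: is_derive_cst.
rewrite zevalD /= zr0 add0r.
have h := is_deriveD (is_derive_cst (zr c) t (1 : R)) (is_deriveM (is_derive_id t (1 : R)) IH).
by apply: is_derive_eq h _; rewrite /GRing.scale /= add0r mulr1 addrC.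
Qed.

Lemma zeval_homo p a b : (forall t, a <= t <= b -> 0 <= zeval (zderiv p) t) ->
  {in `[a, b] &, {homo zeval p : x y / x <= y}}.
Proof.
move=> h x y xab yab xy.
have [||c] := @MVT_segment R (zeval p) (zeval (zderiv p)) x y xy.
- by move=> z _; exact: zeval_derive.
- by apply: derivable_within_continuous => z _; have := zeval_derive p z; case.
move=> cxy e; rewrite -subr_ge0 e mulr_ge0 ?subr_ge0//; apply: h.
move: xab yab cxy; rewrite !in_itv/= => /andP[ax _] /andP[_ yb] /andP[xc cy].
by rewrite (le_trans ax xc) (le_trans cy yb).
Qed.

End Zpoly.

Definition zc (n : nat) := Z.of_nat n.
Arguments zc : simpl never.
Arguments zr : simpl never.

(** 128 * 1000 times a combination of Legendre polynomials of degrees 0 to 5 and 9, with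
    coefficients 0.999, 1.98, 3.49, 2.06, 1.985, 0.187 and 0.354 in absolute value. Odd degrees have
    negative signs because the polynomial is evaluated at the opposite of the cosine. *)
Definition kissZ : seq Z :=
  let z := zc in let m n := Z.opp (zc n) in
  zadd (zscale (z 128%N) [:: z 999%N; m 1980%N])
 (zadd (zscale (z 64%N) (zadd (zscale (z 3490%N) [:: m 1%N; z 0%N; z 3%N])
                            (zscale (m 2060%N) [:: z 0%N; m 3%N; z 0%N; z 5%N])))
 (zadd (zscale (z 16%N) (zadd (zscale (z 1985%N) [:: z 3%N; z 0%N; m 30%N; z 0%N; z 35%N])
                            (zscale (m 187%N) [:: z 0%N; z 15%N; z 0%N; m 70%N; z 0%N; z 63%N])))
   (zscale (m 354%N) [:: z 0%N; z 315%N; z 0%N; Z.mul (m 4%N) (z 1155%N); z 0%N; Z.mul (z 14%N) (z 1287%N); z 0%N;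
                         Z.mul (m 20%N) (z 1287%N); z 0%N; Z.mul (z 11%N) (z 1105%N)]))).

Section Certificates.
Variable k : seq Z.

Definition kiss_gap : seq Z := zadd [:: Z.mul (zc 128) (zc 1930)] (zneg k).

(** The numerator of 1.93 - f (y) - f (u (y) / d), up to scale; u / d is the linear upper bound for
    the larger of two cosines. *)
Definition kiss_pair (u : seq Z) (d : Z) : seq Z :=
  let s := zsubst u [:: d] k in zadd (zmul s.2 kiss_gap) (zneg s.1).

Definition kiss_quad : seq Z :=
  zadd (zscale (zc 128) [:: zc 2465; Z.opp (Z.mul (zc 10) (zc 1152)); Z.mul (zc 10) (zc 1137)]) (zneg k).

(** The interval [-1/2, 283/400[ is cut into four pieces, on each of which the substitution test
    succeeds. The last check gives monotonicity on the range of the larger of two cosines. *)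
Definition kiss_checks : bool := [&& znonneg (zneg k) (zc 814) (zc 1415) (zc 2000),
  znonneg (zneg k) (zc 7) (zc 407) (zc 1000),
  znonneg (zneg k) (Z.opp (zc 53)) (zc 7) (zc 1000),
  znonneg (zneg k) (Z.opp (zc 500)) (Z.opp (zc 53)) (zc 1000) &
  znonneg (zderiv k) (zc 707) (zc 983) (zc 1000)].

Definition kiss_cap_checks : bool := [&& znonneg kiss_gap (zc 70) (zc 95) (zc 100),
  znonneg kiss_gap (zc 95) (zc 101) (zc 100),
  znonneg (kiss_pair [:: zc 436; Z.opp (zc 200)] (zc 300)) (zc 707) (zc 821) (zc 1000),
  znonneg (kiss_pair [:: zc 494; Z.opp (zc 270)] (zc 300)) (zc 820) (zc 867) (zc 1000),
  znonneg kiss_quad (zc 707) (zc 907) (zc 1000) & znonneg kiss_quad (zc 907) (zc 945) (zc 1000)].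

End Certificates.

Lemma kissZ_checks : kiss_checks kissZ.
Proof. by vm_compute. Qed.

Lemma kissZ_cap_checks : kiss_cap_checks kissZ.
Proof. by vm_compute. Qed.

Lemma le_of_sqr (R : realDomainType) (x y : R) : 0 <= y -> x ^+ 2 <= y ^+ 2 -> x <= y.
Proof.
move=> y0 h; rewrite leNgt; apply/negP => yx; have x0 := le_lt_trans y0 yx.
by move: h; apply/negP; rewrite -ltNge ltr_pXn2r// nnegrE ?ltW.
Qed.

(** * Numerical constraints on two or three points in a cap *)

Lemma cap3_top (R : realFieldType) (a b c : R) : 283 / 400 <= b -> 283 / 400 <= c ->
  a ^+ 2 + b ^+ 2 + c ^+ 2 - (a + b + c) ^+ 2 / 4 <= 1 / 2 -> a <= 944 / 1000.
Proof.
move=> b0 c0 h; rewrite leNgt; apply/negP => ha.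
have u0 : 283 / 200 <= b + c by clear h ha; lra.
have e : 2 * (b ^+ 2 + c ^+ 2) = (b + c) ^+ 2 + (b - c) ^+ 2 by ring.
have w0 := sqr_ge0 (b - c); clear b0 c0.
move: h; rewrite -(addrA a b c) -(addrA (a ^+ 2)).
move: (b + c) (b ^+ 2 + c ^+ 2) ((b - c) ^+ 2) u0 e w0 => u v w u0 e w0 h.
have h1 : 0 <= (a - 944 / 1000) ^+ 2 by exact: sqr_ge0.
have h2 : 0 <= (u - 283 / 200) ^+ 2 by exact: sqr_ge0.
have h3 : 0 <= (a - u) ^+ 2 by exact: sqr_ge0.
nra.
Qed.

(** The quadratic majorants reduce the sum to the first two power sums. The dispersion bound
    eliminates the second, and what remains is convex in the sum s, between 849/400 and 2.45, a
    bound for the square root of 6. *)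
Lemma cap3_sum (R : realFieldType) (x y z fx fy fz : R) :
  283 / 400 <= x -> 283 / 400 <= y -> 283 / 400 <= z ->
  (x + y + z) ^+ 2 <= 6 -> x ^+ 2 + y ^+ 2 + z ^+ 2 - (x + y + z) ^+ 2 / 4 <= 1 / 2 ->
  fx <= 2465 / 1000 - 1152 / 100 * x + 1137 / 100 * x ^+ 2 ->
  fy <= 2465 / 1000 - 1152 / 100 * y + 1137 / 100 * y ^+ 2 ->
  fz <= 2465 / 1000 - 1152 / 100 * z + 1137 / 100 * z ^+ 2 ->
  fx + fy + fz <= 193 / 100.
Proof.
move=> x0 y0 z0 h1 h2 ax ay az.
have s0 : 849 / 400 <= x + y + z by clear h1 h2 ax ay az; lra.
have e : fx + fy + fz <= 3 * (2465 / 1000) - 1152 / 100 * (x + y + z) + 1137 / 100 * (x ^+ 2 + y ^+ 2 + z ^+ 2).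
  by clear h1 h2 s0 x0 y0 z0; lra.
clear ax ay az x0 y0 z0; move: (x + y + z) (x ^+ 2 + y ^+ 2 + z ^+ 2) (fx + fy + fz) s0 h1 h2 e => s q F s0 h1 h2 e.
have s1 : s <= 245 / 100 by apply: le_of_sqr; [lra|apply: le_trans h1 _; lra].
have h3 : 0 <= (s - 849 / 400) * (245 / 100 - s) by apply: mulr_ge0; rewrite subr_ge0; assumption.
apply: le_trans e _; clear s0 s1; lra.
Qed.

(** The two quadratic constraints are tangents to the ellipse x^2 - x y + y^2 = 3/4 that bounds the
    admissible pairs of cosines: 19 = 9 + 4 + 6 and 271 = 100 + 81 + 90. Each is used where it is
    the sharper one. *)
Lemma cap2_tangent (R : realFieldType) (x y : R) : 283 / 400 <= y -> y <= x ->
  (3 * x + 2 * y) ^+ 2 <= 19 -> y < 82 / 100 ->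
  [/\ 707 / 1000 <= y < 821 / 1000, 283 / 400 <= x, x <= (436 - 200 * y) / 300 &
    (436 - 200 * y) / 300 <= 982 / 1000].
Proof.
move=> y0 yx h1 ya; have : 3 * x + 2 * y <= 436 / 100.
  by apply: le_of_sqr; [lra|apply: le_trans h1 _; lra].
by clear h1 => h; split; lra.
Qed.

Lemma cap2_tangent' (R : realFieldType) (x y : R) : 82 / 100 <= y -> y <= x ->
  (10 * x + 9 * y) ^+ 2 <= 271 ->
  [/\ 820 / 1000 <= y < 867 / 1000, 283 / 400 <= x, x <= (494 - 270 * y) / 300 &
    (494 - 270 * y) / 300 <= 982 / 1000].
Proof.
move=> y0 yx h1; have : 10 * x + 9 * y <= 494 / 30.
  by apply: le_of_sqr; [lra|apply: le_trans h1 _; lra].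
by clear h1 => h; split; lra.
Qed.

Section Kiss.
Context (R : realType).
Implicit Types (t x y : R).

Lemma zrc n : zr R (zc n) = n%:R. Proof. exact: zr_nat. Qed.

(* The polynomial and the scale are kept abstract: [done] would otherwise try
   to compute with them. *)
Variables (k : seq Z) (K : R).
Hypotheses (K0 : 0 < K) (KE : K = 128 * 1000).
Hypotheses (kP : kiss_checks k) (kcP : kiss_cap_checks k).

Let kiss t : R := zeval k t / K.

Let znonneg_itv p a b d t : znonneg p a b (zc d) -> (0 < d)%N -> zr R a / d%:R <= t < zr R b / d%:R -> 0 <= zeval p t.
Proof.
move=> h d0; have d1 : 0 < d%:R :> R by rewrite ltr0n.
rewrite ler_pdivrMr// ltr_pdivlMr// mulrC => ht.
by apply: (znonnegP h); rewrite zrc.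
Qed.

Lemma kiss_le0 t : - 2^-1 < t < 283 / 400 -> kiss t <= 0.
Proof.
move=> /andP[t0 t1]; have /and5P[h1 h2 h3 h4 _] := kP.
rewrite /kiss pmulr_lle0 ?invr_gt0// -oppr_ge0 -zevalN.
have [ta|ta] := ltP t (- 53 / 1000).
  by apply: (znonneg_itv h4); [exact: isT|rewrite !zrN !zrc; lra].
have [tb|tb] := ltP t (7 / 1000).
  by apply: (znonneg_itv h3); [exact: isT|rewrite !zrN !zrc; lra].
have [tc|tc] := ltP t (407 / 1000).
  by apply: (znonneg_itv h2); [exact: isT|rewrite !zrc; lra].
by apply: (znonneg_itv h1); [exact: isT|rewrite !zrc; lra].
Qed.

Lemma kiss_homo x y : 283 / 400 <= x -> x <= y -> y <= 982 / 1000 -> kiss x <= kiss y.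
Proof.
move=> x0 xy y1; have /and5P[_ _ _ _ h] := kP.
rewrite /kiss ler_pM2r ?invr_gt0//.
apply: (@zeval_homo R k (283 / 400) (982 / 1000)) => //; last 2 first.
- by rewrite in_itv/= x0 (le_trans xy y1).
- by rewrite in_itv/= (le_trans x0 xy) y1.
by move=> t t01; apply: (znonneg_itv h); [exact: isT|rewrite !zrc; lra].
Qed.

Let kiss_gapE t : 193 / 100 - kiss t = zeval (kiss_gap k) t / K.
Proof.
rewrite /kiss_gap zevalD zevalN [RHS]mulrBl -/(kiss t); congr (_ - _).
rewrite -[LHS](mulfK (lt0r_neq0 K0)); congr (_ / _).
by rewrite KE zeval_cons zeval_nil mulr0 addr0 zrM !zrc; field.
Qed.

Lemma kiss_cap1 t : 283 / 400 <= t <= 1 -> kiss t <= 193 / 100.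
Proof.
move=> /andP[t0 t1]; have /and5P[h1 h2 _ _ _] := kcP.
rewrite -subr_ge0 kiss_gapE divr_ge0 ?(ltW K0)//.
have [ta|ta] := ltP t (95 / 100); first by apply: (znonneg_itv h1); [exact: isT|rewrite !zrc; lra].
by apply: (znonneg_itv h2); [exact: isT|rewrite !zrc; lra].
Qed.

Let kiss_pairP (a b d : nat) (lo hi : nat) x y :
  znonneg (kiss_pair k [:: zc a; Z.opp (zc b)] (zc d)) (zc lo) (zc hi) (zc 1000) -> (0 < d)%N ->
  lo%:R / 1000 <= y < hi%:R / 1000 -> 283 / 400 <= x -> x <= (a%:R - b%:R * y) / d%:R ->
  (a%:R - b%:R * y) / d%:R <= 982 / 1000 -> kiss x + kiss y <= 193 / 100.
Proof.
move=> h d0 yb x0 xl l1; have d1 : 0 < d%:R :> R by rewrite ltr0n.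
have := znonneg_itv h isT; rewrite !zrc => /(_ _ yb).
rewrite /kiss_pair zevalD zevalN zevalM.
have w0 : zeval [:: zc d] y != 0 by rewrite /= zrc mulr0 addr0 lt0r_neq0.
have [-> ->] := zeval_subst [:: zc a; Z.opp (zc b)] k w0.
have -> : zeval [:: zc d] y = d%:R by rewrite /= zrc mulr0 addr0.
have -> : zeval [:: zc a; Z.opp (zc b)] y = a%:R - b%:R * y.
  by rewrite /= zrN !zrc mulr0 addr0 mulrN mulrC.
rewrite (mulrC (_ ^+ _)) -mulNr -mulrDl pmulr_lge0 ?exprn_gt0// subr_ge0.
rewrite -(ler_pM2r (x := K^-1)) ?invr_gt0// -kiss_gapE -/(kiss _) => hk.
by rewrite -lerBrDr; apply: le_trans hk; exact: kiss_homo.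
Qed.

(** As f increases on the range of x, x is replaced by its bound from the tangent line, leaving one
    polynomial inequality in y on each side of 0.82. *)
Lemma kiss_cap2 x y : 283 / 400 <= y -> y <= x ->
  (3 * x + 2 * y) ^+ 2 <= 19 -> (10 * x + 9 * y) ^+ 2 <= 271 -> kiss x + kiss y <= 193 / 100.
Proof.
move=> y0 yx h1 h2; have /and5P[_ _ k1 k2 _] := kcP.
have [ya|ya] := ltP y (82 / 100).
  have [b1 b2 b3 b4] := cap2_tangent y0 yx h1 ya.
  exact: (kiss_pairP k1 isT b1 b2 b3 b4).
have [b1 b2 b3 b4] := cap2_tangent' ya yx h2.
exact: (kiss_pairP k2 isT b1 b2 b3 b4).
Qed.

Lemma kiss_quadP t : 283 / 400 <= t <= 944 / 1000 ->
  kiss t <= 2465 / 1000 - 1152 / 100 * t + 1137 / 100 * t ^+ 2.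
Proof.
move=> /andP[t0 t1]; have /and5P[_ _ _ _ /andP[h1 h2]] := kcP.
rewrite -subr_ge0.
have -> : 2465 / 1000 - 1152 / 100 * t + 1137 / 100 * t ^+ 2 - kiss t = zeval (kiss_quad k) t / K.
  rewrite /kiss_quad zevalD zevalN zevalZ [RHS]mulrBl -/(kiss t); congr (_ - _).
  rewrite -[LHS](mulfK (lt0r_neq0 K0)); congr (_ / _).
  by rewrite KE !zeval_cons zeval_nil !(zrN, zrM) !zrc; field.
rewrite divr_ge0 ?(ltW K0)//.
have [ta|ta] := ltP t (907 / 1000); first by apply: (znonneg_itv h1); [exact: isT|rewrite !zrc; lra].
by apply: (znonneg_itv h2); [exact: isT|rewrite !zrc; lra].
Qed.

Lemma kiss_cap3 x y z : 283 / 400 <= x -> 283 / 400 <= y -> 283 / 400 <= z ->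
  (x + y + z) ^+ 2 <= 6 -> x ^+ 2 + y ^+ 2 + z ^+ 2 - (x + y + z) ^+ 2 / 4 <= 1 / 2 ->
  kiss x + kiss y + kiss z <= 193 / 100.
Proof.
move=> x0 y0 z0 h1 h2.
have kx := @kiss_quadP x; have ky := @kiss_quadP y; have kz := @kiss_quadP z.
have tx : x <= 944 / 1000 := cap3_top y0 z0 h2.
have ty : y <= 944 / 1000.
  by apply: (cap3_top x0 z0); rewrite (addrC y) (addrC (y ^+ 2)).
have tz : z <= 944 / 1000.
  by apply: (cap3_top x0 y0); rewrite -(addrA z) (addrC z) -(addrA (z ^+ 2)) (addrC (z ^+ 2)).
apply: (cap3_sum x0 y0 z0 h1 h2); [apply: kx|apply: ky|apply: kz]; apply/andP; split; assumption.
Qed.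

End Kiss.

(** The polynomial is delivered through its properties, which keeps the integer certificate out of
    later computations. *)
Lemma kiss_exists (R : realType) : exists f : R -> R, [/\
  forall t, f t = 999 / 1000 - 198 / 100 * t + 349 / 100 * (3 / 2) * (t ^+ 2 - 1 / 3)
    - 206 / 100 * (5 / 2) * (t ^+ 3 - 3 / 5 * t) + 1985 / 1000 * (35 / 8) * (t ^+ 4 - 6 / 7 * t ^+ 2 + 3 / 35)
    - 187 / 1000 * (63 / 8) * (t ^+ 5 - 10 / 9 * t ^+ 3 + 5 / 21 * t)
    - 354 / 1000 * (11 * 1105 / 128) *
      (t ^+ 9 - 36 / 17 * t ^+ 7 + 126 / 85 * t ^+ 5 - 84 / 221 * t ^+ 3 + 63 / 2431 * t),
  forall t, - 2^-1 < t < 283 / 400 -> f t <= 0,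
  forall t, 283 / 400 <= t <= 1 -> f t <= 193 / 100,
  forall x y, 283 / 400 <= y -> y <= x ->
    (3 * x + 2 * y) ^+ 2 <= 19 -> (10 * x + 9 * y) ^+ 2 <= 271 -> f x + f y <= 193 / 100 &
  forall x y z, 283 / 400 <= x -> 283 / 400 <= y -> 283 / 400 <= z ->
    (x + y + z) ^+ 2 <= 6 -> x ^+ 2 + y ^+ 2 + z ^+ 2 - (x + y + z) ^+ 2 / 4 <= 1 / 2 ->
    f x + f y + f z <= 193 / 100].
Proof.
have [K K0 KE] : exists2 K : R, 0 < K & K = 128 * 1000.
  exists (128 * 1000); last reflexivity.
  apply: mulr_gt0; rewrite ltr0n; exact: isT.
exists (fun t => zeval kissZ t / K); split=> [t| | | |].
- rewrite /kissZ !(zevalD, zevalZ) KE /= !(zrM, zrN, zrc).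
  by field.
- exact: (kiss_le0 K0 kissZ_checks).
- exact: (@kiss_cap1 R kissZ K K0 KE kissZ_cap_checks).
- exact: (@kiss_cap2 R kissZ K K0 KE kissZ_checks kissZ_cap_checks).
- exact: (@kiss_cap3 R kissZ K K0 KE kissZ_cap_checks).
Qed.

Section Legendre.
Context (R : realType).
Let p k t : R := (gegen R 3 k).[t].

Let rec k t : p k.+2 t = t * p k.+1 t - k.+1%:R ^+ 2 / ((2 * k.+1%:R - 1) * (2 * k.+1%:R + 1)) * p k t.
Proof.
rewrite /p gegenSS !hornerE; congr (_ - _ * _).
rewrite /gegen_beta /gegen_kappa -natr1.
have : 0 <= k%:R :> R by []; move: (k%:R : R) => z z0.
by field; rewrite !gt_eqF//; lra.
Qed.

Lemma legendreE t : [/\ (gegen R 3 1).[t] = t, (gegen R 3 2).[t] = t ^+ 2 - 1 / 3,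
  (gegen R 3 3).[t] = t ^+ 3 - 3 / 5 * t, (gegen R 3 4).[t] = t ^+ 4 - 6 / 7 * t ^+ 2 + 3 / 35 &
  (gegen R 3 5).[t] = t ^+ 5 - 10 / 9 * t ^+ 3 + 5 / 21 * t /\
  (gegen R 3 9).[t] = t ^+ 9 - 36 / 17 * t ^+ 7 + 126 / 85 * t ^+ 5 - 84 / 221 * t ^+ 3 + 63 / 2431 * t].
Proof.
have p0 : p 0 t = 1 by rewrite /p gegen0 hornerE.
have p1 : p 1 t = t by rewrite /p gegen1 hornerE.
have p2 : p 2 t = t ^+ 2 - 1 / 3 by rewrite rec p0 p1; field.
have p3 : p 3 t = t ^+ 3 - 3 / 5 * t by rewrite rec p1 p2; field.
have p4 : p 4 t = t ^+ 4 - 6 / 7 * t ^+ 2 + 3 / 35 by rewrite rec p2 p3; field.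
have p5 : p 5 t = t ^+ 5 - 10 / 9 * t ^+ 3 + 5 / 21 * t by rewrite rec p3 p4; field.
have p6 : p 6 t = t ^+ 6 - 15 / 11 * t ^+ 4 + 5 / 11 * t ^+ 2 - 5 / 231 by rewrite rec p4 p5; field.
have p7 : p 7 t = t ^+ 7 - 21 / 13 * t ^+ 5 + 105 / 143 * t ^+ 3 - 35 / 429 * t by rewrite rec p5 p6; field.
have p8 : p 8 t = t ^+ 8 - 28 / 15 * t ^+ 6 + 14 / 13 * t ^+ 4 - 28 / 143 * t ^+ 2 + 7 / 1287.
  by rewrite rec p6 p7; field.
by split=> //; split=> //; rewrite -/(p 9 t) rec p7 p8; field.
Qed.

(** Changing the sign of the argument makes all Legendre coefficients of f nonnegative, so only the
    constant term, 999/1000, is kept. *)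
Lemma kiss_psd (f : R -> R) (I : finType) (x : I -> 'I_3 -> R) :
  (forall t, f t = 999 / 1000 - 198 / 100 * t + 349 / 100 * (3 / 2) * (t ^+ 2 - 1 / 3)
    - 206 / 100 * (5 / 2) * (t ^+ 3 - 3 / 5 * t) + 1985 / 1000 * (35 / 8) * (t ^+ 4 - 6 / 7 * t ^+ 2 + 3 / 35)
    - 187 / 1000 * (63 / 8) * (t ^+ 5 - 10 / 9 * t ^+ 3 + 5 / 21 * t)
    - 354 / 1000 * (11 * 1105 / 128) *
      (t ^+ 9 - 36 / 17 * t ^+ 7 + 126 / 85 * t ^+ 5 - 84 / 221 * t ^+ 3 + 63 / 2431 * t)) ->
  (forall i, Fischer.dotf (x i) (x i) = 1) ->
  999 / 1000 * #|I|%:R ^+ 2 <= \sum_i \sum_j f (- Fischer.dotf (x i) (x j)).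
Proof.
move=> fE x1; have psd k := @Fischer.gegen_psd R 3 isT I x k x1.
have sumZ (c : R) (F : I -> I -> R) : \sum_i \sum_j c * F i j = c * \sum_i \sum_j F i j.
  by rewrite mulr_sumr; apply: eq_bigr => i _; rewrite mulr_sumr.
have sumD (F G : I -> I -> R) : \sum_i \sum_j (F i j + G i j) = \sum_i \sum_j F i j + \sum_i \sum_j G i j.
  by rewrite -big_split; apply: eq_bigr => i _; rewrite -big_split.
pose g k i j := (gegen R 3 k).[Fischer.dotf (x i) (x j)].
have [c1 [c2 [c3 [c4 [c5 [c9 [[p1 p2 p3 p4 p5] p9 cE]]]]]]] : exists c1 c2 c3 c4 c5 c9 : R,
    [/\ [/\ 0 <= c1, 0 <= c2, 0 <= c3, 0 <= c4 & 0 <= c5], 0 <= c9 &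
    forall i j, f (- Fischer.dotf (x i) (x j)) =
    999 / 1000 + (c1 * g 1 i j + (c2 * g 2 i j + (c3 * g 3 i j + (c4 * g 4 i j + (c5 * g 5 i j + c9 * g 9 i j)))))].
  exists (198 / 100), (349 / 100 * (3 / 2)), (206 / 100 * (5 / 2)), (1985 / 1000 * (35 / 8)),
    (187 / 1000 * (63 / 8)), (354 / 1000 * (11 * 1105 / 128)); split; [split; lra|lra|move=> i j].
  rewrite fE /g; have [-> -> -> -> [-> ->]] := legendreE (Fischer.dotf (x i) (x j)).
  move: (Fischer.dotf _ _) => t; ring.
under eq_bigr do under eq_bigr do rewrite cE.
rewrite sumD.
have -> : \sum_(i : I) \sum_(j : I) 999 / 1000 = 999 / 1000 * #|I|%:R ^+ 2 :> R.
  by rewrite !sumr_const -mulrnA -[in RHS]natrX -mulnn mulr_natr.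
rewrite !sumD !sumZ.
by rewrite lerDl !addr_ge0// mulr_ge0//; exact: psd.
Qed.

End Legendre.

Lemma dot_suml (R : realType) d (I : finType) (P : pred I) (u : I -> R) (z : I -> 'rV[R]_d) w :
  dot (\sum_(i | P i) u i *: z i) w = \sum_(i | P i) u i * dot (z i) w.
Proof.
elim/big_rec2: _ => [|i x y _ <-]; last by rewrite dotDl dotZl.
by rewrite /dot big1// => j _; rewrite mxE mul0r.
Qed.

(* The positive and the negative part of the relation are the same vector, of
   nonpositive square. *)
Lemma obtuse_independent (R : realType) d (I : finType) (z : I -> 'rV[R]_d) (w : 'rV[R]_d) (u : I -> R) :
  (forall i j, i != j -> dot (z i) (z j) <= 0) -> (forall i, dot (z i) w < 0) ->
  \sum_i u i *: z i = 0 -> forall i, u i = 0.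
Proof.
move=> zz zw u0.
pose pu i := Num.max (u i) 0; pose nu i := Num.max (- u i) 0.
have pu0 i : 0 <= pu i by rewrite le_max lexx orbT.
have nu0 i : 0 <= nu i by rewrite le_max lexx orbT.
have uE i : u i = pu i - nu i.
  by rewrite /pu /nu; case: (lerP (u i) 0) => h; case: (lerP (- u i) 0) => h'; lra.
have pn i : pu i * nu i = 0.
  rewrite /pu /nu; case: (lerP (u i) 0) => h; rewrite ?mul0r//.
  by case: (lerP (- u i) 0) => h'; [rewrite mulr0|lra].
have PE : \sum_i pu i *: z i = \sum_i nu i *: z i.
  apply/eqP; rewrite -subr_eq0 -sumrB; apply/eqP; rewrite -[RHS]u0.
  by apply: eq_bigr => i _; rewrite uE scalerBl.
have P0 : \sum_i pu i *: z i = 0.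
  apply: dot_eq0; apply/eqP; rewrite eq_le dot_ge0 andbT.
  rewrite {2}PE dot_suml; apply: sumr_le0 => i _.
  rewrite dotC dot_suml mulr_sumr; apply: sumr_le0 => j _.
  have [->|ij] := eqVneq j i; first by rewrite mulrA pn mul0r.
  by rewrite !mulr_ge0_le0// zz.
have zero (v : I -> R) : (forall i, 0 <= v i) -> \sum_i v i *: z i = 0 -> forall i, v i = 0.
  move=> v0 e i; have : \sum_i v i * dot (z i) w = 0.
    by rewrite -dot_suml e /dot big1// => k _; rewrite mxE mul0r.
  move/eqP; rewrite -oppr_eq0 -sumrN psumr_eq0 => [|k _]; last first.
    by rewrite oppr_ge0 mulr_ge0_le0// ltW.
  move=> /allP/(_ i (mem_index_enum i))/=; rewrite oppr_eq0 mulf_eq0 => /orP[/eqP//|].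
  by rewrite lt_eqF.
by move=> i; rewrite uE (zero pu)// (zero nu) ?subr0// -PE.
Qed.

(** The d + 1 vectors x and z i are linearly dependent. By orthogonality x has coefficient 0 in a
    relation, which [obtuse_independent] then excludes. *)
Lemma obtuse_hyperplane (R : realType) (d : nat) (x w : 'rV[R]_d) (z : 'I_d -> 'rV[R]_d) :
  dot x x = 1 -> (forall i, dot x (z i) = 0) ->
  (forall i j, i != j -> dot (z i) (z j) <= 0) -> (forall i, dot (z i) w < 0) -> False.
Proof.
move=> x1 xz zz zw; pose M : 'M[R]_(1 + d, d) := col_mx x (\matrix_i z i).
have : kermx M != 0.
  rewrite -mxrank_eq0 mxrank_ker -lt0n subn_gt0; exact: leq_ltn_trans (rank_leq_col M) (ltnSn d).
case/rowV0Pn => v /sub_kermxP; rewrite -[v]hsubmxK mul_row_col => vM v0.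
have uE : rsubmx v *m (\matrix_i z i) = \sum_i rsubmx v 0 i *: z i.
  by rewrite mulmx_sum_row; apply: eq_bigr => i _; rewrite rowK.
have lE : lsubmx v *m x = lsubmx v 0 0 *: x by rewrite {1}[lsubmx v]mx11_scalar mul_scalar_mx.
rewrite uE lE in vM.
have l0 : lsubmx v 0 0 = 0.
  have : dot (lsubmx v 0 0 *: x + \sum_i rsubmx v 0 i *: z i) x = 0.
    by rewrite vM /dot big1// => k _; rewrite mxE mul0r.
  rewrite dotDl dotZl x1 mulr1 dot_suml big1 ?addr0// => i _.
  by rewrite dotC xz mulr0.
rewrite l0 scale0r add0r in vM.
have r0 := obtuse_independent zz zw vM.
have L : lsubmx v = 0 by apply/rowP => k; rewrite ord1 l0 mxE.
have N : rsubmx v = 0 by apply/rowP => k; rewrite r0 mxE.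
by move: v0; rewrite L N row_mx0 eqxx.
Qed.

Section Caps.
Context (R : realType) (d : nat).
Variable x : 'rV[R]_d.
Hypothesis x1 : dot x x = 1.
Implicit Types y a b c : 'rV[R]_d.

(** Cauchy-Schwarz between x and a nonnegative combination of the three points, whose mutual cosines
    are below 1/2. *)
Lemma caps_gram a b c (al be ga : R) : dot a a = 1 -> dot b b = 1 -> dot c c = 1 ->
  dot a b < 2^-1 -> dot a c < 2^-1 -> dot b c < 2^-1 -> 0 <= al -> 0 <= be -> 0 <= ga ->
  (al * - dot x a + be * - dot x b + ga * - dot x c) ^+ 2 <=
  al ^+ 2 + be ^+ 2 + ga ^+ 2 + al * be + al * ga + be * ga.
Proof.
move=> a1 b1 c1 ab ac bc al0 be0 ga0.
have := dot_CS x (al *: a + be *: b + ga *: c).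
rewrite !dotDl !dotDr !dotZl !dotZr a1 b1 c1 x1 mul1r (dotC b a) (dotC c a) (dotC c b) => h.
have -> : (al * - dot x a + be * - dot x b + ga * - dot x c) ^+ 2 =
  (al * dot x a + be * dot x b + ga * dot x c) ^+ 2 by ring.
apply: le_trans h _.
have h1 := ler_wpM2l (mulr_ge0 al0 be0) (ltW ab).
have h2 := ler_wpM2l (mulr_ge0 al0 ga0) (ltW ac).
have h3 := ler_wpM2l (mulr_ge0 be0 ga0) (ltW bc).
move: h1 h2 h3; clear; lra.
Qed.

Lemma caps_gram2 a b (al be : R) : dot a a = 1 -> dot b b = 1 -> dot a b < 2^-1 -> 0 <= al -> 0 <= be ->
  (al * - dot x a + be * - dot x b) ^+ 2 <= al ^+ 2 + be ^+ 2 + al * be.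
Proof.
move=> a1 b1 ab al0 be0.
have := dot_CS x (al *: a + be *: b).
rewrite !dotDl !dotDr !dotZl !dotZr a1 b1 x1 mul1r (dotC b a) => h.
have -> : (al * - dot x a + be * - dot x b) ^+ 2 = (al * dot x a + be * dot x b) ^+ 2 by ring.
apply: le_trans h _; have := ler_wpM2l (mulr_ge0 al0 be0) (ltW ab); lra.
Qed.

End Caps.

Lemma caps_dispersion (R : realFieldType) (p q r : R) :
  283 / 400 <= p -> 283 / 400 <= q -> 283 / 400 <= r ->
  (forall al be ga, 0 <= al -> 0 <= be -> 0 <= ga ->
    (al * p + be * q + ga * r) ^+ 2 <= al ^+ 2 + be ^+ 2 + ga ^+ 2 + al * be + al * ga + be * ga) ->
  (p + q + r) ^+ 2 <= 6 /\ p ^+ 2 + q ^+ 2 + r ^+ 2 - (p + q + r) ^+ 2 / 4 <= 1 / 2.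
Proof.
move=> p0 q0 r0 h; have h1 : (p + q + r) ^+ 2 <= 6.
  by have := h 1 1 1 ler01 ler01 ler01; rewrite !mul1r; lra.
split=> //; have s1 : p + q + r <= 283 / 100 by apply: le_of_sqr; [lra|apply: le_trans h1 _; lra].
(* The optimal weights up to a factor: the inverse of the identity plus the all-ones matrix J is the
   identity minus J/4. They are nonnegative because the sum is at most 2.83, four times 283/400. The
   inequality becomes w^2 <= w / 2. *)
have := h (p - (p + q + r) / 4) (q - (p + q + r) / 4) (r - (p + q + r) / 4) _ _ _.
move=> /(_ ltac:(lra) ltac:(lra) ltac:(lra)).
set w := p ^+ 2 + q ^+ 2 + r ^+ 2 - (p + q + r) ^+ 2 / 4.
have -> : (p - (p + q + r) / 4) * p + (q - (p + q + r) / 4) * q + (r - (p + q + r) / 4) * r = w.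
  by rewrite /w; field.
have -> : (p - (p + q + r) / 4) ^+ 2 + (q - (p + q + r) / 4) ^+ 2 + (r - (p + q + r) / 4) ^+ 2 +
  (p - (p + q + r) / 4) * (q - (p + q + r) / 4) + (p - (p + q + r) / 4) * (r - (p + q + r) / 4) +
  (q - (p + q + r) / 4) * (r - (p + q + r) / 4) = w / 2 by rewrite /w; field.
clear; nra.
Qed.

Section ThreeDim.
Context (R : realType).
Variable f : R -> R.
Hypothesis f_le0 : forall t, - 2^-1 < t < 283 / 400 -> f t <= 0.
Hypothesis f_cap1 : forall t, 283 / 400 <= t <= 1 -> f t <= 193 / 100.
Hypothesis f_cap2 : forall x y, 283 / 400 <= y -> y <= x ->
  (3 * x + 2 * y) ^+ 2 <= 19 -> (10 * x + 9 * y) ^+ 2 <= 271 -> f x + f y <= 193 / 100.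
Hypothesis f_cap3 : forall x y z, 283 / 400 <= x -> 283 / 400 <= y -> 283 / 400 <= z ->
  (x + y + z) ^+ 2 <= 6 -> x ^+ 2 + y ^+ 2 + z ^+ 2 - (x + y + z) ^+ 2 / 4 <= 1 / 2 ->
  f x + f y + f z <= 193 / 100.
Hypothesis f_psd : forall (I : finType) (x : I -> 'I_3 -> R), (forall i, Fischer.dotf (x i) (x i) = 1) ->
  999 / 1000 * #|I|%:R ^+ 2 <= \sum_i \sum_j f (- Fischer.dotf (x i) (x j)).
Hypothesis f_m1 : f (-1) + 193 / 100 < 13 * (999 / 1000).
Implicit Types (x y : 'rV[R]_3) (s l : seq 'rV[R]_3).

(** Since 283/400 exceeds 1 / sqrt 2, products of cosines with x exceed 1/2, so the projections
    orthogonal to x form pairwise obtuse angles; a plane has no four such vectors. *)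
Lemma no_four_caps x (z : 'I_3 -> 'rV[R]_3) w : dot x x = 1 ->
  (forall i, 283 / 400 <= - dot x (z i)) -> 283 / 400 <= - dot x w ->
  (forall i j, i != j -> dot (z i) (z j) < 2^-1) -> (forall i, dot (z i) w < 2^-1) -> False.
Proof.
move=> x1 xz xw zz zw.
have pr a b : dot (a - dot x a *: x) (b - dot x b *: x) = dot a b - dot x a * dot x b.
  rewrite !dotBl !dotBr !dotZl !dotZr x1 (dotC a x); ring.
have ng a b : 283 / 400 <= - dot x a -> 283 / 400 <= - dot x b -> dot a b < 2^-1 -> dot a b - dot x a * dot x b < 0.
  move: (dot x a) (dot x b) (dot a b) => p q r; nra.
apply: (@obtuse_hyperplane R 3 x (w - dot x w *: x) (fun i => z i - dot x (z i) *: x)) => // [i|i j ij|i].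
- by rewrite dotBr dotZr x1; ring.
- by rewrite pr; apply/ltW/ng => //; exact: zz.
- by rewrite pr; apply: ng.
Qed.

Lemma caps_sum x l : dot x x = 1 -> (forall y, y \in l -> dot y y = 1 /\ 283 / 400 <= - dot x y) ->
  pairwise (fun a b => dot a b < 2^-1) l -> \sum_(y <- l) f (- dot x y) <= 193 / 100.
Proof.
move=> x1; case: l => [|a [|b [|c [|w l]]]] h.
- by rewrite big_nil => _; lra.
- have [a1 ha] := h a (mem_head _ _); rewrite big_seq1 => _; apply: f_cap1; rewrite ha /=.
  have := dot_CS x a; rewrite x1 a1 mul1r; move: (dot x a) => t; nra.
- have [a1 ha] := h a (mem_head _ _).
  have [b1 hb] : dot b b = 1 /\ 283 / 400 <= - dot x b by apply: h; rewrite !inE eqxx orbT.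
  rewrite /= andbT andbT => ab; rewrite big_cons big_seq1.
  have g (p q : 'rV[R]_3) (al be : R) := @caps_gram2 R 3 x x1 p q al be.
  have n3 : 0 <= 3 :> R by []. have n2 : 0 <= 2 :> R by [].
  have n10 : 0 <= 10 :> R by []. have n9 : 0 <= 9 :> R by [].
  have [le|/ltW le] := lerP (- dot x b) (- dot x a).
    apply: f_cap2 => //.
      by apply: le_trans (g a b 3 2 a1 b1 ab n3 n2) _; lra.
    by apply: le_trans (g a b 10 9 a1 b1 ab n10 n9) _; lra.
  rewrite addrC; rewrite dotC in ab; apply: f_cap2 => //.
    by apply: le_trans (g b a 3 2 b1 a1 ab n3 n2) _; lra.
  by apply: le_trans (g b a 10 9 b1 a1 ab n10 n9) _; lra.
- have [a1 ha] := h a (mem_head _ _).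
  have [b1 hb] : dot b b = 1 /\ 283 / 400 <= - dot x b by apply: h; rewrite !inE eqxx orbT.
  have [c1 hc] : dot c c = 1 /\ 283 / 400 <= - dot x c by apply: h; rewrite !inE eqxx !orbT.
  rewrite /= !andbT => /andP[/andP[ab ac] bc]; rewrite !big_cons big_nil addr0 addrA.
  have [] := caps_dispersion ha hb hc (fun al be ga => @caps_gram R 3 x x1 a b c al be ga a1 b1 c1 ab ac bc).
  exact: f_cap3.
move=> /= /andP[/and4P[ab ac aw _] /andP[/and3P[bc bw _] /andP[/andP[cw _] _]]].
have hx y : y \in [:: a; b; c; w] -> 283 / 400 <= - dot x y.
  by move=> yl; apply: (h y _).2; move: yl; rewrite !inE => /or4P[] ->; rewrite ?orbT.
exfalso; apply: (@no_four_caps x (fun i => [:: a; b; c]`_i) w x1).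
- move=> i; apply: hx; rewrite (mem_subseq (s1 := [:: a; b; c])) ?mem_nth//.
  by rewrite /= !eqxx.
- by apply: hx; rewrite !inE eqxx !orbT.
- by move=> [[|[|[|]]]// ?] [[|[|[|]]]// ?] //= _; rewrite // dotC.
- by move=> [[|[|[|]]]// ?].
Qed.

Lemma cap_part_sum x l : dot x x = 1 -> (forall y, y \in l -> dot y y = 1 /\ dot x y < 2^-1) ->
  pairwise (fun a b => dot a b < 2^-1) l -> \sum_(y <- l) f (- dot x y) <= 193 / 100.
Proof.
move=> x1 h pl; pose q y := 283 / 400 <= - dot x y.
rewrite (bigID q) /= -[leRHS]addr0; apply: lerD.
  rewrite -big_filter; apply: (caps_sum x1); last exact: pairwise_filter.
  by move=> y; rewrite mem_filter => /andP[qy /h[]].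
rewrite big_seq_cond; apply: sumr_le0 => y /andP[yl]; rewrite /q -ltNge => qy.
by apply: f_le0; rewrite qy andbT ltrN2; have [] := h y yl.
Qed.

(** Each row of the double sum is at most f (-1) + 1.93, with f (-1) from the diagonal. For the
    polynomial constructed above this is 12.985, while thirteen points would require at least 13 *
    0.999 = 12.987. *)
Lemma spherical_code3 s : (forall x, x \in s -> dot x x = 1) ->
  pairwise (fun x y => dot x y < 2^-1) s -> (size s <= 12)%N.
Proof.
move=> s1 ps; have us : uniq s.
  rewrite uniq_pairwise; apply: (@sub_in_pairwise _ (mem s) (fun x y => dot x y < 2^-1)) ps; last exact/allP.
  move=> x y xs ys h; apply: contraTneq h => ->; rewrite s1// -leNgt.
  by rewrite invf_le1// ler1n.
have sep x y : x \in s -> y \in s -> x != y -> dot x y < 2^-1.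
  move=> xs ys; have lt i j : (i < j < size s)%N -> dot s`_i s`_j < 2^-1.
    move=> /andP[ij js]; have /(pairwiseP 0) := ps; apply => //; rewrite inE//.
    exact: ltn_trans ij js.
  rewrite -(nth_index 0 xs) -(nth_index 0 ys) nth_uniq ?index_mem// neq_ltn.
  by move=> /orP[ij|ij]; last rewrite dotC; apply: lt; rewrite ij index_mem.
have row x : x \in s -> \sum_(y <- s) f (- dot x y) <= f (-1) + 193 / 100.
  move=> xs; rewrite (perm_big _ (perm_to_rem xs)) big_cons s1// lerD2l.
  apply: cap_part_sum; [exact: s1| |exact: (subseq_pairwise (rem_subseq x s))].
  move=> y; rewrite mem_rem_uniq// inE => /andP[yx ys]; split; first exact: s1.
  by apply: sep => //; rewrite eq_sym.
have := f_psd (fun i : 'I_(size s) => s1 _ (mem_nth 0 (ltn_ord i))).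
rewrite card_ord leqNgt => H; apply/negP => n13.
have n13' : 13 <= (size s)%:R :> R by rewrite ler_nat.
have : \sum_(i < size s) \sum_(j < size s) f (- dot s`_i s`_j) <= (f (-1) + 193 / 100) * (size s)%:R.
  rewrite mulr_natr -[size s in leRHS]card_ord -sumr_const; apply: ler_sum => i _.
  by have := row _ (mem_nth 0 (ltn_ord i)); rewrite (big_nth 0) big_mkord.
move/(le_trans H); apply/negP; rewrite -ltNge expr2 mulrA ltr_pM2r; last by lra.
apply: lt_le_trans f_m1 _; rewrite mulrC; apply: ler_wpM2l n13'; lra.
Qed.

End ThreeDim.

Lemma packing_euclidean3_le (R : realType) (s : seq 'rV[R]_3) :
  packing (@euclidean_norm R 3) s -> (size s <= 12)%N.
Proof.
move=> ps; have [s1|s1] := leqP (size s) 1; first exact: leq_trans s1 _.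
have [s' [<- s'1 s'2]] := spherical_packing ps s1.
have [f [fE f0 f1 f2 f3]] := kiss_exists R.
have fm1 : f (-1) + 193 / 100 < 13 * (999 / 1000) by rewrite fE; clear; lra.
exact: (spherical_code3 f0 f1 f2 f3 (fun I x => @kiss_psd R f I x fE) fm1 s'1 s'2).
Qed.

(** The golden ratio is replaced by the Fibonacci quotient 8/5. With the scale 2/19, the squared
    norms are 89 * 4 / 361 < 1 and the squared distances at least 98 * 4 / 361 > 1. *)
Definition icosahedron : seq (seq int) :=
  [:: [:: 0; 5; 8]; [:: 0; 5; -8]; [:: 0; -5; 8]; [:: 0; -5; -8];
      [:: 5; 8; 0]; [:: 5; -8; 0]; [:: -5; 8; 0]; [:: -5; -8; 0];
      [:: 8; 0; 5]; [:: -8; 0; 5]; [:: 8; 0; -5]; [:: -8; 0; -5]].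

Lemma packing_icosahedron (R : realType) :
  packing (@euclidean_norm R 3) [seq \row_i ((p`_i)%:~R * (2 / 19)) | p <- icosahedron].
Proof.
pose v (p : seq int) : 'rV[R]_3 := \row_i ((p`_i)%:~R * (2 / 19)).
pose q (p p' : seq int) := (p`_0 - p'`_0) ^+ 2 + (p`_1 - p'`_1) ^+ 2 + (p`_2 - p'`_2) ^+ 2.
have qE p p' : dot (v p - v p') (v p - v p') = (q p p')%:~R * (4 / 361).
  rewrite /dot !big_ord_recl big_ord0 !mxE /= /q !rmorphD /= !rmorphXn /= !rmorphB /=.
  by field.
split.
  have : all (fun p => q p [::] == 89) icosahedron by [].
  move=> /allP h _ /mapP[p /h /eqP pE ->]; rewrite euclidean_norm_le1.
  have := qE p [::]; rewrite pE (_ : v [::] = 0) ?subr0 => [->|]; first lra.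
  by apply/rowP => i; rewrite !mxE nth_nil mul0r.
have : pairwise (fun p p' => 98 <= q p p') icosahedron by [].
rewrite pairwise_map; apply: sub_pairwise => p p' h /=.
rewrite euclidean_norm_gt1 (qE p p').
have : 98 <= (q p p')%:~R :> R by rewrite (_ : 98 = 98%:~R) // ler_int.
lra.
Qed.

Theorem sup_average_opnorm_euclidean3 (R : realType) :
  sup_average_opnorm (@euclidean_norm R 3) = 12%:E /\
  average_opnorm_attains (@euclidean_norm R 3) 12%:E.
Proof.
apply: (sup_average_opnormE (is_norm_euclidean R 3) (packing_icosahedron R)); first by [].
by move=> s ps; rewrite size_map; exact: packing_euclidean3_le.
Qed.

Theorem corollary3p3 (R : realType) :
  [/\ (* (i) *)
      forall nm : 'rV[R]_2 -> R, is_norm nm ->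
        (parallelogram (closed_nball nm 0 1) ->
           sup_average_opnorm nm = 4%:E) /\
        (~ parallelogram (closed_nball nm 0 1) ->
           sup_average_opnorm nm = 5%:E),
      (* (ii) *)
      forall d : nat, (0 < d)%N ->
        sup_average_opnorm (@linfty_norm R d) = (2 ^+ d)%:E /\
        average_opnorm_attains (@linfty_norm R d) (2 ^+ d)%:E,
      (* (iii) *)
      sup_average_opnorm (@euclidean_norm R 3) = 12%:E /\
      average_opnorm_attains (@euclidean_norm R 3) 12%:E
    & (* (iv) *)
      exists e1 e2 : nat -> R,
        [/\ e1 d @[d --> \oo] --> 0,
            e2 d @[d --> \oo] --> 0
          & \forall d \near \oo,
            (((1 + e1 d) * Num.sqrt (3 * pi / 8) * ln (3 / (2 * Num.sqrt 2)) *
                powR d%:R (3 / 2) * (2 / Num.sqrt 3) ^+ d)%:E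
               <= sup_average_opnorm (@euclidean_norm R d)
               <= (powR 2 (401 / 1000 * (1 + e2 d) * d%:R))%:E)%E]].
Proof.
split=> [nm nmP|d d0||].
- exact: sup_average_opnorm_plane.
- exact: sup_average_opnorm_linfty.
- exact: sup_average_opnorm_euclidean3.
- exact: sup_average_opnorm_euclidean.
Qed.
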